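(* Let $(p,j)$ be an irregular pair such that the $\omega^{2-j}$-eigenspace of $\operatorname{Cl}(\mathbb{Q}(\mu_p))[p]$ vanishes. Then for every classical eigenform $f$ in the corresponding Hida family of tame level $1$, $$\mu\big(\operatorname{Sel}(\mathbb{Q}_\infty,A_f)^\vee\big)\ \le\ \operatorname{ord}_\varpi(a_p(f)-1).$$
   Context: Irregular pair $(p,j)$: $p$ prime, $j\ge 2$ even, $p$ divides the numerator of $B_j/j$ ($B_j$ the Bernoulli number). $\omega$ is the mod $p$ cyclotomic (Teichmüller) character of $\operatorname{Gal}(\mathbb{Q}(\mu_p)/\mathbb{Q})$. A classical eigenform in the corresponding Hida family is a normalized eigenform $f\in S_k(\Gamma_0(p),\overline{\mathbb{Q}}_p)^{\rm ord}$, with $k\ge2$, $k\equiv j\pmod{p-1}$, whose Hecke eigenvalues satisfy $a_\ell(f)\equiv1+\ell^{k-1}$ ($\ell\ne p$) and $a_p(f)\equiv1$ modulo the maximal ideal of $\overline{\mathbb{Z}}_p$, where $a_p(f)$ is the $U_p$-eigenvalue. $K$ is the extension of $\mathbb{Q}_p$ generated by the Hecke eigenvalues of $f$, $\mathcal O$ its ring of integers, $\varpi$ a uniformizer, $\operatorname{ord}_\varpi(\varpi)=1$, $\mathbb{F}=\mathcal O/\varpi$. Selmer groups. $V_f$ is the two-dimensional $K$-representation of $G_{\mathbb{Q}}$ attached to $f$ (trace of arithmetic Frobenius at $\ell\ne p$ equal to $a_\ell(f)$, determinant $\varepsilon^{k-1}$, $\varepsilon$ the $p$-adic cyclotomic character).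 As a $G_{\mathbb{Q}_p}$-representation it sits in $0\to K(\eta^{-1}\varepsilon^{k-1})\to V_f\to K(\eta)\to0$ with $\eta$ unramified, $\eta(\operatorname{Frob}_p)=a_p(f)$. Let $T\subset V_f$ be the $G_{\mathbb{Q}}$-stable $\mathcal O$-lattice, unique up to homothety, such that $T/\varpi T$ is a non-split extension $0\to\mathbb{F}(\omega^{k-1})\to T/\varpi T\to\mathbb{F}\to0$ of $G_{\mathbb{Q}}$-modules, and $A_f=V_f/T$; it has an induced $G_{\mathbb{Q}_p}$-quotient $A_f\to(K/\mathcal O)(\eta)$. $\mathbb{Q}_\infty$ is the cyclotomic $\mathbb{Z}_p$-extension of $\mathbb{Q}$. $\operatorname{Sel}(\mathbb{Q}_\infty,A_f)\subset H^1(\mathbb{Q}_\infty,A_f)$ is the set of classes whose restriction to $H^1(I_v,A_f)$ is zero for all places $v\nmid p$ of $\mathbb{Q}_\infty$ ($I_v$ inertia) and whose image in $H^1(I_{p,\infty},K/\mathcal O)$ is zero, $I_{p,\infty}$ being the inertia group at the unique prime of $\mathbb{Q}_\infty$ over $p$. Its Pontryagin dual is a finitely generated torsion module over $\Lambda_{\mathcal O}=\mathcal O[[\operatorname{Gal}(\mathbb{Q}_\infty/\mathbb{Q})]]$ (Kato), and $\mu$ denotes its $\mu$-invariant: the exponent of $\varpi$ in a generator of the characteristic ideal. *)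

(* Defs.v *)
From HB Require Import structures.
From mathcomp Require Import all_boot all_order all_algebra.
From mathcomp Require Import all_fingroup all_solvable all_field.
From mathcomp Require Import complex generic_quotient ring_quotient.
From mathcomp Require Import boolp classical_sets functions cardinality.
From mathcomp Require Import reals ereal topology normedtype sequences.
From mathcomp Require Import derive exp trigo.

Set Implicit Arguments.
Unset Strict Implicit.
Unset Printing Implicit Defensive.

Import Order.TTheory GRing.Theory Num.Theory.
Import numFieldNormedType.Exports.

Local Open Scope classical_set_scope.
Local Open Scope ring_scope.

(* [:: B_0; ...; B_n], from \sum_(i < n.+1) 'C(n.+1, i) B_i = 0 for n > 0. *)
Fixpoint bernoulli_seq (n : nat) : seq rat :=
  if n is m.+1 then
    let s := bernoulli_seq m in
    rcons s (- (\sum_(i < m.+1) 'C(m.+2, i)%:R * s`_i) / m.+2%:R)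
  else [:: 1].

Definition bernoulli (n : nat) : rat := (bernoulli_seq n)`_n.

Definition irregular_pair (p j : nat) : Prop :=
  [/\ prime p, (2 <= j)%N, ~~ odd j
    & (p%:Z %| numq (bernoulli j / j%:R))%Z].

(* Every ring endomorphism of algC is an automorphism (algC_invaut). *)
Definition galQ := {rmorphism algC -> algC}.

HB.instance Definition _ := gen_eqMixin galQ.
HB.instance Definition _ := gen_choiceMixin galQ.

Definition gal_mul (s t : galQ) : galQ := s \o t.
Definition gal_inv (s : galQ) : galQ := algC_invaut s.
Definition gal_one : galQ := idfun.

Lemma galQ_eqP (s t : galQ) : (forall x, s x = t x) -> s = t.
Proof.
move: s t => [s cs] [t ct] /= h.
have e : s = t by apply/funext.
subst t; congr GRing.RMorphism.Pack.
case: cs ct => [[a] [b]] [[a'] [b']].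
by rewrite (Prop_irrelevance a a') (Prop_irrelevance b b').
Qed.

Lemma gal_mulA : associative gal_mul.
Proof. by move=> s t u; apply: galQ_eqP. Qed.

Lemma gal_mul1 : left_id gal_one gal_mul.
Proof. by move=> s; apply: galQ_eqP. Qed.

Lemma gal_mul1r : right_id gal_one gal_mul.
Proof. by move=> s; apply: galQ_eqP. Qed.

Lemma gal_mulV : left_inverse gal_one gal_inv gal_mul.
Proof. by move=> s; apply: galQ_eqP => x; apply: algC_autK. Qed.

Lemma gal_mulVr : right_inverse gal_one gal_inv gal_mul.
Proof. by move=> s; apply: galQ_eqP => x; apply: algC_invautK. Qed.

HB.instance Definition _ := isGroup.Build galQ
  gal_mulA gal_mul1 gal_mul1r gal_mulV gal_mulVr.

(* Continuity on H for the Krull topology, into a discrete space. *)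
Definition locally_constant (H : set galQ) (T : Type) (c : galQ -> T) : Prop :=
  forall s, H s -> exists r : seq algC,
    forall t, H t -> {in r, forall x, t x = s x} -> c t = c s.

Definition acts_on_mu (s : galQ) (q a : nat) : Prop :=
  forall z : algC, z ^+ q = 1 -> s z = z ^+ a.

(* Prime ideals, above the rational prime l, of the ring of all algebraic
   integers; they amount to compatible choices of places of all number fields *)
Definition prime_above (l : nat) (P : set algC) : Prop :=
  [/\ P `<=` [set x | x \in Aint] /\ P l%:R,
      forall x y, P x -> P y -> P (x + y),
      forall x y, x \in Aint -> P y -> P (x * y),
      ~ P 1
    & forall x y, x \in Aint -> y \in Aint -> P (x * y) -> P x \/ P y].

Definition decomposition (P : set algC) : set galQ :=
  [set s | forall x, P x <-> P (s x)].

Definition inertia (P : set algC) : set galQ :=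
  [set s | forall x, x \in Aint -> P (s x - x)].

Definition frobenius (l : nat) (P : set algC) : set galQ :=
  [set s | forall x, x \in Aint -> P (s x - x ^+ l)].

Definition cyclotomic_int (p : nat) : set algC :=
  [set x | x \in Aint /\ exists (z : algC) (q : {poly rat}),
     p.-primitive_root z /\ x = (map_poly ratr q).[z]].

Definition nonzero_ideal (p : nat) (I : set algC) : Prop :=
  [/\ I `<=` cyclotomic_int p,
      forall x y, I x -> I y -> I (x + y),
      forall x y, cyclotomic_int p x -> I y -> I (x * y)
    & exists2 x, I x & x != 0].

Definition ideal_mul (I J : set algC) : set algC :=
  [set z | exists (n : nat) (x y : 'I_n -> algC),
     (forall i, I (x i) /\ J (y i)) /\ z = \sum_i x i * y i].

Definition ideal_exp (p : nat) (I : set algC) (n : nat) : set algC :=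
  iter n (ideal_mul I) (cyclotomic_int p).

Definition same_class (p : nat) (I J : set algC) : Prop :=
  exists x y, [/\ cyclotomic_int p x /\ x != 0, cyclotomic_int p y /\ y != 0
    & [set x * z | z in I] = [set y * z | z in J]].

Definition principal_ideal (p : nat) (I : set algC) : Prop :=
  same_class p I (cyclotomic_int p).

(* The omega^(2-j)-eigenspace of Cl(Q(mu_p))[p] vanishes (j >= 2). If s raises
   p-th roots of unity to the a, then omega(s) = a mod p, so omega^(2-j)(s)
   is the class m mod p with a^(j-2) m = 1. *)
Definition class_eigenspace_vanishes (p j : nat) : Prop :=
  forall I : set algC, nonzero_ideal p I ->
    principal_ideal p (ideal_exp p I p) ->
    (forall (s : galQ) (a m : nat), acts_on_mu s p a ->
       (a ^ (j - 2) * m = 1 %[mod p])%N ->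
       same_class p (s @` I) (ideal_exp p I m)) ->
    principal_ideal p I.

Section CuspForms.
Variable R : realType.

Definition upper_half : set R[i] := [set t | 0 < complex.Im t].

(* exp (2 pi i t) *)
Definition qexp (t : R[i]) : R[i] :=
  let x := 2 * pi * complex.Re t in
  (expR (- (2 * pi * complex.Im t)))%:C%C * (cos x +i* sin x)%C.

Definition moebius (a b c d : int) (t : R[i]) : R[i] :=
  (a%:~R * t + b%:~R) / (c%:~R * t + d%:~R).

Definition cusp_form (N k : nat) (F : R[i]^o -> R[i]^o) : Prop :=
  [/\ forall t, upper_half t -> derivable F t 1,
      forall (a b c d : int) (t : R[i]), a * d - b * c = 1 -> (N%:Z %| c)%Z ->
        upper_half t ->
        F (moebius a b c d t) = (c%:~R * t + d%:~R) ^+ k * F t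
    & forall a b c d : int, a * d - b * c = 1 ->
        forall e : R, 0 < e -> exists Y : R, 0 < Y /\
          forall t : R[i], Y < complex.Im t ->
          `|(c%:~R * t + d%:~R) ^- k * F (moebius a b c d t)| < e%:C%C].

(* b is the q-expansion of an element of S_k(Gamma_0(N), Z). *)
Definition integral_cusp_form (N k : nat) (b : nat -> int) : Prop :=
  exists F : R[i]^o -> R[i]^o, cusp_form N k F /\
    forall t, upper_half t ->
      series (fun n => ((b n)%:~R * qexp t ^+ n : R[i]^o)) @ \oo --> F t.

(* S_k(Gamma_0(N), C) is S_k(Gamma_0(N), Z) (x) C, inside q-expansions. *)
Definition cusp_space (N k : nat) (C : fieldType) (f : nat -> C) : Prop :=
  exists (r : nat) (c : 'I_r -> C) (b : 'I_r -> nat -> int),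
    (forall i, integral_cusp_form N k (b i)) /\
    forall n, f n = \sum_i c i * (b i n)%:~R.

End CuspForms.

(* T_l (l not dividing N), and U_l (l dividing N), on q-expansions. *)
Definition hecke_op (N k l : nat) (C : fieldType) (f : nat -> C) (n : nat) : C :=
  f (l * n)%N +
  (if ~~ (l %| N)%N && (l %| n)%N then l%:R ^+ (k - 1) * f (n %/ l)%N else 0).

(* For a normalized eigenform f, the T_n-eigenvalue is f n. *)
Definition normalized_eigenform (N k : nat) (C : fieldType) (f : nat -> C) :
    Prop :=
  f 1%N = 1 /\
  forall l, prime l -> forall n, hecke_op N k l f n = f l * f n.

Definition rat_closure (R : realType) (C : fieldType) (v : C -> R) : set C :=
  [set x | forall e : R, 0 < e -> exists q : rat, v (x - ratr q) < e].

(* An algebraically closed field with a nonarchimedean absolute value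
   normalized by |p| = 1/p, in which the closure of Q is complete (hence a
   copy of Q_p), and algebraic over that closure. These axioms determine
   the valued field up to isomorphism. *)
Record padicClosure (R : realType) (p : nat) := PadicClosure {
  padic_sort :> closedFieldType;
  pabs : padic_sort -> R;
  pabs_ge0 : forall x, 0 <= pabs x;
  pabs_eq0 : forall x, pabs x = 0 <-> x = 0;
  pabsM : forall x y, pabs (x * y) = pabs x * pabs y;
  pabsD : forall x y, pabs (x + y) <= Num.max (pabs x) (pabs y);
  pabs_p : pabs p%:R = p%:R^-1;
  padic_complete : forall u : nat -> rat,
    (forall e : R, 0 < e -> exists n0, forall m n, (n0 <= m)%N -> (n0 <= n)%N ->
       pabs (ratr (u m) - ratr (u n)) < e) ->
    exists x, forall e : R, 0 < e -> exists n0, forall n, (n0 <= n)%N ->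
       pabs (x - ratr (u n)) < e;
  padic_algebraic : forall x, exists q : {poly padic_sort},
    [/\ q != 0, forall i, rat_closure pabs q`_i & root q x]
}.

Definition Qp (R : realType) (p : nat) (C : padicClosure R p) : set C :=
  rat_closure (@pabs R p C).

(* The value in Z_p of the p-adic cyclotomic character. *)
Definition cyclotomic_char (R : realType) (p : nat) (C : padicClosure R p)
    (s : galQ) : C :=
  xget 0 [set x | forall n a : nat, acts_on_mu s (p ^ n) a ->
                    pabs (x - a%:R) <= (p%:R ^- n : R)].

Section HeckeField.
Variables (R : realType) (p : nat) (C : padicClosure R p) (f : nat -> C).

Definition hecke_pred : {pred C} := fun x => `[< forall S : {pred C},
  divring_closed S -> (forall y, Qp y -> y \in S) -> (forall n, f n \in S) ->
  x \in S >].

Lemma hecke_pred_divring : divring_closed hecke_pred.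
Proof.
split=> [|x y /asboolP hx /asboolP hy|x y /asboolP hx /asboolP hy];
  apply/asboolP => S hS hQ hf; case: (hS) => S1 SB SV.
- exact: S1.
- by apply: SB; [exact: hx | exact: hy].
- by apply: SV; [exact: hx | exact: hy].
Qed.

HB.instance Definition _ :=
  GRing.isDivringClosed.Build C hecke_pred hecke_pred_divring.

Definition hecke_field := {x : C | x \in hecke_pred}.
HB.instance Definition _ := SubChoice.on hecke_field.
HB.instance Definition _ :=
  [SubChoice_isSubIntegralDomain of hecke_field by <:].
HB.instance Definition _ :=
  [SubIntegralDomain_isSubField of hecke_field by <:].

Definition hecke_int_pred : {pred hecke_field} := fun x => pabs (val x) <= 1.

Lemma pabs1 : pabs (1 : C) = 1.
Proof.
have h : pabs (1 : C) != 0.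
  by apply/eqP => /pabs_eq0/eqP; rewrite oner_eq0.
by apply: (mulfI h); rewrite -pabsM !mulr1.
Qed.

Lemma pabsN (x : C) : pabs (- x) = pabs x.
Proof.
have h : pabs (-1 : C) = 1.
  apply/eqP; rewrite -(@pexpr_eq1 _ _ 2) ?pabs_ge0 //.
  by rewrite expr2 -pabsM mulrNN mulr1 pabs1.
by rewrite -mulN1r pabsM h mul1r.
Qed.

Lemma hecke_int_subring : subring_closed hecke_int_pred.
Proof.
split=> [|x y|x y]; rewrite /in_mem /= /hecke_int_pred.
- by rewrite rmorph1 pabs1.
- move=> hx hy; rewrite rmorphB; apply: le_trans (pabsD _ _) _.
  by rewrite ge_max pabsN hx hy.
- by move=> hx hy; rewrite rmorphM pabsM mulr_ile1 ?pabs_ge0.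
Qed.

HB.instance Definition _ :=
  GRing.isSubringClosed.Build hecke_field hecke_int_pred hecke_int_subring.

Definition hecke_int := {x : hecke_field | x \in hecke_int_pred}.
HB.instance Definition _ := SubChoice.on hecke_int.
HB.instance Definition _ := [SubChoice_isSubComNzRing of hecke_int by <:].

Lemma hecke_eigenvalue_subproof n : f n \in hecke_pred.
Proof. by apply/asboolP => S _ _; apply. Qed.

Definition hecke_eigenvalue (n : nat) : hecke_field :=
  Sub (f n) (hecke_eigenvalue_subproof n).

Definition uniformizer (w : hecke_int) : Prop :=
  pabs (val (val w)) < 1 /\
  forall x : hecke_int, pabs (val (val x)) < 1 -> exists y, x = y * w.

Local Open Scope ereal_scope.
Definition ord_at (w : hecke_int) (x : hecke_field) : \bar int :=
  if x == 0%R then +oo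
  else (xget 0%R [set n : int | pabs (val x) = (pabs (val (val w)) ^ n)%R])%:E.

End HeckeField.

Local Open Scope quotient_scope.

Lemma quot_reprB (V : zmodType) (I : zmodClosed V) (x y : Quotient.quot I) :
  repr (x - y) - (repr x - repr y) \in I.
Proof.
have h : \pi_(Quotient.quot I) (repr x - repr y) =
    \pi_(Quotient.quot I) (repr x) - \pi_(Quotient.quot I) (repr y).
  exact: (raddfB (\pi_(Quotient.quot I))).
by rewrite Quotient.idealrBE h !reprK.
Qed.

Section Cotorsion.
Variables (K : fieldType) (O : comNzRingType) (i : {rmorphism O -> K}).

Definition lattice (n : nat) : {pred 'cV[K]_n} :=
  fun v => `[< exists t : 'cV[O]_n, v = map_mx i t >].

Lemma lattice_zmod n : zmod_closed (@lattice n).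
Proof.
split=> [|x y /asboolP[s ->] /asboolP[t ->]]; apply/asboolP.
  by exists 0; rewrite map_mx0.
by exists (s - t); rewrite map_mxB.
Qed.

HB.instance Definition _ n :=
  GRing.isZmodClosed.Build 'cV[K]_n (@lattice n) (@lattice_zmod n).

Definition cotorsion (n : nat) := Quotient.quot (@lattice n).
HB.instance Definition _ n := GRing.Zmodule.on (cotorsion n).
HB.instance Definition _ n :=
  generic_quotient.Quotient.on (cotorsion n).


Definition cotorsion_mx m n (M : 'M[O]_(m, n)) (x : cotorsion n) :
    cotorsion m :=
  \pi_(cotorsion m) (map_mx i M *m repr x).

Lemma cotorsion_mx_zmod m n (M : 'M[O]_(m, n)) :
  zmod_morphism (cotorsion_mx M).
Proof.
move=> x y; rewrite /cotorsion_mx -raddfB; apply/eqP.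
rewrite -Quotient.idealrBE -!mulmxBr.
have : repr (x - y) - (repr x - repr y) \in @lattice n.
  exact: quot_reprB.
case/asboolP => t ->; apply/asboolP; exists (M *m t).
by rewrite map_mxM.
Qed.

HB.instance Definition _ m n (M : 'M[O]_(m, n)) :=
  GRing.isZmodMorphism.Build (cotorsion n) (cotorsion m) (cotorsion_mx M)
    (cotorsion_mx_zmod M).

End Cotorsion.

Section Cohomology.
Variables (A : zmodType) (act : galQ -> {additive A -> A}) (H : set galQ).

Definition cocycle : {pred galQ -> A} := fun c =>
  `[< (forall s t, H s -> H t -> c (s * t)%g = c s + act s (c t)) /\
      locally_constant H c >].

Definition coboundary (c : galQ -> A) : Prop :=
  exists a : A, forall s, H s -> c s = act s a - a.

Lemma cocycle_zmod : zmod_closed cocycle.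
Proof.
split=> [|c d /asboolP[cM cH] /asboolP[dM dH]]; apply/asboolP; split.
- by move=> s t _ _; rewrite raddf0 addr0.
- by move=> s _; exists [::].
- move=> s t hs ht; rewrite !fctE cM // dM // raddfB opprD.
  by rewrite addrACA.
- move=> s hs; have [r hr] := cH s hs; have [r' hr'] := dH s hs.
  exists (r ++ r') => t ht e; rewrite !fctE hr ?hr' //.
    by move=> x hx; apply: e; rewrite mem_cat hx orbT.
  by move=> x hx; apply: e; rewrite mem_cat hx.
Qed.

HB.instance Definition _ :=
  GRing.isZmodClosed.Build (galQ -> A) cocycle cocycle_zmod.

(* Cocycles on H are represented by functions on all of galQ, their values
   outside H being irrelevant: they are killed by the coboundaries. *)
Definition Z1 := {c : galQ -> A | c \in cocycle}.
HB.instance Definition _ := SubChoice.on Z1.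
HB.instance Definition _ := [SubChoice_isSubZmodule of Z1 by <:].

Definition B1 : {pred Z1} := fun c => `[< coboundary (val c) >].

Lemma coboundaryB c d : coboundary c -> coboundary d -> coboundary (c - d).
Proof.
move=> [a ha] [b hb]; exists (a - b) => s hs; rewrite !fctE ha // hb //.
by rewrite (raddfB (act s)) !opprD !opprK addrACA.
Qed.

Lemma coboundary0 : coboundary 0.
Proof. by exists 0 => s _; rewrite raddf0 subr0. Qed.

Lemma B1_zmod : zmod_closed B1.
Proof.
split=> [|c d /asboolP hc /asboolP hd]; apply/asboolP.
  by rewrite raddf0; apply: coboundary0.
by rewrite raddfB; apply: coboundaryB.
Qed.

HB.instance Definition _ := GRing.isZmodClosed.Build Z1 B1 B1_zmod.

Definition H1 := Quotient.quot B1.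
HB.instance Definition _ := GRing.Zmodule.on H1.

Definition H1_class (c : Z1) : H1 := \pi_(Quotient.quot B1) c.

(* Meaningful when F preserves cocycles and coboundaries. *)
Definition H1_map (F : (galQ -> A) -> (galQ -> A)) (x : H1) : H1 :=
  H1_class (insubd 0 (F (val (repr x)))).

End Cohomology.

(* For p an odd prime, Q_n is the subfield of Q(mu_(p^(n+1))) fixed by the
   subgroup of order p - 1 of (Z/p^(n+1))^*, so that Gal(Q_n/Q) is the quotient
   by that subgroup, which is the largest one of order prime to p. *)
Definition cyc_torsion (p n : nat) : {group {unit 'Z_(p ^ n.+1)}} :=
  'O_p^'(units_Zp (p ^ n.+1))%G.

Definition cyc_level (p n : nat) : finGroupType := coset_of (cyc_torsion p n).

(* The restriction to Q_n, read off from the action on mu_(p^(n+1)). *)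
Definition cyc_res (p n : nat) (s : galQ) : cyc_level p n :=
  coset (cyc_torsion p n)
    (odflt 1%g [pick u : {unit 'Z_(p ^ n.+1)} |
       `[< acts_on_mu s (p ^ n.+1) (val u : 'Z_(p ^ n.+1)) >]]).

(* Gal(Qbar/Q_oo) *)
Definition gal_Qinf (p : nat) : set galQ :=
  [set s | forall n, cyc_res p n s = 1%g].

Record abelian_tower := AbelianTower {
  tower_group :> nat -> finGroupType;
  tower_map : forall n, tower_group n.+1 -> tower_group n;
  tower_mapM : forall n (x y : tower_group n.+1),
    tower_map (x * y)%g = (tower_map x * tower_map y)%g;
  tower_mulC : forall n (x y : tower_group n), (x * y)%g = (y * x)%g
}.

Section CompletedGroupRing.
Variables (O : comNzRingType) (G : abelian_tower).

(* O[[G]] = lim_n O[G n]; cgr_coef x n g is the coefficient of g in the image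
   of x in O[G n]. *)
Record cgr := CGR {
  cgr_coef : forall n, {ffun G n -> O};
  cgr_compat : forall n (g : G n),
    cgr_coef n g = \sum_(h : G n.+1 | tower_map h == g) cgr_coef n.+1 h
}.

Lemma cgr_eqP (x y : cgr) :
  (forall n g, cgr_coef x n g = cgr_coef y n g) -> x = y.
Proof.
case: x y => [x hx] [y hy] /= h.
have e : x = y by apply: functional_extensionality_dep => n; apply/ffunP.
by subst y; rewrite (Prop_irrelevance hx hy).
Qed.

HB.instance Definition _ := gen_eqMixin cgr.
HB.instance Definition _ := gen_choiceMixin cgr.

Program Definition cgr_zero : cgr := @CGR (fun n => [ffun => 0]) _.
Next Obligation. by move=> n g; rewrite ffunE big1 // => h _; rewrite ffunE. Qed.

Program Definition cgr_opp (x : cgr) : cgr :=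
  @CGR (fun n => [ffun g => - cgr_coef x n g]) _.
Next Obligation.
move=> x n g; rewrite ffunE cgr_compat -sumrN.
by apply: eq_bigr => h _; rewrite ffunE.
Qed.

Program Definition cgr_add (x y : cgr) : cgr :=
  @CGR (fun n => [ffun g => cgr_coef x n g + cgr_coef y n g]) _.
Next Obligation.
move=> x y n g; rewrite ffunE !(cgr_compat _ g) -big_split /=.
by apply: eq_bigr => h _; rewrite ffunE.
Qed.

Lemma tower_map1 n : tower_map (1%g : G n.+1) = 1%g :> G n.
Proof. by apply: (@mulgI _ (tower_map 1%g)); rewrite -tower_mapM !mulg1. Qed.

Lemma tower_mapV n (x : G n.+1) : tower_map x^-1%g = (tower_map x)^-1%g.
Proof.
by apply: (@mulgI _ (tower_map x)); rewrite -tower_mapM !mulgV tower_map1.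
Qed.

Program Definition cgr_const (a : O) : cgr :=
  @CGR (fun n => [ffun g => a *+ (g == 1%g)]) _.
Next Obligation.
move=> a n g; rewrite ffunE; have [->|g1] := eqVneq g 1%g; last first.
  rewrite big1 // => h /eqP hg; rewrite ffunE.
  by case: eqVneq => // h1; move: g1; rewrite -hg h1 tower_map1 eqxx.
rewrite (bigD1 1%g) ?tower_map1 //= ffunE eqxx big1 ?addr0 // => h /andP[_ h1].
by rewrite ffunE (negbTE h1).
Qed.

Program Definition cgr_mul (x y : cgr) : cgr :=
  @CGR (fun n => [ffun g => \sum_h cgr_coef x n h * cgr_coef y n (h^-1 * g)%g])
    _.
Next Obligation.
move=> x y n g; rewrite ffunE.
under [RHS]eq_bigr => k _ do rewrite ffunE.
rewrite exchange_big /= [RHS](partition_big (@tower_map G n) xpredT) //=.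
apply: eq_bigr => h _; rewrite (cgr_compat x h) mulr_suml.
apply: eq_bigr => h' /eqP hh; rewrite -mulr_sumr; congr (_ * _).
rewrite cgr_compat (reindex (fun k => h'^-1 * k)%g) /=; last first.
  by exists (fun k => h' * k)%g => k _; rewrite ?mulKg ?mulVKg.
apply: eq_bigl => k; rewrite tower_mapM tower_mapV hh.
by rewrite (inj_eq (@mulgI _ _)).
Qed.

Lemma cgr_addA : associative cgr_add.
Proof. by move=> x y z; apply: cgr_eqP => n g; rewrite !ffunE addrA. Qed.

Lemma cgr_addC : commutative cgr_add.
Proof. by move=> x y; apply: cgr_eqP => n g; rewrite !ffunE addrC. Qed.

Lemma cgr_add0 : left_id cgr_zero cgr_add.
Proof. by move=> x; apply: cgr_eqP => n g; rewrite !ffunE add0r. Qed.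

Lemma cgr_addN : left_inverse cgr_zero cgr_opp cgr_add.
Proof. by move=> x; apply: cgr_eqP => n g; rewrite !ffunE addNr. Qed.

HB.instance Definition _ :=
  GRing.isZmodule.Build cgr cgr_addA cgr_addC cgr_add0 cgr_addN.

Lemma cgr_mulC : commutative cgr_mul.
Proof.
move=> x y; apply: cgr_eqP => n g; rewrite !ffunE.
rewrite (reindex_inj (inj_comp (@mulIg _ g) (@invg_inj _))) /=.
by apply: eq_bigr => h _; rewrite invMg invgK (tower_mulC _ h) mulgVK mulrC.
Qed.

Lemma cgr_mulA : associative cgr_mul.
Proof.
move=> x y z; apply: cgr_eqP => n g; rewrite !ffunE.
under eq_bigr => h _.
  rewrite ffunE mulr_sumr (reindex_inj (@mulgI _ h^-1)%g).
  over.
under [RHS]eq_bigr => h _ do rewrite ffunE mulr_suml.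
rewrite [RHS]exchange_big /=; apply: eq_bigr => h _; apply: eq_bigr => k _.
by rewrite mulrA invMg invgK mulgA -(mulgA _ h) mulgV mulg1.
Qed.

Lemma cgr_mul1 : left_id (cgr_const 1) cgr_mul.
Proof.
move=> x; apply: cgr_eqP => n g; rewrite !ffunE (bigD1 1%g) //= ffunE eqxx.
rewrite mul1r invg1 mul1g big1 ?addr0 // => h h1.
by rewrite ffunE (negbTE h1) mul0r.
Qed.

Lemma cgr_mulD : left_distributive cgr_mul cgr_add.
Proof.
move=> x y z; apply: cgr_eqP => n g; rewrite !ffunE -big_split /=.
by apply: eq_bigr => h _; rewrite ffunE mulrDl.
Qed.

Lemma cgr_1neq0 : cgr_const 1 != 0 :> cgr.
Proof.
apply/eqP => /(congr1 (fun x => cgr_coef x 0 1%g)) /=.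
by rewrite !ffunE eqxx => /eqP; rewrite oner_eq0.
Qed.

HB.instance Definition _ := GRing.Zmodule_isComNzRing.Build cgr
  cgr_mulA cgr_mulC cgr_mul1 cgr_mulD cgr_1neq0.

End CompletedGroupRing.

Section CyclotomicTower.
Variables p n : nat.

Lemma Zp_trunc_dvd :
  ((Zp_trunc (p ^ n.+1)).+2 %| (Zp_trunc (p ^ n.+2)).+2)%N.
Proof.
have [p1|p1] := ltnP 1 p.
  by rewrite !Zp_cast ?dvdn_exp2l // -(expn0 p) ltn_exp2l.
case: p p1 => [|[|q]] // _; first by rewrite !exp0n.
by rewrite !exp1n.
Qed.

Definition Zp_red (x : 'Z_(p ^ n.+2)) : 'Z_(p ^ n.+1) := inZp x.

Lemma Zp_red1 : Zp_red 1 = 1.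
Proof. by apply/val_inj; rewrite /= modn_dvdm ?Zp_trunc_dvd. Qed.

Lemma Zp_redM : {morph Zp_red : x y / x * y}.
Proof.
by move=> x y; apply/val_inj; rewrite /= modn_dvdm ?Zp_trunc_dvd // modnMm.
Qed.

Lemma Zp_red_unit (u : {unit 'Z_(p ^ n.+2)}) : Zp_red (val u) \is a GRing.unit.
Proof.
apply/unitrP; exists (Zp_red (val u^-1%g)).
by rewrite -!Zp_redM -!FinRing.val_unitM mulVg mulgV Zp_red1.
Qed.

Definition unit_red (u : {unit 'Z_(p ^ n.+2)}) : {unit 'Z_(p ^ n.+1)} :=
  FinRing.Unit (Zp_red_unit u).

Lemma unit_redM : {morph unit_red : u v / (u * v)%g}.
Proof. by move=> u v; apply/val_inj; rewrite /= Zp_redM. Qed.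

Canonical unit_red_morphism :=
  @Morphism _ _ (units_Zp (p ^ n.+2)) unit_red (in2W unit_redM).

Lemma in_cyc_torsion m (u : {unit 'Z_(p ^ m.+1)}) :
  (u \in cyc_torsion p m) = (p^'.-elt u)%g.
Proof.
have hall : (p^'.-Hall(units_Zp (p ^ m.+1))(cyc_torsion p m))%g.
  by apply: nilpotent_pcore_Hall; apply/abelian_nil/units_Zp_abelian.
by rewrite (mem_normal_Hall hall) ?pcore_normal ?inE.
Qed.

(* Restriction Gal(Q_(n+1)/Q) -> Gal(Q_n/Q). *)
Definition cyc_level_map (x : cyc_level p n.+1) : cyc_level p n :=
  coset (cyc_torsion p n) (unit_red (fingroup.repr (set_of_coset x))).

End CyclotomicTower.

Section CyclotomicTowerMorphism.
Variables p n : nat.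

Lemma cyc_torsion_norm (u : {unit 'Z_(p ^ n.+1)}) : u \in 'N(cyc_torsion p n)%g.
Proof.
apply: (fintype.subsetP (sub_abelian_norm (units_Zp_abelian _) (finset.subsetT _))).
by rewrite inE.
Qed.

Lemma cyc_levelP (x : cyc_level p n) :
  exists u : {unit 'Z_(p ^ n.+1)}, x = coset (cyc_torsion p n) u.
Proof. by case: (cosetP x) => u _ ->; exists u. Qed.

Lemma cyc_level_mulC (x y : cyc_level p n) : (x * y)%g = (y * x)%g.
Proof.
have [u ->] := cyc_levelP x; have [v ->] := cyc_levelP y.
by rewrite -!morphM ?cyc_torsion_norm //= unit_Zp_mulgC.
Qed.

End CyclotomicTowerMorphism.

Lemma cyc_level_map_coset p n (u : {unit 'Z_(p ^ n.+2)}) :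
  cyc_level_map (coset (cyc_torsion p n.+1) u) =
  coset (cyc_torsion p n) (unit_red u).
Proof.
rewrite /cyc_level_map.
have : fingroup.repr (set_of_coset (coset (cyc_torsion p n.+1) u)) \in coset (cyc_torsion p n.+1) u.
  exact: mem_repr_coset.
rewrite val_coset ?cyc_torsion_norm // => /rcosetP[d hd ->].
rewrite unit_redM morphM ?cyc_torsion_norm //= [X in (X * _)%g]coset_id ?mul1g //.
rewrite in_cyc_torsion; move: hd; rewrite in_cyc_torsion.
by apply: (@morph_p_elt _ _ _ (unit_red_morphism p n)); rewrite inE.
Qed.

Lemma cyc_level_mapM p n (x y : cyc_level p n.+1) :
  cyc_level_map (x * y)%g = (cyc_level_map x * cyc_level_map y)%g.
Proof.
have [u ->] := cyc_levelP x; have [v ->] := cyc_levelP y.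
rewrite -morphM ?cyc_torsion_norm //= !cyc_level_map_coset unit_redM.
by rewrite morphM ?cyc_torsion_norm.
Qed.

Definition cyc_tower (p : nat) : abelian_tower :=
  @AbelianTower (cyc_level p) (@cyc_level_map p) (@cyc_level_mapM p)
    (@cyc_level_mulC p).

Definition iwasawa_algebra (p : nat) (O : comNzRingType) : comNzRingType :=
  cgr O (cyc_tower p).

Section CharacteristicIdeal.
Variable L : comNzRingType.

Definition divides (x y : L) : Prop := exists z, y = z * x.

Definition prime_element (x : L) : Prop :=
  [/\ x != 0, ~ divides x 1
    & forall y z, divides x (y * z) -> divides x y \/ divides x z].

(* Over the Iwasawa algebra of a finite extension of Z_p, the pseudo-null
   finitely generated modules are the finite ones. *)
Definition pseudo_isomorphic (M N : lmodType L) : Prop :=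
  exists f : {linear M -> N}, finite_set [set x | f x = 0] /\
    exists Y : set N, finite_set Y /\ forall y, exists x, Y (y - f x).

(* E is isomorphic to the direct sum of the L / (g i). *)
Definition sum_of_cyclics (E : lmodType L) (r : nat) (g : 'I_r -> L) : Prop :=
  exists q : {linear 'rV[L]_r -> E}, (forall y, exists v, q v = y) /\
    forall v, q v = 0 <-> forall i, divides (g i) (v 0 i).

Definition char_generator (M : lmodType L) (c : L) : Prop :=
  exists (r : nat) (P : 'I_r -> L) (m : 'I_r -> nat) (E : lmodType L),
    [/\ forall i, prime_element (P i),
        sum_of_cyclics E (fun i => P i ^+ m i),
        pseudo_isomorphic M E
      & c = \prod_i P i ^+ m i].

(* The exponent does not depend on the generator; it is 0 by default when M has
   no characteristic ideal, that is, when M is not torsion. *)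
Definition mu_invariant (w : L) (M : lmodType L) : nat :=
  xget 0%N [set n | exists c, [/\ char_generator M c, divides (w ^+ n) c
                                & ~ divides (w ^+ n.+1) c]].

End CharacteristicIdeal.

Definition int_rat : {pred rat} := fun x => x \is a Num.int.

Lemma int_rat_zmod : zmod_closed int_rat.
Proof. by split=> [|x y]; [exact: rpred0 | exact: rpredB]. Qed.

HB.instance Definition _ := GRing.isZmodClosed.Build rat int_rat int_rat_zmod.

Definition QZ := Quotient.quot int_rat.
HB.instance Definition _ := GRing.Zmodule.on QZ.

Section Selmer.
Variables (p : nat) (K : fieldType) (O : comNzRingType).
Variable i : {rmorphism O -> K}.
(* The Galois action on T = O^2, and a quotient T -> O on which the
   decomposition group of P, a prime above p, acts by eta. *)
Variables (rho : galQ -> 'M[O]_2) (P : set algC).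
Variables (lambda : 'rV[O]_2) (eta : galQ -> O).

Definition mx_act n (M : galQ -> 'M[O]_n) (s : galQ) :
    {additive cotorsion i n -> cotorsion i n} :=
  @cotorsion_mx K O i n n (M s).

Let H : set galQ := gal_Qinf p.

Definition selmer_cocycle (c : Z1 (mx_act rho) H) : Prop :=
  (forall l Q, prime l -> l != p -> prime_above l Q ->
     coboundary (mx_act rho) (inertia Q `&` H) (val c)) /\
  coboundary (mx_act (fun s => (eta s)%:M : 'M_1)) (inertia P `&` H)
    (fun s => cotorsion_mx lambda (val c s)).

Definition selmer_pred : {pred H1 (mx_act rho) H} := fun x =>
  `[< exists c : Z1 (mx_act rho) H, H1_class c = x /\ selmer_cocycle c >].

Lemma selmer_zmod : zmod_closed selmer_pred.
Proof.
split=> [|x y /asboolP[c [<- [c1 c2]]] /asboolP[d [<- [d1 d2]]]].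
  apply/asboolP; exists 0; split; first exact: (raddf0 (\pi_(Quotient.quot _))).
  split=> [l Q _ _ _|]; first by rewrite raddf0; apply: coboundary0.
  exists 0 => s _; rewrite raddf0 subr0.
  exact: (raddf0 (@cotorsion_mx K O i 1 2 lambda)).
apply/asboolP; exists (c - d); split.
  exact: (raddfB (\pi_(Quotient.quot _))).
split=> [l Q lp lQ hQ|].
  by rewrite raddfB; apply: coboundaryB; [exact: c1 lQ hQ | exact: d1 lQ hQ].
have [a ha] := coboundaryB c2 d2; exists a => s hs; rewrite -ha //.
by rewrite !fctE -(raddfB (@cotorsion_mx K O i 1 2 lambda)).
Qed.

HB.instance Definition _ :=
  GRing.isZmodClosed.Build (H1 (mx_act rho) H) selmer_pred selmer_zmod.

(* Sel(Q_oo, A) for A = K^2 / O^2. Archimedean places impose no condition, as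
   A is p-primary and p is odd. *)
Definition selmer := {x : H1 (mx_act rho) H | x \in selmer_pred}.
HB.instance Definition _ := SubChoice.on selmer.
HB.instance Definition _ := [SubChoice_isSubZmodule of selmer by <:].

(* The functions below preserve Z1, B1 and the Selmer condition, so the default
   values of insubd, here and in H1_map, are never used. *)
Definition selmer_scale (a : O) (x : selmer) : selmer :=
  insubd 0 (H1_map (fun c s => cotorsion_mx a%:M (c s)) (val x)).

Definition selmer_conj (t : galQ) (x : selmer) : selmer :=
  insubd 0 (H1_map (fun c s => mx_act rho t (c (t^-1 * s * t)%g)) (val x)).

(* X is the Pontryagin dual of the discrete torsion group selmer, through the
   pairing e. If x in selmer is fixed by Gal(Q_oo/Q_n), the action of an element
   of O[[Gal(Q_oo/Q)]] on e _ x factors through O[Gal(Q_n/Q)], where g acts by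
   (g u)(x) = u(g^-1 x). *)
Definition selmer_dual (X : lmodType (iwasawa_algebra p O))
    (e : X -> {additive selmer -> QZ}) : Prop :=
  [/\ forall u v x, e (u + v) x = e u x + e v x,
      forall u, (forall x, e u x = 0) -> u = 0,
      forall chi : {additive selmer -> QZ}, exists u, forall x, e u x = chi x
    & forall (a : iwasawa_algebra p O) u x n (lift : cyc_level p n -> galQ),
        (forall g, cyc_res p n (lift g) = g) ->
        (forall t, cyc_res p n t = 1%g -> selmer_conj t x = x) ->
        e (a *: u) x =
        \sum_g e u (selmer_scale (cgr_coef a n g) (selmer_conj (lift g)^-1%g x))].

End Selmer.

(* An ordinary eigenform in the Hida family of tame level 1 attached to the
   irregular pair (p, j). *)
Definition hida_eigenform (R : realType) (p j k : nat) (C : padicClosure R p)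
    (f : nat -> C) : Prop :=
  [/\ (2 <= k)%N /\ (k = j %[mod p.-1])%N,
      cusp_space R p k f /\ normalized_eigenform p k f,
      pabs (f p) = 1,
      forall l, prime l -> l != p -> pabs (f l - (1 + l%:R ^+ (k - 1))) < 1
    & pabs (f p - 1) < 1].

Section GaloisRepresentation.
Variables (R : realType) (p : nat) (C : padicClosure R p) (f : nat -> C).
Variable k : nat.

Definition hecke_incl : {rmorphism hecke_int f -> hecke_field f} := val.

(* rho is the action on T = O^2 inside V_f = K^2, in a basis of T. *)
Definition attached_rep (rho : galQ -> 'M[hecke_int f]_2) : Prop :=
  [/\ rho 1%g = 1%:M /\ forall s t, rho (s * t)%g = rho s *m rho t,
      forall (e : R) (s : galQ), 0 < e -> exists r : seq algC,
        forall t : galQ, {in r, forall x, t x = s x} ->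
        forall a b, pabs (val (val (rho t a b - rho s a b))) < e,
      forall l Q s, prime l -> l != p -> prime_above l Q -> inertia Q s ->
        rho s = 1%:M,
      forall l Q s, prime l -> l != p -> prime_above l Q -> frobenius l Q s ->
        val (val (\tr (rho s))) = f l
    & forall s, val (val (\det (rho s))) = cyclotomic_char C s ^+ (k - 1)].

Definition eq_mod (w : hecke_int f) (x y : 'cV[hecke_int f]_2) : Prop :=
  exists z, x - y = w *: z.

(* T/wT is a non-split extension of F by F(omega^(k-1)), the latter being
   the line spanned by u modulo w; a splitting would be given by an invariant
   vector v outside that line. *)
Definition residually_nonsplit (w : hecke_int f)
    (rho : galQ -> 'M[hecke_int f]_2) : Prop :=
  exists u : 'cV[hecke_int f]_2,
    [/\ ~ eq_mod w u 0,
        forall s a, acts_on_mu s p a ->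
          eq_mod w (rho s *m u) (a%:R ^+ (k - 1) *: u),
        forall s t, exists b, eq_mod w (rho s *m t - t) (b *: u)
      & ~ exists v, (forall b, ~ eq_mod w v (b *: u)) /\
                    forall s, eq_mod w (rho s *m v) v].

(* lambda : T -> O induces the quotient V_f -> K(eta) at the prime P above p;
   the character of its kernel is then given by the determinant of rho. *)
Definition ordinary_quotient (rho : galQ -> 'M[hecke_int f]_2) (P : set algC)
    (lambda : 'rV[hecke_int f]_2) (eta : galQ -> hecke_int f) : Prop :=
  [/\ prime_above p P,
      exists t, lambda *m t = 1%:M,
      forall s, decomposition P s -> lambda *m rho s = eta s *: lambda,
      forall s, inertia P s -> eta s = 1
    & forall s, frobenius p P s -> val (val (eta s)) = f p].

End GaloisRepresentation.

(* Main.v *)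
Require Import Defs.
From HB Require Import structures.
From mathcomp Require Import all_boot all_order all_algebra all_field.
From mathcomp Require Import all_fingroup all_solvable.
From mathcomp Require Import generic_quotient ring_quotient.
From mathcomp Require Import boolp classical_sets functions cardinality.
From mathcomp Require Import reals ereal.
From mathcomp Require Import zify ring lra.

Require Import Defs.

Set Implicit Arguments.
Unset Strict Implicit.
Unset Printing Implicit Defensive.

Import Order.TTheory GRing.Theory Num.Theory.
Local Open Scope classical_set_scope.
Local Open Scope ring_scope.

(** Let O be the coefficient ring, w its uniformizer, m the order of a_p - 1, and
    A = K^2/O^2 the Galois module attached to the lattice T. Write Gamma for
    Gal(Q_oo/Q), with generator gamma, S for the Selmer group of A over Q_oo, and X for
    its dual. The idea is to control S through its Gamma-invariants.

    Let x be an invariant class. Since A has no invariants over Q_oo (no_invariants), x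
    extends to a cocycle y on Gal(Qbar/Q) (extends_exists). On inertia at p, the
    quotient lambda(y) is a homomorphism that vanishes over Q_oo, hence factors through
    Gamma. Frobenius at p acts on it by a_p, because of the ordinary quotient, and
    trivially, because Gamma is abelian: so lambda(y) is killed by a_p - 1
    (frobenius_kills). If lambda(y) vanishes, so does x (unramified_class). Indeed one
    may assume that w x = 0. Modulo w, the image of y in the unramified quotient of T/wT
    is a character of Gal(Qbar/Q) unramified everywhere, hence trivial by Minkowski's
    theorem (unramified_character_trivial). Therefore y comes from a class in
    F(omega^(k-1)) unramified outside p. These classes form a line (residual_unique),
    spanned by the class of the non-split extension T/wT itself, which dies in A. So x
    is zero. As a consequence the invariants of S are killed by w^m, and their w-torsion
    is at most a line, read off from lambda(y) at one inertial generator of Gamma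
    (invariant_line).

    The line of classes in F(omega^(k-1)) is where the hypothesis on the class group is
    used. Over Q(zeta_p) such a class amounts to Kummer characters with prescribed
    conjugation behaviour. A Kummer generator defines an ideal of Q(zeta_p) whose class is
    killed by p and lies in the omega^(2-j)-eigenspace, so that the generator can be
    replaced by a p-unit (kummer_unit). Modulo p-th powers, the p-units with a given even
    character are at most one-dimensional: this is proved for the group of squared
    absolute values of p-units, a lattice on which a cyclic group acts and whose rational
    span is a quotient of the regular representation, by a pigeonhole argument with
    approximate logarithms (eigen_line, kummer_dependence). The prime p is odd because
    the even Bernoulli numbers are not 2-integral (irregular_odd).

    By duality, the two properties of the invariants say that X is generated by one
    element u0 over O modulo (gamma - 1) X, and that w^m u0 lies in (gamma - 1) X
    (dual_generators). A determinant argument in the Iwasawa algebra then bounds the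
    exponent of w in any generator of the characteristic ideal by m (mu_bound). *)


(** * The fixed field of the Galois group *)
(** Characteristic zero: a minimal polynomial cannot divide its derivative, which has smaller degree. *)
Lemma minCpoly_separable (x : algC) (p : {poly rat}) :
  p \is monic -> root (map_poly ratr p) x ->
  (forall q, root (map_poly ratr q) x = (p %| q)) -> separable_poly p.
Proof.
move=> mon_p px0 minp; have p0 := monic_neq0 mon_p.
have p1 : (1 < size p)%N.
  by rewrite -(size_map_poly (ratr : rat -> algC)) (root_size_gt1 _ px0) ?map_poly_eq0.
have := dvdp_gcdl p p^`() => /dvdpP[h Dh].
have : root (map_poly ratr p) x by [].
rewrite {1}Dh rmorphM rootM /= !minp => /orP[ph|pg]; last first.
  have := dvdp_trans pg (dvdp_gcdr _ _) => /dvdp_leq.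
  have -> : p^`() != 0.
    apply/eqP => /polyP/(_ (size p).-2); rewrite coef_deriv coef0.
    rewrite -[(size p).-2.+1](_ : (size p).-1 = _); last by case: (size p) p1 => [|[]].
    rewrite -/(lead_coef p) (monicP mon_p) => /eqP.
    by rewrite pnatr_eq0; case: (size p) p1 => [|[]].
  by move/(_ isT); rewrite leqNgt lt_size_deriv.
rewrite separable_poly.unlock /coprimep.
have h0 : h != 0 by apply: contra_neq p0 => h0; rewrite Dh h0 mul0r.
have g0 : gcdp p p^`() != 0 by apply: contra_neq p0 => g0; rewrite Dh g0 mulr0.
have sz : size p = (size h + size (gcdp p p^`())).-1 by rewrite {1}Dh size_mul.
have := dvdp_leq h0 ph; rewrite sz.
have : (0 < size h)%N by rewrite size_poly_gt0.
have : (0 < size (gcdp p p^`()))%N by rewrite size_poly_gt0.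
by move: (size _) (size _) => i k; lia.
Qed.

(** The roots of a minimal polynomial are permuted transitively by the automorphisms, and a
    separable polynomial with a single root has degree 1. *)
Lemma fixed_rational (x : algC) : (forall s : galQ, s x = x) -> x \in Crat.
Proof.
move=> fix_x; have [p [Dp mon_p] minp] := minCpolyP x.
have [r] := closed_field_poly_normal (minCpoly x).
rewrite (monicP (minCpoly_monic x)) scale1r => Dr.
have [Qn [QnC [r1 Dr1 genQn]]] := num_field_exists r.
pose p1 := map_poly (in_alg Qn) p.
have p1E : p1 = \prod_(z <- r1) ('X - z%:P).
  apply: (map_poly_inj QnC); rewrite -map_poly_comp rmorph_prod /=.
  rewrite (eq_map_poly (_ : _ =1 ratr)) => [|a]; last first.
    by rewrite /= rmorphZ_num rmorph1 mulr1.
  rewrite -Dp Dr -Dr1 big_map.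
  by apply: eq_bigr => z _; rewrite rmorphB /= map_polyX map_polyC.
have Qp1 : p1 \is a polyOver 1%VS by apply/polyOver1P; exists p.
have spl : splittingFieldFor 1 p1 {:Qn} by exists r1; rewrite // p1E eqpxx.
have Qn_ax : FieldExt_isSplittingField _ Qn by constructor; exists p1.
pose L : splittingFieldType rat := HB.pack_for (splittingFieldType rat) Qn Qn_ax.
have galL : galois 1 {:L}.
  apply/splitting_galoisField; exists p1; split => //.
  rewrite separable_map; apply: (@minCpoly_separable x) => //.
  by rewrite -Dp root_minCpoly.
have /mapP[x1 r1x Dx] : x \in map QnC r1.
  by rewrite Dr1 -root_prod_XsubC -Dr root_minCpoly.
have : x1 \in (1%VS : {vspace L}).
  have /galois_fixedField <- := galL.
  apply/fixedFieldP; rewrite ?memvf // => g _.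
  have [nu Dnu] := extend_algC_subfield_aut QnC (g : {rmorphism L -> L}).
  by apply: (fmorph_inj QnC); rewrite Dnu -Dx; apply: fix_x.
case/vlineP => a Da; rewrite Dx Da alg_num_field fmorph_rat; exact: Crat_rat.
Qed.

(** * Compactness of the Galois group, and lifting of residue automorphisms *)

Lemma finite_conj (x : algC) : exists rs : seq algC, forall s : galQ, s x \in rs.
Proof.
have [rs] := closed_field_poly_normal (minCpoly x).
rewrite (monicP (minCpoly_monic x)) scale1r => Drs; exists rs => s.
rewrite -root_prod_XsubC -Drs; have [p [Dp _] _] := minCpolyP x.
have -> : minCpoly x = map_poly s (minCpoly x).
  rewrite Dp -map_poly_comp; apply: eq_map_poly => a.
  by rewrite /= fmorph_rat.
by rewrite fmorph_root root_minCpoly.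
Qed.

Lemma finite_conj_seq (r : seq algC) :
  exists L : seq (seq algC), forall s : galQ, map s r \in L.
Proof.
elim: r => [|x r [L hL]]; first by exists [:: [::]] => s; rewrite inE.
have [rs hrs] := finite_conj x.
exists [seq y :: l | y <- rs, l <- L] => s.
by apply/allpairsP; exists (s x, map s r); rewrite /= hrs hL.
Qed.

Lemma rmorphism_of (f : algC -> algC) :
  (forall x y, f (x - y) = f x - f y) -> f 1 = 1 ->
  (forall x y, f (x * y) = f x * f y) -> exists s : galQ, forall x, s x = f x.
Proof.
move=> fB f1 fM.
pose m1 := GRing.isZmodMorphism.Build algC algC f fB.
pose m2 := GRing.isMonoidMorphism.Build algC algC f (conj f1 fM).
pose s : {rmorphism algC -> algC} := HB.pack f m1 m2.
by exists s.
Qed.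

Section Compactness.
Variable Phi : seq algC -> galQ -> Prop.
Hypothesis Phi_ex : forall r, exists s, Phi r s.
Hypothesis Phi_sub : forall (r r' : seq algC) s,
  {subset r <= r'} -> Phi r' s -> Phi r s.
Hypothesis Phi_loc : forall (r : seq algC) (s t : galQ),
  {in r, forall x, s x = t x} -> Phi r s -> Phi r t.

Let x_ n : algC := odflt 0 (unpickle n).
Let Good (ys : seq algC) := forall r, exists s, Phi r s /\
  forall i, (i < size ys)%N -> s (x_ i) = ys`_i.

Let Good_next ys : Good ys -> exists y, Good (rcons ys y).
Proof.
move=> hys; apply: contrapT => /forallNP no.
have [rs hrs] := finite_conj (x_ (size ys)).
have /choice[r_ hr_] : forall y, exists r, forall s, Phi r s ->
    (forall i, (i < size ys)%N -> s (x_ i) = ys`_i) -> s (x_ (size ys)) <> y.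
  move=> y; have /existsNP[r hr] := no y; exists r => s Ps hs hy.
  apply: hr; exists s; split=> // i; rewrite size_rcons ltnS leq_eqVlt.
  case/orP => [/eqP->|ilt]; first by rewrite nth_rcons ltnn eqxx.
  by rewrite nth_rcons ilt hs.
have [s [Ps hs]] := hys (flatten (map r_ rs)).
apply: (hr_ (s (x_ (size ys))) s) => //.
apply: Phi_sub Ps => x xr; apply/flattenP; exists (r_ (s (x_ (size ys)))) => //.
by apply: map_f; apply: hrs.
Qed.

(** Compactness of the Galois group, in the form: conditions of finite character that can be met on
    every finite set of numbers can be met simultaneously. The values are chosen one number at a time
    along an enumeration, since each number has finitely many conjugates. *)
Lemma galQ_compact : exists s, forall r, Phi r s.
Proof.
have /choice[next hnext] : forall ys, exists y, Good ys -> Good (rcons ys y).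
  move=> ys; have [/Good_next[y hy]|no] := pselect (Good ys); first by exists y.
  by exists 0.
pose ys := fix ys n := if n is m.+1 then rcons (ys m) (next (ys m)) else [::].
have sz n : size (ys n) = n by elim: n => //= n IH; rewrite size_rcons IH.
have G n : Good (ys n).
  elim: n => [|n IH /=]; last exact: hnext.
  by move=> r; have [s Ps] := Phi_ex r; exists s.
have pre m n i : (i < m)%N -> (m <= n)%N -> (ys n)`_i = (ys m)`_i.
  move=> im; elim: n => [|n IH]; first by rewrite leqn0 => /eqP m0; rewrite m0 in im.
  rewrite leq_eqVlt => /orP[/eqP->//|mn].
  by rewrite /= nth_rcons sz (leq_trans im mn) IH.
pose f (x : algC) := (ys (pickle x).+1)`_(pickle x).
have fP (l : seq algC) : exists s, (forall r, exists s', Phi r s' /\ {in l, forall x, s' x = f x})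
   /\ {in l, forall x, (s : galQ) x = f x}.
  pose n := (\max_(x <- l) pickle x).+1.
  have H r : exists s', Phi r s' /\ {in l, forall x, s' x = f x}.
    have [s [Ps hs]] := G n r; exists s; split=> // x xl.
    have xn : (pickle x < n)%N by rewrite ltnS; apply: (@leq_bigmax_seq _ l xpredT).
    have := hs (pickle x); rewrite sz => /(_ xn).
    have -> : x_ (pickle x) = x by rewrite /x_ pickleK.
    by move=> ->; apply: pre.
  by have [s [_ hs]] := H [::]; exists s; split.
have [s hs] : exists s : galQ, forall x, s x = f x.
  apply: rmorphism_of => [x y||x y].
  - have [s [_ hs]] := fP [:: x - y; x; y].
    by rewrite -!hs ?inE ?eqxx ?orbT // rmorphB.
  - by have [s [_ hs]] := fP [:: 1]; rewrite -hs ?inE // rmorph1.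
  - have [s [_ hs]] := fP [:: x * y; x; y].
    by rewrite -!hs ?inE ?eqxx ?orbT // rmorphM.
exists s => r; have [_ [/(_ r)[t [Pt ht]] _]] := fP r.
by apply: Phi_loc Pt => x xr; rewrite ht // hs.
Qed.
End Compactness.

Section Lifting.
Variables (B : comNzRingType) (iota : {rmorphism B -> algC}).
Hypothesis iota_inj : injective iota.
Variable act : galQ -> {rmorphism B -> B}.
Hypothesis act_iota : forall s b, iota (act s b) = s (iota b).

Lemma galois_orbit (N : set galQ) (bs : seq B) :
  N 1%g -> (forall s t, N s -> N t -> N (s * t)%g) ->
  exists orb : seq {poly B}, [/\ uniq orb,
    forall y, y \in orb <-> exists2 s, N s & map_poly (act s) (Poly bs) = y
  & forall s, N s -> perm_eq (map (map_poly (act s)) orb) orb].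
Proof.
move=> N1 NM; pose z := Poly bs.
have actM s t b : act (s * t)%g b = act s (act t b).
  by apply: iota_inj; rewrite !act_iota.
pose S := [set map_poly (act s) z | s in N].
have [orb0 Dorb0] : exists s : seq {poly B}, S = [set` s].
  apply/finite_seqP; have [L hL] := finite_conj_seq (map iota bs).
  pose g (l : seq algC) := Poly [seq xget 0 [set b | iota b = y] | y <- l].
  apply: (@sub_finite_set _ _ (g @` [set` L])); last exact/finite_image/finite_seq.
  move=> _ [s Ns <-]; exists (map s (map iota bs)); first exact: hL.
  apply/polyP => i; rewrite coef_map !coef_Poly -!map_comp.
  have [il|il] := ltnP i (size bs); last first.
    have -> : bs`_i = 0 by rewrite nth_default.
    transitivity (0 : B); first by rewrite nth_default ?size_map.
    by symmetry; exact: (rmorph0 (act s)).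
  rewrite (nth_map 0) //=; case: xgetP => [b _ /= hb|no].
    by apply: iota_inj; rewrite hb act_iota.
  by case: (no (act s bs`_i)); rewrite /= act_iota.
have mem_orb y : (y \in undup orb0) <-> S y by rewrite mem_undup Dorb0.
exists (undup orb0); split; [exact: undup_uniq | exact: mem_orb |].
move=> s Ns.
have u1 : uniq (map (map_poly (act s)) (undup orb0)).
  rewrite map_inj_uniq ?undup_uniq //; apply: map_inj_poly => [b c e|].
    by apply: iota_inj; apply: (fmorph_inj s); rewrite -!act_iota e.
  exact: rmorph0.
have sub : {subset map (map_poly (act s)) (undup orb0) <= undup orb0}.
  move=> _ /mapP[y /mem_orb[t Nt <-] ->]; apply/mem_orb.
  exists (s * t)%g; first exact: NM.
  rewrite -map_poly_comp; apply: eq_map_poly => b; exact: actM.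
have [|_ eqm] := uniq_min_size u1 sub; first by rewrite size_map.
by apply: uniq_perm; rewrite ?undup_uniq.
Qed.

(** The source of all automorphisms with prescribed reduction (decomposition groups, Frobenius
    elements, transitivity on primes): two maps to a domain that agree on the invariants of N are
    related by N. The product over an orbit of the polynomials X - y is fixed by N, so one of its
    factors must match after reduction; a generic combination of several elements reduces the case
    of a list to that of one element. *)
Lemma galois_lifting (N : set galQ) (Omega : idomainType)
    (psi1 psi2 : {rmorphism B -> Omega}) :
  N 1%g -> (forall s t, N s -> N t -> N (s * t)%g) ->
  (forall b, (forall s, N s -> act s b = b) -> psi1 b = psi2 b) ->
  forall bs : seq B, exists2 s, N s & {in bs, forall b, psi2 b = psi1 (act s b)}.
Proof.
move=> N1 NM psiE bs; have [orb [uorb mem_orb perm_orb]] := galois_orbit bs N1 NM.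
have act1 b : act 1%g b = b by apply: iota_inj; rewrite act_iota.
pose f : {poly {poly B}} := \prod_(y <- orb) ('X - y%:P).
have f_fix s : N s -> map_poly (map_poly (act s)) f = f.
  move=> Ns; rewrite /f rmorph_prod /=.
  under eq_bigr => y _ do rewrite rmorphB /= map_polyX map_polyC /=.
  rewrite -(big_map (map_poly (act s)) xpredT (fun y => 'X - y%:P)).
  exact/perm_big/perm_orb.
have psif : map_poly (map_poly psi1) f = map_poly (map_poly psi2) f.
  apply/polyP => i; rewrite !coef_map; apply/polyP => j; rewrite /= !coef_map.
  apply: psiE => s Ns; rewrite -[LHS]coef_map -[map_poly _ _]coef_map /=.
  by rewrite f_fix.
have : root (map_poly (map_poly psi1) f) (map_poly psi2 (Poly bs)).
  rewrite psif; apply: rmorph_root.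
  have zorb : Poly bs \in orb.
    by apply/mem_orb; exists 1%g => //; rewrite (eq_map_poly act1) map_poly_id.
  rewrite /root /f horner_prod (bigD1_seq (Poly bs)) //=.
  by rewrite hornerXsubC subrr mul0r.
rewrite /f rmorph_prod /=.
under eq_bigr => y _ do rewrite rmorphB /= map_polyX map_polyC /=.
rewrite -(big_map (map_poly psi1) xpredT (fun y => 'X - y%:P)) root_prod_XsubC.
case/mapP => y /mem_orb[s Ns <-] e; exists s => // b /(nthP 0)[i il <-].
by move/polyP/(_ i): e; rewrite !coef_map coef_Poly.
Qed.
End Lifting.

(** * Primes of the ring of algebraic integers *)

Definition algInt := {x : algC | x \in Aint}.
HB.instance Definition _ := SubChoice.on algInt.
HB.instance Definition _ := [SubChoice_isSubComNzRing of algInt by <:].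

Definition aint_act (s : galQ) (x : algInt) : algInt :=
  exist _ (s (val x)) (etrans (Aint_aut s (val x)) (valP x)).

Lemma aint_act_zmod s : zmod_morphism (aint_act s).
Proof. by move=> x y; apply/val_inj; rewrite /= rmorphB. Qed.
HB.instance Definition _ s :=
  GRing.isZmodMorphism.Build algInt algInt (aint_act s) (aint_act_zmod s).
Lemma aint_act_mon s : monoid_morphism (aint_act s).
Proof. by split=> [|x y]; apply/val_inj; rewrite /= ?rmorph1 ?rmorphM. Qed.
HB.instance Definition _ s :=
  GRing.isMonoidMorphism.Build algInt algInt (aint_act s) (aint_act_mon s).

Definition aint_incl : {rmorphism algInt -> algC} := val.

Lemma aint_incl_inj : injective aint_incl. Proof. exact: val_inj. Qed.

Lemma aint_intE (n : int) : val (n%:~R : algInt) = n%:~R.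
Proof. exact: (rmorph_int aint_incl). Qed.

Lemma mk_aint (x : algC) : x \in Aint -> exists y : algInt, val y = x.
Proof. by move=> h; exists (Sub x h). Qed.

Lemma quot_eq0 (V : zmodType) (I : zmodClosed V) (x : V) :
  (\pi_(Quotient.quot I)%qT x == 0) = (x \in I).
Proof.
by rewrite -[0 in LHS](raddf0 (\pi_(Quotient.quot I)%qT)) -Quotient.idealrBE subr0.
Qed.

Lemma classical_idomain (A : comNzRingType) :
  (forall x y : A, x * y = 0 -> (x == 0) || (y == 0)) ->
  exists (Om : idomainType) (h : {rmorphism A -> Om}), injective h.
Proof.
move=> dom; pose unit0 : pred A := fun x => `[< exists y, y * x = 1 >].
have /choice[inv0 hinv] : forall x : A, exists z : A,
    (unit0 x -> z * x = 1) /\ (~~ unit0 x -> z = x).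
  move=> x; rewrite /unit0; case: asboolP => [[y yx]|_]; last by exists x.
  by exists y.
have mulVx : {in unit0, left_inverse 1 inv0 *%R} by move=> x /(proj1 (hinv x)).
have unitPl (x y : A) : y * x = 1 -> unit0 x by move=> h; apply/asboolP; exists y.
have invout : {in [predC unit0], inv0 =1 id} by move=> x /(proj2 (hinv x)).
pose m3 := GRing.ComNzRing_hasMulInverse.Build A mulVx unitPl invout.
pose A1 := HB.pack_for comUnitRingType A m3.
pose m4 := GRing.ComUnitRing_isIntegral.Build A1 dom.
pose Om := HB.pack_for idomainType A A1 m4.
by exists Om, (idfun : {rmorphism A -> A}).
Qed.

Lemma prime_residue l P : prime_above l P ->
  exists (Om : idomainType) (pi : {rmorphism algInt -> Om}),
    forall x, pi x = 0 <-> P (val x).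
Proof.
move=> [[Psub Pl] PD PM P1 PP].
pose S : {pred algInt} := fun x => `[< P (val x) >].
have inS x : x \in S = `[< P (val x) >] by [].
have S_ideal : idealr_closed S.
  split.
  - rewrite inS; apply/asboolP => /=; 
    by rewrite -(mul0r l%:R); apply: (PM) => //; apply: rpred0.
  - by rewrite inS; apply/asboolP.
  - move=> a u v; rewrite !inS => /asboolP Pu /asboolP Pv; apply/asboolP => /=.
    by apply: (PD) => //; apply: (PM) => //; exact: (valP a).
have S_prime : prime_idealr_closed S.
  move=> u v; rewrite !inS => /asboolP /= Puv; apply/orP.
  by case: (PP _ _ (valP u) (valP v) Puv) => h; [left|right]; apply/asboolP.
pose m1 := isIdealr.Build _ S S_ideal.
pose m2 := isPrimeIdealrClosed.Build _ S S_prime.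
pose I : prime_idealr algInt := HB.pack S m1 m2.
have [Om [h hinj]] := @classical_idomain {ideal_quot I} (@Quotient.rquot_IdomainAxiom _ I).
pose q : {rmorphism algInt -> {ideal_quot I}} := \pi_({ideal_quot I})%qT.
exists Om, (h \o q) => x; transitivity (x \in S); last first.
  by rewrite inS; split=> [/asboolP|?]; last apply/asboolP.
rewrite -[x \in S]/(x \in I) -quot_eq0 -[_ == 0]/(q x == 0).
split=> [e|/eqP e]; last by rewrite /= e rmorph0.
by apply/eqP/hinj; rewrite [LHS]e rmorph0.
Qed.

Section PrimeLift.
Variables (l : nat) (P : set algC).
Hypothesis hP : prime_above l P.

Lemma prime0 : P 0.
Proof.
by case: hP => [[_ Pl] _ PM _ _]; rewrite -(mul0r l%:R); apply: (PM); rewrite ?rpred0.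
Qed.

Lemma primeB x y : P x -> P y -> P (x - y).
Proof.
case: hP => [[_ Pl] PD PM _ _] Px Py; apply: (PD) => //.
by rewrite -mulN1r; apply: (PM); rewrite // rpredN rpred1.
Qed.

Lemma prime_sub x : P x -> x \in Aint.
Proof. by case: hP => [[h _] _ _ _ _] /h. Qed.

Lemma prime_int (n : int) : prime l -> P n%:~R -> (l%:Z %| n)%Z.
Proof.
move=> pl Pn; apply: contrapT => /negP ndvd; case: hP => [[_ Pl] PD PM P1 _].
apply: (P1); have : coprimez l n by by rewrite coprimezE /= prime_coprime.
case/coprimezP => [[u v]] /= e; rewrite -[1](_ : 1%:~R = _) // -e.
rewrite rmorphD !rmorphM /=; apply: (PD); apply: (PM); rewrite ?Aint_int //.
Qed.

(** If sigma acts trivially modulo P on the integers fixed by N, then it is inertial at P up to N. *)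
Lemma inertia_lift (N : set galQ) (sigma : galQ) :
  N 1%g -> (forall s t, N s -> N t -> N (s * t)%g) ->
  (forall s : galQ, (forall r : seq algC, exists2 t, N t & {in r, forall x, t x = s x}) ->
    N s) ->
  (forall z, z \in Aint -> (forall t, N t -> t z = z) -> P (sigma z - z)) ->
  exists2 s, N s & inertia P (sigma * s)%g.
Proof.
move=> N1 NM Ncl hs; have [Om [pi piP]] := prime_residue hP.
pose Phi (r : seq algC) (s : galQ) := (exists2 t, N t & {in r, forall x, t x = s x}) /\
  {in r, forall x, x \in Aint -> P (sigma (s x) - x)}.
have [|r r' s sub [[t Nt ht] h]|r s s' ss' [[t Nt ht] h]|s Hs] := @galQ_compact Phi.
- move=> r.
  pose psi1 : {rmorphism algInt -> Om} := pi \o aint_act sigma.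
  pose bs : seq algInt := pmap insub r.
  have [|s Ns es] := galois_lifting aint_incl_inj (act := aint_act)
    (fun _ _ => erefl) (psi1 := psi1) (psi2 := pi) N1 NM _ bs.
    move=> b fixb; apply/eqP; rewrite -subr_eq0 /= -rmorphB; apply/eqP/piP => /=.
    apply: hs => [|t Nt]; first exact: (valP b).
    by rewrite -[RHS](congr1 val (fixb t Nt)).
  exists s; split; first by exists s.
  move=> x xr xA; have [y Dy] := mk_aint xA.
  have yb : y \in bs by rewrite mem_pmap_sub Dy.
  have /esym/eqP := es y yb; rewrite -subr_eq0 /= -rmorphB => /eqP/piP /=.
  by rewrite Dy.
- split; first by exists t => // x xr; apply/ht/sub.
  by move=> x xr; apply/h/sub.
- split; first by exists t => // x xr; rewrite ht // ss'.
  by move=> x xr; rewrite -ss' //; apply: h.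
exists s; first by apply: (Ncl) => r; have [] := Hs r.
by move=> x xA; have [_] := Hs [:: x]; apply; rewrite ?inE.
Qed.

(** The p-power map on residues agrees with the identity on rational integers, hence is induced by an
    automorphism. *)
Lemma frobenius_exists : prime l -> exists s, frobenius l P s.
Proof.
move=> pl; have [Om [pi piP]] := prime_residue hP.
have chl : l \in [pchar Om].
  rewrite inE pl /= -(rmorph_nat pi); apply/eqP/piP; rewrite rmorph_nat.
  by case: hP => [[]].
pose psi2 : {rmorphism algInt -> Om} := pFrobenius_aut chl \o pi.
have [|r r' s sub h|r s s' ss' h|s Hs] := @galQ_compact
  (fun r s => {in r, forall x, x \in Aint -> P (s x - x ^+ l)}).
- move=> r; pose bs : seq algInt := pmap insub r.
  have [|s _ es] := galois_lifting aint_incl_inj (act := aint_act)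
    (fun _ _ => erefl) (N := setT) (psi1 := pi) (psi2 := psi2) I (fun _ _ _ _ => I) _ bs.
    move=> b fixb; have : val b \in Crat.
      by apply: fixed_rational => s; rewrite -[RHS](congr1 val (fixb s I)).
    move/Cint_rat_Aint => /(_ (valP b)) /intrP[n Dn].
    have -> : b = n%:~R by apply: aint_incl_inj; rewrite rmorph_int; exact: Dn.
    by rewrite !rmorph_int.
  exists s => x xr xA; have [y Dy] := mk_aint xA.
  have yb : y \in bs by rewrite mem_pmap_sub Dy.
  have /esym/eqP := es y yb; rewrite /= pFrobenius_autE -rmorphXn -subr_eq0 -rmorphB.
  move=> /eqP/piP; rewrite -[val _]/(aint_incl _) rmorphB rmorphXn.
  by rewrite -[aint_incl y]/(val y) -[aint_incl _]/(s (val y)) Dy.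
- by move=> x xr; apply/h/sub.
- by move=> x xr; rewrite -ss' //; apply: h.
by exists s => x xA; apply: (Hs [:: x]); rewrite ?inE.
Qed.
End PrimeLift.

(** Primes above the same rational prime are conjugate: the two reductions agree on the integers. *)
Lemma prime_conj l P P' : prime l -> prime_above l P -> prime_above l P' ->
  exists s : galQ, forall x, P' x -> P (s x).
Proof.
move=> pl hP hP'; have [Om [pi piP]] := prime_residue hP.
have [|r r' s sub h|r s s' ss' h|s Hs] := @galQ_compact
  (fun r s => {in r, forall x, P' x -> P (s x)}).
- move=> r; pose bs : seq algInt := pmap insub [seq x <- r | `[< P' x >]].
  have [orb [uorb mem_orb perm_orb]] := galois_orbit aint_incl_inj
    (act := aint_act) (fun _ _ => erefl) bs (N := setT) I (fun _ _ _ _ => I).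
  have bsP' b : b \in bs -> P' (val b).
    by rewrite mem_pmap_sub mem_filter => /andP[/asboolP].
  have zorb : Poly bs \in orb.
    apply/mem_orb; exists 1%g => //; apply/polyP => i; rewrite coef_map /=.
    exact/val_inj.
  pose h := \prod_(y <- orb) y.
  have hP'i i : P' (val h`_i).
    change (P' (aint_incl h`_i)); rewrite /h (bigD1_seq (Poly bs)) // coefM raddf_sum.
    have [[_ P'l] P'D P'M _ _] := hP'.
    have P'Mr (x y : algInt) : P' (val x) -> P' (val (x * y)).
      move=> Px; have -> : val (x * y) = val y * val x by rewrite [RHS]mulrC.
      by apply: P'M => //; exact: (valP y).
    apply: big_ind => [||j _]; [exact: prime0 hP' | exact: P'D |].
    apply: P'Mr.
    rewrite coef_Poly; have [jl|jl] := ltnP j (size bs).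
      by apply: bsP'; apply: mem_nth.
    by rewrite nth_default // rmorph0; exact: prime0 hP'.
  have hint i : exists n : int, h`_i = n%:~R.
    have : val h`_i \in Crat.
      apply: fixed_rational => s; rewrite -[LHS](_ : val (map_poly (aint_act s) h)`_i = _).
        rewrite /h rmorph_prod -(big_map (map_poly (aint_act s)) xpredT id) /=.
        by rewrite (perm_big orb) //; apply: perm_orb.
      by rewrite coef_map.
    move/Cint_rat_Aint => /(_ (valP _)) /intrP[n Dn]; exists n.
    by apply: aint_incl_inj; rewrite rmorph_int; exact: Dn.
  have pih : map_poly pi h = 0.
    apply/polyP => i; rewrite coef_map coef0; apply/piP.
    have [n Dn] := hint i; have := hP'i i; rewrite Dn aint_intE.
    move/(prime_int hP' pl) => /dvdzP[m ->]; rewrite rmorphM /=.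
    by case: hP => [[_ Pl] _ PM _ _]; apply: (PM) => //; apply: Aint_int.
  move/eqP: pih; rewrite rmorph_prod prodf_seq_eq0 => /hasP[y /mem_orb[s _ <-] /= /eqP e].
  exists s => x xr P'x; have [b Db] := mk_aint (prime_sub hP' P'x).
  have bb : b \in bs by rewrite mem_pmap_sub Db mem_filter xr andbT; apply/asboolP.
  have [i il Di] := nthP 0 bb.
  have := congr1 (fun q : {poly _} => q`_i) e; rewrite /= !coef_map coef0 coef_Poly Di.
  by move/piP; rewrite /= Db.
- by move=> x xr; apply/h/sub.
- by move=> x xr; rewrite -ss' //; apply: h.
by exists s => x; apply: (Hs [:: x]); rewrite ?inE.
Qed.


(** Subrings and their ideals are predicates, so that ideals of different subrings can be compared. *)
Definition subring_set (B : set algC) : Prop :=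
  [/\ B 1, forall x y, B x -> B y -> B (x - y) & forall x y, B x -> B y -> B (x * y)].

Definition ideal_of (B J : set algC) : Prop :=
  [/\ J `<=` B, J 0, forall x y, J x -> J y -> J (x + y)
    & forall x y, B x -> J y -> J (x * y)].

(** Zorn: an ideal maximal among those that avoid a multiplicative set is prime. The last clause
    records the maximality. *)
Lemma ex_prime_ideal (B J S : set algC) :
  subring_set B -> ideal_of B J -> S `<=` B -> S 1 ->
  (forall x y, S x -> S y -> S (x * y)) -> (forall x, J x -> ~ S x) ->
  exists Q : set algC, [/\ ideal_of B Q, J `<=` Q, forall x, Q x -> ~ S x,
    forall x y, B x -> B y -> Q (x * y) -> Q x \/ Q y
  & forall x, B x -> ~ Q x -> exists q b, [/\ Q q, B b & S (q + x * b)]].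
Proof.
move=> [B1 BsB BM] [JB J0 JD JM] SB S1 SM JS.
pose good (Q : set algC) := [/\ ideal_of B Q, J `<=` Q & forall x, Q x -> ~ S x].
have [F FP Ftot|Q [Qgood Qmax]] := @Zorn_bigcup algC (fun Q => Q = set0 \/ good Q).
  have [[X0 FX0 gX0]|no] := pselect (exists2 X, F X & good X); last first.
    left; apply/seteqP; split=> // x [X FX Xx].
    by case: (FP X FX) => [X0|gX]; [rewrite X0 in Xx | case: no; exists X].
  right; have gX X x : F X -> X x -> good X.
    by move=> FX Xx; case: (FP X FX) => // X00; rewrite X00 in Xx.
  have [[X0B X00 _ _] JX0 _] := gX0.
  split.
  - split.
    + by move=> x [X FX Xx]; have [[XB _ _ _] _ _] := gX X x FX Xx; apply: (XB).
    + by exists X0.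
    + move=> x y [X FX Xx] [Y FY Yy].
      have [[_ _ XD _] _ _] := gX X x FX Xx; have [[_ _ YD _] _ _] := gX Y y FY Yy.
      by case: (Ftot X Y FX FY) => h; [exists Y => //; apply: (YD) => //; apply: h |
        exists X => //; apply: (XD) => //; apply: h].
    + move=> x y Bx [Y FY Yy]; exists Y => //.
      by have [[_ _ _ YM] _ _] := gX Y y FY Yy; apply: (YM).
  - by move=> x Jx; exists X0 => //; apply: (JX0).
  - by move=> x [X FX Xx]; have [_ _] := gX X x FX Xx; apply.
have gQ : good Q.
  case: Qgood => // Q0; exfalso; apply: (Qmax J); last by right; split.
  by rewrite Q0; split=> // /(_ 0 J0).
have [[QB Q0 QD QM] JQ QS] := gQ.
have BN x : B x -> B (- x).
  by move=> Bx; rewrite -[- x]add0r -(subrr 1); apply: (BsB) => //; apply: (BsB).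
have BD x y : B x -> B y -> B (x + y).
  by move=> Bx By; rewrite -[y]opprK; apply: (BsB) => //; apply: (BN).
have meet x : B x -> ~ Q x -> exists q b, [/\ Q q, B b & S (q + x * b)].
  move=> Bx nQx; apply: contrapT => no.
  pose Q' := [set z | exists q b, [/\ Q q, B b & z = q + x * b]].
  apply: (Qmax Q').
    split; last by move=> h; apply/nQx/h; exists 0, 1; rewrite add0r mulr1; split.
    move=> z Qz; exists z, 0; rewrite mulr0 addr0; split=> //; exact: QB.
  right; split.
  - split.
    + by move=> _ [q [b [Qq Bb ->]]]; apply: (BD); [exact: QB | exact: BM].
    + by exists 0, 0; rewrite mulr0 addr0; split=> //; exact: QB.
    + move=> _ _ [q [b [Qq Bb ->]]] [q' [b' [Qq' Bb' ->]]].
      exists (q + q'), (b + b'); rewrite mulrDr addrACA; split=> //; [exact: QD | exact: BD].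
    + move=> c _ Bc [q [b [Qq Bb ->]]]; exists (c * q), (c * b).
      by rewrite mulrDr mulrCA; split=> //; [exact: QM | exact: BM].
  - by move=> z Jz; exists z, 0; rewrite mulr0 addr0; split=> //; [exact: JQ | exact/QB].
  - by move=> _ [q [b [Qq Bb ->]]] Sz; apply: no; exists q, b.
exists Q; split=> // x y Bx By Qxy; apply: contrapT => /not_orP[nQx nQy].
have [q [b [Qq Bb Sq]]] := meet x Bx nQx.
have [q' [b' [Qq' Bb' Sq']]] := meet y By nQy.
apply: (QS ((q + x * b) * (q' + y * b'))); last exact: SM.
have -> : (q + x * b) * (q' + y * b') = (q' + y * b') * q + (x * b) * q' + (b * b') * (x * y).
  by ring.
by apply: (QD); [apply: (QD)|]; apply: (QM) => //; auto.
Qed.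

Lemma Aint_subring_set : subring_set [set x | x \in Aint].
Proof. by split=> [|x y|x y] /=; [exact: rpred1 | exact: rpredB | exact: rpredM]. Qed.

(** An algebraic integer has an equation with coefficients in the subring, so that a multiplicative set
    disjoint from an ideal of the subring remains disjoint from the ideal that it generates. *)
Lemma lying_over (B J S : set algC) :
  subring_set B -> B `<=` [set x | x \in Aint] -> ideal_of B J -> S `<=` B -> S 1 ->
  (forall x y, S x -> S y -> S (x * y)) -> (forall x, J x -> ~ S x) ->
  exists Q : set algC, [/\ ideal_of [set x | x \in Aint] Q, J `<=` Q,
    forall x, Q x -> ~ S x
    & forall x y, x \in Aint -> y \in Aint -> Q (x * y) -> Q x \/ Q y].
Proof.
move=> hB BA hJ SB S1 SM JS.
have [M [hM JM MS Mpr _]] := ex_prime_ideal hB hJ SB S1 SM JS.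
have [B1 BB BM] := hB; have [MB M0 MD MM] := hM.
have B0 : B 0 by rewrite -(subrr 1); apply: (BB).
have BN x : B x -> B (- x).
  by move=> Bx; rewrite -[- x]add0r; apply: (BB).
have BD x y : B x -> B y -> B (x + y).
  by move=> Bx By; rewrite -[y]opprK; apply: (BB) => //; apply: (BN).
have BX x n : B x -> B (x ^+ n).
  by move=> Bx; elim: n => [|n IH]; rewrite ?expr0 // exprS; apply: (BM).
have Bint (n : int) : B n%:~R.
  have Bnat k : B k%:R.
    by elim: k => [|k IH]; rewrite ?mulr0n // mulrS; apply: (BD).
  by case: n => n; rewrite ?NegzE ?mulrNz -pmulrn; [|apply: (BN)]; apply: (Bnat).
have M1 : ~ M 1 by move=> h; exact: (MS 1).
pose S' := [set x | B x /\ ~ M x].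
have [|||||Q [hQ _ QS Qpr Qmax]] :=
  @ex_prime_ideal [set x | x \in Aint] [set 0] S' Aint_subring_set.
- by split=> [_ ->|//|_ _ -> ->|x _ _ ->] /=; rewrite ?rpred0 ?addr0 ?mulr0.
- by move=> x [/BA].
- by [].
- by move=> x y [Bx Mx] [By My]; split; [exact: BM | move=> /(Mpr _ _ Bx By)[]].
- by move=> _ -> [_]; apply.
have [QA Q0 QD QM] := hQ.
have QN x : Q x -> Q (- x).
  by move=> Qx; rewrite -mulN1r; apply: (QM) => //=; rewrite rpredN rpred1.
have QB x : Q x -> B x -> M x.
  by move=> Qx Bx; apply: contrapT => nM; apply: (QS x).
suff MQ : M `<=` Q.
  exists Q; split=> //; first by move=> x /JM/MQ.
  by move=> x Qx Sx; apply: (MS x) => //; apply: (QB) => //; apply: (SB).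
move=> t Mt; apply: contrapT => nQt; have Bt := MB _ Mt.
have [q [b [Qq bA [Bs nMs]]]] := Qmax t (BA _ Bt) nQt.
set s := q + t * b in Bs nMs.
have Qsb : Q (s - t * b) by rewrite /s addrK.
have [p [Dp mon_p]] : exists p : {poly int}, minCpoly b = map_poly intr p /\ p \is monic.
  have /floorpP[p Dp] : minCpoly b \is a polyOver Num.int by [].
  exists p; split=> //; have := minCpoly_monic b; rewrite Dp.
  by rewrite !monicE lead_coef_map_inj ?rmorph0 // => [/eqP/(@intr_inj algC _ 1)->|]; last exact: intr_inj.
(* homogenizing the integral equation of b gives one for t b over M *)
have [d Dd] : exists d, size p = d.+1.
  by exists (size p).-1; rewrite prednK // size_poly_gt0 monic_neq0.
pose h (x : algC) := \sum_(i < d.+1) (p`_i)%:~R * t ^+ (d - i) * x ^+ i.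
have htb : h (t * b) = 0.
  have := root_minCpoly b; rewrite Dp /root horner_coef size_map_inj_poly ?rmorph0 // ?Dd => [/eqP pb0|]; last exact: intr_inj.
  rewrite -(mulr0 (t ^+ d)) -pb0 mulr_sumr; apply: eq_bigr => i _.
  rewrite coef_map /= exprMn; have ile : (i <= d)%N by rewrite -ltnS.
  have -> : t ^+ d = t ^+ (d - i) * t ^+ i by rewrite -exprD subnK.
  by ring.
have Qh : Q (h s).
  rewrite -[h s]subr0 -htb /h -sumrB; apply: big_ind => // i _.
  rewrite -mulrBr; apply: (QM); first by rewrite /= rpredM ?Aint_int ?rpredX //; apply: (BA).
  rewrite subrXX mulrC; apply: (QM) => //=; apply: rpred_sum => k _.
  by rewrite rpredM ?rpredX ?rpredM //; apply: (BA).
have Mh : M (h s).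
  apply: (QB) => //; rewrite /h; apply: big_ind => // i _.
  by apply: (BM); [apply: (BM); [exact: Bint | exact: BX] | exact: BX].
have : M (s ^+ d).
  rewrite (_ : s ^+ _ = h s - \sum_(i < d) (p`_i)%:~R * t ^+ (d - i) * s ^+ i); last first.
    rewrite /h big_ord_recr [RHS]addrC addKr subnn expr0 mulr1.
    by rewrite (_ : p`_d = 1) ?mul1r //; move/monicP: mon_p; rewrite lead_coefE Dd.
  have MN x : M x -> M (- x) by move=> ?; rewrite -mulN1r; apply: (MM) => //; apply: (BN).
  apply: (MD) => //; apply: (MN); apply: big_ind => // i _.
  rewrite mulrAC; apply: (MM); first by apply: (BM); [exact: Bint | exact: BX].
  have : (0 < d - i)%N by rewrite subn_gt0.
  by case: (_ - _)%N => // k _; rewrite exprSr; apply: (MM) => //; exact: BX.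
elim: d {Dd h htb Qh Mh} => [|n IH]; first by rewrite expr0.
by rewrite exprS => /Mpr[|||]//; exact: BX.
Qed.

(** The constant term of the minimal polynomial of a nonzero member is a nonzero integer of the
    ideal; a prime ideal then contains one of its prime factors. *)
Lemma prime_above_ex (Q : set algC) :
  ideal_of [set x | x \in Aint] Q -> ~ Q 1 ->
  (forall x y, x \in Aint -> y \in Aint -> Q (x * y) -> Q x \/ Q y) ->
  (exists2 x, Q x & x != 0) -> exists2 l, prime l & prime_above l Q.
Proof.
move=> [QA Q0 QD QM] Q1 Qpr [x Qx x0].
have QN y : Q y -> Q (- y).
  by move=> Qy; rewrite -mulN1r; apply: (QM) => //=; rewrite rpredN rpred1.
have [p [Dp mon_p] minp] := minCpolyP x.
have /floorpP[q Dq] : minCpoly x \is a polyOver Num.int by exact: QA.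
have q00 : q`_0 != 0.
  apply/eqP => q00; have : p = (p %/ 'X) * 'X.
    have : 'X %| p.
      rewrite -['X]subr0 -polyC0 dvdp_XsubCl /root horner_coef0.
      have : (map_poly ratr p : {poly algC})`_0 = (map_poly intr q)`_0 by rewrite -Dp Dq.
      by rewrite !coef_map /= q00 => /eqP; rewrite fmorph_eq0.
    by move/divpK.
  move=> pE; have : root (map_poly ratr p) x by rewrite -Dp root_minCpoly.
  rewrite {1}pE rmorphM rootM /= map_polyX rootX (negbTE x0) orbF minp.
  have p0 := monic_neq0 mon_p.
  have pd0 : p %/ 'X != 0 by apply: contra_neq p0 => h; rewrite pE h mul0r.
  by move/(dvdp_leq pd0); rewrite {1}pE size_mulX // ltnn.
have Qq0 : Q (q`_0)%:~R.
  have := root_minCpoly x; rewrite Dq /root horner_coef.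
  have sq : (0 < size q)%N.
    by rewrite size_poly_gt0; apply: contra_neq q00 => ->; rewrite coef0.
  rewrite size_map_inj_poly ?rmorph0 //; last exact: intr_inj.
  rewrite -(prednK sq) big_ord_recl /= expr0 mulr1 coef_map /=.
  rewrite addr_eq0 => /eqP ->; apply: (QN); apply: big_ind => // i _.
  rewrite coef_map /= exprSr mulrA; apply: (QM) => //=.
  by rewrite rpredM ?Aint_int ?rpredX //; exact: QA.
have Qnat : Q (absz (q`_0)%R)%:R.
  rewrite -[_%:R]/((Posz (absz (q`_0)%R))%:~R) abszE.
  by case: (ger0P q`_0) => // _; rewrite rmorphN; apply: (QN).
have : (0 < absz (q`_0)%R)%N by rewrite absz_gt0.
move: Qnat; elim/ltn_ind: (absz (q`_0)%R) => n IH Qn n0.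
have [n1|n1] := leqP n 1.
  by case: Q1; case: n n1 n0 Qn {IH} => [|[|]].
have Qpm : Q ((pdiv n)%:R * (n %/ pdiv n)%:R).
  by rewrite -natrM mulnC divnK ?pdiv_dvd.
have [Ql|Qm] := Qpr (pdiv n)%:R (n %/ pdiv n)%:R (rpred_nat _ _) (rpred_nat _ _) Qpm.
- by exists (pdiv n); [exact: pdiv_prime | split].
apply: (IH (n %/ pdiv n)%N) => //.
  by rewrite ltn_Pdiv // prime_gt1 ?pdiv_prime.
by rewrite divn_gt0 ?pdiv_gt0 // pdiv_leq.
Qed.

(** * Minkowski's theorem on linear forms *)
Lemma absz_det_unitmx n (L : 'M[int]_n) : L \in unitmx -> absz (\det L) = 1%N.
Proof.
move=> uL; have := congr1 (fun A => absz (\det A)) (mulmxV uL).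
by rewrite /= det_mulmx det1 abszM => /eqP; rewrite muln_eq1 => /andP[/eqP].
Qed.

Lemma card_ord_lt N a : (#|[pred r : 'I_N | (r < a)%N]| <= a)%N.
Proof.
rewrite cardE -(size_map val) -[leqRHS](size_iota 0); apply: uniq_leq_size.
  by rewrite map_inj_uniq ?enum_uniq //; exact: val_inj.
by move=> k /mapP[r]; rewrite mem_enum inE => ra ->; rewrite mem_iota.
Qed.

(** Pigeonhole on the lattice generated by the rows of M, whose index is read off the Smith normal
    form. *)
Lemma int_pigeonhole n (M : 'M[int]_n) (m : nat) :
  (absz (\det M) < m.+1 ^ n)%N ->
  exists2 x : 'rV[int]_n, x != 0 & forall i, `|(x *m M) 0 i| <= m%:Z.
Proof.
move=> ltdet; have [/eqP/det0P[x x0 xM]|det_n0] := eqVneq (\det M) 0.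
  by exists x => // i; rewrite xM mxE normr0.
have [L uL [R uR [d _ DM]]] := int_Smith_normal_form M.
set D := \matrix_(i, j) _ in DM.
have DD : D = diag_mx (\row_i d`_i).
  apply/matrixP => i j; rewrite !mxE; congr (_ *+ _).
have detM : absz (\det M) = (\prod_(i < n) absz (d`_i)%R)%N.
  rewrite DM !det_mulmx !abszM (absz_det_unitmx uL) (absz_det_unitmx uR) mul1n muln1.
  rewrite DD det_diag; under eq_bigr => i _ do rewrite mxE.
  by apply: (big_morph absz abszM).
have d0 (i : 'I_n) : d`_i != 0.
  apply: contra_neq det_n0 => di; apply/eqP; rewrite -absz_eq0 detM (bigD1 i) //=.
  by rewrite di.
pose w0 (w : {ffun 'I_n -> 'I_m.+1}) : 'rV[int]_n := \row_i (w i)%:Z.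
pose v w := w0 w *m invmx R.
pose K := \max_(i < n) absz (d`_i)%R.
pose g w : {ffun 'I_n -> 'I_K.+1} := [ffun i : 'I_n => inord (absz (modz (v w 0%R i) (d`_i)%R))].
have ltg w (i : 'I_n) : (absz (modz (v w 0%R i) (d`_i)%R) < absz (d`_i)%R)%N.
  have := ltz_mod (v w 0 i) (d0 i); have := modz_ge0 (v w 0 i) (d0 i).
  by case: (modz _ _) => // k _; rewrite -abszE ltz_nat.
have ltgK w (i : 'I_n) : (absz (modz (v w 0%R i) (d`_i)%R) < K.+1)%N.
  rewrite ltnS ltnW // (leq_trans (ltg w i)) //.
  exact: (@leq_bigmax _ (fun i : 'I_n => absz (d`_i)%R) i).
have /injectivePn[w [w' ww' gw]] : ~~ injectiveb g.
  apply: contraTN ltdet => /injectiveP inj_g; rewrite -leqNgt.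
  rewrite -{1}(card_ord n) -[X in (X ^ _)%N](card_ord m.+1) -card_ffun -(card_imset _ inj_g).
  apply: (@leq_trans #|family (fun i : 'I_n => [pred r : 'I_K.+1 | (r < absz (d`_i)%R)%N])|).
    apply: subset_leq_card; apply/fintype.subsetP => _ /imsetP[w _ ->].
    by apply/familyP => i; rewrite inE ffunE inordK.
  rewrite card_family detM foldrE big_map enumT /= -[index_enum _]enumT big_enum.
  by apply: leq_prod => i _; apply: card_ord_lt.
have /all_sig[u Du] (i : 'I_n) : {u | v w 0 i - v w' 0 i = u * d`_i}.
  apply: sig_eqW; apply/dvdzP; rewrite -eqz_mod_dvd; apply/eqP.
  have := congr1 (fun h : {ffun 'I_n -> 'I_K.+1} => nat_of_ord (h i)) gw; rewrite !ffunE !inordK //.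
  have := modz_ge0 (v w 0 i) (d0 i); have := modz_ge0 (v w' 0 i) (d0 i).
  by case: (modz _ _) => // a; case: (modz _ _) => // b _ _ /= ->.
exists ((\row_i u i) *m invmx L).
  apply: contra_neq ww' => x0; apply/ffunP => i.
  have u0 : \row_i u i = 0 by rewrite -[LHS](mulmxKV uL) x0 mul0mx.
  have : v w = v w'.
    apply/rowP => k; apply/eqP; rewrite -subr_eq0 Du.
    by have := congr1 (fun r : 'rV_n => r 0 k) u0; rewrite !mxE => ->; rewrite mul0r.
  move/(congr1 (mulmx^~ R)); rewrite /v !mulmxKV //.
  by move/rowP/(_ i); rewrite !mxE => -[] /val_inj.
move=> i; rewrite DM !mulmxA mulmxKV // (_ : _ *m D = v w - v w'); last first.
  by apply/rowP => k; rewrite DD mul_mx_diag !mxE -Du !mxE.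
rewrite mulmxBl /v !mulmxKV // !mxE.
move: (ltn_ord (w i)) (ltn_ord (w' i)).
by move: (nat_of_ord (w i)) (nat_of_ord (w' i)) => a b; lia.
Qed.

Section LinearForms.
Variable F : archiRealFieldType.

Lemma norm_det_le n (A : 'M[F]_n) :
  `|\det A| <= \prod_i \sum_j `|A i j|.
Proof.
rewrite bigA_distr_bigA /= (le_trans (ler_norm_sum _ _ _)) //.
rewrite (eq_bigr (fun s : 'S_n => \prod_i `|A i (s i)|)); last first.
  by move=> s _; rewrite normrMsign normr_prod.
pose h (s : 'S_n) : {ffun 'I_n -> 'I_n} := [ffun i => s i].
have inj_h : injective h.
  by move=> s t /ffunP e; apply/permP => i; have := e i; rewrite !ffunE.
rewrite (eq_bigr (fun s => \prod_i `|A i (h s i)|)); last first.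
  by move=> s _; apply: eq_bigr => i _; rewrite ffunE.
rewrite -(@big_imset _ _ _ _ _ h predT (fun f => \prod_i `|A i (f i)|)) /=; last first.
  by move=> s t _ _; exact: inj_h.
rewrite [leRHS](bigID (fun f => f \in [set h s | s in predT]%SET)) /= lerDl.
by apply: sumr_ge0 => f _; apply: prodr_ge0.
Qed.

(** Minkowski's theorem on linear forms, up to an arbitrarily small error: scale the forms by a large
    integer, round them, and use the pigeonhole principle for the resulting integral matrix. *)
Lemma linear_forms n (E : 'M[F]_n) (eps : F) :
  (0 < n)%N -> `|\det E| = 1 -> 0 < eps ->
  exists2 x : 'rV[int]_n, x != 0 & forall i, `|(map_mx intr x *m E) 0 i| <= 1 + eps.
Proof.
move=> n0 detE eps0; have uE : E \in unitmx by rewrite unitmxE unitfE -normr_gt0 detE.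
pose K : F := \sum_i \sum_j `|invmx E i j|.
have K0 : 0 <= K by apply: sumr_ge0 => i _; apply: sumr_ge0.
pose delta := eps / (2 * (1 + eps)).
have e1 : 0 < 2 * (1 + eps) by lra.
have d0 : 0 < delta by apply: divr_gt0.
have dE : delta * (2 * (1 + eps)) = eps by rewrite divfK // gt_eqF.
have d1 : delta < eps / 2 by nra.
have [N /= hN] : exists N : nat, n%:R * K / delta < N%:R /\ (0 < N)%N.
  exists (Num.truncn (n%:R * K / delta)).+1; split=> //.
  exact: truncnS_gt.
case: hN => hN N0; have N0' : 0 < N%:R :> F by rewrite ltr0n.
have hNd : n%:R * K / N%:R < delta.
  by move: hN; rewrite !ltr_pdivrMr // (mulrC N%:R).
pose M : 'M[int]_n := \matrix_(i, j) Num.floor (N%:R * E i j).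
pose Dl : 'M[F]_n := E - N%:R^-1 *: map_mx intr M.
have Dl_le i j : `|Dl i j| <= N%:R^-1.
  rewrite !mxE; have /andP[h1 h2] := floor_itv (N%:R * E i j).
  rewrite -(ler_pM2l N0') -[X in X * `|_|](gtr0_norm N0') -normrM mulrBr mulfV ?gt_eqF //.
  rewrite mulrA mulfV ?gt_eqF // mul1r; rewrite intrD in h2.
  by rewrite ger0_norm; lra.
pose W := invmx E *m Dl.
have W_le i j : `|W i j| <= K / N%:R.
  rewrite mxE (le_trans (ler_norm_sum _ _ _)) //.
  apply: (@le_trans _ _ (\sum_k `|invmx E i k| * N%:R^-1)).
    by apply: ler_sum => k _; rewrite normrM ler_wpM2l.
  rewrite -mulr_suml ler_pM2r ?invr_gt0 // /K [leRHS](bigD1 i) //= lerDl.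
  by apply: sumr_ge0 => k _; apply: sumr_ge0.
have EW : map_mx intr M = N%:R *: (E *m (1%:M - W)).
  rewrite mulmxBr mulmx1 mulmxA mulmxV // mul1mx /Dl opprB addrC subrK.
  by rewrite scalerA mulfV ?gt_eqF // scale1r.
pose m := Num.truncn (N%:R * (1 + eps / 2)).
have m0 : 0 <= N%:R * (1 + eps / 2) by apply: mulr_ge0; lra.
have m_le : m%:R <= N%:R * (1 + eps / 2) by rewrite truncn_le.
have m_gt : N%:R * (1 + eps / 2) < m.+1%:R by exact: truncnS_gt.
have detM : (absz (\det M) < m.+1 ^ n)%N.
  rewrite -(ltr_nat F) -[X in X < _](_ : `|(\det M)%:~R| = _); last first.
    by rewrite -intr_norm -abszE.
  rewrite -det_map_mx EW detZ det_mulmx normrM normrM normrX detE mul1r.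
  rewrite natrX (gtr0_norm N0').
  have : `|\det (1%:M - W)| <= (1 + n%:R * K / N%:R) ^+ n.
    apply: (le_trans (norm_det_le _)).
    rewrite -[X in _ ^+ X](card_ord n) -prodr_const; apply: ler_prod => i _.
    rewrite sumr_ge0 //=; apply: (@le_trans _ _ (\sum_j ((i == j)%:R + K / N%:R))).
      apply: ler_sum => j _; rewrite (_ : (1%:M - W) i j = (i == j)%:R - W i j); last first.
        by move: (W) => W'; rewrite !mxE.
      rewrite (le_trans (ler_normB _ _)) // lerD //.
      by case: (i == j); rewrite ?normr1 ?normr0.
    rewrite big_split /= sumr_const card_ord (bigD1 i) //= eqxx big1 => [|j]; last first.
      by rewrite eq_sym => /negbTE->.
    by rewrite addr0 -[_ *+ n]mulr_natl mulrA.
  have k0 : 0 <= n%:R * K / N%:R by rewrite divr_ge0 ?mulr_ge0.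
  move=> h; apply: (le_lt_trans (ler_wpM2l _ h)); first by rewrite exprn_ge0 // ltW.
  have k1 : 0 <= 1 + n%:R * K / N%:R by lra.
  rewrite -exprMn ltr_pXn2r ?nnegrE ?ler0n ?mulr_ge0 //.
  apply: lt_trans m_gt; rewrite ltr_pM2l //; lra.
have [x x0 hx] := int_pigeonhole detM; exists x => //.
pose y := map_mx intr x *m E.
pose i0 := [arg max_(i > Ordinal n0) `|y 0 i|]%O.
have max_i0 i : `|y 0 i| <= `|y 0 i0| by rewrite /i0; case: arg_maxP => // k _; apply.
suff : `|y 0 i0| <= 1 + eps by move=> h i; apply: le_trans (max_i0 i) h.
have Dy : y = N%:R^-1 *: map_mx intr (x *m M) + y *m W.
  rewrite map_mxM /= EW -scalemxAr scalerA mulVf ?gt_eqF // scale1r.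
  by rewrite mulmxA -/y mulmxBr mulmx1 subrK.
have h1 : `|(N%:R^-1 *: map_mx intr (x *m M) : 'rV[F]_n) 0 i0| <= 1 + eps / 2.
  rewrite mxE mxE normrM gtr0_norm ?invr_gt0 // mulrC ler_pdivrMr //.
  apply: le_trans (_ : m%:R <= _); last by rewrite mulrC.
  by rewrite -intr_norm -[m%:R]/((m%:Z)%:~R) ler_int.
have h2 : `|(y *m W) 0 i0| <= `|y 0 i0| * delta.
  rewrite mxE (le_trans (ler_norm_sum _ _ _)) //.
  apply: (@le_trans _ _ (\sum_(k < n) `|y 0 i0| * (K / N%:R))).
    by apply: ler_sum => k _; rewrite normrM; apply: ler_pM.
  by rewrite sumr_const card_ord -mulrnAr ler_wpM2l // -mulr_natl mulrA ltW.
have : `|y 0 i0| <= (1 + eps / 2) + `|y 0 i0| * delta.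
  rewrite {1}Dy mxE (le_trans (ler_normD _ _)) //; exact: lerD.
have := normr_ge0 (y 0 i0); nra.
Qed.
End LinearForms.

(** * Everywhere unramified characters of Gal(Qbar/Q) *)

Lemma Aint_scale (x : algC) : exists2 n : nat, (0 < n)%N & n%:R * x \in Aint.
Proof.
have [p [Dp mon_p] minp] := minCpolyP x.
have [q [a a0 Dq]] := rat_poly_scale p.
have q0 : q != 0.
  apply: contraTneq mon_p => q0; rewrite Dq q0 map_poly0 scaler0.
  by rewrite monicE lead_coef0 eq_sym oner_eq0.
have szq : size q = size p by rewrite Dq size_scale ?size_map_inj_poly ?rmorph0 ?invr_eq0 ?intr_eq0 //; exact: intr_inj.
have [d Dd] : exists d, size q = d.+2.
  exists (size q).-2; have := size_minCpoly x; rewrite Dp size_map_poly -szq.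
  by case: (size q) => [|[]].
have qx : \sum_(i < d.+2) (q`_i)%:~R * x ^+ i = 0 :> algC.
  have := root_minCpoly x; rewrite Dp Dq linearZ /= rootZ; last first.
    by rewrite fmorph_eq0 invr_eq0 intr_eq0.
  rewrite -map_poly_comp (eq_map_poly (_ : _ =1 intr)) => [|i]; last exact: ratr_int.
  rewrite /root horner_coef size_map_inj_poly ?rmorph0 //; last exact: intr_inj.
  by rewrite Dd => /eqP e; rewrite -[RHS]e; apply: eq_bigr => i _; rewrite coef_map.
pose l := q`_d.+1.
have l0 : l != 0 by rewrite /l -[d.+1]/(d.+2.-1) -Dd -lead_coefE lead_coef_eq0.
pose h : {poly algC} := 'X^(d.+1) + \poly_(i < d.+1) ((q`_i)%:~R * l%:~R ^+ (d - i)).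
suff lx : l%:~R * x \in Aint.
  exists (absz l); first by rewrite absz_gt0.
  rewrite -[_%:R]/((Posz (absz l))%:~R) abszE; case: (ger0P l) => // _.
  by rewrite rmorphN mulNr rpredN.
apply: (@root_monic_Aint h).
- rewrite /root /h hornerD hornerXn horner_poly.
  apply/eqP; rewrite -[RHS](mulr0 (l%:~R ^+ d)) -[in RHS]qx mulr_sumr.
  rewrite [RHS]big_ord_recr [LHS]addrC -/l exprMn mulrA -exprSr; congr (_ + _).
  apply: eq_bigr => i _; have ile : (i <= d)%N by rewrite -ltnS.
  have -> : l%:~R ^+ d = l%:~R ^+ (d - i) * l%:~R ^+ i :> algC by rewrite -exprD subnK.
  by rewrite exprMn /=; ring.
- by rewrite monicE lead_coefDl ?lead_coefXn // size_polyXn ltnS size_poly.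
apply/polyOverP => i; rewrite /h coefD coefXn coef_poly rpredD ?rpred_nat //.
by case: ifP => _; rewrite ?rpred0 ?rpredM ?rpredX ?rpred_int.
Qed.

(** Galois correspondence for closed subgroups, phrased with integral elements. *)
Lemma fixed_closure (N : set galQ) (sigma : galQ) :
  N 1%g -> (forall s t, N s -> N t -> N (s * t)%g) ->
  (forall x, x \in Aint -> (forall s, N s -> s x = x) -> sigma x = x) ->
  forall r : seq algC, exists2 t, N t & {in r, forall x, t x = sigma x}.
Proof.
move=> N1 NM h r.
have [|t Nt ht] := @galois_lifting algC idfun (fun _ _ => id) (fun s : galQ => s)
  (fun _ _ => erefl) N algC idfun sigma N1 NM _ r.
  move=> x fx; have [n n0 nx] := Aint_scale x.
  have n0' : n%:R != 0 :> algC by rewrite pnatr_eq0 -lt0n.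
  apply: (mulfI n0'); rewrite /= -[in RHS](rmorph_nat sigma) -rmorphM h // => s Ns.
  by rewrite rmorphM rmorph_nat fx.
by exists t => // x xr; rewrite ht.
Qed.

Section FinalEstimate.
Variable F : archiRealFieldType.

Lemma expr1D_le (eps : F) k : 0 <= eps -> eps <= 1 ->
  (1 + eps) ^+ k <= 1 + (2 ^+ k - 1) * eps.
Proof.
move=> e0 e1; elim: k => [|k IH]; first by rewrite !expr0 subrr mul0r addr0.
rewrite exprS [2 ^+ _]exprS; have h2 : 1 <= 2 ^+ k :> F by rewrite exprn_ege1 // ler1n.
have h : (1 + eps) * (1 + eps) ^+ k <= (1 + eps) * (1 + (2 ^+ k - 1) * eps).
  by rewrite ler_wpM2l //; lra.
apply: le_trans h _; move: (2 ^+ k) h2 => t h2.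
have : 0 <= (t - 1) * (eps * (1 - eps)) by rewrite !mulr_ge0 //; lra.
nra.
Qed.

(** If |y_i1| is about 1/2 and the others are moderate, then 4 y^2 - 1 has small norm: the factor at
    i1 is tiny, because the norm of y is at least 1 in absolute value. *)
Lemma small_norm n (y : 'I_n -> F) (i1 i2 : 'I_n) (eps : F) :
  i1 != i2 -> eps = (2 ^+ n * (4 * 65 ^+ n))^-1 ->
  2 * `|y i1| <= 1 + eps -> `|y i2| <= 2 * (1 + eps) ->
  (forall i, i != i1 -> i != i2 -> `|y i| <= 1 + eps) ->
  1 <= \prod_i `|y i| -> `|\prod_i (4 * y i ^+ 2 - 1)| < 1.
Proof.
move=> i12 Deps h1 h2 h ge1.
pose delta : F := (4 * 65 ^+ n)^-1.
have p65 : 1 <= 65 ^+ n :> F by rewrite exprn_ege1 // ler1n.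
have p2 : 1 <= 2 ^+ n :> F by rewrite exprn_ege1 // ler1n.
have dE : delta * (4 * 65 ^+ n) = 1 by rewrite mulVf // gt_eqF //; lra.
have d0 : 0 < delta by rewrite invr_gt0; lra.
have d1 : delta <= 1 / 4 by nra.
have eE : eps * 2 ^+ n = delta.
  by rewrite Deps invfM /delta mulrAC mulVf ?mul1r // gt_eqF //; lra.
have e0 : 0 < eps by nra.
have ed : eps <= delta by nra.
have qn k : (k <= n)%N -> (1 + eps) ^+ k <= 1 + delta.
  move=> kn; apply: le_trans (_ : (1 + eps) ^+ n <= _).
    by apply: ler_weXn2l => //; lra.
  apply: le_trans (expr1D_le _ _ _) _; [lra|lra|]; set t := 2 ^+ n in eE p2 *; nra.
set b := `|y i1| in h1.
have b0 : 0 <= b by exact: normr_ge0.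
have rest : \prod_(i | i != i1) `|y i| <= 2 * (1 + delta).
  rewrite (bigD1 i2) //= 1?eq_sym //.
  apply: (@le_trans _ _ (2 * (1 + eps) * \prod_(i | (i != i1) && (i != i2)) (1 + eps))).
    apply: ler_pM => //; first exact: prodr_ge0.
    by apply: ler_prod => i /andP[a1 a2]; rewrite normr_ge0 h.
  rewrite -mulrA ler_pM2l // prodr_const -exprS qn //.
  rewrite -[X in (_ < X)%N](card_ord n); apply: proper_card; apply/fintype.properP; split.
    by apply/fintype.subsetP.
  by exists i1; rewrite ?inE ?unfold_in /= ?eqxx.
have hb : 1 <= b * (2 * (1 + delta)).
  apply: le_trans ge1 _; rewrite (bigD1 i1) //= -/b; exact: ler_wpM2l.
have f1 : `|4 * y i1 ^+ 2 - 1| <= 3 * delta.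
  have -> : 4 * y i1 ^+ 2 = (2 * b) ^+ 2 by rewrite /b exprMn real_normK ?num_real // -natrX.
  have lo : 1 - delta <= 2 * b by nra.
  by rewrite ler_norml; apply/andP; split; nra.
have f2 i : `|4 * y i ^+ 2 - 1| <= 65.
  have yi : `|y i| <= 2 * (1 + eps).
    have [->|a1] := eqVneq i i1; first by rewrite -/b; lra.
    have [->//|a2] := eqVneq i i2; have := h i a1 a2; lra.
  have -> : y i ^+ 2 = `|y i| ^+ 2 by rewrite real_normK ?num_real.
  have := normr_ge0 (y i); move: (`|y i|) yi => t t1 t0.
  by rewrite ler_norml; apply/andP; split; nra.
rewrite normr_prod (bigD1 i1) //=.
apply: (@le_lt_trans _ _ (3 * delta * 65 ^+ n)); last first.
  move: (65 ^+ n) p65 dE => t t1 t2; nra.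
apply: ler_pM => //; first exact: prodr_ge0.
apply: (@le_trans _ _ (\prod_(i | i != i1) 65)).
  by apply: ler_prod => i _; rewrite normr_ge0 f2.
rewrite prodr_const; apply: ler_weXn2l; first by rewrite ler1n.
by rewrite -[X in (_ <= X)%N](card_ord n); apply: max_card.
Qed.
End FinalEstimate.

Lemma int_norm_lt1 (k : int) : `|k%:~R| < 1 :> algC -> k = 0.
Proof. by rewrite -intr_norm -[1]/(1%:~R) ltr_int; lia. Qed.

Lemma quarter_not_int : (4^-1 : algC) \isn't a Num.int.
Proof.
apply/negP => /intrP[k Dk]; have : 1 = (k * 4)%:~R :> algC.
  by rewrite intrM -Dk mulVf ?pnatr_eq0.
by rewrite -[1]/(1%:~R) => /intr_inj; lia.
Qed.

Section UnramifiedCharacter.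
Variables (V : zmodType) (y : galQ -> V).
Hypothesis yM : forall s t, y (s * t)%g = y s + y t.
Hypothesis y_loc : locally_constant setT y.
Hypothesis y_unram : forall l Q s, prime l -> prime_above l Q -> inertia Q s -> y s = 0.
Hypothesis y_conj : forall c : galQ, (forall x, c x = x^*) -> y c = 0.

Let N : set galQ := [set s | y s = 0].
Let inB (x : algC) := x \in Aint /\ forall s, y s = 0 -> s x = x.

Let y1 : y 1%g = 0.
Proof. by apply: (addrI (y 1%g)); rewrite -yM mulg1 addr0. Qed.
Let yV s : y s^-1%g = - y s.
Proof. by apply: (addrI (y s)); rewrite -yM mulgV y1 subrr. Qed.
Let NM s t : N s -> N t -> N (s * t)%g.
Proof. by rewrite /N /= yM => -> ->; rewrite addr0. Qed.
Let N_closed (s : galQ) :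
  (forall r : seq algC, exists2 t, N t & {in r, forall x, t x = s x}) -> N s.
Proof.
have [r hr] := y_loc (I : setT s) => /(_ r)[t Nt ts].
by rewrite /N /= -(hr t I ts).
Qed.

Let B_conj (t : galQ) x : inB x -> inB (t x).
Proof.
move=> [xA fx]; split=> [|s ys]; first by rewrite Aint_aut.
have /fx e : y (t^-1 * (s * t))%g = 0 by rewrite !yM yV ys add0r addNr.
by rewrite -[in RHS]e -[RHS]/((t * (t^-1 * (s * t)))%g x) mulKVg.
Qed.
Let B_eq (s t : galQ) x : y s = y t -> inB x -> s x = t x.
Proof.
move=> st [_ fx]; have /fx e : y (t^-1 * s)%g = 0 by rewrite yM yV st addNr.
by rewrite -[in RHS]e -[RHS]/((t * (t^-1 * s))%g x) mulKVg.
Qed.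
Let B1 : inB 1. Proof. by split; rewrite ?rpred1 // => s _; rewrite rmorph1. Qed.
Let BB x z : inB x -> inB z -> inB (x - z).
Proof.
by move=> [xA fx] [zA fz]; split; rewrite ?rpredB // => s ys; rewrite rmorphB fx ?fz.
Qed.
Let BM x z : inB x -> inB z -> inB (x * z).
Proof.
by move=> [xA fx] [zA fz]; split; rewrite ?rpredM // => s ys; rewrite rmorphM fx ?fz.
Qed.
Let B0 : inB 0. Proof. by split; rewrite ?rpred0 // => s _; rewrite rmorph0. Qed.
Let BD x z : inB x -> inB z -> inB (x + z).
Proof.
move=> hx hz; rewrite (_ : x + z = x - (0 - z)); last by rewrite sub0r opprK.
by apply: (BB) => //; apply: (BB).
Qed.
Let Bint (n : int) : inB n%:~R.
Proof. by split; rewrite ?Aint_int // => s _; rewrite rmorph_int. Qed.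
Let Bsum (I : Type) (r : seq I) (P : pred I) (f : I -> algC) :
  (forall i, P i -> inB (f i)) -> inB (\sum_(i <- r | P i) f i).
Proof. by move=> h; apply: big_ind. Qed.

(** An automorphism outside the kernel is separated from the identity by the
    integers of the field cut out: otherwise it would lie in some inertia group,
    up to the kernel. *)
Let separating sigma : y sigma != 0 -> exists ps : seq (algC * algC),
  [/\ forall q, q \in ps -> inB q.1 /\ inB q.2, \sum_(q <- ps) q.1 * q.2 = 1
    & \sum_(q <- ps) q.1 * sigma q.2 = 0].
Proof.
move=> ys0.
pose J := [set z | exists ps : seq (algC * algC),
  (forall q, q \in ps -> inB q.1 /\ inB q.2) /\
  z = \sum_(q <- ps) q.1 * (q.2 - sigma q.2)].
have [[ps [hps e1]]|nJ1] := pselect (J 1).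
  exists ((- \sum_(q <- ps) q.1 * sigma q.2, 1) :: ps); split.
  - move=> q; rewrite inE => /orP[/eqP->|/hps//] /=; split=> //.
    rewrite -sub0r; apply: BB => //; rewrite big_seq; apply: Bsum => q0 /hps[h1 h2].
    by apply: BM => //; apply: B_conj.
  - rewrite big_cons /= mulr1 addrC -sumrB e1.
    by apply: eq_bigr => q _; rewrite mulrBr.
  - by rewrite big_cons /= rmorph1 mulr1 addNr.
have [|||||||Q [hQ JQ QS Qpr]] := @lying_over inB J [set 1].
- by split.
- by move=> x [].
- split.
  + move=> _ [ps [hps ->]]; rewrite big_seq; apply: Bsum => q /hps[h1 h2].
    by apply: BM => //; apply: BB => //; apply: B_conj.
  + by exists [::]; rewrite big_nil; split.
  + move=> _ _ [ps [hps ->]] [qs [hqs ->]]; exists (ps ++ qs); rewrite big_cat.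
    by split=> // q; rewrite mem_cat => /orP[/hps|/hqs].
  + move=> b _ hb [ps [hps ->]]; exists [seq (b * q.1, q.2) | q <- ps]; split.
      by move=> _ /mapP[q /hps[h1 h2] ->]; split=> //; apply: BM.
    by rewrite big_map mulr_sumr; apply: eq_bigr => q _; rewrite mulrA.
- by move=> _ ->.
- by [].
- by move=> _ _ -> ->; rewrite /= mulr1.
- by move=> x Jx x1; apply: nJ1; rewrite -x1.
have Jz z : inB z -> J (z - sigma z).
  move=> hz; exists [:: (1, z)]; rewrite big_seq1 mul1r; split=> // q.
  by rewrite inE => /eqP->.
have [z [hz nz]] : exists z, inB z /\ sigma z != z.
  apply: contrapT => no; move: ys0; rewrite (_ : y sigma = 0) ?eqxx //.
  apply: N_closed; apply: fixed_closure => // x xA fx; apply/eqP/negPn/negP => nx.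
  by apply: no; exists x; split.
have Q1 : ~ Q 1 by move=> h; apply: (QS 1).
have Qnz : exists2 x, Q x & x != 0.
  by exists (z - sigma z); [exact/JQ/Jz | rewrite subr_eq0 eq_sym].
have [l pl hl] := prime_above_ex hQ Q1 Qpr Qnz.
have [|s Ns Is] := @inertia_lift l Q hl N sigma y1 NM N_closed.
  move=> x xA fx; rewrite -opprB -mulN1r; have [_ _ _ QM] := hQ; apply: QM.
    by rewrite /= rpredN rpred1.
  exact/JQ/Jz.
have := yM sigma s; rewrite (y_unram pl hl Is) (Ns : y s = 0) addr0 => e.
by rewrite -e eqxx in ys0.
Qed.

Let separating_seq (ss : seq galQ) : (forall s, s \in ss -> y s != 0) ->
  exists ps : seq (algC * algC),
  [/\ forall q, q \in ps -> inB q.1 /\ inB q.2, \sum_(q <- ps) q.1 * q.2 = 1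
    & forall s, s \in ss -> \sum_(q <- ps) q.1 * s q.2 = 0].
Proof.
elim: ss => [_|s ss IH h].
  exists [:: (1, 1)]; split=> //; last by rewrite big_seq1 mulr1.
  by move=> q; rewrite inE => /eqP->.
have [|ps [hps ps1 ps0]] := IH; first by move=> t ht; apply: h; rewrite inE ht orbT.
have [qs [hqs qs1 qs0]] := separating (h s (mem_head _ _)).
pose f (a b : algC * algC) := (a.1 * b.1, a.2 * b.2).
have fE (g : {rmorphism algC -> algC}) :
    \sum_(q <- [seq f a b | a <- ps, b <- qs]) q.1 * g q.2 =
    (\sum_(q <- ps) q.1 * g q.2) * (\sum_(q <- qs) q.1 * g q.2).
  rewrite big_allpairs_dep mulr_suml; apply: eq_bigr => a _.
  by rewrite mulr_sumr; apply: eq_bigr => b _; rewrite /f /= rmorphM mulrACA.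
exists [seq f a b | a <- ps, b <- qs]; split.
- move=> _ /allpairsP[[a b] [/hps[a1 a2] /hqs[b1 b2] ->]].
  by split; apply: BM.
- by rewrite (fE idfun) /= ps1 qs1 mulr1.
- move=> t; rewrite inE fE => /orP[/eqP->|/ps0->]; last by rewrite mul0r.
  by rewrite qs0 mulr0.
Qed.

Let values : exists vs : seq V, uniq vs /\ forall v, v \in vs <-> exists s, y s = v.
Proof.
have [r hr] := y_loc (I : setT 1%g).
have rE (s t : galQ) : {in r, forall x, s x = t x} -> y s = y t.
  move=> st; apply/eqP; rewrite -subr_eq0 addrC -yV -yM.
  rewrite (hr (t^-1 * s)%g I) ?y1 // => x xr.
  by rewrite -[LHS]/((t^-1)%g (s x)) st // -[LHS]/((t^-1 * t)%g x) mulVg.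
have [L hL] := finite_conj_seq r.
have [vs Dvs] : exists vs : seq V, [set v | exists s, y s = v] = [set` vs].
  apply/finite_seqP.
  pose g (m : seq algC) := y (xget 1%g [set s : galQ | map s r = m]).
  apply: (@sub_finite_set _ _ (g @` [set` L])); last exact/finite_image/finite_seq.
  move=> _ [s <-]; exists (map s r); first exact: hL.
  rewrite /g; case: xgetP => [t _ /= ht|no]; last by case: (no s).
  by apply: rE => x xr; move/eq_in_map: ht => /(_ x xr).
exists (undup vs); split; first exact: undup_uniq.
by move=> v; rewrite mem_undup; change ([set` vs] v <-> exists s, y s = v); rewrite -Dvs.
Qed.

(** Minkowski: Q has no unramified abelian extension in which infinity splits. Otherwise the integers
    of the field cut out by y are a free module whose discriminant is a unit, being separated from
    their conjugates. The theorem on linear forms, in a box of volume 1, yields an integer z all of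
    whose conjugates are at most about 2 in absolute value, and one of them about 1/2; then 4 z^2 - 1 has
    norm less than 1, so that z = 1/2 or -1/2, which is absurd. *)
Theorem unramified_character_trivial sigma : y sigma = 0.
Proof.
apply/eqP/negPn/negP => ys0.
have [vs [uvs mem_vs]] := values.
pose n := size vs.
have /choice[sg hsg] : forall i : 'I_n, exists s, y s = nth 0 vs i.
  by move=> i; apply/mem_vs/mem_nth.
have sg_inj i j : y (sg i) = y (sg j) -> i = j.
  by rewrite !hsg => /eqP; rewrite nth_uniq // => /eqP/val_inj.
have sg_surj s : exists i, y s = y (sg i).
  have /(nthP 0)[i il Di] : y s \in vs by apply/mem_vs; exists s.
  by exists (Ordinal il); rewrite hsg.
(* left translation permutes the conjugations *)
have /choice[tr htr] (t : galQ) : exists pi : 'I_n -> 'I_n, forall i, y (t * sg i)%g = y (sg (pi i)).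
  have /choice[pi hpi] : forall i, exists j, y (t * sg i)%g = y (sg j).
    by move=> i; apply: sg_surj.
  by exists pi.
have tr_inj t : injective (tr t).
  move=> i j e; apply: sg_inj; have := htr t i; rewrite e -htr !yM.
  exact: addrI.
have sgB (t : galQ) i x : inB x -> t (sg i x) = sg (tr t i) x.
  by move=> hx; rewrite -[LHS]/((t * sg i)%g x); apply: B_eq.
have trace_int x : inB x -> \sum_i sg i x \in Num.int.
  move=> hx; apply: Cint_rat_Aint.
    apply: fixed_rational => t; rewrite rmorph_sum /= [RHS](reindex_inj (tr_inj t)).
    by apply: eq_bigr => i _; apply: sgB.
  by apply: rpred_sum => i _; rewrite Aint_aut; case: hx.
have norm_int x : inB x -> \prod_i sg i x \in Num.int.
  move=> hx; apply: Cint_rat_Aint.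
    apply: fixed_rational => t; rewrite rmorph_prod /= [RHS](reindex_inj (tr_inj t)).
    by apply: eq_bigr => i _; apply: sgB.
  by apply: rpred_prod => i _; rewrite Aint_aut; case: hx.
have sg_real i x : inB x -> sg i x \is Creal.
  move=> hx; apply/CrealP; have [c hc] : exists c : galQ, forall x, c x = x^*.
    by exists (Num.conj_op : {rmorphism algC -> algC}).
  rewrite -hc -[LHS]/((c * sg i)%g x); apply: B_eq => //.
  by rewrite yM (y_conj hc) add0r.
have [ps [hps ps1 ps0]] : exists ps : seq (algC * algC),
  [/\ forall q, q \in ps -> inB q.1 /\ inB q.2, \sum_(q <- ps) q.1 * q.2 = 1
    & forall s, y s != 0 -> \sum_(q <- ps) q.1 * s q.2 = 0].
  have [|ps [hps ps1 ps0]] := @separating_seq [seq sg i | i <- enum 'I_n & y (sg i) != 0].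
    by move=> s /mapP[i]; rewrite mem_filter => /andP[h _] ->.
  exists ps; split=> // s s0; have [i si] := sg_surj s.
  rewrite -[RHS](ps0 (sg i)); last first.
    by apply: map_f; rewrite mem_filter -si s0 mem_enum.
  rewrite big_seq [RHS]big_seq; apply: eq_bigr => q /hps[_ h2].
  by rewrite (B_eq si h2).
pose h := size ps.
pose x_ (k : 'I_h) := (nth (0, 0) ps k).1; pose z_ (k : 'I_h) := (nth (0, 0) ps k).2.
have hx k : inB (x_ k) by have [] := hps _ (mem_nth (0, 0) (ltn_ord k)).
have hz k : inB (z_ k) by have [] := hps _ (mem_nth (0, 0) (ltn_ord k)).
have dual (s : galQ) : \sum_k x_ k * s (z_ k) = (y s == 0)%:R.
  transitivity (\sum_(q <- ps) q.1 * s q.2).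
    by rewrite (big_nth (0, 0)) big_mkord.
  have [s0|s0] := eqVneq (y s) 0; last exact: ps0.
  by rewrite -[RHS]ps1 big_seq [RHS]big_seq; apply: eq_bigr => q /hps[_ [_ ->]].
pose X : 'M[algC]_(h, n) := \matrix_(k, i) sg i (x_ k).
pose Z : 'M[algC]_(h, n) := \matrix_(k, i) sg i (z_ k).
have XZ : X^T *m Z = 1%:M.
  apply/matrixP => i j; rewrite !mxE.
  transitivity (sg i (\sum_k x_ k * ((sg i)^-1 * sg j)%g (z_ k))).
    rewrite rmorph_sum; apply: eq_bigr => k _; rewrite !mxE rmorphM; congr (_ * _).
    by rewrite -[RHS]/((sg i * ((sg i)^-1 * sg j))%g (z_ k)) mulKVg.
  rewrite dual rmorph_nat yM yV addrC subr_eq0; congr (nat_of_bool _)%:R.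
  by apply/eqP/eqP => [/sg_inj->|->].
have full_X : row_full X.
  by apply/row_fullP; exists Z^T; rewrite -[LHS]trmxK trmx_mul trmxK XZ trmx1.
pose D (e : 'I_n -> algC) : 'M[algC]_n := \matrix_(i, j) sg j (e i).
have intmx a b (M : 'M[algC]_(a, b)) : (forall i j, M i j \in Num.int) ->
    exists M0 : 'M[int]_(a, b), map_mx intr M0 = M.
  move=> hM; exists (map_mx Num.floor M); apply/matrixP => i j.
  by rewrite !mxE floorK.
have detD2 e : (forall i, inB (e i)) -> \det (D e) ^+ 2 \in Num.int.
  move=> he; have [|M0 DM0] := intmx _ _ (D e *m (D e)^T).
    move=> i j; rewrite mxE; rewrite (eq_bigr (fun k => sg k (e i * e j))).
      exact/trace_int/BM.
    by move=> k _; rewrite !mxE rmorphM.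
  by rewrite expr2 -{2}det_tr -det_mulmx -DM0 det_map_mx rpred_int.
pose size_ok (m : nat) := exists e : 'I_n -> algC,
  [/\ forall i, inB (e i), \det (D e) != 0 & `|\det (D e)| ^+ 2 = m%:R].
have size_ex e : (forall i, inB (e i)) -> \det (D e) != 0 -> exists m, size_ok m /\ `|\det (D e)| ^+ 2 = m%:R.
  move=> he d0; have /natrP[m Dm] : `|\det (D e) ^+ 2| \is a Num.nat.
    by rewrite natr_norm_int // detD2.
  by exists m; rewrite -normrX; split=> //; exists e; rewrite -normrX.
have [m] : exists m, `[< size_ok m >].
  have [|e0 ] := @size_ex (fun i => x_ (fullrankfun full_X i)) (fun i => hx _).
    rewrite -unitfE -unitmxE (_ : D _ = rowsub (fullrankfun full_X) X) ?fullrowsub_unit //.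
    by apply/matrixP => i j; rewrite !mxE.
  by move=> [h0 _]; exists e0; exact/asboolP.
move=> exm; have [{exm}m0 /asboolP[e [he det_e0 Dm]] min_m] := ex_minnP (ex_intro (fun m => `[< size_ok m >]) m exm).
pose E := D e.
have uE : E \in unitmx by rewrite unitmxE unitfE.
have realE : map_mx (Num.conj_op : {rmorphism algC -> algC}) E = E.
  by apply/matrixP => i j; rewrite !mxE; apply/CrealP/sg_real.
(* a basis of minimal discriminant generates *)
have coord z : inB z -> exists c : 'rV[int]_n, \row_j sg j z = map_mx intr c *m E.
  move=> hzB; pose r := (\row_j sg j z) *m invmx E.
  suff rint i j : r i j \in Num.int.
    by have [c Dc] := intmx _ _ r rint; exists c; rewrite Dc mulmxKV.
  have {i} -> : i = 0 by apply: ord1.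
  have rj_real : r 0 j \is Creal.
    apply/CrealP; have : map_mx (Num.conj_op : {rmorphism algC -> algC}) r = r.
      rewrite map_mxM /= map_invmx realE; congr (_ *m _).
      by apply/rowP => k; rewrite !mxE; apply/CrealP/sg_real.
    by move/rowP/(_ j); rewrite mxE.
  set fl := Num.floor (r 0 j).
  have fl_itv := real_floor_itv rj_real; rewrite -/fl in fl_itv.
  apply/negPn/negP => nint.
  pose e' i := if i == j then z - fl%:~R * e j else e i.
  have he' i : inB (e' i).
    by rewrite /e'; case: eqP => // _; apply: BB => //; apply: BM.
  pose A : 'M[algC]_n := \matrix_(a, b) if a == j then r 0 b - fl%:~R * (j == b)%:R else (a == b)%:R.
  have DA : D e' = A *m E.
    apply/matrixP => a b; rewrite !mxE /e'.
    have [->|aj] := eqVneq a j.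
      have : (r *m E) 0 b = sg b z by rewrite mulmxKV // mxE.
      rewrite mxE rmorphB rmorphM rmorph_int /= => <-.
      rewrite [RHS](eq_bigr (fun k => r 0 k * E k b - fl%:~R * (j == k)%:R * E k b)); last first.
        by move=> k _; rewrite !mxE eqxx mulrBl.
      rewrite sumrB; congr (_ - _); rewrite (bigD1 j) //= eqxx mulr1 big1 ?addr0 ?mxE //.
      by move=> k kj; rewrite eq_sym (negbTE kj) mulr0 mul0r.
    rewrite (bigD1 a) //= !mxE (negbTE aj) eqxx mul1r big1 ?addr0 // => k ka.
    by rewrite !mxE (negbTE aj) eq_sym (negbTE ka) mul0r.
  have detA : \det A = r 0 j - fl%:~R.
    rewrite (expand_det_row A j) (bigD1 j) //=.
    have cofA b : cofactor A j b = (j == b)%:R.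
      have -> : cofactor A j b = cofactor 1%:M j b.
        rewrite /cofactor; congr (_ * \det _); apply/matrixP => u v.
        by rewrite !mxE eq_sym (negbTE (neq_lift _ _)).
      have : \adj (1%:M : 'M[algC]_n) = 1%:M by rewrite -[LHS]mul1mx mul_mx_adj det1.
      by move/matrixP/(_ b j); rewrite !mxE eq_sym.
    have -> : A j j = r 0 j - fl%:~R by rewrite mxE !eqxx mulr1.
    rewrite cofA eqxx mulr1 big1 ?addr0 // => k kj.
    by rewrite cofA eq_sym (negbTE kj) mulr0.
  have frac0 : r 0 j - fl%:~R != 0.
    by apply: contraNneq nint => /eqP; rewrite subr_eq0 => /eqP ->; rewrite rpred_int.
  have frac_gt0 : 0 < r 0 j - fl%:~R.
    by rewrite lt_def frac0 subr_ge0; case/andP: fl_itv.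
  have frac_lt1 : r 0 j - fl%:~R < 1.
    by case/andP: fl_itv => _; rewrite intrD ltrBlDl.
  have detE' : \det (D e') = (r 0 j - fl%:~R) * \det E by rewrite DA det_mulmx detA.
  have [|m' [ok_m' Dm']] := size_ex e' he'; first by rewrite detE' mulf_neq0.
  have := min_m m'; case: asboolP => // _ /(_ isT); apply/negP; rewrite -ltnNge.
  rewrite -(ltr_nat algC) -Dm' -Dm detE' normrM exprMn gtr0_norm //.
  rewrite gtr_pMl ?exprn_gt0 ?normr_gt0 // expr_lt1 // ltW //.
have coords (xs : 'I_h -> algC) : (forall k, inB (xs k)) ->
    exists M0 : 'M[int]_(h, n), \matrix_(k, i) sg i (xs k) = map_mx intr M0 *m E.
  move=> hxs; have /choice[c hc] := fun k => coord _ (hxs k).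
  exists (\matrix_(k, i) c k 0 i); apply/row_matrixP => k; rewrite row_mul.
  transitivity (\row_j sg j (xs k)); first by apply/rowP => j; rewrite !mxE.
  by rewrite hc; congr (_ *m _); apply/rowP => j; rewrite !mxE.
have [CX DCX] := coords _ hx; have [CZ DCZ] := coords _ hz.
have m01 : m0 = 1%N.
  have : \det (E^T *m (map_mx intr (CX^T *m CZ) *m E)) = 1.
    by rewrite map_mxM mulmxA -map_trmx mulmxA -trmx_mul -!mulmxA -DCX -DCZ XZ det1.
  rewrite !det_mulmx det_tr det_map_mx mulrCA -expr2 => /(congr1 Num.norm).
  rewrite normrM normr1 normrX Dm -intr_norm -abszE -[_%:~R]/((absz _)%:R) -natrM.
  by move/eqP; rewrite -[1]/(1%:R) eqr_nat muln_eq1 => /andP[_ /eqP].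
have detE1 : `|\det E| = 1.
  by apply/eqP; rewrite -(@pexpr_eq1 _ _ 2) // Dm m01.
(* the box of volume 1 for the linear forms: 1/2 at the identity, 2 at sigma and 1 elsewhere *)
have Er i j : exists a : algR, algRval a = E i j.
  have r : E i j \is Creal by rewrite mxE sg_real.
  by exists (in_algR r).
have /choice[ER0 hER0] : forall ij : 'I_n * 'I_n, exists a : algR, algRval a = E ij.1 ij.2.
  by move=> ij; apply: Er.
pose ER : 'M[algR]_n := \matrix_(i, j) ER0 (i, j).
have DER : map_mx algRval ER = E by apply/matrixP => i j; rewrite mxE mxE hER0.
have detER : `|\det ER| = 1.
  have e1 : algRval `|\det ER| = 1 by rewrite -[LHS]/(`|algRval (\det ER)|) -det_map_mx DER.
  by apply: val_inj; exact: e1.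
have [i1 hi1] := sg_surj 1%g; have [i2 hi2] := sg_surj sigma.
have i12 : i1 != i2.
  by apply: contraNneq ys0 => i12; rewrite hi2 -i12 -hi1 y1.
pose d : 'rV[algR]_n := \row_j (if j == i1 then 2 else if j == i2 then 2^-1 else 1).
have n0 : (0 < n)%N by apply: leq_ltn_trans (ltn_ord i1).
have n0' : 2 != 0 :> algR by rewrite pnatr_eq0.
have detd : `|\det (ER *m diag_mx d)| = 1.
  rewrite det_mulmx det_diag normrM detER mul1r (bigD1 i1) //= (bigD1 i2) 1?eq_sym //=.
  rewrite !mxE eqxx eq_sym (negbTE i12) eqxx big1 ?mulr1 ?mulfV ?normr1 // => j /andP[a1 a2].
  by rewrite mxE (negbTE a1) (negbTE a2).
pose eps : algR := (2 ^+ n * (4 * 65 ^+ n))^-1.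
have eps0 : 0 < eps by rewrite invr_gt0 !mulr_gt0 ?exprn_gt0 // ltr0n.
have [c c0 hc] := linear_forms n0 detd eps0.
pose v : 'rV[algR]_n := map_mx intr c *m ER.
have hv j : `|v 0 j * d 0 j| <= 1 + eps.
  by have := hc j; rewrite mulmxA mul_mx_diag mxE.
pose z := \sum_i (c 0 i)%:~R * e i.
have hzB : inB z by apply: Bsum => i _; apply: BM.
have vE j : algRval (v 0 j) = sg j z.
  rewrite mxE rmorph_sum [RHS]rmorph_sum; apply: eq_bigr => i _.
  have ERE : algRval (ER i j) = sg j (e i) by rewrite mxE hER0 mxE.
  rewrite [map_mx intr c 0 i]mxE rmorphM [RHS]rmorphM !rmorph_int; congr (_ * _).
  exact: ERE.
have z0 : z != 0.
  apply: contra_neq c0 => z00; have : map_mx intr c *m E = 0.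
    apply/rowP => j; rewrite -DER -[map_mx intr c](_ : map_mx algRval (map_mx intr c) = _).
      by rewrite -map_mxM [LHS]mxE [RHS]mxE; apply: (etrans (vE j)); rewrite z00 rmorph0.
    by apply/rowP => i; rewrite !mxE rmorph_int.
  move/(congr1 (mulmx^~ (invmx E))); rewrite mulmxK // mul0mx => c00.
  apply/rowP => i; have := congr1 (fun r : 'rV_n => r 0 i) c00; rewrite !mxE => /eqP.
  by rewrite intr_eq0 => /eqP.
have prodE (g : algR -> algR) (g' : algC -> algC) : (forall a, algRval (g a) = g' (algRval a)) ->
    algRval (\prod_j g (v 0 j)) = \prod_j g' (sg j z).
  move=> gE; rewrite rmorph_prod; apply: eq_bigr => j _.
  exact: (etrans (gE _) (congr1 g' (vE j))).
have norm1 : 1 <= \prod_j `|v 0 j|.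
  have e1 : algRval (\prod_j `|v 0 j|) = `|\prod_j sg j z|.
    by rewrite normr_prod; apply: (prodE Num.norm).
  have : 1 <= `|\prod_j sg j z|.
    have [k Dk] := intrP (norm_int _ hzB).
    have : \prod_j sg j z != 0 by apply/prodf_neq0 => j _; rewrite fmorph_eq0.
    by rewrite Dk -intr_norm intr_eq0 -[1]/(1%:~R) ler_int -normr_gt0.
  by rewrite -e1.
have small : `|\prod_j (4 * v 0 j ^+ 2 - 1)| < 1.
  apply: (@small_norm _ n (v 0) i1 i2 eps) => //.
  - by have := hv i1; rewrite [d _ _]mxE eqxx normrM normr_nat mulrC.
  - have := hv i2; rewrite [d _ _]mxE eq_sym (negbTE i12) eqxx normrM.
    by rewrite (@ger0_norm _ 2^-1) ?invr_ge0 ?ler0n // ler_pdivrMr ?ltr0n // mulrC.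
  - by move=> j a1 a2; have := hv j; rewrite [d _ _]mxE (negbTE a1) (negbTE a2) mulr1.
have hz4 : inB (4 * z ^+ 2 - 1).
  by apply: BB => //; apply: BM; [exact: (Bint 4) | rewrite expr2; apply: BM].
have [k Dk] := intrP (norm_int _ hz4).
have prod4 : algRval (\prod_j (4 * v 0 j ^+ 2 - 1)) = k%:~R.
  rewrite -Dk (prodE (fun a => 4 * a ^+ 2 - 1) (fun a => 4 * a ^+ 2 - 1)); last first.
    by move=> a; rewrite (rmorphB algRval) (rmorphM algRval) (rmorphXn algRval) (rmorph1 algRval) (rmorph_nat algRval).
  by apply: eq_bigr => j _; rewrite rmorphB rmorphM rmorphXn rmorph1 rmorph_nat.
have k0 : k = 0.
  by apply: int_norm_lt1; rewrite -prod4.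
have : \prod_j sg j (4 * z ^+ 2 - 1) = 0 by rewrite Dk k0.
move/eqP; rewrite prodf_seq_eq0 => /hasP[j _ /=]; rewrite fmorph_eq0 subr_eq0 => /eqP z4.
have zz : z ^+ 2 = 4^-1 by apply: (mulfI (_ : 4 != 0 :> algC)); rewrite ?z4 ?mulfV ?pnatr_eq0.
apply/negP: quarter_not_int; rewrite negbK; apply: Cint_rat_Aint.
  by rewrite rpredV rpred_nat.
by rewrite -zz rpredX //; case: hzB.
Qed.
End UnramifiedCharacter.

(** * Cyclotomic fields and the cyclotomic Z_p-extension *)

Definition agree_closed (F : set galQ) := forall s : galQ,
  (forall r : seq algC, exists2 t, F t & {in r, forall x, t x = s x}) -> F s.

(** Compactness in Cantor's form. *)
Lemma galQ_nested (F : nat -> set galQ) :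
  (forall n, agree_closed (F n)) -> (forall n s, F n.+1 s -> F n s) ->
  (forall n, exists s, F n s) -> exists s, forall n, F n s.
Proof.
move=> Fcl Fdec Fex.
have Fmono m n s : (m <= n)%N -> F n s -> F m s.
  by move=> /subnK <-; elim: (n - m)%N => // k IH /Fdec.
pose b (r : seq algC) := \max_(x <- r) pickle x.
have [r|r r' s sub [t Ft ts]|r s s' ss' [t Ft ts]|s hs] := @galQ_compact
  (fun r s => exists2 t, F (b r) t & {in r, forall x, t x = s x}).
- by have [s Fs] := Fex (b r); exists s; exists s.
- exists t; last by move=> x /sub/ts.
  apply: Fmono Ft; apply/bigmax_leqP_seq => x xr _.
  by apply: (@leq_bigmax_seq _ r' xpredT pickle) => //; apply: sub.
- by exists t => // x xr; rewrite ts // ss'.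
exists s => n; apply: Fcl => r.
have [x xn] : exists x : algC, (n <= pickle x)%N.
  apply: contrapT => /forallNP no.
  have lt (i : 'I_n.+1) : (pickle (i%:R : algC) < n)%N by rewrite ltnNge; apply/negP/no.
  have : injective (fun i : 'I_n.+1 => Ordinal (lt i)).
    move=> i j /(congr1 val) /= /(pcan_inj pickleK)/eqP.
    by rewrite eqr_nat => /eqP/val_inj.
  by move/leq_card; rewrite !card_ord ltnn.
have [t Ft ts] := hs (x :: r); exists t; last by move=> y yr; apply: ts; rewrite inE yr orbT.
apply: Fmono Ft; apply: leq_trans xn _.
by apply: (@leq_bigmax_seq _ (x :: r) xpredT pickle); rewrite ?inE ?eqxx.
Qed.

Section RootsOfUnity.
Variable q : nat.
Hypothesis q0 : (0 < q)%N.

Lemma acts_exists (s : galQ) : exists2 a : nat, (a < q)%N & acts_on_mu s q a /\ coprime a q.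
Proof.
have [z pz] := C_prim_root_exists q0.
have sz : s z ^+ q = 1 by rewrite -rmorphXn (prim_expr_order pz) rmorph1.
have [a Da] := prim_rootP pz sz; exists a => //; split.
  move=> x xq; have [b ->] := prim_rootP pz xq.
  by rewrite rmorphXn Da exprAC.
by have := pz; rewrite -(fmorph_primitive_root s) Da prim_root_exp_coprime.
Qed.

Lemma acts_uniq (s : galQ) a b : acts_on_mu s q a -> acts_on_mu s q b -> a = b %[mod q].
Proof.
have [z pz] := C_prim_root_exists q0; move=> ha hb; apply/eqP.
rewrite -(eq_prim_root_expr pz); apply/eqP.
by rewrite -(ha z) ?(prim_expr_order pz) // hb ?(prim_expr_order pz).
Qed.

Lemma acts_mod (s : galQ) a b : a = b %[mod q] -> acts_on_mu s q a -> acts_on_mu s q b.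
Proof.
move=> ab ha x xq; rewrite ha //.
by rewrite -(expr_mod a xq) ab expr_mod.
Qed.

Lemma actsM (s t : galQ) a b :
  acts_on_mu s q a -> acts_on_mu t q b -> acts_on_mu (s * t)%g q (a * b)%N.
Proof.
move=> ha hb x xq; rewrite -[LHS]/(s (t x)) hb // rmorphXn ha //.
by rewrite exprM.
Qed.

Lemma acts1 : acts_on_mu 1%g q 1. Proof. by move=> x _; rewrite expr1. Qed.

Lemma acts_dvd d (s : galQ) a : (d %| q)%N -> acts_on_mu s q a -> acts_on_mu s d a.
Proof. by move=> /dvdnP[k ->] ha x xd; apply: ha; rewrite mulnC exprM xd expr1n. Qed.

Lemma acts_realize a : coprime a q -> exists s : galQ, acts_on_mu s q a.
Proof. by move=> /Qn_aut_exists[u hu]; exists u. Qed.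

Lemma acts_prim z (s : galQ) a : q.-primitive_root z -> s z = z ^+ a -> acts_on_mu s q a.
Proof.
by move=> pz Ds x xq; have [b ->] := prim_rootP pz xq; rewrite rmorphXn Ds exprAC.
Qed.
End RootsOfUnity.

Definition Qadj (z : algC) : set algC := [set x | exists r : {poly rat}, x = (map_poly ratr r).[z]].

Section Qadj.
Variable z : algC.
Lemma Qadj_rat (a : rat) : Qadj z (ratr a).
Proof. by exists a%:P; rewrite map_polyC hornerC. Qed.
Lemma Qadj_Crat a : a \in Crat -> Qadj z a.
Proof. by case/CratP => b ->; apply: Qadj_rat. Qed.
Lemma Qadj_gen : Qadj z z.
Proof. by exists 'X; rewrite map_polyX hornerX. Qed.
Lemma QadjD x y : Qadj z x -> Qadj z y -> Qadj z (x + y).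
Proof. by move=> [r ->] [t ->]; exists (r + t); rewrite rmorphD hornerD. Qed.
Lemma QadjN x : Qadj z x -> Qadj z (- x).
Proof. by move=> [r ->]; exists (- r); rewrite rmorphN hornerN. Qed.
Lemma QadjB x y : Qadj z x -> Qadj z y -> Qadj z (x - y).
Proof. by move=> hx hy; apply: QadjD => //; apply: QadjN. Qed.
Lemma QadjM x y : Qadj z x -> Qadj z y -> Qadj z (x * y).
Proof. by move=> [r ->] [t ->]; exists (r * t); rewrite rmorphM hornerM. Qed.
Lemma Qadj1 : Qadj z 1. Proof. by rewrite -(rmorph1 (ratr : rat -> algC)); apply: Qadj_rat. Qed.
Lemma Qadj0 : Qadj z 0. Proof. by rewrite -(rmorph0 (ratr : rat -> algC)); apply: Qadj_rat. Qed.
Lemma QadjX x n : Qadj z x -> Qadj z (x ^+ n).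
Proof. by move=> hx; elim: n => [|n IH]; rewrite ?expr0 ?exprS; [exact: Qadj1 | exact: QadjM]. Qed.
Lemma Qadj_sum (I : Type) (r : seq I) (P : pred I) (f : I -> algC) :
  (forall i, P i -> Qadj z (f i)) -> Qadj z (\sum_(i <- r | P i) f i).
Proof. by move=> h; apply: big_ind => //; [exact: Qadj0 | exact: QadjD]. Qed.

Lemma QadjV x : Qadj z x -> Qadj z x^-1.
Proof.
move=> hx; have [->|x0] := eqVneq x 0; first by rewrite invr0; apply: Qadj0.
have [p [Dp mon_p] minp] := minCpolyP x.
have p00 : p`_0 != 0.
  apply/eqP => p00; have Xp : 'X %| p.
    by rewrite -['X]subr0 -polyC0 dvdp_XsubCl /root horner_coef0 p00.
  have : root (map_poly ratr p) x by rewrite -Dp root_minCpoly.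
  rewrite -(divpK Xp) rmorphM rootM /= map_polyX rootX (negbTE x0) orbF minp.
  have p0 := monic_neq0 mon_p.
  have pd0 : p %/ 'X != 0 by apply: contra_neq p0 => h; rewrite -(divpK Xp) h mul0r.
  by move/(dvdp_leq pd0); rewrite -{1}(divpK Xp) size_mulX // ltnn.
have : root (map_poly ratr p) x by rewrite -Dp root_minCpoly.
rewrite /root horner_coef size_map_poly.
have sp : (0 < size p)%N by rewrite size_poly_gt0 monic_neq0.
rewrite -(prednK sp) big_ord_recl expr0 mulr1 coef_map /=.
set S := \sum_(i < _) _ => /eqP e.
have [T hT DS] : exists2 T, Qadj z T & S = x * T.
  exists (\sum_(i < (size p).-1) (map_poly ratr p)`_(lift ord0 i) * x ^+ i).
    by apply: Qadj_sum => i _; apply: QadjM; [rewrite coef_map; apply: Qadj_rat | apply: QadjX].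
  by rewrite mulr_sumr; apply: eq_bigr => i _; rewrite exprS mulrCA.
have r0 : ratr p`_0 != 0 :> algC by rewrite fmorph_eq0.
have -> : x^-1 = - (ratr p`_0)^-1 * T.
  apply: (mulfI x0); rewrite mulfV // mulrCA -DS.
  by rewrite -(addKr (ratr p`_0) S) e addr0 mulrNN mulVf.
apply: QadjM hT; apply: QadjN; rewrite -fmorphV; exact: Qadj_rat.
Qed.

Lemma Qadj_prod (I : Type) (r : seq I) (P : pred I) (f : I -> algC) :
  (forall i, P i -> Qadj z (f i)) -> Qadj z (\prod_(i <- r | P i) f i).
Proof. by move=> h; apply: big_ind => //; [exact: Qadj1 | exact: QadjM]. Qed.

Lemma Qadj_fixed (s : galQ) x : s z = z -> Qadj z x -> s x = x.
Proof.
move=> sz [r ->]; rewrite -horner_map /= sz; congr _.[z].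
by rewrite -map_poly_comp; apply: eq_map_poly => a; rewrite /= fmorph_rat.
Qed.
End Qadj.

(** The traces of the x z^i from Q(z) are rational, and x is recovered from them by Lagrange
    interpolation at the conjugates of z. *)
Lemma cyclotomic_fixed q z x : q.-primitive_root z ->
  (forall s : galQ, s z = z -> s x = x) -> Qadj z x.
Proof.
move=> pz fx; have q0 := prim_order_gt0 pz.
have /choice[sg hsg] : forall a : 'I_q, exists s : galQ, coprime a q -> acts_on_mu s q a.
  move=> a; have [ca|_] := boolP (coprime a q); last by exists 1%g.
  by have [s hs] := acts_realize ca; exists s.
have fx_eq (s t : galQ) : s z = t z -> s x = t x.
  move=> st; have : (t^-1 * s)%g z = z by rewrite -[LHS]/((t^-1)%g (s z)) st -[LHS]/((t^-1 * t)%g z) mulVg.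
  by move/fx => e; rewrite -[in RHS]e -[RHS]/((t * (t^-1 * s))%g x) mulKVg.
have zq := prim_expr_order pz.
pose C (a : 'I_q) := coprime a q.
pose t_ i := \sum_(a | C a) sg a (x * z ^+ i).
have t_rat i : t_ i \in Crat.
  apply: fixed_rational => t; have [b _ [hb cb]] := acts_exists q0 t.
  pose m (a : 'I_q) : 'I_q := Ordinal (ltn_pmod (b * a) q0).
  have m_inj : injective m.
    have pzb : q.-primitive_root (z ^+ b) by rewrite prim_root_exp_coprime.
    move=> a a' /(congr1 val) /= /eqP; rewrite -(eq_prim_root_expr pz) !exprM.
    by rewrite (eq_prim_root_expr pzb) !modn_small // => /eqP/val_inj.
  rewrite rmorph_sum /= [RHS](reindex_inj m_inj) /=; apply: eq_big => a.
    by rewrite /C /m /= coprime_modl coprimeMl cb.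
  move=> ca; have e : (t * sg a)%g z = sg (m a) z.
    rewrite -[LHS]/(t (sg a z)) hsg // rmorphXn hb // hsg ?zq //; last first.
      by rewrite /C /m /= coprime_modl coprimeMl cb.
    by rewrite -exprM /= expr_mod.
  rewrite -[LHS]/((t * sg a)%g (x * z ^+ i)) rmorphM [RHS]rmorphM !rmorphXn.
  by rewrite (fx_eq _ _ e) e.
have q1 : (1 %% q < q)%N by rewrite ltn_pmod.
pose o1 : 'I_q := Ordinal q1.
have z1 : z ^+ o1 = z by rewrite /= expr_mod.
have C1 : C o1 by rewrite /C /= coprime_modl coprime1n.
pose L := \prod_(a | C a && (a != o1)) ('X - (z ^+ a)%:P).
have Lz0 : L.[z] != 0.
  rewrite horner_prod; apply/prodf_neq0 => a /andP[_ a1].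
  rewrite hornerXsubC subr_eq0 -{1}z1; apply: contraNneq a1 => e; apply/eqP/val_inj.
  by move/eqP: e; rewrite (eq_prim_root_expr pz) !modn_small // => /eqP.
have La a : C a -> L.[z ^+ a] = (a == o1)%:R * L.[z].
  move=> ca; have [->|a1] := eqVneq a o1; first by rewrite z1 mul1r.
  rewrite mul0r horner_prod; apply/eqP; rewrite prodf_seq_eq0; apply/hasP.
  by exists a; rewrite ?mem_index_enum // ca a1 hornerXsubC subrr eqxx.
have xE : x = \sum_(i < size L) L`_i / L.[z] * t_ i.
  transitivity (\sum_(a | C a) sg a x * (L.[z ^+ a] / L.[z])).
    rewrite (bigD1 o1) // big1 => [|a /andP[ca a1]]; last first.
      by rewrite La // (negbTE a1) mul0r mul0r mulr0.
    rewrite [RHS]addr0 La // eqxx mul1r mulfV // mulr1 (fx_eq _ 1%g) //.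
    by rewrite hsg // z1.
  rewrite /t_; under [RHS]eq_bigr => i _ do rewrite mulr_sumr.
  rewrite exchange_big /=; apply: eq_bigr => a ca.
  rewrite horner_coef mulr_suml mulr_sumr; apply: eq_bigr => i _.
  have -> : sg a (x * z ^+ i) = sg a x * (z ^+ a) ^+ i by rewrite rmorphM rmorphXn (hsg a ca z zq).
  by ring.
rewrite xE; apply: Qadj_sum => i _; apply: QadjM; last exact/Qadj_Crat.
have hL (f : 'I_q -> bool) j : Qadj z (\prod_(a | f a) ('X - (z ^+ a)%:P))`_j.
  elim/big_rec: _ j => [|a P _ IH] j.
    by rewrite coef1; case: (j == 0)%N; [exact: Qadj1 | exact: Qadj0].
  rewrite mulrBl coefB coefXM coefCM; apply: QadjB; last first.
    by apply: QadjM => //; apply: QadjX; exact: Qadj_gen.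
  by case: ifP => _; [exact: Qadj0 | exact: IH].
apply: QadjM; first exact: hL; apply: QadjV; rewrite horner_prod.
apply: Qadj_prod => a _; rewrite hornerXsubC; apply: QadjB; first exact: Qadj_gen.
by apply: QadjX; exact: Qadj_gen.
Qed.

Section PrimePower.
Variables (p n : nat) (z : algC).
Hypothesis pp : prime p.
Let q := (p ^ n.+1)%N.
Hypothesis pz : q.-primitive_root z.
Let q0 : (0 < q)%N. Proof. by rewrite expn_gt0 prime_gt0. Qed.
Let zA : z \in Aint. Proof. exact: Aint_prim_root pz. Qed.
Let zq : z ^+ q = 1. Proof. exact: prim_expr_order. Qed.

(** p is divisible by (1 - z)^totient(q), being the value at 1 of the q-th
    cyclotomic polynomial. *)
Lemma prime_ramified : exists u, [/\ u \in Aint, u^-1 \in Aint & p%:R = (1 - z) ^+ totient q * u].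
Proof.
have Phi1 : ('Phi_q).[1] = p%:Z.
  have e1 : 'X^q - 1 = 'Phi_q * ('X^(p ^ n) - 1) :> {poly int}.
    rewrite -!prod_Cyclotomic ?expn_gt0 ?prime_gt0 // (perm_big (q :: divisors (p ^ n))).
      by rewrite big_cons.
    apply: uniq_perm; first exact: divisors_uniq.
      rewrite /= divisors_uniq andbT -dvdn_divisors ?expn_gt0 ?prime_gt0 //.
      by rewrite dvdn_Pexp2l ?prime_gt1 // ltnn.
    move=> d; rewrite inE -!dvdn_divisors ?expn_gt0 ?prime_gt0 //.
    apply/dvdn_pfactor/orP => // [[k]|].
      rewrite leq_eqVlt => /orP[/eqP-> ->|kn ->]; first by left.
      by right; rewrite dvdn_exp2l.
    case=> [/eqP->|/(dvdn_pfactor _ _ pp)[k kn ->]]; first by exists n.+1.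
    by exists k => //; apply: leqW.
  have e2 : 'X^q - 1 = (\sum_(i < p) 'X^(p ^ n) ^+ i) * ('X^(p ^ n) - 1) :> {poly int}.
    by rewrite mulrC -subrX1 -exprM mulnC -expnS.
  have nz : 'X^(p ^ n) - 1 != 0 :> {poly int}.
    by rewrite -size_poly_gt0 size_XnsubC // expn_gt0 prime_gt0.
  have := mulIf nz (etrans (esym e1) e2) => ->.
  rewrite horner_sum (eq_bigr (fun _ => 1)); last first.
    by move=> i _; rewrite horner_exp hornerXn !expr1n.
  by rewrite sumr_const card_ord natz.
have : (cyclotomic z q).[1] = p%:R.
  by rewrite -(Cintr_Cyclotomic pz) -[X in _.[X]](rmorph1 (intr : int -> algC)) horner_map Phi1.
rewrite /cyclotomic horner_prod => <-.
exists (\prod_(k < q | coprime k q) \sum_(i < k) z ^+ i); split.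
- by apply: rpred_prod => k _; apply: rpred_sum => i _; rewrite rpredX.
- rewrite -prodfV; apply: rpred_prod => k ck.
  have pzk : q.-primitive_root (z ^+ k) by rewrite prim_root_exp_coprime.
  have [k' Dk'] := prim_rootP pzk zq.
  have zk1 : z ^+ k - 1 != 0.
    rewrite subr_eq0 -(expr0 (z ^+ k)) -[X in X != _]expr1 (eq_prim_root_expr pzk) mod0n.
    by rewrite modn_small // /q -(expn0 p) ltn_exp2l ?prime_gt1.
  suff -> : (\sum_(i < k) z ^+ i)^-1 = \sum_(i < k') (z ^+ k) ^+ i.
    by apply: rpred_sum => i _; rewrite !rpredX.
  apply: (mulfI zk1); rewrite -subrX1 -Dk' {1}subrX1 mulfK //.
  by apply: contraNneq zk1 => s0; rewrite subrX1 s0 mulr0.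
rewrite -[X in (1 - z) ^+ X](_ : \sum_(k < q | coprime k q) 1 = _)%N; last first.
  rewrite totient_count_coprime big_mkord big_mkcond; apply: eq_bigr => k _.
  by rewrite coprime_sym; case: coprime.
rewrite sum1_card -prodr_const -big_split /=; apply: eq_bigr => k _.
by rewrite hornerXsubC -opprB subrX1 -mulNr opprB.
Qed.

Lemma one_minus_root_prime Q : prime_above p Q -> Q (1 - z).
Proof.
move=> hQ; have [Om [pi piP]] := prime_residue hQ.
have [y Dy] := mk_aint zA.
have chp : p \in [pchar Om].
  rewrite inE pp /= -(rmorph_nat pi); apply/eqP/piP; rewrite (rmorph_nat aint_incl).
  by case: hQ => [[]].
have yq : y ^+ q = 1.
  apply: aint_incl_inj; rewrite rmorphXn rmorph1 -[aint_incl y]/(val y) Dy; exact: zq.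
have e : pi (1 - y) ^+ q = 0.
  apply/eqP; rewrite -[X in X == _](addrK (pi y ^+ q)) -exprDn_pchar; last first.
    by rewrite pnatX pnatE // chp.
  by rewrite -rmorphD subrK rmorph1 -rmorphXn yq rmorph1 expr1n subrr.
have /piP : pi (1 - y) = 0 by apply/eqP; move/eqP: e; rewrite expf_eq0 => /andP[].
by rewrite (rmorphB aint_incl) rmorph1 -Dy.
Qed.

(** An integer of Q(z) is congruent to a rational number modulo 1 - z: p is
    totally ramified in Q(z). *)
Lemma cyc_residue Q x : prime_above p Q -> x \in Aint -> Qadj z x ->
  exists (m d : int) b, [/\ ~~ (p%:Z %| m)%Z, b \in Aint & m%:~R * x - d%:~R = (1 - z) * b].
Proof.
move=> hQ xA [r Dx]; have [g0 [a a0 Dg]] := rat_poly_scale r.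
pose m := Pdiv.Ring.rmodp g0 'Phi_q.
have hm : a%:~R * x = (map_poly intr m).[z].
  have Phiz : (map_poly intr 'Phi_q).[z] = 0 :> algC.
    by apply/eqP; rewrite (Cintr_Cyclotomic pz) -[_ == 0]/(root _ z) -(minCpoly_cyclotomic pz) root_minCpoly.
  have a0' : a%:~R != 0 :> algC by rewrite intr_eq0.
  have -> : a%:~R * x = (map_poly intr g0).[z].
    rewrite Dx Dg; rewrite map_polyZ hornerZ /= fmorphV rmorph_int mulrA mulfV // mul1r.
    congr _.[z]; rewrite -map_poly_comp; apply: eq_map_poly => c /=; exact: rmorph_int.
  rewrite {1}(Pdiv.RingMonic.rdivp_eq (Cyclotomic_monic q) g0) rmorphD rmorphM hornerD hornerM.
  by rewrite Phiz mulr0 add0r.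
have sm : (size m <= totient q)%N.
  by rewrite -ltnS -(size_Cyclotomic q) Pdiv.Ring.ltn_rmodp monic_neq0 ?Cyclotomic_monic.
pose g := m \Po (1 - 'X).
have sg : (size g <= totient q)%N.
  by rewrite /g size_comp_poly2 // -opprB size_polyN -[1]polyC1 size_XsubC.
have hg : a%:~R * x = (map_poly intr g).[1 - z].
  by rewrite hm /g map_comp_poly horner_comp rmorphB rmorph1 /= map_polyX !hornerE opprB addrC subrK.
have [N] := ubnP (absz a).
move: g sg hg => {Dg hm sm} {}g sg hg; elim: N a a0 g sg hg => // N IH a a0 g sg hg aN.
have [pa|pa] := boolP (p%:Z %| a)%Z; last first.
  exists a, g`_0, (\sum_(i < (size g).-1) (g`_i.+1)%:~R * (1 - z) ^+ i); split => //.
    by apply: rpred_sum => i _; rewrite rpredM ?rpredX ?rpredB ?rpred1 // Aint_int.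
  rewrite hg; have [->|gn0] := eqVneq g 0.
    by rewrite rmorph0 horner0 coef0 subr0 size_poly0 big_ord0 mulr0.
  rewrite horner_coef size_map_inj_poly ?rmorph0 //; last exact: intr_inj.
  have := prednK (_ : 0 < size g)%N; rewrite size_poly_gt0 => /(_ gn0) <-.
  rewrite big_ord_recl expr0 mulr1 coef_map /= addrC addKr mulr_sumr; apply: eq_bigr => i _.
  by rewrite coef_map exprS mulrCA.
have [u [uA _ Du]] := prime_ramified.
have piA : 1 - z \in Aint by rewrite rpredB ?rpred1.
have pi0 : 1 - z != 0.
  apply/eqP => e; have := Du; rewrite e expr0n (gtn_eqF _) ?totient_gt0 ?q0 // mul0r => /eqP.
  by rewrite pnatr_eq0 => /eqP p0; move: (pp); rewrite p0.
have hdiv i : (p%:Z %| g`_i)%Z.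
  elim/ltn_ind: i => i IHi; have [ie|ie] := ltnP i (size g); last by rewrite nth_default ?dvdz0.
  apply: (prime_int hQ pp).
  have [b bA Db] : exists2 b, b \in Aint & \sum_(j < i) (g`_j)%:~R * (1 - z) ^+ j = p%:R * b :> algC.
    exists (\sum_(j < i) (g`_j %/ p%:Z)%Z%:~R * (1 - z) ^+ j).
      by apply: rpred_sum => j _; rewrite rpredM ?rpredX // Aint_int.
    rewrite mulr_sumr; apply: eq_bigr => j _; rewrite mulrA -[p%:R]/(p%:Z%:~R) -rmorphM.
    by rewrite /= [(p%:Z * _)%R]mulrC divzK ?IHi.
  have [a' Da] : exists a', a = a' * p%:Z by exists (a %/ p%:Z)%Z; rewrite divzK.
  pose c := \sum_(j < size g - i.+1) (g`_(i.+1 + j))%:~R * (1 - z) ^+ j : algC.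
  have cA : c \in Aint by apply: rpred_sum => j _; rewrite rpredM ?rpredX // Aint_int.
  have e1 : (g`_i)%:~R * (1 - z) ^+ i + (1 - z) ^+ i.+1 * c = p%:R * (a'%:~R * x - b).
    rewrite mulrBr -Db mulrA -[p%:R]/(p%:Z%:~R) -rmorphM mulrC [p%:Z * _]mulrC -Da hg.
    rewrite mulrC horner_coef size_map_inj_poly ?rmorph0 //; last exact: intr_inj.
    rewrite -(big_mkord xpredT (fun j => (map_poly intr g)`_j * (1 - z) ^+ j)).
    rewrite (@big_cat_nat _ _ _ i) //=; last exact: ltnW.
    rewrite big_mkord (eq_bigr (fun j : 'I_i => (g`_j)%:~R * (1 - z) ^+ j)); last first.
      by move=> j _; rewrite coef_map.
    rewrite addrAC subrr add0r big_ltn // coef_map; congr (_ + _).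
    rewrite -[i.+1 in RHS]add0n big_addn big_mkord mulr_sumr; apply: eq_bigr => j _.
    by rewrite coef_map exprD addnC; ring.
  have e2 : (g`_i)%:~R = (1 - z) * ((1 - z) ^+ (totient q - i.+1) * u * (a'%:~R * x - b) - c).
    apply: (mulIf (expf_neq0 i pi0)).
    rewrite -[LHS](addrK ((1 - z) ^+ i.+1 * c)) e1 Du.
    by rewrite -{1}(subnKC (leq_trans ie sg)) exprD !exprS; ring.
  rewrite e2 mulrC; case: (hQ) => _ _ QM _ _; apply: QM (one_minus_root_prime hQ).
  by rewrite rpredB ?rpredM ?rpredX ?rpredB ?rpredM // Aint_int.
have [a' Da] : exists a', a = a' * p%:Z by exists (a %/ p%:Z)%Z; rewrite divzK.
pose g' : {poly int} := \poly_(i < size g) (g`_i %/ p%:Z)%Z.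
have Dg : g = p%:Z *: g'.
  apply/polyP => i; rewrite coefZ coef_poly; case: ltnP => ig.
    by rewrite mulrC divzK.
  by rewrite mulr0 nth_default.
have p0 : p%:R != 0 :> algC by rewrite pnatr_eq0 -lt0n prime_gt0.
apply: (IH a' _ g').
- by apply: contraNneq a0 => a'0; rewrite Da a'0 mul0r.
- exact: leq_trans (size_poly _ _) sg.
- apply: (mulfI p0); rewrite mulrA -[p%:R]/(p%:Z%:~R) -rmorphM mulrC [p%:Z * _]mulrC -Da mulrC hg.
  by rewrite {1}Dg map_polyZ hornerZ.
- move: aN; rewrite Da abszM ltnS; apply: leq_trans; rewrite /= ltn_Pmulr ?prime_gt1 // absz_gt0.
  by apply: contraNneq a0 => a'0; rewrite Da a'0 mul0r.
Qed.

(** The prime above p is totally ramified in Q(z), so that Galois acts trivially on its residues. *)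
Lemma cyc_residue_gal Q x (t : galQ) : prime_above p Q -> x \in Aint -> Qadj z x -> Q (t x - x).
Proof.
move=> hQ xA xz; have [m [d [b [pm bA e]]]] := cyc_residue hQ xA xz.
have hpi := one_minus_root_prime hQ.
have QM : forall x y, x \in Aint -> Q y -> Q (x * y) by case: hQ.
have tpi : Q (1 - t z).
  have tq : t z ^+ q = 1 by rewrite -rmorphXn zq rmorph1.
  have [a ->] := prim_rootP pz tq.
  rewrite -opprB subrX1 -mulNr opprB mulrC; apply: QM => //.
  by apply: rpred_sum => i _; rewrite rpredX.
have Qm : Q (m%:~R * (t x - x)).
  have -> : m%:~R * (t x - x) = t b * (1 - t z) - b * (1 - z).
    have -> : t b * (1 - t z) = t ((1 - z) * b) by rewrite rmorphM rmorphB rmorph1 mulrC.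
    by rewrite [b * _]mulrC -e rmorphB rmorphM !rmorph_int; ring.
  by apply: (primeB hQ); apply: QM => //; rewrite Aint_aut.
case: (hQ) => _ _ _ _ Qpr; case: (Qpr _ _ _ _ Qm) => //.
- exact: Aint_int.
- by rewrite rpredB // Aint_aut.
- by move/(prime_int hQ pp) => /(negP pm).
Qed.
End PrimePower.

(** The sum of the powers of a nontrivial q-th root of unity is 0, whereas it would reduce to q,
    which is prime to l. *)
Lemma root_reduction l Q q w : prime_above l Q -> prime l -> coprime l q -> (0 < q)%N ->
  w ^+ q = 1 -> Q (w - 1) -> w = 1.
Proof.
move=> hQ pl lq q0 wq Qw; apply/eqP/contraT => w1.
have wA : w \in Aint by apply: (@Aint_unity_root q) => //; apply/unity_rootP.
have s0 : \sum_(i < q) w ^+ i = 0.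
  by apply: (mulfI (_ : w - 1 != 0)); rewrite ?subr_eq0 // -subrX1 wq subrr mulr0.
have [_ _ QM _ _] := hQ.
have : Q (\sum_(i < q) (w ^+ i - 1)).
  apply: (big_ind Q); first exact: (prime0 hQ).
    by case: hQ.
  move=> i _; rewrite subrX1 mulrC; apply: QM => //; apply: rpred_sum => j _; exact: rpredX.
rewrite sumrB s0 sumr_const card_ord => /(primeB hQ (prime0 hQ)).
rewrite !sub0r opprK -[q%:R]/(q%:Z%:~R) => /(prime_int hQ pl).
by rewrite dvdzE /= => lq'; move: lq; rewrite prime_coprime ?lq'.
Qed.

(** Hence inertia at l acts trivially on roots of unity of order prime to l. *)
Lemma inertia_acts1 l Q q s : prime_above l Q -> prime l -> coprime l q -> (0 < q)%N ->
  inertia Q s -> acts_on_mu s q 1.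
Proof.
move=> hQ pl lq q0 hs z zq; rewrite expr1.
have zA : z \in Aint by apply: (@Aint_unity_root q) => //; apply/unity_rootP.
have z0 : z != 0 by apply: contraTneq (oner_neq0 algC) => z0; rewrite -zq z0 expr0n gtn_eqF ?eqxx.
apply: (mulIf (invr_neq0 z0)); rewrite mulfV //.
apply: (root_reduction hQ pl lq) => //.
  by rewrite exprMn -rmorphXn exprVn zq rmorph1 invr1 mulr1.
rewrite -[X in _ - X](mulfV z0) -mulrBl mulrC; case: (hQ) => _ _ QM _ _; apply: QM; last exact: hs.
by apply: (@Aint_unity_root q) => //; apply/unity_rootP; rewrite exprVn zq invr1.
Qed.

Lemma LTE_aux1 (k b y d : nat) :
  ((1 + y) * (1 + k * y + b * y ^ 2 + y ^ 3 * d) =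
   1 + k.+1 * y + (b + k) * y ^ 2 + y ^ 3 * (b + d + y * d))%N.
Proof. rewrite !expnS expn0 muln1; lia. Qed.

Lemma LTE_aux2 (p Q h c d : nat) (y := (p * Q + p * (p * Q) * c)%N) :
  (1 + p * y + p * h * y ^ 2 + y ^ 3 * d = 1 + p * (p * Q) +
   p * (p * (p * Q)) * (c + h * Q * (1 + p * c) ^ 2 + Q * Q * (1 + p * c) ^ 3 * d))%N.
Proof.
have -> : y = (p * Q * (1 + p * c))%N by rewrite /y; lia.
set e := (1 + p * c)%N.
have -> : (p * (p * Q * e) = p * (p * Q) + p * (p * (p * Q)) * c)%N by rewrite /e; lia.
by move: e => e; rewrite !expnS expn0 muln1; lia.
Qed.

Section CycRes.
Variable p : nat.
Hypothesis pp : prime p.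
Let p1 : (1 < p)%N. Proof. exact: prime_gt1. Qed.
Let q n := (p ^ n.+1)%N.
Let q1 n : (1 < q n)%N. Proof. by rewrite -(expn0 p) ltn_exp2l. Qed.
Let q0 n : (0 < q n)%N. Proof. exact: ltnW. Qed.

Lemma Zp_val_lt n (u : 'Z_(q n)) : (u < q n)%N.
Proof. by rewrite -[X in (_ < X)%N](Zp_cast (q1 n)). Qed.

Lemma cyc_res_unit n s (u : {unit 'Z_(q n)}) :
  acts_on_mu s (q n) (val u : 'Z_(q n)) -> cyc_res p n s = coset (cyc_torsion p n) u.
Proof.
move=> hu; rewrite /cyc_res; case: pickP => [v /asboolP hv|/(_ u) /asboolP//].
congr coset; apply/val_inj/val_inj => /=.
by have := acts_uniq (q0 n) hv hu; rewrite !modn_small // Zp_val_lt.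
Qed.

Lemma cyc_res_ex n s : exists u : {unit 'Z_(q n)}, acts_on_mu s (q n) (val u : 'Z_(q n)).
Proof.
have [a aq [ha ca]] := acts_exists (q0 n) s.
have ua : (a%:R : 'Z_(q n)) \is a GRing.unit by rewrite unitZpE ?q1 // coprime_sym.
exists (FinRing.Unit ua) => /=; rewrite val_Zp_nat ?q1 //.
by apply: (acts_mod _ ha); rewrite modn_mod.
Qed.

Lemma cyc_resM n s t : cyc_res p n (s * t)%g = (cyc_res p n s * cyc_res p n t)%g.
Proof.
have [u hu] := cyc_res_ex n s; have [v hv] := cyc_res_ex n t.
rewrite (cyc_res_unit hu) (cyc_res_unit hv) -morphM ?cyc_torsion_norm //=.
apply: cyc_res_unit; apply: (acts_mod _ (actsM hu hv)).
by rewrite /= modn_dvdm // (Zp_cast (q1 n)).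
Qed.

Lemma cyc_res1 n : cyc_res p n 1%g = 1%g.
Proof. by apply: (@mulgI _ (cyc_res p n 1%g)); rewrite -cyc_resM !mulg1. Qed.

Lemma cyc_resV n s : cyc_res p n s^-1%g = (cyc_res p n s)^-1%g.
Proof. by apply: (@mulgI _ (cyc_res p n s)); rewrite -cyc_resM !mulgV cyc_res1. Qed.

Lemma cyc_res_loc n : exists z : algC, forall s t : galQ, s z = t z -> cyc_res p n s = cyc_res p n t.
Proof.
have [z pz] := C_prim_root_exists (q0 n); exists z => s t st.
have [u hu] := cyc_res_ex n s; rewrite (cyc_res_unit hu).
by rewrite (@cyc_res_unit n t u) //; apply: (acts_prim pz); rewrite -st hu // (prim_expr_order pz).
Qed.

Lemma cyc_res_map n s : cyc_level_map (cyc_res p n.+1 s) = cyc_res p n s.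
Proof.
have [u hu] := cyc_res_ex n.+1 s; rewrite (cyc_res_unit hu) cyc_level_map_coset.
symmetry; apply: cyc_res_unit.
apply: (@acts_mod _ _ (val u : 'Z_(q n.+1))); last first.
  by apply: acts_dvd hu; rewrite dvdn_exp2l.
by rewrite /= modn_dvdm // (Zp_cast (q1 n)).
Qed.

Lemma cyc_res_acts1 n s : acts_on_mu s (q n) 1 -> cyc_res p n s = 1%g.
Proof.
move=> hs; have [u hu] := cyc_res_ex n 1%g; rewrite -(cyc_res1 n) (cyc_res_unit hu).
apply: cyc_res_unit; apply: acts_mod (hs).
by apply: (@acts_uniq (q n) (q0 n) 1%g) => //; exact: acts1.
Qed.

Lemma gal_Qinf1 : gal_Qinf p 1%g. Proof. by move=> n; exact: cyc_res1. Qed.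
Lemma gal_QinfM s t : gal_Qinf p s -> gal_Qinf p t -> gal_Qinf p (s * t)%g.
Proof. by move=> hs ht n; rewrite cyc_resM hs ht mulg1. Qed.
Lemma gal_QinfV s : gal_Qinf p s -> gal_Qinf p s^-1%g.
Proof. by move=> hs n; rewrite cyc_resV hs invg1. Qed.
Lemma gal_QinfJ s t : gal_Qinf p s -> gal_Qinf p (t^-1 * s * t)%g.
Proof. by move=> hs n; rewrite !cyc_resM cyc_resV hs mulg1 mulVg. Qed.

Lemma gal_Qinf_closed : agree_closed (gal_Qinf p).
Proof.
move=> s hs n; have [z hz] := cyc_res_loc n; have [t ht ts] := hs [:: z].
by rewrite -(hz t s) ?ts ?inE.
Qed.

(** Q_oo is unramified outside p. *)
Lemma inertia_gal_Qinf l Q s : prime l -> l != p -> prime_above l Q -> inertia Q s -> gal_Qinf p s.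
Proof.
move=> pl lp hQ hs n; apply: cyc_res_acts1; apply: (inertia_acts1 hQ) => //.
by rewrite coprimeXr // prime_coprime // dvdn_prime2.
Qed.

(** The extension Q_oo is totally ramified at p: residues of its integers at p are rational. *)
Lemma inertia_onto P (t : galQ) : prime_above p P -> exists2 s, gal_Qinf p s & inertia P (t * s)%g.
Proof.
move=> hP; apply: (inertia_lift hP); [exact: gal_Qinf1|exact: gal_QinfM|exact: gal_Qinf_closed|].
move=> x xA fx.
have [z pz] : exists m, forall s : galQ, acts_on_mu s (q m) 1 -> s x = x.
  apply: contrapT => /forallNP no.
  have [| | |s hs] := @galQ_nested (fun m => [set s : galQ | acts_on_mu s (q m) 1 /\ s x <> x]).
  - move=> m s hs; split.
      by move=> z zq; have [r [hr _] rs] := hs [:: z]; rewrite -rs ?inE // hr.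
    by have [r [_ rx] rs] := hs [:: x]; rewrite -rs ?inE.
  - move=> m s [hs sx]; split => //; apply: acts_dvd hs; rewrite dvdn_exp2l //.
  - by move=> m; have /existsNP[s /not_implyP hs] := no m; exists s.
  by case: (hs 0) => _; apply; apply: fx => m; apply: cyc_res_acts1; case: (hs m).
have [y py] := C_prim_root_exists (q0 z).
apply: (cyc_residue_gal pp py) => //; apply: (cyclotomic_fixed py) => s sy.
by apply: pz; apply: (acts_prim py); rewrite sy expr1.
Qed.

Lemma card_cyc_level n : #|[set: cyc_level p n]%SET| = (p ^ n)%N.
Proof.
have hall : (p^'.-Hall(units_Zp (q n))(cyc_torsion p n))%g.
  by apply: nilpotent_pcore_Hall; apply/abelian_nil/units_Zp_abelian.
have nH : (units_Zp (q n) \subset 'N(cyc_torsion p n))%g.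
  by apply: sub_abelian_norm; [exact: units_Zp_abelian | exact: pcore_sub].
have -> : [set: cyc_level p n]%SET = (units_Zp (q n) / cyc_torsion p n)%g.
  apply/finset.setP => x; rewrite inE; have [u ->] := cyc_levelP x.
  by rewrite mem_quotient // inE.
rewrite card_quotient //.
have cU : #|units_Zp (q n)| = (p.-1 * p ^ n)%N by rewrite card_units_Zp // totient_pfactor.
have cT : #|cyc_torsion p n| = p.-1.
  have pm0 : (0 < p.-1)%N by case: (p) p1 => [|[]].
  have pn : (p^'.-nat p.-1)%N.
    rewrite (p'natE _ pp); apply/negP => /(dvdn_leq pm0); case: (p) p1 => [|k] //= _.
    by rewrite ltnn.
  have pn0 : (0 < p ^ n)%N by rewrite expn_gt0 prime_gt0.
  rewrite (card_Hall hall) cU (partnM _ pm0 pn0) (part_pnat_id pn).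
  have pn' : ((p^')^'.-nat (p ^ n))%N by rewrite pnatNK pnatX pnat_id.
  by rewrite (part_p'nat pn') muln1.
rewrite -divgS ?pcore_sub // cU cT mulKn //; by case: (p) p1 => [|[]].
Qed.

Lemma cyc_res_onto n (g : cyc_level p n) : exists s, cyc_res p n s = g.
Proof.
have [u ->] := cyc_levelP g.
have [s hs] : exists s, acts_on_mu s (q n) (val u : 'Z_(q n)).
  apply: acts_realize; have := valP u; rewrite -{1}[val u]natr_Zp unitZpE ?q1 //.
  by rewrite coprime_sym.
by exists s; apply: cyc_res_unit.
Qed.

Hypothesis podd : odd p.

(** The group Gal(Q_n/Q) has odd order, so that it contains no involution. *)
Lemma involution_gal_Qinf s : (s * s)%g = 1%g -> gal_Qinf p s.
Proof.
move=> ss n; apply/eqP; rewrite -order_eq1.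
have d2 : (#[cyc_res p n s]%g %| 2)%N.
  by rewrite order_dvdn expgS expg1 -cyc_resM ss cyc_res1.
have dp : (#[cyc_res p n s]%g %| p ^ n)%N.
  by rewrite -card_cyc_level; apply: order_dvdG; rewrite inE.
have : (#[cyc_res p n s]%g %| gcdn 2 (p ^ n))%N by rewrite dvdn_gcd d2 dp.
have /eqP-> : coprime 2 (p ^ n) by rewrite coprimeXr // coprime2n.
by rewrite dvdn1.
Qed.

Lemma LTE m : exists c, ((1 + p) ^ (p ^ m) = 1 + p ^ m.+1 + p ^ m.+2 * c)%N.
Proof.
elim: m => [|m [c IH]]; first by exists 0%N; rewrite muln0 addn0 expn1 expn0 expn1.
rewrite expnSr expnM {}IH; set y := (p ^ m.+1 + p ^ m.+2 * c)%N.
have -> : (1 + p ^ m.+1 + p ^ m.+2 * c = 1 + y)%N by rewrite /y addnA.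
have [d ->] : exists d, ((1 + y) ^ p = 1 + p * y + 'C(p, 2) * y ^ 2 + y ^ 3 * d)%N.
  elim: (p) => [|k [d IH]]; first by exists 0%N; rewrite expn0 muln0.
  exists ('C(k, 2) + d + y * d)%N; rewrite expnS IH binS bin1; exact: LTE_aux1.
rewrite bin2odd // /y !(expnS p).
exists (c + p.-1./2 * p ^ m * (1 + p * c) ^ 2 + p ^ m * p ^ m * (1 + p * c) ^ 3 * d)%N.
exact: LTE_aux2.
Qed.

Lemma coprime_succ n : coprime (1 + p) (q n).
Proof. by rewrite coprimeXr // add1n coprimeSn. Qed.

(** An automorphism raising all p-power roots of unity to the power 1 + p
    restricts to a generator at every level. *)
Lemma cyc_generator : exists g0, forall n, [set: cyc_level p n]%SET = <[cyc_res p n g0]>%g.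
Proof.
have [| | |g0 hg0] := @galQ_nested (fun n => [set s : galQ | acts_on_mu s (q n) (1 + p)]).
- by move=> n s hs z zq; have [r hr rs] := hs [:: z]; rewrite -rs ?inE // hr.
- by move=> n s hs; apply: acts_dvd hs; rewrite dvdn_exp2l.
- by move=> n; apply: acts_realize; exact: coprime_succ.
exists g0 => n; apply/esym/eqP; rewrite eqEcard finset.subsetT card_cyc_level /=.
have op : (#[cyc_res p n g0]%g %| p ^ n)%N.
  by rewrite -card_cyc_level; apply: order_dvdG; rewrite inE.
rewrite -orderE; have [m mn Do] := dvdn_pfactor _ _ pp op.
rewrite Do leqNgt; apply/negP; rewrite ltn_exp2l // => {}mn.
have [k Dn] : exists k, n = k.+1 by case: (n) mn => // k _; exists k.
have [u hu] := cyc_res_ex n g0; have Du := cyc_res_unit hu.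
have ux : (u ^+ (p ^ k))%g \in cyc_torsion p n.
  apply: coset_idr; rewrite ?cyc_torsion_norm // morphX ?cyc_torsion_norm //= -Du.
  apply/eqP; rewrite -order_dvdn Do dvdn_exp2l //; move: mn; rewrite Dn ltnS; lia.
have valX j : (u ^+ j == 1)%g = ((1 + p) ^ j == 1 %[mod q n])%N.
  rewrite -(inj_eq val_inj) /= FinRing.val_unitX.
  have -> : val u = (1 + p)%:R :> 'Z_(q n).
    apply: ord_inj; rewrite val_Zp_nat ?q1 //.
    by have := acts_uniq (q0 n) hu (hg0 n); rewrite (modn_small (Zp_val_lt _)).
  by rewrite -natrX -[X in _ == X](mulr1n 1) -(inj_eq (@ord_inj _)) !val_Zp_nat ?q1.
have up : (p.-elt u)%g.
  apply: (@pnat_dvd _ (p ^ n)); last by rewrite pnatX pnat_id.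
  rewrite order_dvdn valX; have [c ->] := LTE n.
  rewrite eqn_mod_dvd -?addnA ?leq_addr // addKn dvdn_add //.
  by rewrite /q (expnSr p n.+1) -mulnA dvdn_mulr.
have : ((u ^+ (p ^ k))%g == 1%g).
  rewrite -order_eq1; apply/eqP; apply: (@pnat_1 p).
    exact: p_eltX.
  by move: ux; rewrite in_cyc_torsion.
rewrite valX; have [c ->] := LTE k; rewrite -Dn.
rewrite eqn_mod_dvd -?addnA ?leq_addr // addKn dvdn_addl; last first.
  by rewrite /q dvdn_mulr.
by rewrite /q dvdn_Pexp2l // ltnn.
Qed.
End CycRes.

(** * Eigenvectors modulo p in a lattice with a cyclic action *)
Section PolyAct.
Variables (V : zmodType) (tau : {additive V -> V}).

Definition pact (A : {poly int}) (x : V) : V := \sum_(i < size A) iter i tau x *~ A`_i.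

Lemma pactE n (A : {poly int}) x : (size A <= n)%N -> pact A x = \sum_(i < n) iter i tau x *~ A`_i.
Proof.
move=> An; rewrite /pact -!(big_mkord xpredT (fun i => iter i tau x *~ A`_i)).
rewrite (big_cat_nat _ An) //= [X in _ + X]big1_seq ?addr0 // => i /andP[_].
by rewrite mem_index_iota => /andP[Ai _]; rewrite nth_default // mulr0z.
Qed.

Lemma iter_tauB n x y : iter n tau (x - y) = iter n tau x - iter n tau y.
Proof. by elim: n => //= n ->; rewrite raddfB. Qed.
Lemma iter_tau0 n : iter n tau 0 = 0.
Proof. by elim: n => //= n ->; rewrite raddf0. Qed.
Lemma iter_tauD n x y : iter n tau (x + y) = iter n tau x + iter n tau y.
Proof. by elim: n => //= n ->; rewrite raddfD. Qed.
Lemma iter_tauMz n x (m : int) : iter n tau (x *~ m) = iter n tau x *~ m.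
Proof. by elim: n => //= n ->; rewrite raddfMz. Qed.
Lemma iter_tau_sum n (I : Type) (r : seq I) (P : pred I) (F : I -> V) :
  iter n tau (\sum_(i <- r | P i) F i) = \sum_(i <- r | P i) iter n tau (F i).
Proof. exact: (big_morph _ (iter_tauD n) (iter_tau0 n)). Qed.

Lemma pact0 x : pact 0 x = 0. Proof. by rewrite /pact size_poly0 big_ord0. Qed.

Lemma pactD A B x : pact (A + B) x = pact A x + pact B x.
Proof.
rewrite (pactE x (leq_maxl (size A) (size B))) (pactE x (leq_maxr (size A) (size B))).
rewrite (pactE x (size_polyD A B)) -big_split; apply: eq_bigr => i _.
by rewrite coefD mulrzDr.
Qed.

Lemma pactC a x : pact a%:P x = x *~ a.
Proof. by rewrite (@pactE 1) ?size_polyC ?leq_b1 // big_ord_recl big_ord0 addr0 coefC. Qed.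

Lemma pactN A x : pact (- A) x = - pact A x.
Proof.
by apply: (addrI (pact A x)); rewrite -pactD !subrr pact0.
Qed.
Lemma pactB A B x : pact (A - B) x = pact A x - pact B x.
Proof. by rewrite pactD pactN. Qed.

Lemma pactMX A x : pact (A * 'X) x = tau (pact A x).
Proof.
rewrite (@pactE (size A).+1); last first.
  by have [->|A0] := eqVneq A 0; rewrite ?mul0r ?size_poly0 // size_mulX.
rewrite big_ord_recl coefMX mulr0z add0r raddf_sum; apply: eq_bigr => i _.
by rewrite coefMX /= raddfMz.
Qed.

Lemma pact_lin A x y : pact A (x + y) = pact A x + pact A y.
Proof. by rewrite -big_split; apply: eq_bigr => i _; rewrite iter_tauD mulrzDl. Qed.
Lemma pact_z A x n : pact A (x *~ n) = pact A x *~ n.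
Proof. by rewrite /pact mulrz_suml; apply: eq_bigr => i _; rewrite iter_tauMz -!mulrzA mulrC. Qed.
Lemma pact_0r A : pact A 0 = 0.
Proof. by rewrite -[0 in LHS](mulr0z 0) pact_z mulr0z. Qed.

Lemma pactCM c B x : pact (c%:P * B) x = pact B x *~ c.
Proof.
rewrite (@pactE (size B)); last by rewrite mul_polyC size_scale_leq.
by rewrite /pact mulrz_suml; apply: eq_bigr => i _; rewrite coefCM mulrC mulrzA.
Qed.

Lemma pactM A B x : pact (A * B) x = pact A (pact B x).
Proof.
elim/poly_ind: A => [|A c IH]; first by rewrite mul0r !pact0.
by rewrite mulrDl mulrAC !pactD !pactMX pactC pactCM IH.
Qed.

Lemma pact_Xn n x : pact 'X^n x = iter n tau x.
Proof.
elim: n => [|n IH]; first by rewrite expr0 -[1]polyC1 pactC.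
by rewrite exprSr pactMX IH.
Qed.

(** If x is an eigenvector modulo p, then so is every A(tau) x, with A(tau)
    acting through the value of A. *)
Lemma pact_eigen (m : int) (mu : int) x w : tau x = x *~ mu + w *~ m ->
  forall A, exists w', pact A x = x *~ A.[mu] + w' *~ m.
Proof.
move=> ex; elim/poly_ind => [|A c [w' IH]]; first by exists 0; rewrite pact0 horner0 mulr0z mul0rz addr0.
exists (w *~ A.[mu] + tau w').
rewrite pactD pactMX IH pactC raddfD !raddfMz ex !mulrzDl hornerMXaddC mulrzDr.
rewrite -!mulrzA [mu * _]mulrC [m * _]mulrC -!addrA.
by congr (_ + _); rewrite addrA addrC.
Qed.
End PolyAct.

Lemma absz_lt (X : int) (N : nat) : 0 <= X < N%:Z -> (absz X < N)%N.
Proof. lia. Qed.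

Lemma near_aux (u v t K N : int) : 0 <= v + K < N -> 0 <= u + K < N ->
  absz (v + K) = absz (u + K) -> `|u - t - v| <= 1 -> `|t| <= 8.
Proof. lia. Qed.

Section QuasiLattice.
Variables (V : zmodType) (tau : {additive V -> V}) (lg : V -> int).
Hypothesis lgD : forall x y, `|lg (x + y) - lg x - lg y| <= 1.

Let bd x (M : int) := `|lg x| <= M.

Lemma bd0 : bd 0 1.
Proof. by have := lgD 0 0; rewrite /bd addr0; lia. Qed.
Lemma bdD x y M N : bd x M -> bd y N -> bd (x + y) (M + N + 1).
Proof. by have := lgD x y; rewrite /bd; lia. Qed.
Lemma bdN x M : bd x M -> bd (- x) (M + 2).
Proof. by have := lgD x (- x); have := bd0; rewrite /bd subrr; lia. Qed.
Lemma bdMn x M (n : nat) : bd x M -> bd (x *+ n) (n%:Z * (M + 1) + 1).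
Proof.
move=> hx; elim: n => [|n IH]; first by rewrite mulr0n mul0r; exact: bd0.
have -> : n.+1%:Z * (M + 1) + 1 = M + (n%:Z * (M + 1) + 1) + 1.
  by rewrite -addn1 PoszD; ring.
by rewrite mulrS; exact: bdD.
Qed.
Lemma bdMz x M (n : int) : bd x M -> bd (x *~ n) (`|n| * (M + 1) + 3).
Proof.
move=> hx; case: n => n; last first.
  have := bdN (bdMn n.+1 hx); rewrite /bd NegzE mulrNz -pmulrn; lia.
have := bdMn n hx; rewrite /bd -pmulrn; lia.
Qed.
Lemma bd_sum n (F : 'I_n -> V) (M : int) :
  (forall i, bd (F i) M) -> bd (\sum_i F i) (n%:Z * (M + 1) + 1).
Proof.
elim: n F => [|n IH] F hF; first by rewrite big_ord0 mul0r; exact: bd0.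
have -> : n.+1%:Z * (M + 1) + 1 = M + (n%:Z * (M + 1) + 1) + 1.
  by rewrite -addn1 PoszD; ring.
by rewrite big_ord_recl; apply: bdD => //; apply: IH.
Qed.

Lemma bd_sumT (T : finType) (F : T -> V) (M : int) :
  (forall i, bd (F i) M) -> bd (\sum_i F i) (#|T|%:Z * (M + 1) + 1).
Proof.
move=> hF; have -> : \sum_i F i = \sum_(j < #|T|) F (enum_val j).
  by rewrite -(big_enum_val (A := T)); apply: eq_bigl.
exact: bd_sum.
Qed.

Lemma bd_ex x : exists M : nat, bd x M%:Z.
Proof. by exists (absz (lg x)); rewrite /bd; lia. Qed.

Variables (Phi : {poly int}) (f d : nat).
Hypotheses (sPhi : size Phi = f.+1) (mPhi : Phi \is monic) (f0 : (0 < f)%N).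
Hypothesis fin : forall C : nat, exists r : seq V,
  forall x, (forall i, (i < d)%N -> bd (iter i tau x) C%:Z) -> x \in r.

(** The recurrence given by Phi bounds all the iterates in terms of f consecutive ones. *)
Lemma bd_conj (C0 n : nat) : exists C : nat, forall x, pact tau Phi x = 0 ->
  (forall i, (i < f)%N -> bd (iter i tau x) C0%:Z) ->
  forall i, (i < n)%N -> bd (iter i tau x) C%:Z.
Proof.
elim: n => [|n [C IH]]; first by exists 0%N.
pose S := (\sum_(j < f) absz (Phi`_j)%R)%N.
exists (C0 + C + (f * (S * (C + 1) + 3 + 1) + 1 + 2))%N => x hx h0 i.
have hC := IH x hx h0; rewrite ltnS leq_eqVlt => /orP[/eqP->|/hC]; last by rewrite /bd; lia.
have [nf|fn] := ltnP n f; first by have := h0 n nf; rewrite /bd; lia.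
have e : iter n tau x = - \sum_(j < f) iter (n - f + j) tau x *~ Phi`_j.
  apply/eqP; rewrite -subr_eq0 opprK; apply/eqP.
  transitivity (iter (n - f) tau (pact tau Phi x)); last by rewrite hx iter_tau0.
  have Pf : Phi`_f = 1 by rewrite -(monicP mPhi) lead_coefE sPhi.
  rewrite /pact sPhi big_ord_recr /= Pf mulr1z iter_tauD.
  rewrite -iterD subnK // addrC; congr (_ + _); rewrite iter_tau_sum; apply: eq_bigr => j _.
  by rewrite iter_tauMz iterD.
rewrite e; have := bdN (@bd_sum f _ (S%:Z * (C%:Z + 1) + 3) _).
move=> /(_ (fun j => iter (n - f + j) tau x *~ Phi`_j)) h.
suff /h : forall j : 'I_f, bd (iter (n - f + j) tau x *~ Phi`_j) (S%:Z * (C%:Z + 1) + 3).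
  by rewrite /bd => h'; apply: le_trans h' _; lia.
move=> j; have := bdMz Phi`_j (hC (n - f + j)%N _).
have jS : (absz (Phi`_j)%R <= S)%N by rewrite /S (bigD1 j) //= leq_addr.
have jn : (n - f + j < n)%N by have := ltn_ord j; lia.
move=> /(_ jn); rewrite /bd => h'; apply: le_trans h' _.
rewrite lerD2r ler_wpM2r //; lia.
Qed.

(** The kernel of Phi(tau) has rank one over the ring generated by tau: two of
    its elements satisfy a nontrivial relation, by the pigeonhole principle. *)
Lemma pact_relation x1 x2 : pact tau Phi x1 = 0 -> pact tau Phi x2 = 0 ->
  exists A B : {poly int}, [/\ (size A <= f)%N, (size B <= f)%N, (A != 0) || (B != 0)
    & pact tau A x1 + pact tau B x2 = 0].
Proof.
move=> h1 h2.
have [C hC] := bd_conj 8 d; have [F hF] := fin C.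
have {}hF x : pact tau Phi x = 0 -> (forall i, (i < f)%N -> bd (iter i tau x) 8) -> x \in F.
  by move=> hx h; apply: hF; exact: hC.
pose z (i : 'I_f * bool) := iter i.1 tau (if i.2 then x1 else x2).
have [M hM] : exists M : nat, forall l (i : 'I_f * bool), (l < f)%N -> bd (iter l tau (z i)) M%:Z.
  have /choice[M_ hM_] : forall q : 'I_f * ('I_f * bool), exists M : nat, bd (iter q.1 tau (z q.2)) M%:Z.
    by move=> q; exact: bd_ex.
  exists (\sum_q M_ q)%N => l i lf; have := hM_ (Ordinal lf, i).
  rewrite (bigD1 (Ordinal lf, i)) //= /bd; lia.
pose y B (a : {ffun 'I_f * bool -> 'I_B}) := \sum_i z i *+ a i.
pose n := #|{: 'I_f * bool}|; pose C0 := (n * (M + 3) + 1)%N.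
have hy B a l : (0 < B)%N -> (l < f)%N -> bd (iter l tau (@y B a)) (C0 * B)%N%:Z.
  move=> B0 lf; rewrite /y iter_tau_sum.
  have hi i : bd (iter l tau (z i *+ a i)) (B%:Z * (M%:Z + 1) + 1).
    rewrite pmulrn iter_tauMz -pmulrn.
    have := bdMn (a i) (hM l i lf); rewrite /bd => h'; apply: le_trans h' _.
    by rewrite lerD2r ler_wpM2r //; have := ltn_ord (a i); lia.
  have := bd_sumT hi; rewrite /bd -/n => h'; apply: le_trans h' _.
  rewrite /C0; move: B0 => {hi}; nia.
have [B [B0 hB]] : exists B, (0 < B)%N /\ ((2 * (C0 * B)).+1 ^ f * (size F).+1 < B ^ (f * 2))%N.
  pose r := (size F).+1; pose B := (3 * C0 * r.+1)%N.
  have B0 : (0 < B)%N by rewrite /B /C0 !muln_gt0 addn1.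
  exists B; split=> //; rewrite mulnC expnM -/r.
  have CB : (0 < C0 * B)%N by rewrite muln_gt0 B0 /C0 addn1.
  apply: (@leq_ltn_trans (r * (3 * (C0 * B)) ^ f)).
    by rewrite leq_mul2l leq_exp2r //; apply/orP; right; lia.
  have -> : ((B ^ f) ^ 2 = B ^ f * B ^ f)%N by rewrite expnS expn1.
  rewrite mulnA /B; have : (0 < 3 * C0)%N by rewrite /C0 addn1.
  move: (3 * C0)%N => K K0; 
  have [r' Dr'] : exists r', r' = r.+1 by exists r.+1.
  have r0 : (0 < r')%N by rewrite Dr'.
  have rr' : (r < r')%N by rewrite Dr'.
  rewrite -Dr' {Dr'} [((K * (K * r')) ^ f)%N]expnMn mulnA.
  rewrite ltn_pmul2r ?expn_gt0 ?muln_gt0 ?K0 ?r0 // expnMn mulnC ltn_pmul2l ?expn_gt0 ?K0 //.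
  by apply: leq_trans rr' _; rewrite -{1}(expn1 r') leq_pexp2l.
have cP a l : (l < f)%N -> 0 <= lg (iter l tau (@y B a)) + (C0 * B)%N%:Z < (2 * (C0 * B)).+1%:Z.
  by move=> lf; have := hy B a l B0 lf; rewrite /bd; lia.
pose cell (a : {ffun 'I_f * bool -> 'I_B}) : {ffun 'I_f -> 'I_(2 * (C0 * B)).+1} :=
  [ffun l : 'I_f => inord (absz (lg (iter l tau (y B a)) + (C0 * B)%N%:Z))].
pose ref (a : {ffun 'I_f * bool -> 'I_B}) := odflt a [pick b | cell b == cell a].
have ref_cell a b : cell a = cell b -> cell (ref a) = cell a /\ ref a = ref b.
  move=> ab; rewrite /ref -ab; case: pickP => [c /eqP//|/(_ a)]; by rewrite eqxx.
have yPhi a : pact tau Phi (y B a) = 0.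
  rewrite /y; apply: (big_ind (fun v => pact tau Phi v = 0)).
  - exact: pact_0r.
  - by move=> u v hu hv; rewrite pact_lin hu hv addr0.
  - move=> i _; rewrite pmulrn pact_z /z.
    have hz v : pact tau Phi v = 0 -> pact tau Phi (iter i.1 tau v) = 0.
      by move=> hv; rewrite -pact_Xn -pactM mulrC pactM hv pact_0r.
    by case: (i.2); rewrite hz // mul0rz.
have near a : y B a - y B (ref a) \in F.
  apply: hF => [|l lf].
    by rewrite pact_lin -[- y B _]mulrN1z pact_z !yPhi mul0rz addr0.
  have := (ref_cell a a erefl).1 => /ffunP/(_ (Ordinal lf)); rewrite !ffunE /= => e.
  have := congr1 (@nat_of_ord _) e; rewrite !inordK; first last.
  - exact/absz_lt/cP.
  - exact/absz_lt/cP.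
  have := cP a l lf; have := cP (ref a) l lf => g1 g2 g3.
  rewrite iter_tauB; have := lgD (iter l tau (y B a) - iter l tau (y B (ref a))) (iter l tau (y B (ref a))).
  rewrite subrK /bd; exact: near_aux g1 g2 g3.
pose key a := (cell a, inord (index (y B a - y B (ref a)) F) : 'I_(size F).+1).
have /injectivePn[a [b ab kab]] : ~~ injectiveb key.
  apply/negP => /injectiveP /leq_card; rewrite leqNgt; apply/negP; rewrite negbK.
  rewrite card_prod !card_ffun !card_ord card_prod card_ord card_bool; exact: hB.
have [cab Fab] : cell a = cell b /\ y B a = y B b.
  move: kab; rewrite /key => -[cab /(congr1 (@nat_of_ord _))].
  rewrite !inordK ?ltnS ?index_size // => e; split=> //.
  have : nth 0 F (index (y B a - y B (ref a)) F) = nth 0 F (index (y B b - y B (ref b)) F) by rewrite e.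
  by rewrite !nth_index // (ref_cell a b cab).2; apply: addIr.
pose A (c : bool) := \poly_(i < f) (if insub i is Some j then (a (j, c))%:Z - (b (j, c))%:Z else 0).
have Ac c (i : 'I_f) : (A c)`_i = (a (i, c))%:Z - (b (i, c))%:Z.
  by rewrite coef_poly ltn_ord valK.
exists (A true), (A false); split; [exact: size_poly|exact: size_poly| |].
  apply: contraNT ab; rewrite negb_or !negbK => /andP[/eqP A1 /eqP A2].
  apply/eqP/ffunP => -[i c]; apply/val_inj/eqP; rewrite -eqz_nat -subr_eq0 -Ac.
  by case: c; rewrite ?A1 ?A2 coef0.
rewrite !(@pactE _ _ f) ?size_poly //; transitivity (y B a - y B b); last by rewrite Fab subrr.
rewrite /y -sumrB -big_split /=.
transitivity (\sum_(i < f) \sum_(c : bool) (z (i, c) *+ a (i, c) - z (i, c) *+ b (i, c))).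
  by apply: eq_bigr => i _; rewrite big_bool !Ac /z /= !mulrzBr -!pmulrn.
by rewrite pair_bigA; apply: eq_bigr => -[i c] _.
Qed.
End QuasiLattice.
Lemma prime_dvdzM p (a b : int) : prime p -> (p%:Z %| a * b)%Z -> (p%:Z %| a)%Z \/ (p%:Z %| b)%Z.
Proof. by move=> pp; rewrite !dvdzE abszM /= Euclid_dvdM // => /orP. Qed.

Lemma dvdz_horner (A : {poly int}) (x y m : int) : (m %| x - y)%Z -> (m %| A.[x] - A.[y])%Z.
Proof.
move=> xy; elim/poly_ind: A => [|A c IH]; first by rewrite !horner0 subrr dvdz0.
rewrite !hornerMXaddC.
have -> : A.[x] * x + c - (A.[y] * y + c) = (A.[x] - A.[y]) * x + A.[y] * (x - y) by ring.
by rewrite rpredD // ?(dvdz_mulr _ IH) ?(dvdz_mull _ xy).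
Qed.

Lemma power_lifting (p N : nat) (y : int) : (p%:Z %| y - 1)%Z -> ((p ^ N.+1)%N%:Z %| y ^+ (p ^ N) - 1)%Z.
Proof.
move=> hy; elim: N => [|N IH]; first by rewrite expn0 expr1 expn1.
rewrite expnS mulnC exprM subrX1 [(p ^ N.+2)%N]expnS mulnC PoszM dvdz_mul //.
set x := y ^+ _ in IH *.
have px : (p%:Z %| x - 1)%Z by apply: dvdz_trans IH; rewrite dvdzE /= expnS dvdn_mulr.
have -> : \sum_(i < p) x ^+ i = \sum_(i < p) (x ^+ i - 1) + p%:Z.
  by rewrite sumrB sumr_const card_ord natz subrK.
rewrite rpredD ?dvdzz //; apply: rpred_sum => i _; rewrite subrX1 dvdz_mulr //.
Qed.

Section CyclotomicBezout.
Variables (e : nat) (z : algC).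
Hypothesis pz : e.-primitive_root z.

Lemma cyclotomic_minimal (A : {poly int}) : (size A < size ('Phi_e))%N ->
  (map_poly intr A).[z] = 0 -> A = 0.
Proof.
move=> sA Az; have [p [Dp mon_p] minp] := minCpolyP z.
have : root (map_poly ratr (map_poly intr A)) z.
  rewrite /root -map_poly_comp (eq_map_poly (g := intr)) ?Az //.
  by move=> c /=; rewrite rmorph_int.
rewrite minp => dv; apply/eqP/contraT => A0; move: sA; rewrite ltnNge.
have {dv} : (size p <= size A)%N.
  rewrite -(size_map_inj_poly (@intr_inj rat) (rmorph0 _) A); apply: dvdp_leq dv.
  by rewrite -size_poly_gt0 size_map_inj_poly ?size_poly_gt0 //; exact: intr_inj.
suff -> : size p = size 'Phi_e by move->.
rewrite -(size_map_poly (ratr : {rmorphism rat -> algC}) p) -Dp (minCpoly_cyclotomic pz).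
by rewrite -(Cintr_Cyclotomic pz) size_map_inj_poly //; exact: intr_inj.
Qed.

Lemma cyclotomic_bezout (A : {poly int}) : A != 0 -> (size A < size ('Phi_e))%N ->
  exists S T R, R != 0 /\ S * A + T * 'Phi_e = R%:P.
Proof.
move=> A0 sA; set v := (map_poly intr A).[z] : algC.
have v0 : v != 0 by apply: contraNneq A0 => /cyclotomic_minimal-> //.
have [r Dr] : Qadj z v^-1.
  apply: QadjV; exists (map_poly intr A); rewrite -map_poly_comp; congr _.[z].
  by apply: eq_map_poly => c /=; rewrite rmorph_int.
have [S [a a0 DS]] := rat_poly_scale r.
have Phiz : (map_poly intr 'Phi_e).[z] = 0 :> algC.
  by apply/eqP; rewrite (Cintr_Cyclotomic pz) -[_ == 0]/(root _ z) -(minCpoly_cyclotomic pz) root_minCpoly.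
have hS : (map_poly intr S).[z] * v = a%:~R.
  apply: (mulfI (invr_neq0 (_ : a%:~R != 0 :> algC))); rewrite ?intr_eq0 // mulVf ?intr_eq0 //.
  rewrite mulrA -[RHS](mulVf v0); congr (_ * _); rewrite Dr DS map_polyZ hornerZ fmorphV rmorph_int.
  congr (_ * _.[z]); rewrite -map_poly_comp; apply: eq_map_poly => c /=; rewrite rmorph_int //.
pose D := a%:P - S * A.
have Q := Pdiv.RingMonic.rdivp_eq (Cyclotomic_monic e) D.
exists S, (Pdiv.Ring.rdivp D 'Phi_e), a; split=> //.
have m0 : Pdiv.Ring.rmodp D 'Phi_e = 0.
  apply: cyclotomic_minimal; first by rewrite Pdiv.Ring.ltn_rmodp monic_neq0 ?Cyclotomic_monic.
  have E (q1 q2 : {poly int}) : (map_poly intr (q1 * 'Phi_e + q2)).[z] = (map_poly intr q2).[z] :> algC.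
    by rewrite rmorphD rmorphM hornerD hornerM Phiz mulr0 add0r.
  rewrite -(E (Pdiv.Ring.rdivp D 'Phi_e)) -Q.
  by rewrite /D rmorphB rmorphM /= map_polyC !hornerE hS subrr.
by rewrite m0 addr0 in Q; rewrite -Q addrC subrK.
Qed.
End CyclotomicBezout.

Section EigenLine.
Variables (V : zmodType) (tau : {additive V -> V}) (lg : V -> int) (p d mu : nat).
Hypothesis lgD : forall x y, `|lg (x + y) - lg x - lg y| <= 1.
Hypothesis fin : forall C : nat, exists r : seq V,
  forall x, (forall i, (i < d)%N -> `|lg (iter i tau x)| <= C%:Z) -> x \in r.
Hypotheses (pp : prime p) (pd : ~~ (p %| d)%N).
Hypothesis tau_d : forall x, iter d tau x = x.
Hypothesis tfree : forall x : V, x *+ p = 0 -> x = 0.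
Hypothesis mu_d : (p%:Z %| mu%:Z ^+ d - 1)%Z.

(** A relation modulo a power of p can be divided by p until a coefficient is prime to p, as there is
    no p-torsion. *)
Lemma divide_relation N (a b : int) (x y w : V) : x *~ a + y *~ b = w *~ (p ^ N)%N%:Z ->
  ~ (((p ^ N)%N%:Z %| a)%Z /\ ((p ^ N)%N%:Z %| b)%Z) ->
  exists (n1 n2 : int) (w' : V), ~ ((p%:Z %| n1)%Z /\ (p%:Z %| n2)%Z) /\ x *~ n1 + y *~ n2 = w' *~ p%:Z.
Proof.
elim: N a b => [|N IH] a b e nab; first by case: nab; rewrite expn0 !dvd1z.
have [[/dvdzP[a' Da] /dvdzP[b' Db]]|n] := pselect ((p%:Z %| a)%Z /\ (p%:Z %| b)%Z); last first.
  exists a, b, (w *~ (p ^ N)%N%:Z); split=> //.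
  by rewrite e expnSr PoszM mulrzA.
apply: (IH a' b').
  apply/eqP; rewrite -subr_eq0; apply/eqP/tfree; rewrite pmulrn mulrzBl mulrzDl -!mulrzA -Da -Db e.
  by rewrite expnSr PoszM subrr.
by move=> [h1 h2]; apply: nab; rewrite Da Db !expnSr !PoszM !dvdz_mul.
Qed.

(** Some cyclotomic factor Phi of X^d - 1 vanishes at mu modulo p. The cofactor Psi(tau), which acts
    on eigenvectors modulo p through a unit, moves them into the kernel of Phi(tau), where they
    satisfy a nontrivial relation; evaluating it at a lift of mu modulo a high power of p and
    removing powers of p gives the claim. *)
Lemma eigen_line x1 x2 w1 w2 :
  tau x1 = x1 *+ mu + w1 *+ p -> tau x2 = x2 *+ mu + w2 *+ p ->
  exists (n1 n2 : int) w, ~ ((p%:Z %| n1)%Z /\ (p%:Z %| n2)%Z) /\ x1 *~ n1 + x2 *~ n2 = w *~ p%:Z.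
Proof.
rewrite !pmulrn => e1 e2.
have d0 : (0 < d)%N by case: (d) pd => //; rewrite dvdn0.
have p1 : ~~ (p%:Z %| 1)%Z by rewrite dvdzE dvdn1 /= gtn_eqF // prime_gt1.
have pmu : ~~ (p%:Z %| mu%:Z)%Z.
  apply/negP => h; have : (p%:Z %| mu%:Z ^+ d)%Z by rewrite -(prednK d0) exprS dvdz_mulr.
  move=> h'; have := rpredB h' mu_d; by rewrite opprB addrC subrK (negbTE p1).
have [e [Psi [DPsi e0 pPhi]]] : exists e Psi, [/\ 'X^d - 1 = 'Phi_e * Psi, (0 < e)%N & (p%:Z %| ('Phi_e).[mu%:Z])%Z].
  have [e ed pe] : exists2 e, e \in divisors d & (p%:Z %| ('Phi_e).[mu%:Z])%Z.
    have : (p%:Z %| ('X^d - 1).[mu%:Z])%Z by rewrite !hornerE.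
    rewrite -prod_Cyclotomic // horner_prod.
    elim: (divisors d) => [|e r IH]; first by rewrite big_nil (negbTE p1).
    rewrite big_cons => /(prime_dvdzM pp)[h|/IH[e' e'r h]]; first by exists e; rewrite ?inE ?eqxx.
    by exists e'; rewrite // inE e'r orbT.
  exists e, (\prod_(e' <- rem e (divisors d)) 'Phi_e'); split=> //.
    by rewrite -prod_Cyclotomic // (big_rem e).
  by move: ed; rewrite -dvdn_divisors // => /dvdn_gt0->.
have pPsi : ~~ (p%:Z %| Psi.[mu%:Z])%Z.
  apply/negP => h; have := congr1 (fun q => q^`().[mu%:Z]) DPsi.
  rewrite derivB derivM derivXn derivC subr0 hornerMn hornerXn hornerD !hornerM => De.
  have : (p%:Z %| (mu%:Z ^+ d.-1 *+ d))%Z by rewrite De rpredD // ?(dvdz_mull _ h) ?(dvdz_mulr _ pPhi).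
  rewrite -mulr_natr => /(prime_dvdzM pp)[h'|]; last by rewrite natz dvdzE (negbTE pd).
  move: (d.-1) h' => k; elim: k => [|k IH]; last by rewrite exprS => /(prime_dvdzM pp)[|//]; rewrite (negbTE pmu).
  by rewrite expr0 (negbTE p1).
pose y1 := pact tau Psi x1; pose y2 := pact tau Psi x2.
have kerPhi x : pact tau 'Phi_e (pact tau Psi x) = 0.
  by rewrite -pactM -DPsi pactB pact_Xn tau_d -[1]polyC1 pactC mulr1z subrr.
have [z pz] := C_prim_root_exists e0.
have sPhi := size_Cyclotomic e; have mPhi := Cyclotomic_monic e.
have f0 : (0 < totient e)%N by rewrite totient_gt0.
have [A [B [sA sB AB0 rel]]] := pact_relation lgD sPhi mPhi f0 fin (kerPhi x1) (kerPhi x2).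
have bez (A' : {poly int}) : (size A' <= totient e)%N -> A' != 0 ->
    exists N0, forall N M : nat, (N0 <= N)%N -> (M%:Z = mu%:Z %[mod p])%Z ->
      ((p ^ N)%N%:Z %| M%:Z ^+ d - 1)%Z -> ~ ((p ^ N)%N%:Z %| A'.[M%:Z])%Z.
  move=> sA' A'0; have [|S [T [r [r0 e3]]]] := cyclotomic_bezout pz A'0; first by rewrite sPhi.
  exists (absz r) => N M rN Mmu Md hA.
  have hPhi : ((p ^ N)%N%:Z %| ('Phi_e).[M%:Z])%Z.
    have cop : coprimez (p ^ N)%N%:Z Psi.[M%:Z].
      rewrite coprimezE /= coprimeXl // prime_coprime //; apply: contra pPsi => h.
      have h' : (p%:Z %| M%:Z - mu%:Z)%Z by rewrite -eqz_mod_dvd; apply/eqP.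
      have := rpredB (h : (p%:Z %| Psi.[M%:Z])%Z) (dvdz_horner Psi h').
      by rewrite opprB addrC subrK.
    rewrite -(Gauss_dvdzl _ cop) -hornerM -DPsi !hornerE //.
  have : ((p ^ N)%N%:Z %| r)%Z.
    have -> : r = S.[M%:Z] * A'.[M%:Z] + T.[M%:Z] * ('Phi_e).[M%:Z].
      by rewrite -!hornerM -hornerD e3 hornerC.
    by rewrite rpredD ?dvdz_mull.
  rewrite dvdzE /= => /dvdn_leq; rewrite absz_gt0 => /(_ r0); rewrite leqNgt => /negP; apply.
  apply: leq_ltn_trans rN _; exact: ltn_expl (prime_gt1 pp).
have [N0 hN0] : exists N0, forall N M : nat, (N0 <= N)%N -> (M%:Z = mu%:Z %[mod p])%Z ->
    ((p ^ N)%N%:Z %| M%:Z ^+ d - 1)%Z ->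
    ~ (((p ^ N)%N%:Z %| A.[M%:Z])%Z /\ ((p ^ N)%N%:Z %| B.[M%:Z])%Z).
  case/orP: AB0 => [/(bez _ sA)|/(bez _ sB)] [N0 h]; exists N0 => N M h1 h2 h3 [h4 h5].
    exact: (h _ _ h1 h2 h3 h4).
  exact: (h _ _ h1 h2 h3 h5).
pose M := (mu ^ (p ^ N0))%N.
have Mmu : (M%:Z = mu%:Z %[mod p])%Z.
  apply/eqP; rewrite eqz_mod_dvd; rewrite /M; elim: (N0) => [|N IH].
    by rewrite expn0 expn1 subrr dvdz0.
  have := fermat_little (mu ^ (p ^ N)) pp; rewrite -expnM -expnSr => /eqP h.
  have {}h : (p%:Z %| (mu ^ (p ^ N.+1))%N%:Z - (mu ^ (p ^ N))%N%:Z)%Z.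
    by rewrite -eqz_mod_dvd !modz_nat eqz_nat.
  have := rpredD h IH; by rewrite addrA subrK.
have Md : ((p ^ N0.+1)%N%:Z %| M%:Z ^+ d - 1)%Z.
  have -> : M%:Z = mu%:Z ^+ (p ^ N0) by rewrite -[LHS]natz natrX natz.
  by rewrite -exprM mulnC exprM power_lifting.
have Md' : ((p ^ N0)%N%:Z %| M%:Z ^+ d - 1)%Z.
  by apply: dvdz_trans Md; rewrite dvdzE /= expnS dvdn_mull.
pose H : {poly int} := \sum_(i < d) 'X^(d.-1 - i) * (M%:Z)%:P ^+ i.
have DH : 'X^d - (M%:Z ^+ d)%:P = ('X - (M%:Z)%:P) * H.
  by rewrite rmorphXn subrXX.
pose y x := pact tau (H * Psi) x.
have y_eigen x w : tau x = x *~ mu + w *~ p -> exists w', y x = x *~ (H * Psi).[mu%:Z] + w' *~ p.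
  by move=> ex; exact: pact_eigen ex (H * Psi).
have y_pact x (A' : {poly int}) : exists w, pact tau A' (y x) = y x *~ A'.[M%:Z] + w *~ (p ^ N0)%N%:Z.
  case/dvdzP: Md' => c Dc; apply: (@pact_eigen _ _ _ _ _ (- (pact tau Psi x *~ c))).
  rewrite -[tau _]/(tau (pact tau (H * Psi) x)) -pactMX mulrC -['X](subrK (M%:Z)%:P) mulrDl pactD mulrA -DH.
  rewrite pactCM (pactM tau ('X^d - _)) pactB pact_Xn tau_d pactC addrC; congr (_ + _).
  by rewrite -[X in X - _]mulr1z -mulrzBr -opprB Dc mulrNz mulrzA mulNrz.
have pc : ~~ (p%:Z %| (H * Psi).[mu%:Z])%Z.
  rewrite hornerM; apply/negP => /(prime_dvdzM pp)[|h]; last by rewrite h in pPsi.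
  have hH : (p%:Z %| H.[mu%:Z] - mu%:Z ^+ d.-1 *+ d)%Z.
    have -> : mu%:Z ^+ d.-1 *+ d = \sum_(i < d) mu%:Z ^+ d.-1 by rewrite sumr_const card_ord.
    rewrite horner_sum -sumrB; apply: rpred_sum => i _; rewrite hornerM !horner_exp hornerX hornerC.
    have -> : mu%:Z ^+ d.-1 = mu%:Z ^+ (d.-1 - i) * mu%:Z ^+ i.
      by rewrite -exprD subnK // -ltnS prednK.
    rewrite -mulrBr dvdz_mull //.
    have h' : (p%:Z %| M%:Z - mu%:Z)%Z by rewrite -eqz_mod_dvd; apply/eqP.
    by have := dvdz_horner 'X^i h'; rewrite !hornerXn.
  move=> h; have := rpredB h hH; rewrite opprB addrC subrK -mulr_natr => /(prime_dvdzM pp)[|].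
    move: (d.-1) => k; elim: k => [|k IH]; first by rewrite expr0 (negbTE p1).
    by rewrite exprS => /(prime_dvdzM pp)[|//]; rewrite (negbTE pmu).
  by rewrite natz dvdzE (negbTE pd).
have rel' : pact tau A (y x1) + pact tau B (y x2) = 0.
  have Ey A' x : pact tau A' (y x) = pact tau H (pact tau A' (pact tau Psi x)).
    by rewrite /y -!pactM mulrCA mulrA.
  by rewrite !Ey -pact_lin rel pact_0r.
have [u1 E1] := y_pact x1 A; have [u2 E2] := y_pact x2 B.
have : y x1 *~ A.[M%:Z] + y x2 *~ B.[M%:Z] = - (u1 + u2) *~ (p ^ N0)%N%:Z.
  apply/eqP; rewrite mulNrz mulrzDl -addr_eq0 addrACA -E1 -E2; exact/eqP.
case/divide_relation; first exact: hN0.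
move=> n1 [n2 [w [nn De]]].
have [v1 F1] := y_eigen _ _ e1; have [v2 F2] := y_eigen _ _ e2.
exists ((H * Psi).[mu%:Z] * n1), ((H * Psi).[mu%:Z] * n2), (w - v1 *~ n1 - v2 *~ n2); split.
  by case=> /(prime_dvdzM pp)[|h1]; [rewrite (negbTE pc) | case/(prime_dvdzM pp) => h2; [rewrite h2 in pc | apply: nn]].
set c := (H * Psi).[mu%:Z]; rewrite !mulrzBl -De F1 F2 !mulrzDl -/c.
have E x a b : (x : V) *~ a *~ b = x *~ (b * a) by rewrite -mulrzA mulrC.
rewrite !E [n1 * c]mulrC [n2 * c]mulrC [p%:Z * n1]mulrC [p%:Z * n2]mulrC.
set X1 := x1 *~ _; set X2 := x2 *~ _; set Y1 := v1 *~ _; set Y2 := v2 *~ _.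
by rewrite addrACA -[_ - Y1 - Y2]addrA -opprD addrK.
Qed.
End EigenLine.

(** * Kummer characters and ideal classes of Q(zeta_p) *)

Lemma coprime_inv (j p : nat) : (0 < j)%N -> coprime j p -> exists2 r, (0 < r)%N & (j * r = 1 %[mod p])%N.
Proof.
move=> j0 cjp; case: (egcdnP p j0) => km kn e _.
have g1 : gcdn j p = 1%N by apply/eqP.
exists km; first by case: km e => //; rewrite mul0n g1 addn1.
by rewrite mulnC e g1 modnMDl.
Qed.

Lemma gal_sum (s : galQ) (I : Type) (r : seq I) (P : pred I) (F : I -> algC) :
  s (\sum_(i <- r | P i) F i) = \sum_(i <- r | P i) s (F i).
Proof. exact: rmorph_sum. Qed.

Lemma sub1_sub2 k : (2 <= k)%N -> (k - 1 = (k - 2).+1)%N.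
Proof. lia. Qed.

Lemma expn_mod_pred p a m n : prime p -> coprime a p -> (m = n %[mod p.-1])%N ->
  (a ^ m = a ^ n %[mod p])%N.
Proof.
move=> pp cap mn; suff h k : (a ^ k = a ^ (k %% p.-1) %[mod p])%N by rewrite h mn -h.
have E : (a ^ (k %/ p.-1 * p.-1) = 1 %[mod p])%N.
  by rewrite mulnC expnM -modnXm -(totient_prime pp) Euler_exp_totient // modnXm exp1n.
by rewrite {1}(divn_eq k p.-1) expnD -modnMml E modnMml mul1n.
Qed.

Section Kummer.
Variables (p : nat) (zeta : algC) (P0 : set algC).
Hypotheses (pp : prime p) (podd : odd p) (pz : p.-primitive_root zeta) (hP0 : prime_above p P0).

Let K := Qadj zeta.
Let O := cyclotomic_int p.
Let G1 := [set s : galQ | acts_on_mu s p 1].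
Let p0 : (0 < p)%N. Proof. exact: prime_gt0. Qed.
Let pn0 : p%:R != 0 :> algC. Proof. by rewrite pnatr_eq0 -lt0n. Qed.
Let zA : zeta \in Aint. Proof. exact: Aint_prim_root pz. Qed.
Let zp : zeta ^+ p = 1. Proof. exact: prim_expr_order pz. Qed.

Lemma G1E s : G1 s <-> s zeta = zeta.
Proof.
split=> [h|h]; first by rewrite h ?expr1.
by apply: (acts_prim pz); rewrite expr1.
Qed.
Lemma G1_1 : G1 1%g. Proof. exact/G1E. Qed.
Lemma G1M s t : G1 s -> G1 t -> G1 (s * t)%g.
Proof. by move=> /G1E hs /G1E ht; apply/G1E; rewrite -[LHS]/(s (t zeta)) ht hs. Qed.
Lemma G1V s : G1 s -> G1 s^-1%g.
Proof.
move=> /G1E hs; apply/G1E; rewrite -[in LHS]hs.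
by rewrite -[LHS]/((s^-1 * s)%g zeta) mulVg.
Qed.
Lemma G1X s n : G1 s -> G1 (s ^+ n)%g.
Proof. by move=> hs; elim: n => [|n IH]; rewrite ?expg0 ?expgS; [exact: G1_1 | exact: G1M]. Qed.
Lemma G1J s t : G1 s -> G1 (t^-1 * s * t)%g.
Proof.
move=> hs; have [a _ [ha _]] := acts_exists p0 t; apply/G1E.
rewrite -[LHS]/((t^-1)%g (s (t zeta))) ha // rmorphXn (G1E _).1 //.
by rewrite -ha // -[LHS]/((t^-1 * t)%g zeta) mulVg.
Qed.

Lemma K_fixed x : K x <-> forall s, G1 s -> s x = x.
Proof.
split=> [hx s /G1E hs|h]; first exact: Qadj_fixed hx.
by apply: (cyclotomic_fixed pz) => s hs; apply/h/G1E.
Qed.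

Lemma K_gal (t : galQ) x : K x -> K (t x).
Proof.
move=> /K_fixed hx; apply/K_fixed => s /(G1J t)/hx e.
have : t ((t^-1 * s * t)%g x) = t x by rewrite e.
by rewrite -[LHS]/((t * (t^-1 * s * t))%g x) !mulgA mulgV mul1g.
Qed.

Lemma OE x : O x <-> x \in Aint /\ K x.
Proof.
split=> [[xA [z [q [pz' Dx]]]]|[xA [q Dx]]]; last by split=> //; exists zeta, q.
split=> //; have [a Da] := prim_rootP pz (prim_expr_order pz'); rewrite Dx Da.
rewrite horner_coef; apply: Qadj_sum => i _; rewrite coef_map.
by apply: QadjM; [exact: Qadj_rat | do 2!apply: QadjX; exact: Qadj_gen].
Qed.

Lemma OD x y : O x -> O y -> O (x + y).
Proof. by move=> /OE[xA xK] /OE[yA yK]; apply/OE; split; [exact: rpredD | exact: QadjD]. Qed.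
Lemma OM x y : O x -> O y -> O (x * y).
Proof. by move=> /OE[xA xK] /OE[yA yK]; apply/OE; split; [exact: rpredM | exact: QadjM]. Qed.
Lemma OX x n : O x -> O (x ^+ n).
Proof. by move=> /OE[xA xK]; apply/OE; split; [exact: rpredX | exact: QadjX]. Qed.
Lemma Oint (n : int) : O n%:~R.
Proof. by apply/OE; split; [exact: Aint_int | apply: Qadj_Crat; rewrite -(ratr_int _ n); apply: Crat_rat]. Qed.
Lemma Onat n : O n%:R. Proof. exact: (Oint n). Qed.
Lemma O1 : O 1. Proof. exact: (Oint 1). Qed.
Lemma O_pi : O (1 - zeta).
Proof.
apply/OE; split; first by rewrite rpredB ?rpred1.
by apply: QadjB; [exact: Qadj1 | exact: Qadj_gen].
Qed.
Lemma O_gal (t : galQ) x : O x -> O (t x).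
Proof. by move=> /OE[xA xK]; apply/OE; split; [rewrite Aint_aut | exact: K_gal]. Qed.

Let pz1 : (p ^ 1)%N.-primitive_root zeta. Proof. by rewrite expn1. Qed.
Let pi := 1 - zeta.

Lemma pi_neq0 : pi != 0.
Proof.
rewrite subr_eq0 eq_sym; apply/eqP => z1; have := prim_order_dvd pz 1.
by rewrite expr1 z1 eqxx dvdn1 => /eqP p1; move: pp; rewrite p1.
Qed.

Lemma p_pi : exists u, [/\ u \in Aint, u^-1 \in Aint & p%:R = pi ^+ p.-1 * u].
Proof.
have [u [uA uV Du]] := prime_ramified pp pz1; exists u; split => //.
by rewrite Du expn1 totient_prime.
Qed.

Lemma pi_div x : O x -> P0 x -> exists2 y, O y & x = pi * y.
Proof.
move=> /OE[xA xK] Px; have [m [d [b [pm bA e]]]] := cyc_residue pp pz1 hP0 xA xK.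
have PM : forall a b, a \in Aint -> P0 b -> P0 (a * b) by case: hP0.
have Ppi : P0 pi := one_minus_root_prime pp pz1 hP0.
have Pd : P0 d%:~R.
  have -> : d%:~R = m%:~R * x - b * pi by rewrite [b * _]mulrC -e; ring.
  by apply: (primeB hP0); apply: PM => //; exact: Aint_int.
have /dvdzP[d' Dd] := prime_int hP0 pp Pd.
have [u [uA _ Du]] := p_pi.
have p2 : (1 < p)%N := prime_gt1 pp.
pose u' := pi ^+ p.-2 * u.
have Du' : p%:R = pi * u' by rewrite Du mulrA -exprS prednK // -ltnS prednK.
have u'A : u' \in Aint by rewrite rpredM ?rpredX ?rpredB ?rpred1.
have : coprimez p m by rewrite coprimezE /= prime_coprime.
case/coprimezP => [[c a]] /= cop.
have cop' : c%:~R * p%:R + a%:~R * m%:~R = 1 :> algC.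
  by rewrite -[p%:R]/(p%:Z%:~R) -!rmorphM -rmorphD cop.
have xE : x = c%:~R * (pi * u') * x + a%:~R * (d'%:~R * (pi * u') + pi * b).
  have -> : d'%:~R * (pi * u') + pi * b = m%:~R * x.
    by rewrite -Du' -e -[p%:R]/(p%:Z%:~R) -rmorphM -Dd /= addrC subrK.
  by rewrite -Du' -[LHS]mul1r -{1}cop'; ring.
exists (c%:~R * u' * x + a%:~R * (d'%:~R * u' + b)); last by rewrite [LHS]xE; ring.
apply/OE; split.
  have cA m' : m'%:~R \in Aint := Aint_int m'.
  by rewrite rpredD // rpredM // ?rpredD // rpredM // ?cA //.
have -> : c%:~R * u' * x + a%:~R * (d'%:~R * u' + b) = x / pi.
  by apply: (mulIf pi_neq0); rewrite divfK ?pi_neq0 // [RHS]xE; ring.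
by apply: QadjM => //; apply: QadjV; case/OE: O_pi.
Qed.

Lemma rational_div (n : nat) (b : algC) r : (0 < n)%N -> b \in Aint ->
  n%:R = (p ^ r)%:R * b -> (p ^ r %| n)%N.
Proof.
move=> n0 bA e; have q0 : (p ^ r)%:R != 0 :> algC by rewrite pnatr_eq0 expn_eq0 negb_and -lt0n p0.
have bQ : b \in Crat.
  have -> : b = ratr (n%:R / (p ^ r)%:R).
    by rewrite fmorph_div !rmorph_nat e mulrAC mulfV // mul1r.
  exact: Crat_rat.
have /intrP[c Dc] : b \in Num.int by rewrite (Cint_rat_Aint bQ).
have : (n%:Z = (p ^ r)%:Z * c)%R.
  by apply: (@intr_inj algC); rewrite rmorphM /= -Dc -e.
by move/(congr1 absz); rewrite abszM /= => ->; rewrite dvdn_mulr.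
Qed.

(** Repeated division by pi must stop, since pi^(p-1) is p up to a unit and a nonzero integer is not
    divisible by arbitrarily high powers of p. *)
Lemma pi_val x : O x -> x != 0 -> exists i y, [/\ O y, x = pi ^+ i * y & ~ P0 y].
Proof.
move=> Ox x0; apply: contrapT => no.
have dvd i : exists2 y, O y & x = pi ^+ i * y.
  elim: i => [|i [y Oy e]]; first by exists x; rewrite // expr0 mul1r.
  have [Py|nP] := pselect (P0 y); last by case: no; exists i, y.
  by have [y' Oy' e'] := pi_div Oy Py; exists y'; rewrite // exprSr -mulrA -e'.
have [n n0 nx] := Aint_scale x^-1.
have [y Oy e] := dvd (p.-1 * n)%N; have [u [uA uV Du]] := p_pi.
have /(rational_div n0) : y * u^-1 ^+ n * (n%:R / x) \in Aint.
  by apply: rpredM nx; apply: rpredM; [case/OE: Oy | exact: rpredX].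
move=> /(_ n) h; have : (p ^ n %| n)%N.
  apply: h; rewrite natrX Du exprMn -exprM -{1}(divfK x0 n%:R) {2}e.
  have u0 : u != 0 by apply: contraNneq pn0 => u0; rewrite Du u0 mulr0.
  by rewrite exprVn -[LHS]mulr1 -(mulfV (expf_neq0 n u0)); ring.
by move/(dvdn_leq n0); rewrite leqNgt ltn_expl // prime_gt1.
Qed.

(** x belongs to a Aint[1/p]. *)
Definition pint (a x : algC) := exists N b, b \in Aint /\ p%:R ^+ N * x = a * b.

Lemma pintM a b x y : pint a x -> pint b y -> pint (a * b) (x * y).
Proof.
move=> [N [c [cA e]]] [M [d [dA e']]]; exists (N + M)%N, (c * d).
by rewrite rpredM // mulrACA -e -e' exprD; split => //; ring.
Qed.
Lemma pint_mull a x y : y \in Aint -> pint a x -> pint a (y * x).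
Proof.
by move=> yA [N [c [cA e]]]; exists N, (y * c); rewrite rpredM //; split=> //; rewrite mulrCA e mulrCA.
Qed.
Lemma pintD a x y : pint a x -> pint a y -> pint a (x + y).
Proof.
move=> [N [c [cA e]]] [M [d [dA e']]]; exists (N + M)%N, (p%:R ^+ M * c + p%:R ^+ N * d).
by rewrite rpredD ?rpredM ?rpredX ?rpred_nat //; split=> //; rewrite mulrDr mulrDr [a * (_ * c)]mulrCA -e [a * (_ * d)]mulrCA -e' exprD; ring.
Qed.
Lemma pint_sum a (I : Type) (r : seq I) (f : I -> algC) :
  (forall i, pint a (f i)) -> pint a (\sum_(i <- r) f i).
Proof.
move=> h; apply: (big_ind (pint a)) => //; last exact: pintD.
by exists 0%N, 0; rewrite !mulr0 rpred0.
Qed.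
Lemma pint_self a x : x \in Aint -> pint a (a * x).
Proof. by move=> xA; exists 0%N, x; rewrite expr0 mul1r. Qed.

(** The part prime to p of the ideal generated by a, intersected with Q(zeta). *)
Definition Iset (a : algC) : set algC := [set x | O x /\ pint a x].

Lemma Iset_nat a : a \in Aint -> a != 0 -> exists2 n : nat, coprime p n & Iset a n%:R.
Proof.
move=> aA a0; have [n n0 nA] := Aint_scale a^-1.
have [m cm e] := pfactor_coprime pp n0; exists m => //; split; first exact: Onat.
exists (logn p n), (n%:R / a); split=> //; rewrite [RHS]mulrC divfK //.
by rewrite [in RHS]e natrM natrX mulrC.
Qed.

Lemma Iset_ideal a : a \in Aint -> a != 0 -> nonzero_ideal p (Iset a).
Proof.
move=> aA a0; split.
- by move=> x [].
- by move=> x y [Ox px] [Oy py]; split; [exact: OD | exact: pintD].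
- by move=> x y Ox [Oy py]; split; [exact: OM | apply: pint_mull => //; case/OE: Ox].
- have [n cn In] := Iset_nat aA a0; exists n%:R => //.
  rewrite pnatr_eq0; apply/eqP => n0; move: cn; rewrite n0 /coprime gcdn0 => /eqP p1.
  by move: pp; rewrite p1.
Qed.

(** a Aint[1/p] is generated by its intersection with Q(zeta). *)
Definition generated (a : algC) := exists N n (x y : 'I_n -> algC),
  (forall i, [/\ K (x i), pint a (x i), K (y i) & a * y i \in Aint]) /\
  p%:R ^+ N = \sum_i x i * y i.

Lemma K_pint_O a x : a \in Aint -> K x -> pint a x -> exists2 N, O (p%:R ^+ N * x) & pint a (p%:R ^+ N * x).
Proof.
move=> aA Kx [N [b [bA e]]]; exists N.
  by apply/OE; split; [rewrite e rpredM | apply: QadjM => //; case/OE: (OX N (Onat p))].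
by rewrite e; exists 0%N, b; rewrite expr0 mul1r.
Qed.

Lemma Iset_mul a b : a \in Aint -> a != 0 -> b \in Aint -> b != 0 -> generated a ->
  ideal_mul (Iset a) (Iset b) = Iset (a * b).
Proof.
move=> aA a0 bA b0 [N [n [x [y [hxy e]]]]]; apply/seteqP; split=> z.
  move=> [m [u [v [huv ->]]]]; split.
    have O0 : O 0 := Oint 0.
    by apply: (big_ind O) => //; [exact: OD | move=> i _; have [[? _] [? _]] := huv i; exact: OM].
  by apply: pint_sum => i; have [[_ ?] [_ ?]] := huv i; exact: pintM.
move=> [Oz pz'].
have hx i : exists2 M, O (p%:R ^+ M * x i) & pint a (p%:R ^+ M * x i).
  by have [? ? _ _] := hxy i; exact: K_pint_O.
have hy i : exists2 M, O (p%:R ^+ M * (y i * z)) & pint b (p%:R ^+ M * (y i * z)).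
  have [_ _ yK yA] := hxy i; apply: K_pint_O => //.
    by apply: QadjM => //; case/OE: Oz.
  have [L [c [cA ec]]] := pz'; exists L, (a * y i * c).
  by rewrite rpredM //; split=> //; rewrite mulrCA ec; ring.
have /choice[M1 hM1] : forall i, exists M, O (p%:R ^+ M * x i) /\ pint a (p%:R ^+ M * x i).
  by move=> i; have [M ? ?] := hx i; exists M.
have /choice[M2 hM2] : forall i, exists M, O (p%:R ^+ M * (y i * z)) /\ pint b (p%:R ^+ M * (y i * z)).
  by move=> i; have [M ? ?] := hy i; exists M.
pose M := (\sum_i (M1 i + M2 i))%N.
have [n1 cn1 I1] := Iset_nat aA a0; have [n2 cn2 I2] := Iset_nat bA b0.
have : coprimez (p ^ (N + M))%N%:Z (n1 * n2)%N%:Z by rewrite coprimezE /= coprimeXl // coprimeMr cn1.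
case/coprimezP => [[c d]] /= cop.
have {}cop : c%:~R * p%:R ^+ (N + M) + d%:~R * (n1%:R * n2%:R) = 1 :> algC.
  by rewrite -natrX -natrM -[(p ^ _)%:R]/((p ^ (N + M))%N%:Z%:~R) -[(n1 * n2)%:R]/((n1 * n2)%N%:Z%:~R) -!rmorphM -rmorphD cop.
pose M3 i := (M - M1 i - M2 i)%N.
have hM i : (M = M3 i + M1 i + M2 i)%N by rewrite /M3 -subnDA -addnA subnK // /M (bigD1 i) // leq_addr.
exists n.+1, (fun i => if unlift ord0 i is Some j then c%:~R * p%:R ^+ M3 j * (p%:R ^+ M1 j * x j) else d%:~R * z * n1%:R),
  (fun i => if unlift ord0 i is Some j then p%:R ^+ M2 j * (y j * z) else n2%:R); split.
  have Om a' u v : O u -> Iset a' v -> Iset a' (u * v).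
    move=> Ou [Ov pv]; split; [exact: OM | by apply: pint_mull => //; case/OE: Ou].
  move=> i; case: (unlift ord0 i) => [j|]; split.
  - apply: Om; last exact: hM1.
    by apply: OM; [exact: Oint | exact: OX (Onat p)].
  - exact: hM2.
  - by apply: Om => //; apply: OM => //; exact: Oint.
  - by [].
rewrite big_ord_recl unlift_none.
under eq_bigr => j _ do rewrite liftK.
rewrite -[LHS]mul1r -{1}cop mulrDl addrC exprD; congr (_ + _); first by ring.
rewrite e mulr_suml mulr_sumr mulr_suml; apply: eq_bigr => i _.
rewrite (hM i) !exprD; ring.
Qed.

Lemma Iset_pow a m : a \in Aint -> a != 0 -> generated a -> ideal_exp p (Iset a) m = Iset (a ^+ m).
Proof.
move=> aA a0 ga; elim: m => [|m IH].
  apply/seteqP; split=> x; rewrite expr0; last by case.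
  move=> Ox.
  by split=> //; exists 0%N, x; rewrite expr0; split=> //; case/OE: Ox.
rewrite /ideal_exp iterS -/(ideal_exp p (Iset a) m) IH exprS.
by apply: Iset_mul => //; [rewrite rpredX | rewrite expf_neq0].
Qed.

Lemma Iset_gal a (s : galQ) : s @` Iset a = Iset (s a).
Proof.
have sub (t : galQ) b x : Iset b x -> Iset (t b) (t x).
  move=> [Ox [N [c [cA e]]]]; split; first exact: O_gal.
  exists N, (t c); rewrite Aint_aut; split=> //.
  by rewrite -rmorphM -e rmorphM rmorphXn rmorph_nat.
apply/seteqP; split=> x; first by move=> [y hy <-]; exact: sub.
move=> /(sub (s^-1)%g); rewrite -[(s^-1)%g (s a)]/((s^-1 * s)%g a) mulVg => h.
by exists ((s^-1)%g x) => //; rewrite -[LHS]/((s * s^-1)%g x) mulgV.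
Qed.

(** Multiplying a by an element of Z[zeta] multiplies its ideal by a principal one. *)
Lemma Iset_principal b : O b -> b != 0 ->
  exists b', [/\ O b', b' != 0 & forall a, a \in Aint -> a != 0 -> Iset (a * b) = [set b' * x | x in Iset a]].
Proof.
move=> Ob b0; have [i [b' [Ob' Db nP]]] := pi_val Ob b0; exists b'.
have b'0 : b' != 0 by apply: contraNneq b0 => b'0; rewrite Db b'0 mulr0.
have p2 : (0 < p.-1)%N by rewrite -ltnS prednK // prime_gt1.
have [u [uA uV Du]] := p_pi.
have u0 : u != 0 by apply: contraNneq pn0 => u0; rewrite Du u0 mulr0.
have piA : pi \in Aint by case/OE: O_pi.
have pi_p : p%:R ^+ i = pi ^+ i * (pi ^+ (p.-2 * i) * u ^+ i).
  by rewrite Du exprMn -exprM mulrA -exprD -mulSn prednK.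
split=> // a aA a0; apply/seteqP; split=> x.
  move=> [Ox [N [c [cA e]]]]; exists (x / b'); last by rewrite mulrC divfK.
  have e1 : p%:R ^+ N * (x / b') = a * (pi ^+ i * c).
    by apply: (mulIf b'0); rewrite mulrA divfK // e Db; ring.
  split; last by exists N, (pi ^+ i * c); rewrite rpredM ?rpredX.
  have descend M w : K w -> O (pi ^+ M * w) -> O (b' * w) -> O w.
    move=> Kw; elim: M => [|M IH]; first by rewrite expr0 mul1r.
    move=> Ov Obw; apply: IH => //; have : P0 (pi ^+ M.+1 * w).
      have [_ _ PM _ Ppr] := hP0.
      have : P0 (b' * (pi ^+ M.+1 * w)).
        have -> : b' * (pi ^+ M.+1 * w) = (pi ^+ M * (b' * w)) * pi by rewrite exprS; ring.
        have Ppi : P0 pi := one_minus_root_prime pp pz1 hP0.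
        by apply: (PM _ _ _ Ppi); rewrite rpredM ?rpredX //; case/OE: Obw.
      by case/Ppr; [case/OE: Ob' | case/OE: Ov | |].
    case/(pi_div Ov) => y Oy; rewrite exprS -mulrA => /(mulfI pi_neq0) -> //.
  have Kx : K (x / b') by apply: QadjM; [case/OE: Ox | apply: QadjV; case/OE: Ob'].
  apply: (descend (p.-1 * N)%N) => //; last by rewrite mulrC divfK.
  apply/OE; split; last by apply: QadjM => //; case/OE: (OX (p.-1 * N) O_pi).
  have -> : pi ^+ (p.-1 * N) * (x / b') = u^-1 ^+ N * (a * (pi ^+ i * c)).
    rewrite -e1 Du exprMn -exprM exprVn [RHS]mulrA [u ^- N * _]mulrC mulfK ?expf_neq0 //.
  by rewrite !rpredM ?rpredX.
move=> [w [Ow [N [c [cA e]]]] <-]; split; first exact: OM.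
exists (N + i)%N, (c * (pi ^+ (p.-2 * i) * u ^+ i)); split; first by rewrite !rpredM ?rpredX.
have -> : p%:R ^+ (N + i) * (b' * w) = (p%:R ^+ N * w) * b' * p%:R ^+ i by rewrite exprD; ring.
by rewrite e pi_p Db; ring.
Qed.

(** Kummer characters: homomorphisms from Gal(Qbar/Q(zeta)) to the p-th roots of
    unity, unramified outside p, on which Gal(Q(zeta)/Q) acts through the (k-1)-st
    power of the cyclotomic character. *)
Record kummer_char (k : nat) (chi : galQ -> algC) : Prop := KummerChar {
  kchM : forall s t, G1 s -> G1 t -> chi (s * t)%g = chi s * chi t;
  kchp : forall s, G1 s -> chi s ^+ p = 1;
  kch_loc : locally_constant G1 chi;
  kch_conj : forall s t a, G1 s -> acts_on_mu t p a -> chi (t * s * t^-1)%g = chi s ^+ (a ^ (k - 1));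
  kch_unr : forall l Q s, prime l -> l != p -> prime_above l Q -> inertia Q s -> chi s = 1 }.

Section Generator.
Variables (k : nat) (chi : galQ -> algC).
Hypothesis hchi : kummer_char k chi.

Lemma kch_neq0 s : G1 s -> chi s != 0.
Proof.
move=> hs; apply: contra_eq_neq (kchp hchi hs) => ->.
by rewrite expr0n gtn_eqF // eq_sym oner_eq0.
Qed.
Lemma kch1 : chi 1%g = 1.
Proof.
have h := kchM hchi G1_1 G1_1; rewrite mulg1 in h.
by apply: (mulfI (kch_neq0 G1_1)); rewrite mulr1 -h.
Qed.
Lemma kchX s n : G1 s -> chi (s ^+ n)%g = chi s ^+ n.
Proof.
move=> hs; elim: n => [|n IH]; first by rewrite expg0 kch1.
by rewrite expgS (kchM hchi) ?IH ?exprS //; exact: G1X.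
Qed.
Lemma kchV s : G1 s -> chi s^-1%g = (chi s)^-1.
Proof.
move=> hs; have h := kchM hchi (G1V hs) hs; rewrite mulVg kch1 in h.
by apply: (mulIf (kch_neq0 hs)); rewrite -h mulVf ?kch_neq0.
Qed.

Variable sigma : galQ.
Hypotheses (Gs : G1 sigma) (s_neq1 : chi sigma != 1).
Let om := chi sigma.
Let N := [set s | G1 s /\ chi s = 1].

Lemma om_prim : p.-primitive_root om.
Proof.
have [i Di] := prim_rootP pz (kchp hchi Gs); rewrite /om Di prim_root_exp_coprime //.
rewrite coprime_sym prime_coprime //; apply: contra s_neq1 => /dvdnP[c Dc].
by rewrite Di Dc mulnC exprM zp expr1n.
Qed.

Lemma N1 : N 1%g. Proof. by split; [exact: G1_1 | exact: kch1]. Qed.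
Lemma NM s t : N s -> N t -> N (s * t)%g.
Proof. by move=> [hs cs] [ht ct]; split; [exact: G1M | rewrite (kchM hchi) // cs ct mulr1]. Qed.
Lemma N_decomp s : G1 s -> exists i, N (sigma ^- i * s)%g.
Proof.
move=> hs; have [i Di] := prim_rootP om_prim (kchp hchi hs); exists i.
have Gi : G1 (sigma ^+ i)%g by exact: G1X.
split; first by apply: G1M => //; exact: G1V.
by rewrite (kchM hchi) ?kchV ?kchX ?Di ?mulVf ?expf_neq0 ?kch_neq0 //; exact: G1V.
Qed.
Lemma N_conj s i : N s -> N (sigma ^- i * s * sigma ^+ i)%g.
Proof.
move=> [hs cs]; have Gi : G1 (sigma ^+ i)%g by exact: G1X.
split; first by do 2?apply: G1M => //; exact: G1V.
rewrite (kchM hchi) ?(kchM hchi) ?kchV ?cs ?mulr1 ?mulVf //; try exact: G1V.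
  exact: kch_neq0.
by apply: G1M => //; exact: G1V.
Qed.

Let B := [set x | x \in Aint /\ forall s, N s -> s x = x].

Lemma B_fixed x : (forall s, N s -> s x = x) -> sigma x = x -> K x.
Proof.
move=> xN xs; apply/K_fixed => s /N_decomp[i /xN e].
have xi j : (sigma ^+ j)%g x = x.
  by elim: j => [|j IH]; rewrite ?expgS // -[LHS]/(sigma ((sigma ^+ j)%g x)) IH.
rewrite -{1}[s](mulKVg (sigma ^+ i)%g) -[LHS]/((sigma ^+ i)%g ((sigma ^- i * s)%g x)).
by rewrite e xi.
Qed.

(** Lagrange resolvents. *)
Let res (j : nat) x := \sum_(i < p) om ^- (i * j) * (sigma ^+ i)%g x.

Lemma B_sigma x i : B x -> B ((sigma ^+ i)%g x).
Proof.
move=> [xA xN]; split; first by rewrite Aint_aut.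
move=> s /(N_conj i)/xN e.
rewrite -[LHS]/((s * sigma ^+ i)%g x) -[(s * _)%g](mulKVg (sigma ^+ i)%g).
by rewrite -[LHS]/((sigma ^+ i)%g ((sigma ^- i * (s * sigma ^+ i))%g x)) mulgA e.
Qed.

Let om_fixed i : (sigma ^+ i)%g om = om.
Proof.
have [c Dc] := prim_rootP pz (kchp hchi Gs).
by rewrite /om Dc rmorphXn (G1E _).1 //; exact: G1X.
Qed.
Let om0 : om != 0. Proof. exact: kch_neq0. Qed.
Let omp : om ^+ p = 1. Proof. exact: (kchp hchi Gs). Qed.
Let omA : om \in Aint. Proof. exact: Aint_prim_root om_prim. Qed.

Lemma sigma_p x : B x -> (sigma ^+ p)%g x = x.
Proof. by move=> [_]; apply; split; [exact: G1X | rewrite kchX // omp]. Qed.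

Lemma resE j x : B x -> sigma (res j x) = om ^+ j * res j x.
Proof.
move=> Bx; pose F i := om ^- (i * j) * (sigma ^+ i)%g x.
have Fp : F p = F 0%N by rewrite /F sigma_p // mulnC exprM (exprAC _ j) omp expr1n !expr0 expg0.
have sF i : sigma (F i) = om ^+ j * F i.+1.
  rewrite /F rmorphM rmorphV ?unitfE ?expf_neq0 // rmorphXn -[sigma om]/((sigma ^+ 1)%g om) om_fixed.
  rewrite -[sigma _]/((sigma * sigma ^+ i)%g x) -expgS mulSn exprD invfM mulrA mulrA mulfV ?expf_neq0 //.
  by rewrite mul1r.
rewrite /res rmorph_sum mulr_sumr -[LHS]/(\sum_(i < p) sigma (F i)).
under eq_bigr => i _ do rewrite sF.
rewrite -!mulr_sumr; congr (_ * _); apply: (addrI (F 0%N)).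
rewrite -[X in _ = X + _]Fp -[LHS](big_ord_recl p (fun i => F i)).
by rewrite addrC -[RHS](big_ord_recr p (fun i => F i)).
Qed.

Lemma res_B j x : B x -> B (res j x).
Proof.
move=> Bx; split.
  apply: rpred_sum => i _; rewrite rpredM //; last by rewrite Aint_aut; case: Bx.
  have -> : om ^- (i * j) = (om ^+ p.-1) ^+ (i * j).
    rewrite -exprVn; congr (_ ^+ _); apply: (mulfI om0).
    by rewrite mulfV // -exprS prednK ?omp.
  by rewrite !rpredX.
move=> s Ns; rewrite rmorph_sum; apply: eq_bigr => i _; rewrite rmorphM.
congr (_ * _); last by case: (B_sigma i Bx) => _; apply.
apply: (K_fixed _).1; last by case: Ns.
apply: QadjV; apply: QadjX; have [c Dc] := prim_rootP pz (kchp hchi Gs).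
by rewrite /om Dc; apply: QadjX; exact: Qadj_gen.
Qed.

Lemma res_sum x : \sum_(j < p) res j x = p%:R * x.
Proof.
rewrite exchange_big (bigD1 (Ordinal p0)) //= [X in _ + X]big1 => [|i i0].
  rewrite [LHS]addr0 -mulr_suml; congr (_ * _).
  by rewrite (eq_bigr (fun _ => 1)) ?sumr_const ?card_ord // => j _; rewrite mul0n expr0 invr1.
rewrite -mulr_suml; set S := \sum_(j < p) _.
have e : (om ^- i - 1) * S = 0.
  rewrite /S; under eq_bigr => j _ do rewrite exprM -exprVn.
  by rewrite -subrX1 exprVn -exprM mulnC exprM omp expr1n invr1 subrr.
move/eqP: e; rewrite mulf_eq0 subr_eq0 invr_eq1 => /orP[|/eqP->]; last by rewrite mul0r.
rewrite -(prim_order_dvd om_prim) => /dvdn_leq; rewrite lt0n => /(_ i0).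
by rewrite leqNgt ltn_ord.
Qed.

(** The resolvent is an eigenvector for the j-th power of chi(sigma); raise it to an inverse of j
    modulo p. *)
Lemma res_pow x j : B x -> (0 < j < p)%N -> exists2 r, (0 < r)%N & sigma (res j x ^+ r) = om * res j x ^+ r.
Proof.
move=> Bx /andP[j0 jp]; have cj : coprime j p by rewrite coprime_sym prime_coprime // gtnNdvd.
have [r r0 Dr] := coprime_inv j0 cj; exists r => //.
rewrite rmorphXn resE // exprMn -exprM; congr (_ * _).
by rewrite -(expr_mod _ omp) Dr -[RHS](expr1 om) -[RHS](expr_mod _ omp).
Qed.

Lemma eigen_ex : exists al, [/\ B al, al != 0 & sigma al = om * al].
Proof.
have [x Bx sx] : exists2 x, B x & sigma x != x.
  apply: contrapT => no; case/negP: s_neq1; apply/eqP.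
  have [r hr] := kch_loc hchi Gs.
  have [|t [Gt ct] ht] := fixed_closure N1 NM (sigma := sigma) _ r.
    move=> x xA xN; apply/eqP; apply: contraT => sx; case: no; exists x => //.
  by rewrite -(hr t).
have [j j0 hj] : exists2 j : 'I_p, (0 < j)%N & res j x != 0.
  apply: contrapT => no; case/negP: sx; apply/eqP/(mulfI pn0).
  have e : p%:R * x = res 0 x.
    rewrite -res_sum (bigD1 (Ordinal p0)) //= big1 ?addr0 // => j j0.
    apply/eqP; apply: contraT => hj; case: no; exists j => //; rewrite lt0n //.
  have <- : sigma (p%:R * x) = p%:R * sigma x by rewrite rmorphM rmorph_nat.
  by rewrite e resE // expr0 mul1r.
have [|r r0 hr] := @res_pow x j Bx _; first by rewrite j0 ltn_ord.
exists (res j x ^+ r); split=> //; last by rewrite expf_neq0.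
have [zA' zN] := res_B j Bx; split; first by rewrite rpredX.
by move=> s Ns; rewrite rmorphXn zN.
Qed.

Lemma eigen_all al s : B al -> sigma al = om * al -> G1 s -> s al = chi s * al.
Proof.
move=> [_ aN] sa /[dup] Gs' /N_decomp[i Ni].
have si j : (sigma ^+ j)%g al = om ^+ j * al.
  elim: j => [|j IH]; first by rewrite expg0 expr0 mul1r.
  rewrite expgSr -[LHS]/((sigma ^+ j)%g (sigma al)) sa rmorphM om_fixed IH exprS; ring.
have Gi : G1 (sigma ^+ i)%g by exact: G1X.
have -> : chi s = om ^+ i.
  case: Ni => _; rewrite (kchM hchi) ?kchV ?kchX //; last exact: G1V.
  by move=> e; apply: (mulfI (invr_neq0 (expf_neq0 i om0))); rewrite e mulVf ?expf_neq0.
rewrite -{1}[s](mulKVg (sigma ^+ i)%g) -[LHS]/((sigma ^+ i)%g ((sigma ^- i * s)%g al)).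
by rewrite aN.
Qed.

Lemma N_closed : agree_closed N.
Proof.
move=> s hs; have Gs' : G1 s.
  by have [t [/G1E Gt _] ts] := hs [:: zeta]; apply/G1E; rewrite -ts ?inE.
split=> //; have [r hr] := kch_loc hchi Gs'; have [t [Gt ct] ts] := hs r.
by rewrite -(hr t).
Qed.

Lemma B_subring : subring_set B.
Proof.
split; first by split=> [|s _]; rewrite ?rpred1 ?rmorph1.
  by move=> x y [xA xN] [yA yN]; split=> [|s Ns]; rewrite ?rpredB // rmorphB xN ?yN.
by move=> x y [xA xN] [yA yN]; split=> [|s Ns]; rewrite ?rpredM // rmorphM xN ?yN.
Qed.

Variable al : algC.
Hypotheses (Bal : B al) (al0 : al != 0) (sal : sigma al = om * al).
Let alA : al \in Aint. Proof. by case: Bal. Qed.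

(** The ideal of B generated by the integral elements of al K. *)
Let J := [set z | exists r : seq (algC * algC),
  {in r, forall q, [/\ K q.1, al * q.1 \in Aint & B q.2]} /\ z = \sum_(q <- r) al * q.1 * q.2].

Lemma J_ideal : ideal_of B J.
Proof.
have [B1 BB BM] := B_subring.
have B0 : B 0 by rewrite -(subrr 1); exact: BB.
have BD x y : B x -> B y -> B (x + y).
  by move=> Bx By; rewrite -[y]opprK -[- y]sub0r; apply: (BB _ _ Bx); exact: BB.
split.
- move=> z [r [hr ->]]; rewrite big_seq; apply: (big_ind B) => // q /hr[Kq qA Bq].
  apply: BM => //; split=> // s [Gs' cs]; rewrite rmorphM (K_fixed q.1).1 //.
  by congr (_ * _); case: Bal => _; apply.
- by exists [::]; rewrite big_nil; split.
- move=> x y [r [hr ->]] [t [ht ->]]; exists (r ++ t); rewrite big_cat; split=> //.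
  by move=> q; rewrite mem_cat => /orP[/hr|/ht].
- move=> x y Bx [r [hr ->]]; exists [seq (q.1, x * q.2) | q <- r]; split.
    by move=> _ /mapP[q /hr[? ? ?] ->] /=; split=> //; exact: BM.
  by rewrite big_map mulr_sumr; apply: eq_bigr => q _ /=; ring.
Qed.

Lemma J_intro y b : K y -> al * y \in Aint -> B b -> J (al * y * b).
Proof.
by move=> Ky yA Bb; exists [:: (y, b)]; rewrite big_seq1; split=> // q; rewrite inE => /eqP->.
Qed.

Lemma J_eigen x : B x -> sigma x = om * x -> J x.
Proof.
move=> Bx sx; have -> : x = al * (x / al) * 1 by rewrite mulr1 mulrC divfK.
apply: J_intro; last by have [] := B_subring.
  apply: B_fixed => [s Ns|].
    by rewrite fmorph_div; case: Bal => _ -> //; case: Bx => _ ->.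
  by rewrite fmorph_div sx sal -mulf_div mulfV ?mul1r.
by rewrite mulrC divfK //; case: Bx.
Qed.

(** Otherwise sigma would be inertial, modulo N, at a prime not above p. *)
Lemma J_meets_p : exists i, J (p%:R ^+ i).
Proof.
apply: contrapT => no; have [B1 BB BM] := B_subring.
have Bp i : B (p%:R ^+ i).
  by split=> [|s _]; rewrite ?rpredX ?rpred_nat // rmorphXn rmorph_nat.
pose S := [set z : algC | exists i, z = p%:R ^+ i].
have [|||||Q [hQ JQ QS Qpr]] := @lying_over B J S B_subring _ J_ideal.
- by move=> x [].
- by move=> _ [i ->].
- by exists 0%N; rewrite expr0.
- by move=> _ _ [i ->] [j ->]; exists (i + j)%N; rewrite exprD.
- by move=> x Jx [i e]; apply: no; exists i; rewrite -e.
have nQ i : ~ Q (p%:R ^+ i) by move=> h; apply: (QS _ h); exists i.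
have Q1 : ~ Q 1 by have := nQ 0%N; rewrite expr0.
have Jal : J al by apply: J_eigen.
have [l pl hl] : exists2 l, prime l & prime_above l Q.
  by apply: prime_above_ex => //; exists al => //; exact: JQ.
have lp : l != p.
  by apply/eqP => lp; apply: (nQ 1%N); rewrite expr1 -lp; case: hl => [[]].
have QX x r : x \in Aint -> Q (x ^+ r) -> Q x.
  move=> xA; elim: r => [|r IH]; first by rewrite expr0.
  by rewrite exprS => /Qpr[||//|/IH//] //; rewrite rpredX.
have hin z : B z -> Q (sigma z - z).
  move=> Bz; have Qres j : (0 < j < p)%N -> Q (res j z).
    move=> hj; have [r r0 hr] := res_pow Bz hj; have [rA rN] := res_B j Bz.
    apply: (QX _ r) => //; apply/JQ/J_eigen => //; split; first by rewrite rpredX.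
    by move=> s Ns; rewrite rmorphXn rN.
  have Bsz : B (sigma z) by have := B_sigma 1 Bz; rewrite expg1.
  have : Q (p%:R * (sigma z - z)).
    have -> : p%:R * (sigma z - z) = \sum_(j < p) (om ^+ j - 1) * res j z.
      rewrite mulrBr -{1}(rmorph_nat sigma p) -rmorphM -!res_sum rmorph_sum -sumrB.
      by apply: eq_bigr => j _; rewrite resE // mulrBl mul1r.
    have [QA Q0 QD QM] := hQ; apply: (big_ind Q) => // j _.
    have [j0|j0] := posnP j; first by rewrite j0 expr0 subrr mul0r.
    by apply: QM; [rewrite /= rpredB ?rpredX ?rpred1 | apply: Qres; rewrite j0 ltn_ord].
  case/Qpr => [||h|//]; first exact: rpred_nat.
    by rewrite rpredB //; [case: Bsz | case: Bz].
  by case: (nQ 1%N); rewrite expr1.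
have [|s [Gs' cs] hs] := inertia_lift (sigma := sigma) hl N1 NM N_closed.
  by move=> z ? ?; apply: hin.
case/negP: s_neq1; apply/eqP; rewrite -[chi sigma]mulr1 -cs -(kchM hchi) //.
rewrite [RHS]cs; exact: (kch_unr hchi pl lp hl hs).
Qed.

(** Apart from p, the extension defined by the character is unramified, so that the ideal of al comes
    from Q(zeta). *)
Lemma al_generated : generated al.
Proof.
have [i [r [hr e]]] := J_meets_p.
pose tr b := \sum_(j < p) (sigma ^+ j)%g (al * b).
have sj j b : (sigma ^+ j)%g (al * b) = al * (om ^+ j * (sigma ^+ j)%g b).
  rewrite rmorphM; suff -> : (sigma ^+ j)%g al = om ^+ j * al by ring.
  elim: j => [|j IH]; first by rewrite expg0 expr0 mul1r.
  by rewrite expgSr -[LHS]/((sigma ^+ j)%g (sigma al)) sal rmorphM om_fixed IH exprS; ring.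
have trK b : B b -> K (tr b).
  move=> Bb; have Bab : B (al * b) by have [_ _] := B_subring; apply.
  have -> : tr b = res 0 (al * b).
    by apply: eq_bigr => j _; rewrite muln0 expr0 invr1 mul1r.
  by apply: B_fixed; [case: (res_B 0 Bab) | rewrite resE // expr0 mul1r].
have trA b : B b -> pint al (tr b).
  move=> [bA _]; apply: pint_sum => j; rewrite sj; apply: pint_self.
  by rewrite rpredM ?rpredX // Aint_aut.
pose nq := nth (0, 0) r.
exists i.+1, (size r), (fun j => tr (nq j).2), (fun j => (nq j).1); split.
  by move=> j; have [? ? ?] := hr _ (mem_nth (0, 0) (ltn_ord j)); split=> //; [exact: trK | exact: trA].
rewrite -(big_mkord xpredT (fun j => tr (nq j).2 * (nq j).1)) -(big_nth (0, 0) xpredT (fun q => tr q.2 * q.1)).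
have -> : p%:R ^+ i.+1 = \sum_(j < p) (sigma ^+ j)%g (p%:R ^+ i) :> algC.
  rewrite (eq_bigr (fun=> p%:R ^+ i)) => [|j _]; last by rewrite rmorphXn rmorph_nat.
  by rewrite sumr_const card_ord exprS mulr_natl.
transitivity (\sum_(j < p) \sum_(q <- r) (sigma ^+ j)%g (al * q.1 * q.2)).
  by apply: eq_bigr => j _; rewrite e; exact: gal_sum.
rewrite exchange_big /= big_seq [RHS]big_seq; apply: eq_bigr => q /hr[Kq _ _].
rewrite /tr mulr_suml; apply: eq_bigr => j _.
have -> : al * q.1 * q.2 = al * q.2 * q.1 by ring.
by rewrite [LHS]rmorphM; congr (_ * _); apply: (K_fixed _).1 => //; exact: G1X.
Qed.
End Generator.

(** Hilbert's theorem 90, through Lagrange resolvents. *)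
Lemma kummer_generator k chi : kummer_char k chi ->
  exists al, [/\ al \in Aint, al != 0, forall s, G1 s -> s al = chi s * al & generated al].
Proof.
move=> hchi; have [triv|] := pselect (forall s, G1 s -> chi s = 1).
  exists 1; split=> [||s Gs|]; rewrite ?rpred1 ?oner_neq0 ?rmorph1 ?triv ?mulr1 //.
  exists 0%N, 1%N, (fun=> 1), (fun=> 1); rewrite big_ord1 mulr1 expr0; split=> // i.
  split; rewrite ?mulr1 ?rpred1 //; try exact: Qadj1.
  by exists 0%N, 1; rewrite !mulr1 rpred1 expr0.
move=> /existsNP[s /not_implyP[Gs /eqP s1]].
have [al [Bal al0 sal]] := eigen_ex hchi Gs s1.
exists al; split=> //; first by case: Bal.
  by move=> t Gt; apply: (eigen_all hchi Gs s1).
exact: (al_generated hchi Gs s1 Bal al0 sal).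
Qed.

(** Both t al and al^m are eigenvectors under Gal(Qbar/Q(zeta)): conjugation by t^-1 changes chi to
    its power a^(1-k), and t raises its values to the power a. *)
Lemma kummer_conj k chi al (t : galQ) a m : (2 <= k)%N -> kummer_char k chi -> al != 0 ->
  (forall s, G1 s -> s al = chi s * al) -> acts_on_mu t p a ->
  (a ^ (k - 2) * m = 1 %[mod p])%N -> K (t al / al ^+ m).
Proof.
move=> k2 hchi al0 hal ha hm.
apply/K_fixed => s Gs; pose r := (t^-1 * s * t)%g.
have Gr : G1 r := G1J t Gs.
have e1 : s (t al) = t (chi r) * t al.
  by rewrite -rmorphM -hal // -[RHS]/((t * r)%g al) /r !mulgA mulgV mul1g.
have e2 : t (chi r) = chi r ^+ a by apply: ha; exact: (kchp hchi Gr).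
have e3 : chi s = chi r ^+ (a ^ (k - 1)).
  by rewrite -(kch_conj hchi Gr ha) /r !mulgA mulgV mul1g mulgK.
have rp := (kchp hchi Gr); have r0 : chi r != 0 := kch_neq0 hchi Gr.
have e4 : chi s ^+ m = chi r ^+ a.
  rewrite e3 -exprM -(expr_mod _ rp) -[RHS](expr_mod _ rp); congr (_ ^+ _).
  have -> : (a ^ (k - 1) = a ^ (k - 2) * a)%N by rewrite (sub1_sub2 k2) expnSr.
  by rewrite mulnAC mulnC -modnMmr hm modnMmr muln1.
rewrite fmorph_div e1 e2 rmorphXn (hal s Gs) exprMn e4 -mulf_div mulfV ?mul1r // expf_neq0 //.
Qed.

(** The ideal of al has class killed by p, and by kummer_conj this class lies in the
    omega^(2-j)-eigenspace; so the ideal is principal, and dividing al by a generator leaves a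
    p-unit. *)
Lemma kummer_unit k j chi : ~~ odd k -> (2 <= k)%N -> (2 <= j)%N -> (k = j %[mod p.-1])%N ->
  class_eigenspace_vanishes p j -> kummer_char k chi ->
  exists ep, [/\ ep != 0, forall s, G1 s -> s ep = chi s * ep &
    exists M, p%:R ^+ M * ep \in Aint /\ p%:R ^+ M / ep \in Aint].
Proof.
move=> ko k2 j2 kj hcl hchi; have [al [alA al0 hal gal]] := kummer_generator hchi.
have al_conj (t : galQ) a m : acts_on_mu t p a -> (a ^ (j - 2) * m = 1 %[mod p])%N ->
    K (t al / al ^+ m).
  move=> ha hm; apply: (kummer_conj k2 hchi al0 hal ha).
  have cap : coprime a p.
    by have [b _ [hb cb]] := acts_exists p0 t; rewrite -coprime_modl (acts_uniq p0 ha hb) coprime_modl.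
  have ekj : (a ^ (k - 2) = a ^ (j - 2) %[mod p])%N.
    apply: (expn_mod_pred pp cap); apply/eqP; rewrite -(eqn_modDr 2) !subnK //; exact/eqP.
  by rewrite -modnMml ekj modnMml hm.
have Ip : Iset 1 = O.
  apply/seteqP; split=> x; first by case.
  by move=> Ox; split=> //; exists 0%N, x; rewrite expr0; split=> //; case/OE: Ox.
have alpO : O (al ^+ p).
  apply/OE; split; first by rewrite rpredX.
  by apply/K_fixed => s Gs; rewrite rmorphXn hal // exprMn (kchp hchi Gs) mul1r.
have cl : principal_ideal p (Iset al).
  apply: hcl; first exact: Iset_ideal.
    rewrite Iset_pow //; have [b' [Ob' b'0 hb]] := Iset_principal alpO (expf_neq0 p al0).
    exists 1, b'; split; [by split; [exact: O1 | exact: oner_neq0] | by [] |].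
    have := hb 1 (rpred1 _) (oner_neq0 _); rewrite mul1r Ip => ->.
    apply/seteqP; split=> x; first by move=> [y hy <-]; rewrite mul1r.
    by move=> hx; exists x; rewrite ?mul1r.
  move=> s a m ha hm; rewrite Iset_gal Iset_pow //.
  have Kk := al_conj s a m ha hm; set ka := s al / al ^+ m in Kk.
  have sal0 : s al != 0 by rewrite fmorph_eq0.
  have ka0 : ka != 0 by rewrite mulf_neq0 // invr_eq0 expf_neq0.
  have [n n0 nA] := Aint_scale ka.
  have n0' : n%:R != 0 :> algC by rewrite pnatr_eq0 -lt0n.
  have On : O (n%:R * ka) by apply/OE; split=> //; apply: QadjM => //; case/OE: (Onat n).
  have [x [Ox x0 hx]] := Iset_principal (Onat n) n0'.
  have [y [Oy y0 hy]] := Iset_principal On (mulf_neq0 n0' ka0).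
  exists x, y; split=> //; rewrite -hx ?Aint_aut // -hy ?rpredX ?expf_neq0 //.
  by congr Iset; rewrite /ka mulrCA [al ^+ m * _]mulrC divfK ?expf_neq0 // mulrC.
have [x [y [[Ox x0] [Oy y0] exy]]] := cl.
have [g Ig Dg] : exists2 g, Iset al g & x * g = y.
  have : [set y * z | z in O] y by exists 1; rewrite ?mulr1 //; exact: O1.
  by rewrite -exy => -[g Ig <-]; exists g.
have g0 : g != 0 by apply: contraNneq y0 => g0; rewrite -Dg g0 mulr0.
have gen z : Iset al z -> exists2 o, O o & z = g * o.
  move=> Iz; have : [set x * z | z in Iset al] (x * z) by exists z.
  by rewrite exy => -[o Oo e]; exists o => //; apply: (mulfI x0); rewrite -e -Dg mulrA.
exists (al / g); split; first by rewrite mulf_neq0 ?invr_eq0.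
  move=> s Gs; rewrite fmorph_div hal // -mulrA; congr (_ * (_ / _)).
  by apply: (K_fixed g).1 => //; case: Ig => /OE[].
have [_ [N1 [b1 [b1A e1]]]] := Ig.
have [N2 [n [xs [ys [hxy e2]]]]] := gal.
have /choice[M hM] : forall i, exists M, exists2 o, O o & p%:R ^+ M * xs i = g * o.
  move=> i; have [Kx px _ _] := hxy i; have [M OM pM] := K_pint_O alA Kx px.
  by exists M; apply: gen; split.
pose MM := (\sum_i M i)%N.
have leM i : (M i <= MM)%N by rewrite /MM (bigD1 i) // leq_addr.
exists (N1 + (N2 + MM))%N; split; last first.
  have -> : p%:R ^+ (N1 + (N2 + MM)) / (al / g) = p%:R ^+ (N2 + MM) * b1.
    have -> : b1 = p%:R ^+ N1 * g / al by rewrite e1 mulrAC mulfV // mul1r.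
    rewrite exprD; field.
    by rewrite al0 g0.
  by rewrite rpredM ?rpredX ?rpred_nat.
rewrite exprD -mulrA rpredM ?rpredX ?rpred_nat // exprD e2 mulrC mulr_suml mulr_sumr.
apply: rpred_sum => i _; have [o Oo eo] := hM i; have [_ _ _ yA] := hxy i.
have -> : al / g * (xs i * ys i * p%:R ^+ MM) = p%:R ^+ (MM - M i) * (o * (al * ys i)).
  apply: (mulIf g0); rewrite -(subnK (leM i)) exprD addnK.
  have -> : p%:R ^+ (MM - M i) * (o * (al * ys i)) * g = p%:R ^+ (MM - M i) * (g * o) * (al * ys i) by ring.
  by rewrite -eo; field.
have oA : o \in Aint by case/OE: Oo.
by apply: rpredM; [rewrite rpredX ?rpred_nat | exact: rpredM].
Qed.
End Kummer.

(** * Units of Z[zeta_p, 1/p] and dependence of Kummer characters *)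

Lemma additive_of (V W : zmodType) (f : V -> W) : (forall x y, f (x - y) = f x - f y) ->
  exists g : {additive V -> W}, forall x, g x = f x.
Proof.
move=> fB; pose m1 := GRing.isZmodMorphism.Build V W f fB.
pose g : {additive V -> W} := HB.pack f m1.
by exists g.
Qed.

Lemma natr_Fp_eq p a b : prime p -> (a%:R == b%:R :> 'F_p) = (a == b %[mod p])%N.
Proof. by move=> pp; rewrite -(inj_eq val_inj) /= !val_Fp_nat. Qed.

Lemma primitive_root_mod p : prime p -> odd p -> exists g : nat, [/\ coprime g p,
  forall a, coprime a p -> exists2 i, (i < p.-1)%N & (a = g ^ i %[mod p])%N
  & (g ^ p.-1./2 = p.-1 %[mod p])%N].
Proof.
move=> pp podd; have p2 := prime_gt1 pp.
have p0 : (0 < p.-1)%N by case: (p) p2 => [|[]].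
have fermat (x : 'F_p) : x != 0 -> x ^+ p.-1 = 1.
  move=> x0; apply: (mulfI x0); rewrite -exprS prednK ?prime_gt0 // mulr1.
  by rewrite -[in RHS](expf_card x) card_Fp.
pose rs := enum [pred x : 'F_p | x != 0].
have /hasP[z zrs pz] : has p.-1.-primitive_root rs.
  apply: cyclic.has_prim_root => //; last 1 first.
  - rewrite -cardE -(@leq_add2l 1) add1n prednK ?prime_gt0 //.
    have := cardC (pred1 (0 : 'F_p)); rewrite card1 card_Fp // => {1}<-.
    by [].
  - by apply/allP => x; rewrite mem_enum inE => x0; apply/unity_rootP; exact: fermat.
  - exact: enum_uniq.
have z0 : z != 0 by move: zrs; rewrite mem_enum.
pose g : nat := val z.
have Dz : z = g%:R by rewrite [RHS]natr_Zp.
have cF a : (a%:R != 0 :> 'F_p) = coprime a p.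
  by rewrite -[0]/(0%:R) natr_Fp_eq // mod0n coprime_sym prime_coprime.
exists g; split; first by rewrite -cF -Dz.
- move=> a; rewrite -cF => /fermat /(prim_rootP pz)[i Di]; exists i => //.
  by apply/eqP; rewrite -natr_Fp_eq // natrX -Dz Di.
- apply/eqP; rewrite -natr_Fp_eq // natrX -Dz.
  have -> : p.-1%:R = -1 :> 'F_p.
    by apply/eqP; rewrite eq_sym -subr_eq0 -opprD oppr_eq0 addrC -[1]/(1%:R) -natrD addn1 prednK ?prime_gt0 // -[0]/(0%:R) natr_Fp_eq // modnn mod0n.
  have e2 : (p.-1./2 * 2 = p.-1)%N by rewrite muln2 -[RHS]odd_double_half; case: (p) podd p2 => //= q /negbTE->.
  have : (z ^+ p.-1./2) ^+ 2 = 1 by rewrite -exprM e2 (prim_expr_order pz).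
  move/eqP; rewrite sqrf_eq1 => /orP[|//].
  rewrite -(prim_order_dvd pz) => /dvdn_leq h; exfalso.
  by have : (p.-1 <= p.-1./2)%N; [apply: h; rewrite -(ltn_pmul2r (_ : 0 < 2)%N) // e2 mul0n | lia].
Qed.

Lemma floor_log (F : archiRealFieldType) (x : F) : 0 < x -> exists c : int, 2 ^ c <= x < 2 ^ (c + 1).
Proof.
move=> x0; have gt1 : 1 < 2 :> F by rewrite ltr1n.
have two_gt n : n%:R < 2 ^+ n :> F by rewrite -natrX ltr_nat ltn_expl.
have bound (y : F) : 0 <= y -> exists n : nat, y < 2 ^+ n.
  by move=> y0; exists (Num.bound y); apply: lt_trans (archi_boundP y0) (two_gt _).
have xV0 : 0 <= x^-1 by rewrite invr_ge0 ltW.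
have [m hm] := bound _ xV0; pose y := x * 2 ^+ m.
have y1 : 1 <= y by rewrite /y -ler_pdivrMl // mulr1 ltW.
have [n hn] := bound y (le_trans ler01 y1).
pose Q k := (2 ^+ k <= y).
have Qn k : Q k -> (k <= n)%N.
  move=> Qk; have : 2 ^+ k < 2 ^+ n :> F by apply: le_lt_trans hn.
  by rewrite ltr_eXn2l // => /ltnW.
have Q0 : exists k, Q k by exists 0%N; rewrite /Q expr0.
case: (ex_maxnP Q0 Qn) => k Qk kmax.
have nQ : y < 2 ^+ k.+1 by rewrite ltNge; apply/negP => /kmax; rewrite ltnn.
have two0 : 2 != 0 :> F by rewrite pnatr_eq0.
have E : 2 ^ (k%:Z - m%:Z) = 2 ^+ k / 2 ^+ m :> F by rewrite expfzDr // -exprnP exprnN.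
exists (k%:Z - m%:Z); rewrite [2 ^ (_ + 1)]expfzDr // E expr1z; apply/andP; split.
  by rewrite ler_pdivrMr ?exprn_gt0.
by rewrite mulrAC ltr_pdivlMr ?exprn_gt0 // -exprSr.
Qed.

Lemma quasi_aux (a b c : int) : a + b < c + 1 -> c < a + 1 + (b + 1) -> `|c - a - b| <= 1.
Proof. lia. Qed.

Lemma Aint_root n x : (0 < n)%N -> x ^+ n \in Aint -> x \in Aint.
Proof.
move=> n0 h; have sX : (1 < size ('X^n : {poly algC}))%N by rewrite size_polyXn ltnS.
apply: (@root_monic_Aint (minCpoly (x ^+ n) \Po 'X^n)).
- by rewrite /root horner_comp hornerXn -[_ == 0]/(root _ _) root_minCpoly.
- by rewrite monicE lead_coef_comp // (monicP (minCpoly_monic _)) lead_coefXn expr1n mulr1.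
- by apply: polyOver_comp; [exact: h | rewrite rpredX // polyOverX].
Qed.

Lemma nat_of_Aint x : x \in Crat -> x \in Aint -> 0 <= x -> exists n : nat, x = n%:R.
Proof.
move=> xQ xA x0; have /intrP[c Dc] := Cint_rat_Aint xQ xA.
by move: x0; rewrite Dc ler0z; case: (c) => // n _; exists n.
Qed.

Lemma coef_bound (r : seq algC) (D : algC) : 0 <= D -> (forall z, z \in r -> `|z| <= D) ->
  forall i, `|(\prod_(z <- r) ('X - z%:P))`_i| <= (1 + D) ^+ size r.
Proof.
move=> D0; elim: r => [|z r IH] hr i.
  by rewrite big_nil coef1 expr0; case: (i == 0)%N; rewrite ?normr1 ?normr0 ?ler01.
have {}IH : forall i, `|(\prod_(z <- r) ('X - z%:P))`_i| <= (1 + D) ^+ size r.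
  by apply: IH => y yr; apply: hr; rewrite inE yr orbT.
rewrite big_cons mulrBl coefB coefXM coefCM /= exprS mulrDl mul1r.
apply: le_trans (ler_normB _ _) _; apply: lerD.
  by case: (i == 0)%N; [rewrite normr0 exprn_ge0 // addr_ge0 | exact: IH].
by rewrite normrM ler_pM // hr // mem_head.
Qed.

Lemma absz_le_aux (c : int) (E : nat) : `|c| <= E%:Z -> (absz (c + E%:Z)%R < (E + E).+1)%N.
Proof. lia. Qed.
Lemma abszE_aux (c : int) (E : nat) : `|c| <= E%:Z -> (absz (c + E%:Z))%:Z = c + E%:Z.
Proof. lia. Qed.

Lemma half_bounds p : odd p -> (1 < p)%N -> (0 < p.-1./2)%N /\ (p.-1./2 < p)%N.
Proof. lia. Qed.

Section Units.
Variables (p : nat) (zeta : algC) (P0 : set algC).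
Hypotheses (pp : prime p) (podd : odd p) (pz : p.-primitive_root zeta) (hP0 : prime_above p P0).

Let K := Qadj zeta.
Let O := cyclotomic_int p.
Let G1 := [set s : galQ | acts_on_mu s p 1].
Let p0 : (0 < p)%N. Proof. exact: prime_gt0. Qed.
Let pn0 : p%:R != 0 :> algC. Proof. by rewrite pnatr_eq0 -lt0n. Qed.
Let zp : zeta ^+ p = 1. Proof. exact: prim_expr_order pz. Qed.
Let OE x := OE pz x.
Let K_fixed x := K_fixed pz x.

Lemma K_comm (s t : galQ) x : K x -> s (t x) = t (s x).
Proof.
move=> Kx; have [a _ [ha _]] := acts_exists p0 s; have [b _ [hb _]] := acts_exists p0 t.
have /((K_fixed x).1 Kx) e : G1 ((t * s)^-1 * (s * t))%g.
  apply/(G1E pz).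
  have e : (t * s)%g zeta = (s * t)%g zeta.
    by rewrite -[LHS]/(t (s zeta)) -[RHS]/(s (t zeta)) ha // rmorphXn hb // [RHS]rmorphXn ha // exprAC.
  by rewrite -[LHS]/((t * s)^-1%g ((s * t)%g zeta)) -e -[LHS]/(((t * s)^-1 * (t * s))%g zeta) mulVg.
by rewrite -[RHS]/((t * s)%g x) -[in RHS]e -[RHS]/((t * s * ((t * s)^-1 * (s * t)))%g x) mulKVg.
Qed.

Lemma K_acts (s t : galQ) x a : K x -> acts_on_mu s p a -> acts_on_mu t p a -> s x = t x.
Proof.
move=> Kx ha hb.
have /((K_fixed x).1 Kx) e : G1 (t^-1 * s)%g.
  apply/(G1E pz); rewrite -[LHS]/(t^-1%g (s zeta)) ha // -hb //.
  by rewrite -[LHS]/((t^-1 * t)%g zeta) mulVg.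
by rewrite -[in RHS]e -[RHS]/((t * (t^-1 * s))%g x) mulKVg.
Qed.

(** Units of Z[zeta, 1/p]. *)
Definition punit (x : algC) :=
  [/\ K x, x != 0 & exists M, p%:R ^+ M * x \in Aint /\ p%:R ^+ M / x \in Aint].

Lemma punit1 : punit 1.
Proof.
by split; [exact: Qadj1 | exact: oner_neq0 | exists 0%N; rewrite expr0 mulr1 divr1 rpred1].
Qed.
Lemma punitM x y : punit x -> punit y -> punit (x * y).
Proof.
move=> [Kx x0 [M [h1 h2]]] [Ky y0 [N [h3 h4]]]; split; [exact: QadjM | exact: mulf_neq0 |].
exists (M + N)%N; rewrite exprD; split.
  by rewrite mulrACA rpredM.
by rewrite invfM mulrACA rpredM.
Qed.
Lemma punitV x : punit x -> punit x^-1.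
Proof.
move=> [Kx x0 [M [h1 h2]]]; split; [exact: QadjV | by rewrite invr_eq0 |].
by exists M; rewrite invrK.
Qed.
Lemma punit_gal (t : galQ) x : punit x -> punit (t x).
Proof.
move=> [Kx x0 [M [h1 h2]]]; split; [exact: (K_gal pp pz) | by rewrite fmorph_eq0 |].
exists M; rewrite -(rmorph_nat t p) -rmorphXn -fmorph_div -rmorphM !Aint_aut //.
Qed.

Lemma unit_of_dvd y b L : O y -> ~ P0 y -> b \in Aint -> y * b = p%:R ^+ L -> y^-1 \in Aint.
Proof.
move=> Oy nP bA e; have [yA Ky] := (OE y).1 Oy.
have pz1 : (p ^ 1)%N.-primitive_root zeta by rewrite expn1.
have Ppi := one_minus_root_prime pp pz1 hP0.
have [_ _ PM _ Ppr] := hP0.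
have [m [d [c [pm cA em]]]] := cyc_residue pp pz1 hP0 yA Ky.
have pd : ~~ (p%:Z %| d)%Z.
  apply/negP => /dvdzP[d' Dd]; have : P0 (m%:~R * y).
    have -> : m%:~R * y = c * (1 - zeta) + d'%:~R * p%:R.
      by rewrite [c * _]mulrC -em -[p%:R]/(p%:Z%:~R) -rmorphM -Dd /= subrK.
    have [[_ Pp] PD _ _ _] := hP0.
    by apply: PD; apply: PM => //; exact: Aint_int.
  case/Ppr => [||/(prime_int hP0 pp)|//]; [exact: Aint_int | exact: yA | by apply/negP].
have [u [uA uV Du]] := p_pi pp pz.
have p2 : (1 < p)%N := prime_gt1 pp.
have : coprimez d p by rewrite coprimezE /= coprime_sym prime_coprime.
case/coprimezP => [[d' f]] /= cop.
have cop' : d'%:~R * d%:~R + f%:~R * p%:R = 1 :> algC.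
  by rewrite -[p%:R]/(p%:Z%:~R) -!rmorphM -rmorphD cop.
(* y is invertible modulo pi, hence modulo the p-th power of pi *)
pose q := (1 - zeta) ^+ p.-2 * u.
have Dq : p%:R = (1 - zeta) * q by rewrite Du mulrA -exprS prednK // -ltnS prednK.
have zA : zeta \in Aint := Aint_prim_root pz.
have piA : 1 - zeta \in Aint by rewrite rpredB ?rpred1.
have qA : q \in Aint by rewrite rpredM ?rpredX.
pose A := d'%:~R * m%:~R : algC; pose C := - (d'%:~R * c) + f%:~R * q.
have AA : A \in Aint by rewrite rpredM ?Aint_int.
have CA : C \in Aint by apply: rpredD; [rewrite rpredN rpredM ?Aint_int | rewrite rpredM ?Aint_int].
have e1 : y * A + (1 - zeta) * C = 1.
  have -> : y * A + (1 - zeta) * C = d'%:~R * (m%:~R * y - (1 - zeta) * c) + f%:~R * ((1 - zeta) * q).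
    by rewrite /A /C; ring.
  by rewrite -em -Dq opprB addrC subrKC addrC.
have [D DA eN] : exists2 D, D \in Aint & 1 = y * D + (1 - zeta) ^+ (p.-1 * L) * C ^+ (p.-1 * L).
  elim: (_ * L)%N => [|N [D DA IH]].
    by exists 0; rewrite ?rpred0 // mulr0 !expr0 mulr1 add0r.
  exists (D + (1 - zeta) ^+ N * C ^+ N * A).
    apply: rpredD => //; apply: rpredM => //; apply: rpredM; exact: rpredX.
  rewrite {1}IH mulrDr -addrA; congr (_ + _).
  transitivity ((1 - zeta) ^+ N * C ^+ N * (y * A + (1 - zeta) * C)); first by rewrite e1 mulr1.
  by rewrite !exprS; ring.
have -> : y^-1 = D + b * u^-1 ^+ L * C ^+ (p.-1 * L).
  have y0 : y != 0 by apply: contraTneq isT => y0; case: nP; rewrite y0; exact: (prime0 hP0).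
  have u0 : u != 0 by apply: contraNneq pn0 => u0; rewrite Du u0 mulr0.
  apply: (mulfI y0); rewrite mulfV // mulrDr; rewrite [LHS]eN; congr (_ + _).
  rewrite !mulrA e Du exprMn -exprM exprVn mulfK ?expf_neq0 //.
by rewrite rpredD // !rpredM ?rpredX.
Qed.

(** The ratio of two conjugates of a p-unit is a unit, as p is totally ramified. *)
Lemma punit_ratio x (t : galQ) : punit x -> x / t x \in Aint.
Proof.
move=> [Kx x0 [M [h1 h2]]]; pose X := p%:R ^+ M * x.
have OX' : O X by apply/OE; split=> //; apply: QadjM => //; case/OE: (OX pz M (Onat pz p)).
have X0 : X != 0 by rewrite mulf_neq0 ?expf_neq0.
have [i [y [Oy DX nP]]] := pi_val pp pz hP0 OX' X0.
have yV : y^-1 \in Aint.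
  apply: (@unit_of_dvd y ((1 - zeta) ^+ i * (p%:R ^+ M / x)) (M + M)) => //.
    by rewrite rpredM ?rpredX // rpredB ?rpred1 // (Aint_prim_root pz).
  by rewrite mulrA [y * _]mulrC -DX /X exprD; field.
have -> : x / t x = ((1 - zeta) / t (1 - zeta)) ^+ i * (y / t y).
  transitivity (X / t X).
    by rewrite /X rmorphM rmorphXn rmorph_nat; field; rewrite fmorph_eq0 x0 expf_neq0.
  by rewrite DX rmorphM rmorphXn expr_div_n mulf_div.
have yA : y \in Aint by case/OE: Oy.
rewrite rpredM //; last by rewrite rpredM // -fmorphV Aint_aut.
rewrite rpredX //; have tz : t zeta ^+ p = 1 by rewrite -rmorphXn zp rmorph1.
have ptz : p.-primitive_root (t zeta) by rewrite fmorph_primitive_root.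
have [a Da] := prim_rootP ptz zp.
have n1 : 1 - t zeta != 0 by rewrite -(rmorph1 t) -rmorphB fmorph_eq0 (pi_neq0 pp pz).
rewrite rmorphB rmorph1 {1}Da -opprB subrX1 -mulNr opprB mulrAC mulfV // mul1r.
by apply: rpred_sum => k _; rewrite rpredX // (Aint_prim_root ptz).
Qed.

Definition conj_gal : galQ := @Num.conj algC.

Lemma conj_acts : acts_on_mu conj_gal p p.-1.
Proof.
move=> z zp1; have z0 : z != 0 by apply: contraTneq (oner_neq0 algC) => z0; rewrite -zp1 z0 expr0n gtn_eqF ?eqxx.
have nz : `|z| = 1.
  by apply/eqP; rewrite -(@pexpr_eq1 _ _ p) // -normrX zp1 normr1.
apply: (mulfI z0); rewrite -exprS prednK // zp1 -[conj_gal z]/(z^* ) -normCK nz expr1n //.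
Qed.

(** Squared absolute values of p-units: this kills the torsion, and complex conjugation acts trivially. *)
Definition Uplus (x : algC) := exists2 v, punit v & x = v * conj_gal v.

Lemma Uplus_punit x : Uplus x -> punit x.
Proof. by move=> [v hv ->]; apply: punitM => //; exact: punit_gal. Qed.
Lemma Uplus_gt0 x : Uplus x -> 0 < x.
Proof. by move=> [v [_ v0 _] ->]; rewrite -[conj_gal v]/(v^* ) -normCK exprn_gt0 // normr_gt0. Qed.
Lemma Uplus1 : Uplus 1.
Proof. by exists 1; [exact: punit1 | rewrite rmorph1 mulr1]. Qed.
Lemma UplusM x y : Uplus x -> Uplus y -> Uplus (x * y).
Proof. by move=> [v hv ->] [w hw ->]; exists (v * w); [exact: punitM | rewrite rmorphM mulrACA]. Qed.
Lemma UplusV x : Uplus x -> Uplus x^-1.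
Proof. by move=> [v hv ->]; exists v^-1; [exact: punitV | rewrite fmorphV invfM]. Qed.
Lemma Uplus_gal (t : galQ) x : Uplus x -> Uplus (t x).
Proof.
move=> [v hv ->]; exists (t v); first exact: punit_gal.
by rewrite rmorphM (K_comm t) //; case: hv.
Qed.
Lemma Uplus_conj x : Uplus x -> conj_gal x = x.
Proof.
move=> [v _ ->]; rewrite rmorphM -[conj_gal (conj_gal v)]/(v^*^* ) conjCK mulrC //.
Qed.

Definition Ugrp := {x : algC | `[< Uplus x >]}.
HB.instance Definition _ := [isSub of Ugrp for (@sval _ _)].
HB.instance Definition _ := [Choice of Ugrp by <:].
Definition mkU x (h : Uplus x) : Ugrp := Sub x (asboolT h).
Lemma UP (x : Ugrp) : Uplus (val x). Proof. by have := valP x => /asboolP. Qed.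
Definition Uzero := mkU Uplus1.
Definition Uopp (x : Ugrp) := mkU (UplusV (UP x)).
Definition Uadd (x y : Ugrp) := mkU (UplusM (UP x) (UP y)).
Lemma UaddA : associative Uadd. Proof. by move=> x y z; apply/val_inj; rewrite /= mulrA. Qed.
Lemma UaddC : commutative Uadd. Proof. by move=> x y; apply/val_inj; rewrite /= mulrC. Qed.
Lemma Uadd0 : left_id Uzero Uadd. Proof. by move=> x; apply/val_inj; rewrite /= mul1r. Qed.
Lemma UaddN : left_inverse Uzero Uopp Uadd.
Proof. by move=> x; apply/val_inj; rewrite /= mulVf // gt_eqF // Uplus_gt0 //; exact: UP. Qed.
HB.instance Definition _ := GRing.isZmodule.Build Ugrp UaddA UaddC Uadd0 UaddN.

Lemma val_UD (x y : Ugrp) : val (x + y) = val x * val y. Proof. by []. Qed.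
Lemma val_UN (x : Ugrp) : val (- x) = (val x)^-1. Proof. by []. Qed.
Lemma val_UMn (x : Ugrp) n : val (x *+ n) = val x ^+ n.
Proof. by elim: n => [|n IH]; rewrite ?mulr0n ?expr0 // mulrS val_UD IH exprS. Qed.
Lemma val_UMz (x : Ugrp) (n : int) : val (x *~ n) = val x ^ n.
Proof. by case: n => n; rewrite ?NegzE ?mulrNz -?pmulrn ?val_UN val_UMn // exprnN. Qed.

(** A logarithm up to bounded error is enough for counting arguments. *)
Lemma log_ex : exists lg : Ugrp -> int, forall x, exists2 r : algR, algRval r = val x & 2 ^ lg x <= r < 2 ^ (lg x + 1).
Proof.
suff /choice[lg h] : forall x : Ugrp, exists c : int, exists2 r : algR, algRval r = val x & 2 ^ c <= r < 2 ^ (c + 1) by exists lg.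
move=> x; have x0 := Uplus_gt0 (UP x).
have xR : val x \in Num.real by rewrite realE ltW.
have [r Dr] : exists r : algR, algRval r = val x by exists (in_algR xR).
have r0 : 0 < r by rewrite -[0 < r]/(0 < algRval r) Dr.
by have [c hc] := floor_log r0; exists c, r.
Qed.

Variable lg : Ugrp -> int.
Hypothesis hlg : forall x, exists2 r : algR, algRval r = val x & 2 ^ lg x <= r < 2 ^ (lg x + 1).

Lemma lg_quasi x y : `|lg (x + y) - lg x - lg y| <= 1.
Proof.
have [r Dr /andP[r1 r2]] := hlg x; have [t Dt /andP[t1 t2]] := hlg y.
have [q Dq /andP[q1 q2]] := hlg (x + y).
have gt1 : 1 < 2 :> algR by rewrite ltr1n.
have two0 : 2 != 0 :> algR by rewrite pnatr_eq0.
have pos c : 0 < 2 ^ c :> algR by rewrite exprz_gt0 // ltr0n.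
have Dq' : q = r * t.
  apply/val_inj; rewrite -[LHS]/(algRval q) Dq -[RHS]/(algRval (r * t)).
  have -> : algRval (r * t) = algRval r * algRval t by exact: (rmorphM algRval).
  by rewrite Dr Dt.
have a1 : (2 : algR) ^ (lg x + lg y) < 2 ^ (lg (x + y) + 1).
  by apply: le_lt_trans q2; rewrite Dq' expfzDr // ler_pM // ltW.
have a2 : (2 : algR) ^ (lg (x + y)) < 2 ^ ((lg x + 1) + (lg y + 1)).
  apply: le_lt_trans q1 _; rewrite Dq' [2 ^ _]expfzDr // ltr_pM //; apply: le_trans (ltW (pos _)) _; eassumption.
move: a1 a2; rewrite !ltr_eXz2l //; exact: quasi_aux.
Qed.

Lemma lg_bound x (C : nat) : `|lg x| <= C%:Z -> (2 ^+ C)^-1 <= val x <= 2 ^+ C.+1.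
Proof.
have [r Dr /andP[r1 r2]] := hlg x; move=> hC.
have gt1 : 1 < 2 :> algR by rewrite ltr1n.
have h1 : (2 : algR) ^ (- C%:Z) <= r.
  by apply: le_trans r1; rewrite ler_eXz2l //; lia.
have h2 : r <= (2 : algR) ^ C.+1%:Z.
  by apply: le_trans (ltW r2) _; rewrite ler_eXz2l //; lia.
have v2 n : algRval (2 ^+ n) = 2 ^+ n by rewrite (rmorphXn algRval) (rmorph_nat algRval).
rewrite -Dr -v2 -[(2 ^+ C.+1 : algC)]v2; apply/andP; split; last exact: h2.
have -> : (algRval (2 ^+ C))^-1 = algRval (2 ^+ C)^-1 by exact/esym/(fmorphV algRval).
by move: h1; rewrite -exprnN.
Qed.

(** A finite Galois orbit in Q(zeta) is exhausted by the powers of tau. *)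
Variables (g : nat) (tau : galQ).
Hypotheses (cg : coprime g p) (htau : acts_on_mu tau p g).
Hypothesis gen : forall a, coprime a p -> exists2 i, (i < p.-1)%N & (a = g ^ i %[mod p])%N.
Hypothesis g_half : (g ^ p.-1./2 = p.-1 %[mod p])%N.
Let d := p.-1./2.

Lemma tau_iter i x : iter i tau x = (tau ^+ i)%g x.
Proof. by elim: i => //= i ->; rewrite expgS. Qed.

Lemma tau_acts i : acts_on_mu (tau ^+ i)%g p (g ^ i).
Proof.
elim: i => [|i IH]; first by rewrite expg0 expn0; exact: acts1.
by rewrite expgS expnS; exact: actsM.
Qed.

Lemma gal_tau (s : galQ) : exists2 i, (i < p.-1)%N & forall x, K x -> s x = iter i tau x.
Proof.
have [a _ [ha ca]] := acts_exists p0 s; have [i ip ai] := gen ca; exists i => // x Kx.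
rewrite tau_iter; apply: (K_acts Kx ha); apply: acts_mod (tau_acts i); exact/esym.
Qed.

Lemma d_double : p.-1 = (d + d)%N.
Proof.
by rewrite /d addnn -[LHS]odd_double_half; case: (p) podd p0 => //= q /negbTE->.
Qed.

Lemma tau_half x : Uplus x -> iter d tau x = x.
Proof.
move=> hx; rewrite -[RHS](Uplus_conj hx) tau_iter.
have [Kx _ _] := Uplus_punit hx; apply: (K_acts (a := (g ^ d)%N) Kx); first exact: tau_acts.
by apply: acts_mod conj_acts; exact/esym.
Qed.

Lemma Uplus_iter i x : Uplus x -> Uplus (iter i tau x).
Proof. by move=> hx; elim: i => //= i IH; exact: Uplus_gal. Qed.

Lemma gal_tau_half (s : galQ) : exists2 i, (i < d)%N & forall x, Uplus x -> s x = iter i tau x.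
Proof.
have [i ip hi] := gal_tau s; have KU x : Uplus x -> K x by move=> /Uplus_punit[].
have [id|di] := ltnP i d; first by exists i => // x /KU/hi.
exists (i - d)%N; first by rewrite d_double in ip; lia.
by move=> x hx; rewrite (hi x (KU x hx)) -{1}(subnK di) iterD tau_half.
Qed.

(** Northcott's argument: the conjugates are the roots of one of finitely many polynomials. *)
Lemma U_finite (C : nat) : exists r : seq Ugrp, forall x, (forall (s : galQ), (2 ^+ C)^-1 <= s (val x) <= 2 ^+ C.+1) -> x \in r.
Proof.
pose B := (C * p.-1)%N; pose D : algC := p%:R ^+ B * 2 ^+ C.+1.
have pR : 0 <= p%:R :> algC by rewrite ler0n.
have D0 : 0 <= D by rewrite mulr_ge0 ?exprn_ge0.
have intx x : (forall (s : galQ), (2 ^+ C)^-1 <= s (val x) <= 2 ^+ C.+1) -> p%:R ^+ B * val (x : Ugrp) \in Aint.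
  move=> hx; set X := val x; have hX : Uplus X := UP x; have [KX X0 _] := Uplus_punit hX.
  pose N := \prod_(i < p.-1) iter i tau X.
  have hN : punit N.
    by apply: (big_ind punit); [exact: punit1 | exact: punitM | move=> i _; apply: Uplus_punit; exact: Uplus_iter].
  have tN : tau N = N.
    rewrite /N rmorph_prod /=; apply: (mulfI X0).
    rewrite -[LHS](big_ord_recl p.-1 (fun i => iter i tau X)) (big_ord_recr p.-1 (fun i => iter i tau X)) /=.
    by rewrite mulrC d_double iterD !tau_half //; exact: tau_half.
  have NQ : N \in Crat.
    apply: fixed_rational => s; have [i _ ->] := gal_tau s; last by case: hN.
    by elim: i => //= i ->.
  have [_ N0 [L [nA mA]]] := hN.
  have Nle : (2 ^+ B)^-1 <= N.
    have -> : (2 ^+ B)^-1 = \prod_(i < p.-1) (2 ^+ C)^-1 :> algC by rewrite prodr_const card_ord exprVn -exprM.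
    apply: ler_prod => i _.
    rewrite invr_ge0 exprn_ge0 ?ler0n //=; have /andP[h _] := hx (tau ^+ i)%g.
    by rewrite tau_iter.
  have Npos : 0 < N by apply: lt_le_trans Nle; rewrite invr_gt0 exprn_gt0 // ltr0n.
  have pQ i : p%:R ^+ i \in Crat by rewrite rpredX ?rpred_nat.
  have [n Dn] : exists n : nat, p%:R ^+ L * N = n%:R.
    by apply: nat_of_Aint => //; [exact: rpredM | rewrite mulr_ge0 ?exprn_ge0 // ltW].
  have [m Dm] : exists m : nat, p%:R ^+ L / N = m%:R.
    by apply: nat_of_Aint => //; [exact: rpred_div | rewrite mulr_ge0 ?exprn_ge0 // invr_ge0 ltW].
  have nm : (n * m = p ^ (L + L))%N.
    by apply/eqP; rewrite -(eqr_nat algC) natrM -Dn -Dm natrX exprD; apply/eqP; field.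
  have [h hL Dh] : exists2 h, (h <= L + L)%N & n = (p ^ h)%N.
    by apply/dvdn_pfactor => //; rewrite -nm dvdn_mulr.
  have BA : p%:R ^+ B * N \in Aint.
    have [LB|BL] := leqP L (B + h).
      have -> : p%:R ^+ B * N = p%:R ^+ (B + h - L).
        apply: (mulfI (expf_neq0 L pn0)); rewrite mulrCA Dn Dh natrX -!exprD subnKC //.
      by rewrite rpredX ?rpred_nat.
    have e1 : p%:R ^+ (L - h) * N = 1.
      apply: (mulfI (expf_neq0 h pn0)); rewrite mulrA -exprD subnKC; last exact: ltnW (leq_ltn_trans (leq_addl _ _) BL).
      by rewrite Dn Dh natrX mulr1.
    have : p%:R ^+ (L - h) <= 2 ^+ B :> algC.
      have : p%:R ^+ (L - h) / 2 ^+ B <= 1 :> algC by rewrite -[X in _ <= X]e1 ler_wpM2l ?exprn_ge0.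
      by rewrite ler_pdivrMr ?mul1r // exprn_gt0 // ltr0n.
    rewrite -!natrX ler_nat leqNgt => /negP[]; apply: (@leq_ltn_trans (p ^ B)).
      by case: (B) => // b; rewrite leq_exp2r ?prime_gt1.
    by rewrite ltn_exp2l ?prime_gt1 // ltn_subRL addnC.
  apply: (@Aint_root p.-1); first by rewrite -ltnS prednK ?prime_gt1.
  have -> : (p%:R ^+ B * X) ^+ p.-1 = (p%:R ^+ B) ^+ p.-2 * (p%:R ^+ B * N) * \prod_(i < p.-1) (X / iter i tau X).
    rewrite big_split /= prodr_const card_ord prodfV -/N exprMn mulrA -exprSr.
    rewrite [p.-2.+1]prednK; last by rewrite -ltnS prednK ?prime_gt1.
    by field.
  apply: rpredM; first by apply: rpredM => //; rewrite !rpredX ?rpred_nat.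
  apply: rpred_prod => i _.
  by rewrite tau_iter; apply: punit_ratio; exact: Uplus_punit.
pose E := Num.bound ((1 + D) ^+ p.-1).
have ED : (1 + D) ^+ p.-1 <= E%:R.
  by apply/ltW/archi_boundP; rewrite exprn_ge0 // addr_ge0.
have /choice[rts hrts] : forall F : {poly algC}, exists rs : seq algC, F != 0 -> forall z, root F z -> z \in rs.
  move=> F; have [rs Drs] := closed_field_poly_normal F; exists rs => F0 z.
  by rewrite Drs rootZ ?lead_coef_eq0 // root_prod_XsubC.
pose poly_of (t : {ffun 'I_p -> 'I_(E + E).+1}) : {poly algC} := \poly_(i < p) (if insub i is Some j then (t j)%:R - E%:R else 0).
pose zs := flatten [seq rts (poly_of t) | t <- enum {ffun 'I_p -> 'I_(E + E).+1}].
exists (pmap insub [seq z / p%:R ^+ B | z <- zs]) => x hx.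
have XA := intx x hx; set X := p%:R ^+ B * val x in XA.
have KX : K X by case: (Uplus_punit (UP x)) => Kx _ _; apply: QadjM => //; case/OE: (OX pz B (Onat pz p)).
rewrite mem_pmap_sub; apply/mapP; exists X; last by rewrite /X mulrC mulKf ?expf_neq0.
pose F := \prod_(i < p.-1) ('X - (iter i tau X)%:P).
have DF : F = \prod_(z <- [seq iter i tau X | i : 'I_p.-1]) ('X - z%:P) by rewrite big_image.
have tau_all : iter p.-1 tau X = X.
  have [Kx _ _] := Uplus_punit (UP x).
  rewrite d_double iterD /X; have e j : iter j tau (p%:R ^+ B * val x) = p%:R ^+ B * iter j tau (val x).
    by elim: j => //= j ->; rewrite rmorphM rmorphXn rmorph_nat.
  by rewrite e (tau_half (UP x)) e (tau_half (UP x)).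
have tF : map_poly tau F = F.
  rewrite /F rmorph_prod /=; apply: (mulfI (monic_neq0 (monicXsubC X))).
  under eq_bigr => i _ do rewrite rmorphB /= map_polyX map_polyC /=.
  rewrite -[LHS](big_ord_recl p.-1 (fun i => 'X - (iter i tau X)%:P)).
  by rewrite (big_ord_recr p.-1 (fun i => 'X - (iter i tau X)%:P)) /= tau_all mulrC.
have FK i : K F`_i.
  rewrite /F; elim/big_rec: _ i => [|j Q _ IH] i.
    by rewrite coef1; case: (i == 0)%N; [exact: Qadj1 | exact: Qadj0].
  rewrite mulrBl coefB coefXM coefCM; apply: QadjB.
    by case: ifP => _; [exact: Qadj0 | exact: IH].
  apply: QadjM; last exact: IH.
  by rewrite (tau_iter j X); exact: (K_gal pp pz).
have FA i : F`_i \in Aint.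
  rewrite /F; elim/big_rec: _ i => [|j Q _ IH] i.
    by rewrite coef1; case: (i == 0)%N; rewrite ?rpred1 ?rpred0.
  rewrite mulrBl coefB coefXM coefCM; apply: rpredB.
    by case: ifP => _; [exact: rpred0 | exact: IH].
  by apply: rpredM => //; rewrite tau_iter Aint_aut.
have sF : size F = p by rewrite DF size_prod_XsubC size_image card_ord prednK.
have FZ i : exists2 c : int, F`_i = c%:~R & `|c| <= E%:Z.
  have FQ : F`_i \in Crat.
    apply: fixed_rational => s; have [j _ ->] := gal_tau s; last exact: FK.
    by elim: j => //= j ->; rewrite -[in RHS]tF coef_map.
  have /intrP[c Dc] := Cint_rat_Aint FQ (FA i); exists c => //.
  rewrite -(ler_int algC) intr_norm -Dc; apply: le_trans ED; rewrite DF.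
  have sz : size [seq iter j tau X | j : 'I_p.-1] = p.-1 by rewrite size_image card_ord.
  rewrite -[X in (1 + D) ^+ X]sz; apply: coef_bound => // z /mapP[j _ ->].
  rewrite tau_iter /X rmorphM rmorphXn rmorph_nat normrM ger0_norm ?exprn_ge0 //.
  have /andP[_ h] := hx (tau ^+ j)%g; rewrite ler_wpM2l ?exprn_ge0 // ger0_norm //.
  by rewrite -tau_iter; apply/ltW/Uplus_gt0/Uplus_iter/UP.
have [t Dt] : exists t, poly_of t = F.
  have /choice[c hc] : forall i : 'I_p, exists c : int, F`_i = c%:~R /\ `|c| <= E%:Z.
    by move=> i; have [c ? ?] := FZ i; exists c.
  exists [ffun i => inord (absz (c i + E%:Z))]; apply/polyP => i; rewrite coef_poly.
  case: ltnP => ip; last by rewrite nth_default ?sF.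
  rewrite insubT ffunE; have [-> hcE] := hc (Sub i ip); rewrite inordK; last exact: absz_le_aux.
  by rewrite -[X in X - _]/((absz (c (Sub i ip) + E%:Z))%:Z%:~R) abszE_aux // rmorphD addrK.
apply/flattenP; exists (rts (poly_of t)); first by apply: map_f; rewrite mem_enum.
apply: hrts; first by rewrite Dt -size_poly_gt0 sF.
rewrite Dt DF root_prod_XsubC; apply/mapP.
have p10 : (0 < p.-1)%N by rewrite -ltnS prednK ?prime_gt1.
by exists (Ordinal p10); rewrite ?mem_enum.
Qed.

End Units.

(** Two Kummer characters are linearly dependent: their generators are units
    outside p, and the part of the unit group modulo p-th powers on which Galois
    acts through the relevant even character is a line. *)
Lemma kummer_dependence p (zeta : algC) P0 k j chi1 chi2 :
  prime p -> odd p -> p.-primitive_root zeta -> prime_above p P0 ->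
  ~~ odd k -> (2 <= k)%N -> (2 <= j)%N -> (k = j %[mod p.-1])%N ->
  class_eigenspace_vanishes p j -> kummer_char p k chi1 -> kummer_char p k chi2 ->
  exists n1 n2 : nat, ~ ((p %| n1)%N /\ (p %| n2)%N) /\
    forall s, acts_on_mu s p 1 -> chi1 s ^+ n1 * chi2 s ^+ n2 = 1.
Proof.
move=> pp podd pz hP0 ko k2 j2 kj hcl h1 h2.
have p0 := prime_gt0 pp; have p2 := prime_gt1 pp.
have pn0 : p%:R != 0 :> algC by rewrite pnatr_eq0 -lt0n.
have [g [cg gen g_half]] := primitive_root_mod pp podd.
have [tau htau] := acts_realize cg.
have [lg hlg] := log_ex p zeta.
have g0 : (0 < g ^ (k - 2))%N.
  by rewrite expn_gt0; case: (g) cg => [|//]; rewrite /coprime gcd0n => /eqP p1; move: p2; rewrite p1.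
have [mu mu0 hmu] := coprime_inv g0 (coprimeXl (k - 2) cg).
pose d := p.-1./2; have dd := d_double pp podd.
have k2e : (k - 2 = (k - 2)./2 * 2)%N.
  by rewrite muln2 -[LHS]odd_double_half oddB // (negbTE ko).
have pm1 (c : nat) : (c = p.-1 %[mod p])%N -> (c ^ (k - 2) = 1 %[mod p])%N.
  move=> hc; rewrite -modnXm hc modnXm k2e mulnC expnM -modnXm.
  have -> : (p.-1 ^ 2 = 1 %[mod p])%N.
    case: (p) p2 => [|[|q]] //= _; rewrite (_ : (q.+1 ^ 2 = q * q.+2 + 1)%N); last by rewrite expnS expn1; lia.
    by rewrite modnMDl.
  by rewrite modnXm exp1n.
have mu_d : (p%:Z %| mu%:Z ^+ d - 1)%Z.
  have : (mu ^ d = 1 %[mod p])%N.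
    have e1 : ((g ^ (k - 2)) ^ d = 1 %[mod p])%N.
      by rewrite -expnM mulnC expnM; apply: pm1.
    have e2 : ((g ^ (k - 2)) ^ d * mu ^ d = 1 %[mod p])%N by rewrite -expnMn -modnXm hmu modnXm exp1n.
    by move: e2; rewrite -modnMml e1 modnMml mul1n.
  move/eqP; rewrite -eqz_nat -!modz_nat eqz_mod_dvd.
  by have -> : (mu ^ d)%N%:Z = mu%:Z ^+ d by rewrite -[LHS]natz natrX natz.
have pd : ~~ (p %| d)%N.
  have [d0 dp] := half_bounds podd p2.
  by apply/negP => /(dvdn_leq d0); rewrite leqNgt dp.
have H chi : kummer_char p k chi -> exists ep ka (x w : Ugrp p zeta),
    [/\ ep != 0, forall s, acts_on_mu s p 1 -> s ep = chi s * ep, Qadj zeta ka /\ ka != 0,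
      val x = (ep ^+ 2 * ka) ^+ p & tau (val x) = val x ^+ mu * val w ^+ p].
  move=> hchi.
  have [ep [ep0 hep [M [A1 A2]]]] := kummer_unit pp pz hP0 ko k2 j2 kj hcl hchi.
  have K1 := kummer_conj pp pz k2 hchi ep0 hep htau hmu.
  have K2 : Qadj zeta (conj_gal ep / ep ^+ 1).
    by apply: (kummer_conj pp pz k2 hchi ep0 hep (conj_acts pp)); rewrite muln1; apply: pm1.
  rewrite expr1 in K2.
  have pA : p%:R ^+ M \in Aint by rewrite rpredX ?rpred_nat.
  have hv : punit p zeta (ep ^+ p).
    split; [|exact: expf_neq0|].
      apply/(K_fixed pz) => s hs; rewrite rmorphXn hep // exprMn.
      by rewrite (kchp hchi hs) mul1r.
    by exists (M * p)%N; rewrite exprM -exprMn -expr_div_n !rpredX.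
  have hk : punit p zeta (tau ep / ep ^+ mu).
    split=> //; first by rewrite mulf_neq0 ?invr_eq0 ?expf_neq0 ?fmorph_eq0.
    have tp : tau (p%:R ^+ M) = p%:R ^+ M by rewrite rmorphXn rmorph_nat.
    exists (M + M * mu)%N; split.
      have -> : p%:R ^+ (M + M * mu) * (tau ep / ep ^+ mu) = tau (p%:R ^+ M * ep) * (p%:R ^+ M / ep) ^+ mu.
        by rewrite rmorphM tp exprD exprM expr_div_n mulrACA.
      by rewrite rpredM ?rpredX ?Aint_aut.
    have -> : p%:R ^+ (M + M * mu) / (tau ep / ep ^+ mu) = tau (p%:R ^+ M / ep) * (p%:R ^+ M * ep) ^+ mu.
      by rewrite fmorph_div tp exprD exprM exprMn invf_div mulrACA [_ * (_^-1)]mulrC mulrA; ring.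
    by rewrite rpredM ?rpredX ?Aint_aut.
  have hx : Uplus p zeta (ep ^+ p * conj_gal (ep ^+ p)) by exists (ep ^+ p).
  have hw : Uplus p zeta (tau ep / ep ^+ mu * conj_gal (tau ep / ep ^+ mu)) by exists (tau ep / ep ^+ mu).
  exists ep, (conj_gal ep / ep), (mkU hx), (mkU hw); split=> //=.
  - by split=> //; rewrite mulf_neq0 ?invr_eq0 ?fmorph_eq0.
  - by rewrite rmorphXn -exprMn; congr (_ ^+ _); rewrite expr2 -mulrA [ep * (_ / _)]mulrC divfK.
  have tv : tau (ep ^+ p) = (ep ^+ p) ^+ mu * (tau ep / ep ^+ mu) ^+ p.
    by rewrite rmorphXn exprAC -exprMn mulrC divfK ?expf_neq0.
  rewrite rmorphM (K_comm pp pz tau conj_gal); last by case: hv.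
  have cE y : conj_gal y = y^* by [].
  move: (tau ep / ep ^+ mu) tv => ka tv; move: (ep ^+ p) tv => v ->.
  by rewrite cE rmorphM !rmorphXn !exprMn mulrACA.
have [e1 [k1 [x1 [w1 [e10 he1 [Kk1 k10] Dx1 tx1]]]]] := H _ h1.
have [e2 [k2' [x2 [w2 [e20 he2 [Kk2 k20] Dx2 tx2]]]]] := H _ h2.
have [|T hT] := @additive_of (Ugrp p zeta) (Ugrp p zeta) (fun x => mkU (Uplus_gal pp pz tau (UP x))).
  by move=> x y; apply/val_inj => /=; rewrite fmorph_div.
have vT x : val (T x) = tau (val x) by rewrite hT.
have vTi i x : val (iter i T x) = iter i tau (val x) by elim: i => [//|i IH]; rewrite !iterS vT IH.
have fin (C : nat) : exists r : seq (Ugrp p zeta),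
    forall x, (forall i, (i < d)%N -> `|lg (iter i T x)| <= C%:Z) -> x \in r.
  have [r hr] := U_finite pp podd pz hP0 htau gen g_half C; exists r => x hx.
  apply: hr => s; have [i id hi] := gal_tau_half pp podd pz cg htau gen g_half s.
  by rewrite (hi _ (UP x)) -vTi; apply: (lg_bound pp podd hlg); exact: hx.
have T_d (x : Ugrp p zeta) : iter d T x = x.
  by apply/val_inj; rewrite vTi (tau_half pp pz htau g_half (UP x)).
have tfree (x : Ugrp p zeta) : x *+ p = 0 -> x = 0.
  move/(congr1 val); rewrite val_UMn => /eqP h; apply/val_inj/eqP.
  by move: h; rewrite pexpr_eq1 // ltW // (Uplus_gt0 (UP x)).
have T1 : T x1 = x1 *+ mu + w1 *+ p by apply/val_inj; rewrite vT tx1 val_UD !val_UMn.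
have T2 : T x2 = x2 *+ mu + w2 *+ p by apply/val_inj; rewrite vT tx2 val_UD !val_UMn.
have [n1 [n2 [W [nn eW]]]] := eigen_line (lg_quasi hlg) fin pp pd T_d tfree mu_d T1 T2.
pose E := (e1 ^+ 2 * k1) ^ n1 * (e2 ^+ 2 * k2') ^ n2.
have a10 : e1 ^+ 2 * k1 != 0 by rewrite mulf_neq0 ?expf_neq0.
have a20 : e2 ^+ 2 * k2' != 0 by rewrite mulf_neq0 ?expf_neq0.
have E0 : E != 0 by rewrite mulf_neq0 ?expfz_neq0.
have W0 : val W != 0 by rewrite gt_eqF // (Uplus_gt0 (UP W)).
have Ep : E ^+ p = val W ^+ p.
  have e := congr1 val eW; rewrite val_UD !val_UMz Dx1 Dx2 in e.
  rewrite [RHS]exprnP -e.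
  by rewrite /E exprMn; congr (_ * _); rewrite !exprnP exprzAC.
have KE : Qadj zeta E.
  have q1 : (E / val W) ^+ p = 1 by rewrite expr_div_n Ep mulfV ?expf_neq0.
  have [i Di] := prim_rootP pz q1.
  have -> : E = zeta ^+ i * val W by rewrite -Di divfK.
  by apply: QadjM; [apply: QadjX; exact: Qadj_gen | case: (Uplus_punit pp pz (UP W))].
have two n s (chi : galQ -> algC) : kummer_char p k chi -> acts_on_mu s p 1 ->
    (chi s ^+ 2) ^ n = chi s ^+ absz ((2 * n) %% p)%Z.
  move=> hchi hs; have c1 := kchp hchi hs; have c0 : chi s != 0.
    by apply: contra_eq_neq c1 => ->; rewrite expr0n gtn_eqF // eq_sym oner_eq0.
  have -> : (chi s ^+ 2) ^ n = chi s ^ (2 * n)%Z by rewrite -exprz_exp.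
  move: (2 * n)%Z => m; have m0 : (0 <= m %% p)%Z by rewrite modz_ge0 // -lt0n.
  rewrite {1}(divz_eq m p) expfzDr // mulrC -exprz_exp exprzAC -[_ ^ p%:Z]/(_ ^+ p) c1 exp1rz mulr1.
  by rewrite exprnP gez0_abs.
have ndvd n : (p %| absz ((2 * n) %% p)%Z)%N -> (p%:Z %| n)%Z.
  move=> h; have m0 : (0 <= (2 * n) %% p)%Z by rewrite modz_ge0 // -lt0n.
  have h3 : (p%:Z %| (2 * n) %% p)%Z by rewrite dvdzE.
  have : (p%:Z %| 2 * n)%Z by rewrite (divz_eq (2 * n)%Z p) rpredD // dvdz_mull ?dvdzz.
  by case/(prime_dvdzM pp) => // /dvdn_leq /=; case: (p) p2 podd => [|[|[|q]]] // _ _ /(_ isT).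
exists (absz ((2 * n1) %% p)%Z), (absz ((2 * n2) %% p)%Z); split.
  by move=> [/ndvd d1 /ndvd d2]; apply: nn.
move=> s hs; rewrite -(two _ _ _ h1 hs) -(two _ _ _ h2 hs).
have sE : s E = E by apply: (K_fixed pz E).1.
have Kf x : Qadj zeta x -> s x = x by move=> Kx; apply: (K_fixed pz x).1.
have sa1 : s (e1 ^+ 2 * k1) = chi1 s ^+ 2 * (e1 ^+ 2 * k1).
  by rewrite rmorphM (Kf _ Kk1) !expr2 rmorphM he1 //; ring.
have sa2 : s (e2 ^+ 2 * k2') = chi2 s ^+ 2 * (e2 ^+ 2 * k2').
  by rewrite rmorphM (Kf _ Kk2) !expr2 rmorphM he2 //; ring.
apply: (mulIf E0); rewrite mul1r -[RHS]sE /E [RHS]rmorphM !fmorphXz sa1 sa2.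
by rewrite [(chi1 s ^+ 2 * _) ^ n1]expfzMl [(chi2 s ^+ 2 * _) ^ n2]expfzMl mulrACA.
Qed.

(** * Bernoulli numbers at 2 *)
Lemma bernoulli_seq_size n : size (bernoulli_seq n) = n.+1.
Proof. by elim: n => //= n IH; rewrite size_rcons IH. Qed.

Lemma bernoulli_seq_nth n i : (i <= n)%N -> (bernoulli_seq n)`_i = bernoulli i.
Proof.
elim: n => [|n IH]; first by rewrite leqn0 => /eqP->.
rewrite leq_eqVlt => /orP[/eqP->//|]; rewrite ltnS => i_n.
by rewrite /= nth_rcons bernoulli_seq_size ltnS i_n IH.
Qed.

Lemma bernoulli_sum n : \sum_(i < n.+2) 'C(n.+2, i)%:R * bernoulli i = 0.
Proof.
rewrite big_ord_recr /= {2}/bernoulli /= nth_rcons bernoulli_seq_size ltnn eqxx.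
rewrite (eq_bigr (fun i : 'I_n.+1 => 'C(n.+2, i)%:R * (bernoulli_seq n)`_i)) => [|i _]; last first.
  by rewrite bernoulli_seq_nth // -ltnS.
by rewrite binSn mulrCA divff ?pnatr_eq0 // mulr1 subrr.
Qed.

(** Through this functional, identities between Bernoulli numbers become substitutions in polynomials. *)
Definition umbral (q : {poly rat}) : rat := \sum_(i < size q) q`_i * bernoulli i.

Lemma umbralE n (q : {poly rat}) : (size q <= n)%N -> umbral q = \sum_(i < n) q`_i * bernoulli i.
Proof.
move=> qn; rewrite /umbral -!(big_mkord xpredT (fun i => q`_i * bernoulli i)).
rewrite (big_cat_nat _ qn) //= [X in _ + X]big1_seq ?addr0 // => i /andP[_].
by rewrite mem_index_iota => /andP[qi _]; rewrite nth_default // mul0r.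
Qed.

Lemma umbralD q r : umbral (q + r) = umbral q + umbral r.
Proof.
rewrite (umbralE (leq_maxl (size q) (size r))) (umbralE (leq_maxr (size q) (size r))).
by rewrite (umbralE (size_polyD q r)) -big_split; apply: eq_bigr => i _; rewrite coefD mulrDl.
Qed.

Lemma umbralZ c q : umbral (c *: q) = c * umbral q.
Proof.
rewrite (umbralE (size_scale_leq c q)) mulr_sumr; apply: eq_bigr => i _.
by rewrite coefZ mulrA.
Qed.

Lemma umbral0 : umbral 0 = 0. Proof. by rewrite /umbral size_poly0 big_ord0. Qed.

Lemma umbral_sum n (F : 'I_n -> {poly rat}) : umbral (\sum_i F i) = \sum_i umbral (F i).
Proof. exact: (big_morph _ umbralD umbral0). Qed.

Lemma umbral_binom c m : umbral (('X + c%:P) ^+ m) = \sum_(i < m.+1) 'C(m, i)%:R * c ^+ (m - i) * bernoulli i.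
Proof.
rewrite addrC exprDn umbral_sum; apply: eq_bigr => i _.
rewrite -mulr_natl -rmorphXn mulrA -(rmorph_nat (polyC : rat -> {poly rat})) -rmorphM /= mul_polyC umbralZ.
congr (_ * _); rewrite (@umbralE i.+1) ?size_polyXn // (bigD1 ord_max) //= coefXn eqxx mul1r.
by rewrite big1 ?addr0 // => k kn; rewrite coefXn (_ : _ == _ = false) ?mul0r //; apply/negbTE.
Qed.

Lemma umbral_shift q : umbral (q \Po ('X + 1)) = umbral q + q`_1.
Proof.
rewrite -[q in LHS]coefK poly_def rmorph_sum /= umbral_sum.
have h m : umbral (('X + 1) ^+ m) = bernoulli m + (m == 1%N)%:R.
  rewrite -[1]polyC1 umbral_binom.
  under eq_bigr => i _ do rewrite expr1n mulr1.
  case: m => [|[|m]]; first by rewrite big_ord1 bin0 mul1r addr0.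
    by rewrite big_ord_recr big_ord1 /= !bin0 binn !mul1r addrC.
  by rewrite big_ord_recr bernoulli_sum /= binn mul1r add0r addr0.
under eq_bigr => i _ do rewrite comp_polyZ comp_Xn_poly umbralZ h mulrDr.
rewrite big_split; congr (_ + _).
have [s1|s1] := ltnP 1 (size q).
  rewrite (bigD1 (Ordinal s1)) //= mulr1 big1 ?addr0 // => i i1.
  by rewrite (_ : (i == 1%N :> nat) = false) ?mulr0 //; apply/negbTE.
rewrite [RHS]nth_default // big1 // => i _.
by rewrite (_ : (i == 1%N :> nat) = false) ?mulr0 //; apply/negbTE; rewrite neq_ltn (leq_trans (ltn_ord i) s1).
Qed.

(** The sum of the first two (m-1)-st powers, through Bernoulli polynomials. *)
Lemma bernoulli_two m : (1 < m)%N -> \sum_(i < m) 'C(m, i)%:R * 2 ^+ (m - i) * bernoulli i = m%:R.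
Proof.
move=> m1; have e2 : ('X + 1) ^+ m \Po ('X + 1) = ('X + 2%:P) ^+ m :> {poly rat}.
  rewrite rmorphXn /= comp_polyD comp_polyX -[1 in X in _ + X]polyC1 comp_polyC -addrA -polyC1 -polyCD.
  by [].
have h1 : umbral (('X + 1) ^+ m) = bernoulli m.
  rewrite -[1]polyC1 umbral_binom; case: m m1 {e2} => [|[|m]] // _.
  under eq_bigr => i _ do rewrite expr1n mulr1.
  by rewrite big_ord_recr bernoulli_sum /= binn mul1r add0r.
have := umbral_shift (('X + 1) ^+ m); rewrite e2 h1 umbral_binom big_ord_recr /= binn subnn expr0 !mul1r addrC.
move/addrI => ->; rewrite addrC exprDn coef_sum.
rewrite (bigD1 (Ordinal (ltnW m1 : 1 < m.+1)%N)) //= expr1n mul1r coefMn coefX /= bin1.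
rewrite big1 ?addr0 // => i i1; rewrite expr1n mul1r coefMn coefXn.
by rewrite (_ : (1%N == i :> nat) = false) ?mul0rn // eq_sym; apply/negbTE.
Qed.

(** The localization of Z at 2. *)
Definition two_integral (x : rat) := exists (d : nat) (c : int), odd d /\ d%:R * x = c%:~R.

Lemma two_int (c : int) : two_integral c%:~R.
Proof. by exists 1%N, c; rewrite mul1r. Qed.
Lemma two_nat (n : nat) : two_integral n%:R. Proof. exact: (two_int n). Qed.
Lemma two_intD x y : two_integral x -> two_integral y -> two_integral (x + y).
Proof.
move=> [d [c [od e]]] [d' [c' [od' e']]]; exists (d * d')%N, (c * d'%:Z + c' * d%:Z).
rewrite oddM od od' natrM mulrDr rmorphD !rmorphM /= -e -e'; split=> //.
by rewrite -!pmulrn; ring.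
Qed.
Lemma two_intM x y : two_integral x -> two_integral y -> two_integral (x * y).
Proof.
move=> [d [c [od e]]] [d' [c' [od' e']]]; exists (d * d')%N, (c * c').
by rewrite oddM od od' natrM rmorphM /= -e -e'; split=> //; ring.
Qed.
Lemma two_int_sum n (F : 'I_n -> rat) : (forall i, two_integral (F i)) -> two_integral (\sum_i F i).
Proof. by move=> h; apply: big_ind => //; [exact: (two_int 0) | exact: two_intD]. Qed.
Lemma two_intN x : two_integral x -> two_integral (- x).
Proof. by move=> h; rewrite -mulN1r; apply: two_intM => //; exact: (two_int (-1)). Qed.

Lemma two_pow_over j : (0 < j)%N -> two_integral (2 ^+ j.-1 / j%:R) /\
  ((2 < j)%N -> exists2 y, two_integral y & 2 ^+ j.-1 / j%:R = 2 * y).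
Proof.
move=> j0; have [o co Dj] := pfactor_coprime (isT : prime 2) j0.
have oo : odd o by rewrite -coprime2n.
set e := logn 2 j in Dj.
have ej : (e < j)%N by apply: (leq_trans (ltn_expl e (isT : 1 < 2)%N)); rewrite Dj leq_pmull // odd_gt0.
have gen t : (e <= t)%N -> two_integral (2 ^+ t / j%:R).
  move=> et; exists o, (2%:Z ^+ (t - e)); split=> //; have o0 : o%:R != 0 :> rat by rewrite pnatr_eq0 -lt0n odd_gt0.
  rewrite Dj natrM natrX -{1}(subnK et) exprD rmorphXn /=.
  have z2 : 2%Z%:~R = 2 :> rat by [].
  by rewrite z2 -!natrX; field; rewrite o0 natrX expf_neq0.
split; first by apply: gen; rewrite -ltnS prednK.
move=> j2; exists (2 ^+ j.-2 / j%:R).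
  apply: gen; have : (2 ^ e <= j)%N by rewrite Dj leq_pmull // odd_gt0.
  move=> h; rewrite leqNgt; apply/negP => h2.
  have : (2 ^ j.-1 <= j)%N by apply: leq_trans h; rewrite leq_exp2l; lia.
  rewrite leqNgt => /negP; apply; case: (j) j2 => [|[|[|m]]] // _.
  by elim: m => //= m IH; rewrite expnS; move: IH => /=; lia.
by rewrite mulrA -exprS; case: (j) j2 => [|[|]].
Qed.

(** Twice a Bernoulli number is a 2-adic integer, and a unit in even index. *)
Lemma bernoulli_two_adic n : two_integral (2 * bernoulli n) /\
  ((0 < n)%N -> ~~ odd n -> exists2 y, two_integral y & 2 * bernoulli n = 1 + 2 * y).
Proof.
elim/ltn_ind: n => n IH; case: n IH => [|N] IH; first by split=> //; exact: (two_nat 2).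
set n := N.+1 in IH *.
pose t (i : 'I_n) := 'C(n, i)%:R * (2 ^+ (n.+1 - i).-1 / (n.+1 - i)%:R) * (2 * bernoulli i).
have e : 2 * bernoulli n = 1 - \sum_i t i.
  have n0 : n.+1%:R != 0 :> rat by rewrite pnatr_eq0.
  apply: (mulfI n0); have := bernoulli_two (isT : (1 < n.+1)%N).
  rewrite big_ord_recr /= binSn subSnn expr1 -mulrA mulrBr mulr1 => h.
  apply/eqP; rewrite eq_sym subr_eq -[X in X == _]h addrC; apply/eqP; congr (_ + _).
  rewrite mulr_sumr; apply: eq_bigr => i _.
  have j0 : (0 < n.+1 - i)%N by rewrite subn_gt0 ltnS ltnW.
  have jn : (n.+1 - i)%:R != 0 :> rat by rewrite pnatr_eq0 -lt0n.
  have eb : n.+1%:R * 'C(n, i)%:R = (n.+1 - i)%:R * 'C(n.+1, i)%:R :> rat.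
    by rewrite -!natrM; congr (_%:R); exact: mul_bin_down n.+1 i.
  rewrite /t -{1}(prednK j0) exprS !mulrA eb; field.
  by [].
have tI i : two_integral (t i).
  have [hb _] := IH i (ltn_ord i); have j0 : (0 < n.+1 - i)%N by rewrite subn_gt0 ltnS ltnW.
  by apply: two_intM hb; apply: two_intM (two_nat _) (two_pow_over j0).1.
split; first by rewrite e; apply: two_intD; [exact: (two_int 1) | apply/two_intN/two_int_sum].
move=> _ ev; have /choice[y hy] : forall i, exists y, two_integral y /\ t i = 2 * y.
  move=> i; have [hb _] := IH i (ltn_ord i).
  have [i1|i1] := ltnP i N.
    have j0 : (0 < n.+1 - i)%N by rewrite subn_gt0 ltnS ltnW.
    have [|z hz ez] := (two_pow_over j0).2; first by rewrite ltn_subRL addn2 !ltnS.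
    exists ('C(n, i)%:R * z * (2 * bernoulli i)); split; last by rewrite /t ez; ring.
    by apply: two_intM hb; apply: two_intM hz; exact: two_nat.
  have Di : i = N :> nat by apply/eqP; rewrite eqn_leq i1 -ltnS ltn_ord.
  exists (n./2%:R * (2 * bernoulli i)); split; first by apply: two_intM hb; exact: two_nat.
  rewrite /t Di subSn // subSnn expr1 /n binSn mulfV // mulr1.
  by rewrite -[in LHS](odd_double_half N.+1) (negbTE ev) add0n -mul2n natrM mulrA.
exists (- \sum_i y i); first by apply/two_intN/two_int_sum => i; case: (hy i).
by rewrite e mulrN mulr_sumr; congr (_ - _); apply: eq_bigr => i _; case: (hy i).
Qed.

(** For even j the 2-adic valuation of B_j is -1, so that 2 cannot divide the numerator of B_j / j. *)
Lemma irregular_odd p j : irregular_pair p j -> odd p.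
Proof.
move=> [pp j2 ej]; apply: contraTT => ep; have -> : p = 2%N.
  by case: (even_prime pp) => // op; rewrite op in ep.
apply/negP => /dvdzP[c Dc].
have [_ [||y [d [b [od eb]]] e]] := bernoulli_two_adic j; [exact: ltnW| by [] |].
pose r := bernoulli j / j%:R; have d0 : denq r != 0 by rewrite denq_eq0.
have j0 : j%:R != 0 :> rat by rewrite pnatr_eq0 -lt0n ltnW.
have er : bernoulli j = j%:R * (c * 2)%:~R / (denq r)%:~R.
  by rewrite -Dc -/r -mulrA divq_num_den /r mulrCA mulfV ?mulr1.
(* a parity contradiction after clearing denominators *)
have od' : ~~ (2 %| denq r)%Z.
  have := coprime_num_den r; rewrite -/r in Dc; rewrite Dc abszM /= => h.
  apply/negP; rewrite dvdzE /= => h2; move: h; rewrite coprimeMl => /andP[_].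
  by rewrite prime_coprime // h2.
have : (2 * d%:Z * j%:Z * c * 2 = (d%:Z + 2 * b) * denq r)%Z.
  apply: (@intr_inj rat); rewrite !(intrM, intrD) -eb.
  have -> : d%:Z%:~R + 2%:~R * (d%:R * y) = d%:R * (2 * bernoulli j) :> rat by rewrite e; ring.
  rewrite er intrM; field.
  by rewrite intr_eq0.
move=> h; have : (2 %| (d%:Z + 2 * b) * denq r)%Z by rewrite -h dvdz_mull.
case/(prime_dvdzM (isT : prime 2)) => [h2|h2]; last by rewrite h2 in od'.
have : (2 %| d%:Z)%Z by rewrite -[d%:Z](addrK (2 * b)%Z) rpredB // dvdz_mulr.
by rewrite dvdzE /= dvdn2 od.
Qed.

(** * The Iwasawa algebra and the mu-invariant *)
Lemma ltn_add_aux (a b c d : nat) : (a < c)%N -> (b < d)%N -> (a + b < c + d)%N.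
Proof. lia. Qed.

Lemma sub_swap (V : zmodType) (a b c d : V) : a - b = c - d -> b - d = a - c.
Proof. by move/eqP; rewrite subr_eq => /eqP ->; rewrite -addrA addrC addrA subrK. Qed.

Lemma ring_morphism_of (A B : nzRingType) (f : A -> B) :
  (forall x y, f (x - y) = f x - f y) ->
  f 1 = 1 /\ (forall x y, f (x * y) = f x * f y) -> exists g : {rmorphism A -> B}, forall x, g x = f x.
Proof.
move=> fB fM.
pose m1 := GRing.isZmodMorphism.Build A B f fB.
pose m2 := GRing.isMonoidMorphism.Build A B f fM.
pose g : {rmorphism A -> B} := HB.pack f m1 m2.
by exists g.
Qed.

Module CgrConst.
Section CgrConst.
Variables (O : comNzRingType) (G : abelian_tower).
Lemma cgr_const_zmod : zmod_morphism (@cgr_const O G).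
Proof. by move=> a b; apply: cgr_eqP => n g; rewrite !ffunE mulrnBl. Qed.
Lemma cgr_const_mon : monoid_morphism (@cgr_const O G).
Proof.
split=> // a b; apply: cgr_eqP => n g; rewrite !ffunE (bigD1 1%g) //= !ffunE eqxx invg1 mul1g big1.
  by rewrite addr0 mulr1n mulrnAr.
by move=> h h1; rewrite ffunE (negbTE h1) mulr0n mul0r.
Qed.
#[export] HB.instance Definition _ := GRing.isZmodMorphism.Build O (cgr O G) (@cgr_const O G) cgr_const_zmod.
#[export] HB.instance Definition _ := GRing.isMonoidMorphism.Build O (cgr O G) (@cgr_const O G) cgr_const_mon.
End CgrConst.
Module Exports. HB.reexport. End Exports.
End CgrConst.
Export CgrConst.Exports.

Section GroupRing.
Variables (O : comNzRingType) (G : abelian_tower).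
Let L := cgr O G.

Lemma coefD (x y : L) n g : cgr_coef (x + y) n g = cgr_coef x n g + cgr_coef y n g.
Proof. by rewrite ffunE. Qed.
Lemma coefN (x : L) n g : cgr_coef (- x) n g = - cgr_coef x n g.
Proof. by rewrite ffunE. Qed.
Lemma coefM_ (x y : L) n g : cgr_coef (x * y) n g = \sum_h cgr_coef x n h * cgr_coef y n (h^-1 * g)%g.
Proof. by rewrite ffunE. Qed.
Lemma coef0_ n g : cgr_coef (0 : L) n g = 0.
Proof. by rewrite ffunE. Qed.
Lemma coef_const a n g : cgr_coef (cgr_const G a : L) n g = a *+ (g == 1%g).
Proof. by rewrite ffunE. Qed.
Lemma coef_sum_ (I : Type) (r : seq I) (P : pred I) (F : I -> L) n g :
  cgr_coef (\sum_(i <- r | P i) F i) n g = \sum_(i <- r | P i) cgr_coef (F i) n g.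
Proof. by apply: (big_morph (fun x : L => cgr_coef x n g)) => [x y|]; rewrite ffunE. Qed.
Lemma coef_constM a (y : L) n g : cgr_coef (cgr_const G a * y) n g = a * cgr_coef y n g.
Proof.
rewrite coefM_ (bigD1 1%g) //= big1 => [|h h1]; first by rewrite addr0 coef_const eqxx invg1 mul1g.
by rewrite coef_const (negbTE h1) mul0r.
Qed.

Definition level_eq n (x y : L) := forall g, cgr_coef x n g = cgr_coef y n g.

Lemma level_eq_mul n x x' y y' : level_eq n x x' -> level_eq n y y' -> level_eq n (x * y) (x' * y').
Proof. by move=> hx hy g; rewrite !coefM_; apply: eq_bigr => h _; rewrite hx hy. Qed.
Lemma level_eq_add n x x' y y' : level_eq n x x' -> level_eq n y y' -> level_eq n (x + y) (x' + y').
Proof. by move=> hx hy g; rewrite !coefD hx hy. Qed.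
Lemma level_eq_trans n x y z : level_eq n x y -> level_eq n y z -> level_eq n x z.
Proof. by move=> hx hy g; rewrite hx hy. Qed.
Lemma level_eq_sym n x y : level_eq n x y -> level_eq n y x.
Proof. by move=> h g; rewrite h. Qed.
Lemma level_eq_refl n x : level_eq n x x. Proof. by []. Qed.
Lemma level_eq_down n x y : level_eq n.+1 x y -> level_eq n x y.
Proof. by move=> h g; rewrite !(cgr_compat _ g); apply: eq_bigr => k _; rewrite h. Qed.

Variable gam : forall n, G n.
Hypotheses (gam_map : forall n, tower_map (gam n.+1) = gam n)
  (gam_gen : forall n, [set: G n]%SET = <[gam n]>%g).

Lemma gamma_compat n (g : G n) : [ffun g => (g == gam n)%:R : O] g =
  \sum_(h : G n.+1 | tower_map h == g) [ffun h => (h == gam n.+1)%:R : O] h.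
Proof.
rewrite ffunE; have [->|gn] := eqVneq g (gam n).
  rewrite (bigD1 (gam n.+1)) ?gam_map //= ffunE eqxx big1 ?addr0 // => h /andP[_ h1].
  by rewrite ffunE (negbTE h1).
rewrite big1 // => h /eqP e; rewrite ffunE; case: eqVneq => // h1.
by move: gn; rewrite -e h1 gam_map eqxx.
Qed.
(** The topological generator, as an element of the completed group ring. *)
Definition gamma : L := CGR gamma_compat.

Lemma coef_gammaM (y : L) n g : cgr_coef (gamma * y) n g = cgr_coef y n ((gam n)^-1 * g)%g.
Proof.
rewrite coefM_ (bigD1 (gam n)) //= big1 => [|h h1]; first by rewrite addr0 ffunE eqxx mul1r.
by rewrite ffunE (negbTE h1) mul0r.
Qed.
Lemma coef_gammaX i n g : cgr_coef (gamma ^+ i) n g = (g == gam n ^+ i)%g%:R.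
Proof.
elim: i g => [|i IH] g; first by rewrite expr0 -[1]/(cgr_const G 1) coef_const.
by rewrite exprS coef_gammaM IH expgS -(inj_eq (@mulgI _ (gam n))) mulKVg.
Qed.

(** Polynomials in gamma: at each level they give everything, which reduces questions modulo w to
    polynomials over the residue field. *)
Definition ev (q : {poly O}) : L := (map_poly (@cgr_const O G) q).[gamma].

Lemma evD q r : ev (q + r) = ev q + ev r. Proof. by rewrite /ev rmorphD hornerD. Qed.
Lemma evM q r : ev (q * r) = ev q * ev r. Proof. by rewrite /ev rmorphM hornerM. Qed.
Lemma evC a : ev a%:P = cgr_const G a. Proof. by rewrite /ev map_polyC hornerC. Qed.
Lemma evX : ev 'X = gamma. Proof. by rewrite /ev map_polyX hornerX. Qed.
Lemma evE n (q : {poly O}) : (size q <= n)%N -> ev q = \sum_(i < n) cgr_const G q`_i * gamma ^+ i.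
Proof.
move=> sq; have sm : (size (map_poly (@cgr_const O G) q) <= n)%N by apply: leq_trans (size_poly _ _) sq.
by rewrite /ev (horner_coef_wide _ sm); apply: eq_bigr => i _; rewrite coef_map.
Qed.

Let N n := #|[set: G n]%SET|.
Lemma N_order n : #[gam n]%g = N n. Proof. by rewrite orderE -gam_gen. Qed.
Lemma N_gt0 n : (0 < N n)%N. Proof. by rewrite -N_order order_gt0. Qed.

Lemma coef_ev n (q : {poly O}) j : (size q <= N n)%N -> (j < N n)%N -> cgr_coef (ev q) n (gam n ^+ j)%g = q`_j.
Proof.
move=> sq jn; rewrite (evE sq) coef_sum_ (bigD1 (Ordinal jn)) //= big1.
  by rewrite addr0 coef_constM coef_gammaX eqxx mulr1.
move=> i ij; rewrite coef_constM coef_gammaX eq_expg_mod_order N_order !modn_small //.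
by rewrite eq_sym (_ : (i == j :> nat) = false) ?mulr0 //; apply/negbTE.
Qed.

Lemma gam_pow n (g : G n) : exists2 j, (j < N n)%N & g = (gam n ^+ j)%g.
Proof.
have : g \in <[gam n]>%g by rewrite -gam_gen inE.
by case/cyclePmin => j; rewrite N_order => jn ->; exists j.
Qed.

Lemma ev_surj n (y : L) : exists2 q : {poly O}, (size q <= N n)%N & level_eq n y (ev q).
Proof.
exists (\poly_(j < N n) cgr_coef y n (gam n ^+ j)%g); first exact: size_poly.
by move=> g; have [j jn ->] := gam_pow g; rewrite coef_ev ?size_poly // coef_poly jn.
Qed.

Lemma gamma_order n : level_eq n (gamma ^+ N n) 1.
Proof. by move=> g; rewrite -(expr0 gamma) !coef_gammaX -N_order expg_order expg0. Qed.

Lemma ev_mod n q : level_eq n (ev q) (ev (Pdiv.Ring.rmodp q ('X^(N n) - 1))).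
Proof.
have mon : 'X^(N n) - 1 \is @monic O by rewrite -[1]polyC1; exact: monicXnsubC (N_gt0 n).
rewrite {1}(Pdiv.RingMonic.rdivp_eq mon q) evD evM.
rewrite -[X in level_eq n _ X]add0r; apply: level_eq_add; last exact: level_eq_refl.
rewrite -[X in level_eq n _ X](mulr0 (ev (Pdiv.Ring.rdivp q ('X^(N n) - 1)))).
apply: level_eq_mul; first exact: level_eq_refl.
have -> : ev ('X^(N n) - 1) = gamma ^+ N n - 1.
  by rewrite /ev rmorphB rmorph1 rmorphXn /= map_polyX !hornerE.
rewrite -[X in level_eq n _ X](subrr 1); apply: level_eq_add; [exact: gamma_order | exact: level_eq_refl].
Qed.

(** Inverses at the various levels are unique, hence compatible. *)
Lemma cgr_inv_glue (x : L) : (forall n, exists y, level_eq n (x * y) 1) -> exists y, y * x = 1.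
Proof.
move=> /choice[y hy].
have uniq_ n (u v : L) : level_eq n (x * u) 1 -> level_eq n (x * v) 1 -> level_eq n u v.
  move=> hu hv; rewrite -[X in level_eq n X _]mul1r; apply: level_eq_trans (_ : level_eq n (x * v * u) v).
    by apply: level_eq_mul; [exact: level_eq_sym | exact: level_eq_refl].
  rewrite mulrAC -[X in level_eq n _ X]mul1r.
  by apply: level_eq_mul; [exact: hu | exact: level_eq_refl].
have compat n g : cgr_coef (y n) n g = \sum_(h : G n.+1 | tower_map h == g) cgr_coef (y n.+1) n.+1 h.
  rewrite -cgr_compat; apply: uniq_ => //; apply: level_eq_down; exact: hy.
exists (CGR compat : L); rewrite mulrC; apply: cgr_eqP => n g; rewrite -(hy n g).
by apply: level_eq_mul.
Qed.

Section Residue.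
Variables (w : O) (F : fieldType) (res : {rmorphism O -> F}) (p : nat).
Hypotheses (res0 : forall x, res x = 0 <-> exists y, x = y * w)
  (res_unit : forall x, res x != 0 -> exists y, y * x = 1)
  (wreg : forall x, x * w = 0 -> x = 0)
  (pp : prime p) (charF : res p%:R = 0) (cardG : forall n, N n = (p ^ n)%N).

Let charFp : p \in [pchar F].
Proof. by rewrite inE pp /= -(rmorph_nat res) charF eqxx. Qed.

(** Quotients of the coefficients by w are unique, hence compatible. *)
Lemma w_dvdP (x : L) : divides (cgr_const G w) x <-> forall n g, res (cgr_coef x n g) = 0.
Proof.
split=> [[z ->] n g|h].
  by rewrite mulrC coef_constM; apply/res0; exists (cgr_coef z n g); rewrite mulrC.
pose c n : {ffun G n -> O} := [ffun g => xget 0 [set a | cgr_coef x n g = a * w]].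
have hc n g : cgr_coef x n g = c n g * w.
  by rewrite ffunE; have hex := (res0 _).1 (h n g); exact: (xgetPex 0 hex).
have compat n g : c n g = \sum_(h : G n.+1 | tower_map h == g) c n.+1 h.
  apply/eqP; rewrite -subr_eq0; apply/eqP/wreg; rewrite mulrBl mulr_suml -hc cgr_compat.
  by apply/eqP; rewrite subr_eq0; apply/eqP/eq_bigr => k _; rewrite hc.
exists (CGR compat : L); apply: cgr_eqP => n g.
by rewrite mulrC coef_constM hc mulrC.
Qed.

Lemma w_zero_down n (x : L) : (forall g, res (cgr_coef x n.+1 g) = 0) -> forall g, res (cgr_coef x n g) = 0.
Proof. by move=> h g; rewrite cgr_compat rmorph_sum big1 // => k _; rewrite h. Qed.

Lemma XpN_res n : map_poly res ('X^(N n) - 1) = ('X - 1%:P) ^+ (p ^ n).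
Proof.
rewrite rmorphB rmorph1 rmorphXn /= map_polyX cardG.
have ch : p \in [pchar {poly F}] by rewrite pchar_poly.
have -> : 'X^(p ^ n) = (('X - 1%:P) + 1%:P) ^+ (p ^ n) :> {poly F} by rewrite subrK.
by rewrite exprDn_pchar ?pnatX ?pnatE ?ch // -rmorphXn expr1n polyC1 addrK.
Qed.

(** Modulo w, the n-th level is F[X]/(X - 1)^(p^n). *)
Lemma ev_res n (q : {poly O}) :
  (forall g, res (cgr_coef (ev q) n g) = 0) <-> ('X - 1%:P) ^+ (p ^ n) %| map_poly res q.
Proof.
have mon : 'X^(N n) - 1 \is @monic O by rewrite -[1]polyC1; exact: monicXnsubC (N_gt0 n).
pose r := Pdiv.Ring.rmodp q ('X^(N n) - 1).
have sr : (size r <= N n)%N.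
  have := Pdiv.Ring.ltn_rmodp q ('X^(N n) - 1); rewrite monic_neq0 //.
  by rewrite -[X in _ - X]polyC1 size_XnsubC ?N_gt0.
have e : map_poly res q = map_poly res (Pdiv.Ring.rdivp q ('X^(N n) - 1)) * ('X - 1%:P) ^+ (p ^ n) + map_poly res r.
  by rewrite {1}(Pdiv.RingMonic.rdivp_eq mon q) rmorphD rmorphM -XpN_res.
rewrite e dvdp_addr ?dvdp_mull //; split=> [h|h].
  suff -> : map_poly res r = 0 by rewrite dvdp0.
  apply/polyP => j; rewrite coef_map coef0; have [jn|jn] := ltnP j (N n).
    rewrite -(coef_ev sr jn); have := @ev_mod n q (gam n ^+ j)%g; rewrite -/r => <-; exact: h.
  have -> : r`_j = 0 by apply: nth_default; exact: leq_trans sr jn.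
  exact: rmorph0.
have r0 : map_poly res r = 0.
  apply/eqP; apply: contraTT h => r0; apply/negP => /(dvdp_leq r0).
  rewrite size_exp_XsubC leqNgt ltnS -cardG => /negP; apply.
  exact: leq_trans (size_poly _ _) sr.
move=> g; rewrite (@ev_mod n q) -/r; have [j jn ->] := gam_pow g.
by rewrite (coef_ev sr jn) -coef_map r0 coef0.
Qed.

(** Modulo w, a level is F[X]/(X - 1)^(p^n). If neither y nor z vanishes at level n, then both have
    (X - 1)-valuation less than p^n, hence their product is nonzero at level n + 1. *)
Lemma w_prime : prime_element (cgr_const G w).
Proof.
have const0 a n : res (cgr_coef (cgr_const G a : L) n 1%g) = res a by rewrite coef_const eqxx.
split.
- apply/eqP => h; have w0 : w = 0 by have := @coef_const w 0 1%g; rewrite eqxx mulr1n h coef0_.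
  have /eqP : 1 = 0 :> O by apply: wreg; rewrite w0 mulr0.
  by rewrite oner_eq0.
- move=> /w_dvdP/(_ 0%N 1%g); rewrite -[1]/(cgr_const G 1) const0 rmorph1 => /eqP.
  by rewrite oner_eq0.
move=> y z /w_dvdP hyz; apply: contrapT => /not_orP[/w_dvdP/existsNP[n1 /existsNP[g1 h1]] /w_dvdP/existsNP[n2 /existsNP[g2 h2]]].
have up (x : L) n m : (n <= m)%N -> (forall g, res (cgr_coef x m g) = 0) -> forall g, res (cgr_coef x n g) = 0.
  by move=> /subnK <-; elim: (m - n)%N => // k IH h; apply: IH; exact: w_zero_down.
pose n := maxn n1 n2.
have ny : ~ forall g, res (cgr_coef y n g) = 0 by move=> h; apply: h1; apply: up h _; exact: leq_maxl.
have nz : ~ forall g, res (cgr_coef z n g) = 0 by move=> h; apply: h2; apply: up h _; exact: leq_maxr.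
have [q1 _ e1] := ev_surj n.+1 y; have [q2 _ e2] := ev_surj n.+1 z.
have nd1 : ~~ (('X - 1%:P) ^+ (p ^ n) %| map_poly res q1).
  by apply/negP => /ev_res h; apply: ny => g; rewrite (level_eq_down e1).
have nd2 : ~~ (('X - 1%:P) ^+ (p ^ n) %| map_poly res q2).
  by apply/negP => /ev_res h; apply: nz => g; rewrite (level_eq_down e2).
have : ('X - 1%:P) ^+ (p ^ n.+1) %| map_poly res (q1 * q2).
  by apply/ev_res => g; rewrite evM -(level_eq_mul e1 e2).
have q10 : map_poly res q1 != 0 by apply: contraNneq nd1 => ->; rewrite dvdp0.
have q20 : map_poly res q2 != 0 by apply: contraNneq nd2 => ->; rewrite dvdp0.
rewrite rmorphM -mup_geq ?mulf_neq0 // mupM //.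
move: nd1 nd2; rewrite -!mup_geq // -!ltnNge => l1 l2 h.
have : (p ^ n + p ^ n <= p ^ n.+1)%N by rewrite expnS addnn -mul2n leq_mul2r prime_gt1 ?orbT.
by move=> h3; have := leq_trans h3 h; rewrite leqNgt (ltn_add_aux l1 l2).
Qed.

(** T^k corresponds to (X - 1)^k, which is nonzero at a level n with k < p^n. *)
Lemma w_ndvd_T k : ~ divides (cgr_const G w) ((gamma - 1) ^+ k).
Proof.
have -> : (gamma - 1) ^+ k = ev (('X - 1%:P) ^+ k).
  by elim: k => [|k IH]; rewrite ?expr0 ?exprS ?evM ?evD ?evX -?IH /ev ?rmorphN ?hornerN -/(ev _) ?evC ?rmorph1 ?hornerC.
move=> /w_dvdP/(_ k)/ev_res; rewrite rmorphXn rmorphB /= map_polyX map_polyC /= (rmorph1 res).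
rewrite dvdp_Pexp2l ?size_XsubC // leqNgt => /negP; apply; exact: ltn_expl (prime_gt1 pp).
Qed.

Hypothesis res_surj : forall a, exists x, res x = a.

Let z_unit n (z : L) : (forall g, res (cgr_coef z n g) = (g == 1%g)%:R) -> exists y, level_eq n (z * y) 1.
Proof.
move=> hz; pose S : 'M[O]_(N n) := \matrix_(i, j) cgr_coef (z * gamma ^+ i) n (gam n ^+ j)%g.
have coefz i g : cgr_coef (z * gamma ^+ i) n g = cgr_coef z n (gam n ^- i * g)%g.
  rewrite mulrC; elim: i g => [|i IH] g; first by rewrite expr0 mul1r expg0 invg1 mul1g.
  by rewrite exprS -mulrA coef_gammaM IH expgS invMg mulgA.
have resS : map_mx res S = 1%:M.
  apply/matrixP => i j; rewrite !mxE coefz hz; congr (_%:R); congr nat_of_bool.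
  rewrite -(inj_eq (@mulgI _ (gam n ^+ i)%g)) mulKVg mulg1 eq_expg_mod_order N_order !modn_small //.
  by rewrite eq_sym.
have [u hu] : exists u, u * \det S = 1.
  by apply: res_unit; rewrite -det_map_mx resS det1 oner_neq0.
pose C : 'M[O]_(N n) := u *: \adj S.
have CS : C *m S = 1%:M by rewrite -scalemxAl mul_adj_mx scale_scalar_mx hu.
pose i0 : 'I_(N n) := Ordinal (N_gt0 n).
exists (\sum_i cgr_const G (C i0 i) * gamma ^+ i) => g.
have [j jn ->] := gam_pow g; rewrite mulr_sumr coef_sum_.
have -> : cgr_coef (1 : L) n (gam n ^+ j)%g = (1%:M : 'M[O]_(N n)) i0 (Ordinal jn).
  rewrite -[1]/(cgr_const G 1) coef_const mxE -(expg0 (gam n)) eq_expg_mod_order N_order !modn_small ?N_gt0 //.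
  by rewrite eq_sym.
rewrite -CS mxE; apply: eq_bigr => i _; rewrite mulrCA coef_constM !mxE //.
Qed.

(** At level n, choose a Bezout inverse modulo w of the polynomial representing x; the product is then
    congruent to 1 modulo w, so that the matrix of multiplication by it has unit determinant. *)
Lemma aug_unit (x : L) : res (cgr_coef x 0 1%g) != 0 -> exists y, y * x = 1.
Proof.
move=> hx; apply: cgr_inv_glue => n.
have [q sq eq] := ev_surj n x.
have rq1 : (map_poly res q).[1] != 0.
  apply: contra hx => /eqP h; apply/eqP.
  have : ('X - 1%:P) ^+ (p ^ 0) %| map_poly res q.
    by rewrite expn0 expr1 dvdp_XsubCl; apply/eqP.
  move/ev_res => /(_ 1%g); have e0 : level_eq 0 x (ev q).
    by elim: (n) eq => // k IH /level_eq_down.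
  by rewrite -e0.
have cop : coprimep (map_poly res q) (('X - 1%:P) ^+ (p ^ n)).
  by rewrite coprimep_expr // coprimep_XsubC.
case/Bezout_eq1_coprimepP: cop => -[u v] /= e.
have [v' hv] : exists v' : {poly O}, map_poly res v' = u.
  have /choice[c hc] : forall a, exists x, res x = a by exact: res_surj.
  exists (\poly_(i < size u) c u`_i); apply/polyP => i; rewrite coef_map coef_poly.
  have [iu|iu] := ltnP i (size u); first exact: hc.
  by rewrite [u`_i]nth_default //; exact: rmorph0.
have hz g : res (cgr_coef (x * ev v') n g) = (g == 1%g)%:R.
  have e1 : level_eq n (x * ev v') (ev (q * v')) by rewrite evM; apply: level_eq_mul => //; exact: level_eq_refl.
  have /ev_res/(_ g) : ('X - 1%:P) ^+ (p ^ n) %| map_poly res (q * v' - 1%:P).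
    have -> : map_poly res (q * v' - 1%:P) = - (v * ('X - 1%:P) ^+ (p ^ n)).
      apply/eqP; rewrite rmorphB rmorphM /= hv map_polyC /= rmorph1 -subr_eq0 opprK addrAC [_ * u]mulrC e.
      by rewrite subr_eq0 polyC1.
    by rewrite dvdpNr dvdp_mull.
  rewrite evD coefD rmorphD -e1 /ev rmorphN hornerN -/(ev 1%:P) evC coefN coef_const rmorphN.
  by move/eqP; rewrite subr_eq0 => /eqP ->; case: (g == 1%g); rewrite ?mulr1n ?mulr0n ?rmorph1 ?rmorph0.
have [y hy] := z_unit hz.
by exists (ev v' * y); rewrite mulrA.
Qed.

Section MuBound.
Variables (X : lmodType L) (u0 : X) (m : nat).
Let T : L := gamma - 1.
Hypotheses (genX : forall x : X, exists a y, x = cgr_const G a *: u0 + T *: y)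
  (killX : exists y : X, cgr_const G w ^+ m *: u0 = T *: y).

Let aug (x : L) : O := cgr_coef x 0 1%g.
Let G0_triv (g : G 0) : g = 1%g.
Proof.
have [j] := gam_pow g; rewrite cardG expn0 ltnS leqn0 => /eqP-> ->; exact: expg0.
Qed.
Let augM x y : aug (x * y) = aug x * aug y.
Proof.
rewrite /aug coefM_ (bigD1 1%g) //= big1 => [|h]; first by rewrite addr0 invg1 mul1g.
by rewrite (G0_triv h) eqxx.
Qed.
Let augB x y : aug (x - y) = aug x - aug y. Proof. by rewrite /aug coefD coefN. Qed.
Let augC a : aug (cgr_const G a) = a. Proof. by rewrite /aug coef_const eqxx. Qed.
Let augT : aug T = 0.
Proof.
rewrite /T augB -[1]/(cgr_const G 1) augC /aug -(expr1 gamma) coef_gammaX (G0_triv (_ ^+ 1)%g) eqxx subrr.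
by [].
Qed.
Let aug1 : aug 1 = 1. Proof. exact: (augC 1). Qed.

Let unit_of_aug1 x : aug x = 1 -> exists y, y * x = 1.
Proof. by move=> e; apply: aug_unit; rewrite -/(aug x) e rmorph1 oner_neq0. Qed.

Let wL := cgr_const G w.
Let wL_reg (x : L) : x * wL = 0 -> x = 0.
Proof.
move=> e; apply: cgr_eqP => n g; rewrite coef0_; apply: wreg.
by rewrite mulrC -coef_constM mulrC e coef0_.
Qed.

(** Some T^N maps E into the image of X (pigeonhole in the finite cokernel, 1 - T^k being a
    unit). By the determinant trick T^N E lies in a cyclic module L v0, killed by theta = w^m modulo T.
    Hence all the elementary divisors divide theta T^N, and at most one of them is divisible by w, as
    T^N E has rank one modulo w. So w^n divides theta, and n <= m by augmentation. *)
Lemma mu_bound c n : char_generator X c -> divides (wL ^+ n) c -> (n <= m)%N.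
Proof.
case=> r [P [ms [E [Pprime [q [qsurj qker]] [f [_ [Y [Yfin hY]]]] ->]]]] hdiv.
have [wL0 wL1 wLpr] := w_prime.
(* pigeonhole on T^i y modulo the image of f, and 1 - T^k is a unit *)
have [N1 hN1] : exists N1, forall y, exists x, T ^+ N1 *: y = f x.
  have [ys hys] : exists ys : seq E, forall y, Y y -> y \in ys.
    by move/finite_seqP: Yfin => [ys ->]; exists ys.
  exists (size ys) => y.
  have /choice[x hx] : forall i : nat, exists x, T ^+ i *: y - f x \in ys.
    by move=> i; have [x hx] := hY (T ^+ i *: y); exists x; apply: hys.
  have [i [j [ij js e]]] : exists i j, [/\ (i < j)%N, (j <= size ys)%N & T ^+ i *: y - f (x i) = T ^+ j *: y - f (x j)].
    have idx (i : nat) : (index (T ^+ i *: y - f (x i))%R ys < size ys)%N by rewrite index_mem.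
    pose idF (i : 'I_(size ys).+1) : 'I_(size ys) := Ordinal (idx i).
    have /injectivePn[i [j ij Fij]] : ~~ injectiveb idF.
      by apply/negP => /injectiveP/leq_card; rewrite !card_ord ltnn.
    have e : T ^+ i *: y - f (x i) = T ^+ j *: y - f (x j).
      have := congr1 val Fij => /= e; rewrite -(nth_index 0 (hx i)) e nth_index //.
    have [lt|lt|ee] := ltngtP i j; last by case/eqP: ij; exact/val_inj.
      by exists i, j; split=> //; rewrite -ltnS; exact: ltn_ord.
    by exists j, i; split=> //; rewrite -ltnS; exact: ltn_ord.
  have [v hv] : exists v, v * (1 - T ^+ (j - i)) = 1.
    apply: unit_of_aug1; rewrite augB aug1 (_ : aug (T ^+ _) = 0) ?subr0 //.
    by rewrite -(prednK (_ : 0 < j - i)%N) ?subn_gt0 // exprS augM augT mul0r.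
  have e2 : T ^+ i *: y = f (v *: (x i - x j)).
    rewrite linearZ /= linearB /=.
    have -> : f (x i) - f (x j) = (T ^+ i - T ^+ j) *: y.
      by rewrite scalerBl; exact: sub_swap e.
    have -> : T ^+ i - T ^+ j = (1 - T ^+ (j - i)) * T ^+ i.
      by rewrite mulrBl mul1r -exprD subnK // ltnW.
    by rewrite scalerA mulrA hv mul1r.
  exists (T ^+ (size ys - i) *: (v *: (x i - x j))).
  rewrite linearZ /= -e2 scalerA -exprD subnK //; apply: ltnW; exact: leq_trans ij js.
pose v0 := f u0.
have iter_gen M (x : X) : exists b y, x = b *: u0 + T ^+ M *: y.
  elim: M x => [|M IH] x; first by exists 0, x; rewrite scale0r add0r expr0 scale1r.
  have [a [y ->]] := genX x; have [b [y' ->]] := IH y.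
  exists (cgr_const G a + T * b), y'.
  by rewrite scalerDr !scalerA addrA scalerDl exprS.
pose d i : E := q (delta_mx 0 i).
have spanE y : exists v : 'rV[L]_r, y = \sum_j v 0 j *: d j.
  have [v <-] := qsurj y; exists v; rewrite {1}(row_sum_delta v) linear_sum.
  by apply: eq_bigr => j _; rewrite linearZ.
(* determinant trick, with a matrix congruent to the identity modulo T *)
have dv0 : exists b : 'I_r -> L, forall i, T ^+ N1 *: d i = b i *: v0.
  have /choice[ab hab] : forall i, exists ab : L * 'rV[L]_r,
      T ^+ N1 *: d i = ab.1 *: v0 + \sum_j (T * ab.2 0 j) *: (T ^+ N1 *: d j).
    move=> i; have [x ->] := hN1 (d i); have [b [y ->]] := iter_gen N1.+1 x.
    have [v hv] := spanE (f y); exists (b, v).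
    rewrite linearD !linearZ /= hv scaler_sumr; congr (_ + _); apply: eq_bigr => j _.
    by rewrite !scalerA exprS; congr (_ *: _); ring.
  pose A : 'M[L]_r := \matrix_(i, j) (i == j)%:R - \matrix_(i, j) (T * (ab i).2 0 j).
  have [augR haug] := ring_morphism_of augB (conj aug1 augM).
  have [z hz] : exists z, z * \det A = 1.
    apply: unit_of_aug1; rewrite -haug -det_map_mx (_ : map_mx augR A = 1%:M) ?det1 //.
    by apply/matrixP => i j; rewrite !mxE rmorphB rmorph_nat rmorphM !haug augT mul0r subr0.
  have hA i : \sum_j A i j *: (T ^+ N1 *: d j) = (ab i).1 *: v0.
    under eq_bigr => j _ do rewrite !mxE scalerBl.
    rewrite sumrB (bigD1 i) //= eqxx scale1r big1 => [|j ji]; last by rewrite eq_sym (negbTE ji) scale0r.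
    by rewrite addr0 {1}hab addrK.
  exists (fun k => z * \sum_i \adj A k i * (ab i).1) => k.
  rewrite -scalerA scaler_suml.
  under eq_bigr => i _ do rewrite -scalerA -hA scaler_sumr.
  rewrite exchange_big /=.
  under eq_bigr => j _ do [under eq_bigr => i _ do rewrite scalerA; rewrite -scaler_suml].
  have := mul_adj_mx A => /matrixP eA.
  under eq_bigr => j _ do [have := eA k j; rewrite mxE [X in _ = X]mxE => ->].
  rewrite (bigD1 k) //= eqxx mulr1n big1 => [|j jk]; last by rewrite eq_sym (negbTE jk) mulr0n scale0r.
  by rewrite addr0 scalerA hz scale1r.
have [b hb] := dv0.
have [g hg] : exists g, (wL ^+ m - T * g) *: v0 = 0.
  have [y hy] := killX; have [a [y' ey]] := iter_gen N1 y.
  have [v hv] := spanE (f y'); exists (a + \sum_j v 0 j * b j).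
  have e1 : f y = (a + \sum_j v 0 j * b j) *: v0.
    rewrite ey linearD !linearZ /= hv scalerDl; congr (_ + _).
    rewrite scaler_sumr scaler_suml; apply: eq_bigr => j _.
    by rewrite scalerA mulrC -scalerA hb scalerA.
  by have := congr1 f hy; rewrite !linearZ /= -/v0 -/wL e1 scalerA scalerBl => ->; exact: subrr.
pose theta := wL ^+ m - T * g.
have kill i : divides (P i ^+ ms i) (theta * T ^+ N1).
  have : q ((theta * T ^+ N1) *: delta_mx 0 i) = 0.
    by rewrite linearZ /= -scalerA hb scalerA mulrC -scalerA hg scaler0.
  by move/qker/(_ i); rewrite !mxE !eqxx mulr1.
have [u hu] := qsurj v0.
have rel i j : divides (P j ^+ ms j) (T ^+ N1 * (i == j)%:R - b i * u 0 j).
  have : q (T ^+ N1 *: delta_mx 0 i - b i *: u) = 0.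
    by rewrite linearB !linearZ /= hu hb scalerN; exact: subrr.
  by move/qker/(_ j); rewrite !mxE eqxx /= eq_sym.
have dvT (x y z : L) : divides x y -> divides y z -> divides x z.
  by move=> [a ->] [a' ->]; exists (a' * a); rewrite mulrA.
have dvB (x y z : L) : divides x y -> divides x z -> divides x (y + z).
  by move=> [a ->] [a' ->]; exists (a + a'); rewrite mulrDl.
have dvMr (x y z : L) : divides x y -> divides x (y * z).
  by move=> [a ->]; exists (a * z); rewrite mulrAC.
(* otherwise T^N1 would be divisible by w *)
have uniq_w i l : i != l -> divides wL (P i ^+ ms i) -> ~ divides wL (P l ^+ ms l).
  move=> il wi wl.
  have h1 := dvT _ _ _ wi (rel i i); have h2 := dvT _ _ _ wl (rel i l).
  have h3 := dvT _ _ _ wl (rel l l); move: h1 h2 h3; rewrite !eqxx (negbTE il) mulr1 mulr0 sub0r.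
  move=> h1 [a ha] h3.
  have : divides wL (b i * u 0 l) by exists (- a); rewrite mulNr -ha opprK.
  case/wLpr => [hbi|hul]; apply: (@w_ndvd_T N1).
    by rewrite -(subrK (b i * u 0 i) (T ^+ N1)); apply: dvB => //; exact: dvMr.
  by rewrite -(subrK (b l * u 0 l) (T ^+ N1)); apply: dvB => //; rewrite mulrC; exact: dvMr.
have cancel_w (x y : L) k : ~ divides wL y -> divides (wL ^+ k) (x * y) -> divides (wL ^+ k) x.
  move=> ny; elim: k x => [|k IH] x h; first by exists x; rewrite expr0 mulr1.
  have : divides wL (x * y) by apply: dvT h; exists (wL ^+ k); rewrite exprSr.
  case/wLpr => // -[x' ex]; case: h => a ha.
  have h' : divides (wL ^+ k) (x' * y).
    exists a; apply/eqP; rewrite -subr_eq0; apply/eqP/wL_reg.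
    by rewrite mulrBl mulrAC -ex ha -mulrA -exprSr subrr.
  by have [a' ea] := IH _ h'; exists a'; rewrite ex ea -mulrA -exprSr.
case: n hdiv => // n hdiv.
have [i0 hi0] : exists i0, divides wL (P i0 ^+ ms i0).
  have : divides wL (\prod_i P i ^+ ms i) by apply: dvT hdiv; exists (wL ^+ n); rewrite exprSr.
  by elim/big_ind: _ => // [x y hx hy /wLpr[]|i _ h] //; exists i.
have nR : ~ divides wL (\prod_(i | i != i0) P i ^+ ms i).
  apply: (big_ind (fun x => ~ divides wL x)) => // [x y hx hy /wLpr[]|i ii0 h] //.
  exact: (uniq_w i i0 ii0 h hi0).
have : divides (wL ^+ n.+1) theta.
  apply: (@cancel_w _ (T ^+ N1)); first exact: w_ndvd_T.
  by apply: dvT (kill i0); apply: cancel_w nR _; move: hdiv; rewrite (bigD1 i0).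
case=> z hz; rewrite leqNgt; apply/negP => lt.
have ew : w ^+ m = aug z * w ^+ n.+1.
  have := congr1 aug hz; rewrite /theta augB !augM augT mul0r subr0.
  have augX k : aug (wL ^+ k) = w ^+ k.
    by elim: k => [|k IH]; rewrite ?expr0 ?aug1 // !exprS augM IH augC.
  by rewrite !augX.
have wXreg k x : x * w ^+ k = 0 -> x = 0.
  by elim: k x => [|k IH] x; rewrite ?expr0 ?mulr1 // exprSr mulrA => /wreg/IH.
have : 1 - aug z * w ^+ (n.+1 - m) = 0.
  apply: (@wXreg m); rewrite mulrBl mul1r -mulrA -exprD subnK; last exact: ltnW.
  by rewrite -ew subrr.
move/(congr1 res)/eqP; rewrite rmorphB rmorph1 rmorphM rmorphXn rmorph0.
have -> : res w = 0 by apply/res0; exists 1; rewrite mul1r.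
by rewrite expr0n subn_eq0 leqNgt lt mulr0 subr0 oner_eq0.
Qed.
End MuBound.
End Residue.
End GroupRing.

(** * The coefficient ring of an eigenform *)
Lemma classical_field (A : comNzRingType) :
  (forall x : A, x != 0 -> exists y, y * x = 1) ->
  exists (F : fieldType) (h : {rmorphism A -> F}), injective h /\ forall y, exists x, h x = y.
Proof.
move=> hinv.
have /choice[inv0 hi] : forall x : A, exists z : A, (x != 0 -> z * x = 1) /\ (x = 0 -> z = 0).
  by move=> x; have [->|x0] := eqVneq x 0; [exists 0|have [z hz] := hinv x x0; exists z; split=> // e; rewrite e eqxx in x0].
have mulVf : forall x, x != 0 -> inv0 x * x = 1 by move=> x /(proj1 (hi x)).
have inv00 : inv0 0 = 0 by apply: (proj2 (hi 0)).
pose m := GRing.ComNzRing_isField.Build A mulVf inv00.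
pose F := HB.pack_for fieldType A m.
exists F, (idfun : {rmorphism A -> A}); split=> // y; by exists y.
Qed.

Lemma residue_field_of (A : comNzRingType) (S : {pred A}) :
  idealr_closed S -> (forall x, x \notin S -> exists y, y * x - 1 \in S) ->
  exists (F : fieldType) (res : {rmorphism A -> F}),
    (forall x, res x = 0 <-> x \in S) /\ forall y, exists x, res x = y.
Proof.
move=> S_ideal S_max.
pose I : idealr A := HB.pack S (isIdealr.Build _ S S_ideal).
pose q : {rmorphism A -> {ideal_quot I}} := \pi_({ideal_quot I})%qT.
have q0 x : q x = 0 <-> x \in S.
  rewrite -[x \in S]/(x \in I) -quot_eq0 -[(\pi_(_) x)%qT == 0]/(q x == 0).
  by split=> [->|/eqP].
have qsurj y : exists x, q x = y by exists (repr y); rewrite /q /= reprK.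
have [y|F [h [hinj hsurj]]] := @classical_field {ideal_quot I}.
  have [x <-] := qsurj y => qx; have [|z hz] := S_max x.
    by apply/negP => /q0 e; rewrite e eqxx in qx.
  exists (q z); apply/eqP; rewrite -subr_eq0 -rmorphM -(rmorph1 q) -rmorphB.
  by apply/eqP/q0.
exists F, (h \o q); split=> [x|y].
  rewrite -q0 /=; split=> [e|->]; last by rewrite rmorph0.
  by apply: hinj; rewrite rmorph0.
by have [z <-] := hsurj y; have [x <-] := qsurj z; exists x.
Qed.

Section PadicField.
Variables (R : realType) (p : nat) (C : padicClosure R p).
Hypothesis pp : prime p.
Implicit Types x y z : C.

Lemma pabs0 : pabs (0 : C) = 0. Proof. exact/pabs_eq0. Qed.
Lemma pabsB x y : pabs (x - y) <= Num.max (pabs x) (pabs y).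
Proof. by rewrite -(pabsN y); exact: pabsD. Qed.
Lemma pabsV x : pabs x^-1 = (pabs x)^-1.
Proof.
have [->|x0] := eqVneq x 0; first by rewrite invr0 pabs0 invr0.
have h : pabs x != 0 by apply: contra x0 => /eqP/pabs_eq0 ->.
by apply: (mulfI h); rewrite -pabsM !mulfV // pabs1.
Qed.
Lemma pabs_sum (I : Type) (r : seq I) (P : pred I) (F : I -> C) (e : R) :
  0 < e -> (forall i, P i -> pabs (F i) < e) -> pabs (\sum_(i <- r | P i) F i) < e.
Proof.
move=> e0 h; elim/big_ind: _ => // [|x y hx hy]; first by rewrite pabs0.
by apply: le_lt_trans (pabsD _ _) _; rewrite gt_max hx hy.
Qed.
Lemma pabs_sum_le (I : Type) (r : seq I) (P : pred I) (F : I -> C) (e : R) :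
  0 <= e -> (forall i, P i -> pabs (F i) <= e) -> pabs (\sum_(i <- r | P i) F i) <= e.
Proof.
move=> e0 h; elim/big_ind: _ => // [|x y hx hy]; first by rewrite pabs0.
by apply: le_trans (pabsD _ _) _; rewrite ge_max hx hy.
Qed.
Lemma pabs_int (n : int) : pabs (n%:~R : C) <= 1.
Proof.
have hn (m : nat) : pabs (m%:R : C) <= 1.
  elim: m => [|m IH]; first by rewrite pabs0.
  by rewrite mulrS; apply: le_trans (pabsD _ _) _; rewrite ge_max pabs1 lexx.
by case: n => n; rewrite ?NegzE ?rmorphN ?pabsN; exact: hn.
Qed.
Lemma pinv_lt1 : (p%:R^-1 : R) < 1.
Proof. by rewrite invf_lt1 ?ltr0n ?prime_gt0 // ltr1n prime_gt1. Qed.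
Lemma pabs_dvd (n : int) : (p%:Z %| n)%Z -> pabs (n%:~R : C) <= p%:R^-1.
Proof.
case/dvdzP => q ->; rewrite intrM pabsM -[p%:~R]/(p%:R) pabs_p ler_piMl ?invr_ge0 ?ler0n //.
exact: pabs_int.
Qed.
Lemma pabs_unit (n : int) : ~~ (p%:Z %| n)%Z -> pabs (n%:~R : C) = 1.
Proof.
move=> nd; apply/eqP; rewrite eq_le pabs_int leNgt; apply/negP => lt.
have : coprimez p n by rewrite coprimezE /= prime_coprime.
case/coprimezP => [[u v]] /= e.
have : pabs ((u * p + v * n)%:~R : C) < 1.
  rewrite rmorphD /= !intrM; apply: le_lt_trans (pabsD _ _) _; rewrite gt_max !pabsM.
  rewrite (le_lt_trans _ pinv_lt1) /=; last first.
    by rewrite -[p%:~R]/(p%:R) pabs_p ler_piMl ?invr_ge0 ?ler0n ?pabs_int.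
  by apply: le_lt_trans lt; rewrite ler_piMl ?pabs_ge0 ?pabs_int.
by rewrite e pabs1 ltxx.
Qed.
Lemma pabs_intP (n : int) : pabs (n%:~R : C) < 1 -> (p%:Z %| n)%Z.
Proof. by move=> lt; apply: contraLR lt => /pabs_unit ->; rewrite ltxx. Qed.

Lemma natr_neq0 (n : nat) : (0 < n)%N -> (n%:R : C) != 0.
Proof.
elim/ltn_ind: n => n IH n0; have [d|nd] := boolP (p%:Z %| n%:Z)%Z; last first.
  by apply/eqP => e; have := pabs_unit nd; rewrite -[n%:~R]/(n%:R) e pabs0 => /esym/eqP; rewrite oner_eq0.
have p0 : (p%:R : C) != 0.
  apply/eqP => e; have := @pabs_p R p C; rewrite e pabs0 => /esym/eqP.
  by rewrite invr_eq0 pnatr_eq0 => /eqP e'; move: pp; rewrite e'.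
have /dvdnP[q e] : (p %| n)%N by [].
rewrite e natrM mulf_neq0 // IH //; move: n0; rewrite e muln_gt0 => /andP[] // q0 _.
by rewrite -[ltnLHS]muln1 ltn_pmul2l // prime_gt1.
Qed.
Lemma intr_neq0 (n : int) : n != 0 -> (n%:~R : C) != 0.
Proof.
case: n => [[|n]|n] // _; first exact: natr_neq0.
by rewrite NegzE rmorphN oppr_eq0; exact: natr_neq0.
Qed.

Lemma ratr_rmorph : exists g : {rmorphism rat -> C}, forall q, g q = ratr q.
Proof.
have dn0 (q : rat) : ((denq q)%:~R : C) != 0 by rewrite intr_neq0 ?denq_neq0.
have rE (a b : int) : b != 0 -> ratr (a%:~R / b%:~R : rat) = a%:~R / b%:~R :> C.
  move=> b0; set q := a%:~R / b%:~R.
  have e : (numq q * b = a * denq q)%Z.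
    apply: (@intr_inj rat); rewrite !intrM.
    have := divq_num_den q => h; have dq : (denq q)%:~R != 0 :> rat by rewrite intr_eq0 denq_neq0.
    have bq : b%:~R != 0 :> rat by rewrite intr_eq0.
    have qb : q * b%:~R = a%:~R by rewrite /q divfK.
    by have := congr1 (fun t => t * (denq q)%:~R) h; rewrite divfK // => ->; rewrite mulrAC qb.
  rewrite /ratr; apply/eqP; rewrite eqr_div ?dn0 ?intr_neq0 //.
  by rewrite -!intrM e.
apply: ring_morphism_of => [x y|]; last split=> [|x y].
- rewrite -[in LHS](divq_num_den x) -[in LHS](divq_num_den y).
  rewrite -mulNr addf_div ?intr_eq0 ?denq_neq0 // -rmorphN -!intrM -rmorphD rE ?mulf_neq0 ?denq_neq0 //.
  rewrite /ratr -mulNr addf_div ?dn0 // intrM; congr (_ / _).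
  by rewrite !mulNr rmorphB /= !intrM.
- by rewrite /ratr /= divr1.
rewrite -[in LHS](divq_num_den x) -[in LHS](divq_num_den y).
by rewrite mulf_div -!intrM rE ?mulf_neq0 ?denq_neq0 // /ratr mulf_div !intrM.
Qed.

Definition Qp_pred : {pred C} := fun x => `[< Qp x >].

(** Quotients are approximated by quotients: |1/y - 1/b| is small when b is close to y, as |b| = |y|. *)
Lemma Qp_divring : divring_closed Qp_pred.
Proof.
have [g hg] := ratr_rmorph.
have Qp1 : Qp (1 : C) by move=> e e0; exists 1; rewrite -hg rmorph1 subrr pabs0.
split=> [|x y /asboolP hx /asboolP hy|x y /asboolP hx /asboolP hy]; apply/asboolP => //.
  move=> e e0; have [a ha] := hx e e0; have [b hb] := hy e e0; exists (a - b).
  rewrite -hg rmorphB !hg (_ : x - y - (ratr a - ratr b) = (x - ratr a) - (y - ratr b)); last by ring.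
  by apply: le_lt_trans (pabsB _ _) _; rewrite gt_max ha hb.
have [->|y0] := eqVneq y 0.
  by move=> e e0; exists 0; rewrite -hg rmorph0 invr0 mulr0 subrr pabs0.
have ay : 0 < pabs y by rewrite lt_def pabs_ge0 andbT; apply: contra y0 => /eqP/pabs_eq0 ->.
move=> e e0; pose A := 1 + pabs x; have A0 : 0 < A by rewrite /A ltr_wpDr ?pabs_ge0.
pose d1 := Num.min (pabs y) (e * pabs y ^+ 2 / A).
have d10 : 0 < d1 by rewrite /d1 lt_min ay !(divr_gt0, mulr_gt0, exprn_gt0).
have [b hb] := hy d1 d10.
have yb : pabs (ratr b : C) = pabs y.
  have h1 : pabs (y - ratr b) < pabs y by apply: lt_le_trans hb _; rewrite ge_min lexx.
  apply/eqP; rewrite eq_le; apply/andP; split.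
    rewrite -[ratr b](subrK y); apply: le_trans (pabsD _ _) _.
    by rewrite ge_max lexx andbT -pabsN opprB ltW.
  rewrite leNgt; apply/negP => lt; have := ltxx (pabs y); rewrite -{1}(subrK (ratr b) y).
  by move=> /negP; apply; apply: le_lt_trans (pabsD _ _) _; rewrite gt_max h1 lt.
have d20 : 0 < e * pabs y by rewrite mulr_gt0.
have [a ha] := hx _ d20; exists (a / b).
have b0 : ratr b != 0 :> C by apply/eqP => e1; move: ay; rewrite -yb e1 pabs0 ltxx.
rewrite -hg fmorph_div !hg.
rewrite (_ : x / y - ratr a / ratr b = (x - ratr a) / ratr b + x * (ratr b - y) / (y * ratr b)); last by field; exact/andP.
move: (ratr b : C) yb b0 hb => B yb b0 hb.
apply: le_lt_trans (pabsD _ _) _; rewrite gt_max !pabsM !pabsV !pabsM yb.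
rewrite ltr_pdivrMr // ha /= ltr_pdivrMr ?mulr_gt0 // -[pabs (B - y)]pabsN opprB -expr2.
have : pabs (y - B) < e * pabs y ^+ 2 / A by apply: lt_le_trans hb _; rewrite ge_min lexx orbT.
rewrite ltr_pdivlMr // mulrC; apply: le_lt_trans.
by rewrite ler_wpM2r ?pabs_ge0 // /A lerDr ler01.
Qed.
HB.instance Definition _ := GRing.isDivringClosed.Build C Qp_pred Qp_divring.
Definition QpF := {x : C | x \in Qp_pred}.
HB.instance Definition _ := [isSub of QpF for (@sval _ _)].
HB.instance Definition _ := [Choice of QpF by <:].
HB.instance Definition _ := [SubChoice_isSubIntegralDomain of QpF by <:].
HB.instance Definition _ := [SubIntegralDomain_isSubField of QpF by <:].

Lemma QpFP x : Qp x -> exists a : QpF, val a = x.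
Proof. move=> hx; have h : x \in Qp_pred by exact/asboolP.
by exists (Sub x h); rewrite SubK. Qed.

Definition qspan (I : finType) (g : I -> C) : {pred C} :=
  fun x => `[< exists a : I -> QpF, x = \sum_i val (a i) * g i >].

Lemma qspanP (I : finType) (g : I -> C) x :
  reflect (exists a : I -> QpF, x = \sum_i val (a i) * g i) (x \in qspan g).
Proof. exact: asboolP. Qed.

Lemma qspan_lin (I : finType) (g : I -> C) (a : QpF) x y :
  x \in qspan g -> y \in qspan g -> val a * x + y \in qspan g.
Proof.
move=> /qspanP[b ->] /qspanP[c ->]; apply/qspanP; exists (fun i => a * b i + c i).
rewrite mulr_sumr -big_split; apply: eq_bigr => i _ /=.
by rewrite mulrDl mulrA.
Qed.
Lemma qspan0 (I : finType) (g : I -> C) : 0 \in qspan g.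
Proof. by apply/qspanP; exists (fun=> 0); rewrite big1 // => i _; rewrite mul0r. Qed.
Lemma qspan_gen (I : finType) (g : I -> C) i : g i \in qspan g.
Proof.
apply/qspanP; exists (fun j => (j == i)%:R); rewrite (bigD1 i) //= eqxx mul1r big1 ?addr0 // => j ji.
by rewrite (negbTE ji) mul0r.
Qed.
Lemma qspanD (I : finType) (g : I -> C) x y : x \in qspan g -> y \in qspan g -> x + y \in qspan g.
Proof. by move=> hx hy; rewrite -[x]mul1r; exact: (qspan_lin 1 hx hy). Qed.
Lemma qspanB (I : finType) (g : I -> C) x y : x \in qspan g -> y \in qspan g -> x - y \in qspan g.
Proof. by move=> hx hy; rewrite addrC -mulN1r; exact: (qspan_lin (-1) hy hx). Qed.
Lemma qspan_Qp (I : finType) (g : I -> C) a : 1 \in qspan g -> Qp a -> a \in qspan g.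
Proof.
move=> g1 /QpFP[b <-]; rewrite -[val b]mulr1 -[_ * 1]addr0; exact: qspan_lin (qspan0 g).
Qed.
Lemma qspan_sum (I : finType) (g : I -> C) (J : finType) (a : J -> QpF) (h : J -> C) :
  (forall j, h j \in qspan g) -> \sum_j val (a j) * h j \in qspan g.
Proof.
move=> hh; elim/big_rec: _ => [|j y _ hy]; first exact: qspan0.
exact: qspan_lin.
Qed.

Lemma qspan_prod (I J : finType) (g : I -> C) (h : J -> C) x y :
  x \in qspan g -> y \in qspan h -> x * y \in qspan (fun ij : I * J => g ij.1 * h ij.2).
Proof.
move=> /qspanP[a ->] /qspanP[b ->]; apply/qspanP; exists (fun ij => a ij.1 * b ij.2).
rewrite big_distrlr /= pair_bigA; apply: eq_bigr => -[i j] _ /=.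
by rewrite mulrACA.
Qed.

(** Its equation over Q_p expresses high powers by lower ones. *)
Lemma qspan_powers c : exists d, forall n, c ^+ n \in qspan (fun i : 'I_d => c ^+ i).
Proof.
have [q [q0 qQ rq]] := @padic_algebraic R p C c.
have lq0 : lead_coef q != 0 by rewrite lead_coef_eq0.
have /choice[a ha] : forall i, exists a : QpF, val a = q`_i by move=> i; apply: QpFP; exact: qQ.
pose d := (size q).-1; have sq : size q = d.+1 by rewrite /d prednK // size_poly_gt0.
have ad : val (a d) != 0 by rewrite ha -/(lead_coef q).
exists d; elim/ltn_ind=> n IH; have [nd|dn] := ltnP n d.
  exact: (qspan_gen (fun i : 'I_d => c ^+ i) (Ordinal nd)).
have -> : c ^+ n = \sum_(i < d) val (- (a d)^-1 * a i) * c ^+ (i + (n - d)).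
  have := rootP rq; rewrite horner_coef sq big_ord_recr /= -(ha d) => e.
  have e1 : c ^+ d = - (val (a d))^-1 * \sum_(i < d) q`_i * c ^+ i.
    by apply: (mulfI ad); rewrite mulNr mulrN mulVKf //; apply/eqP; rewrite -subr_eq0 opprK addrC e.
  rewrite -{1}(subnKC dn) exprD e1 mulr_sumr mulr_suml; apply: eq_bigr => i _.
  by rewrite exprD -ha !mulrA.
apply: qspan_sum => i; apply: IH; rewrite -[ltnRHS](subnKC dn) ltn_add2r; exact: ltn_ord.
Qed.

(** The monomials of bounded exponents in finitely many algebraic elements span a ring over Q_p. *)
Lemma finite_ring (cs : seq C) : exists (I : finType) (g : I -> C),
  [/\ 1 \in qspan g, forall x y, x \in qspan g -> y \in qspan g -> x * y \in qspan g
    & {in cs, forall c, c \in qspan g}].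
Proof.
elim: cs => [|c cs [I [g [g1 gM gcs]]]].
  exists 'I_1, (fun=> 1); split=> // [|x y].
    exact: (qspan_gen (fun _ : 'I_1 => 1) ord0).
  move=> /qspanP[a ->] /qspanP[b ->]; apply/qspanP; exists (fun i => a i * b i).
  by rewrite !big_ord1 /= !mulr1.
have [d hd] := qspan_powers c.
pose h (ij : I * 'I_d) := g ij.1 * c ^+ ij.2.
exists (I * 'I_d)%type, h; split=> [|x y /qspanP[a ->] /qspanP[b ->]|x].
- by have := qspan_prod g1 (hd 0%N); rewrite mulr1.
- rewrite mulr_suml; under eq_bigr => i _ do rewrite -mulrA.
  apply: qspan_sum => -[i j]; rewrite mulr_sumr; under eq_bigr => i' _ do rewrite mulrCA.
  apply: qspan_sum => -[i' j']; rewrite /h /= mulrACA -exprD; apply: qspan_prod (hd _).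
  by apply: gM; exact: qspan_gen.
rewrite inE => /orP[/eqP ->|/gcs hx].
  by have := qspan_prod g1 (hd 1%N); rewrite mul1r.
by have := qspan_prod hx (hd 0%N); rewrite mulr1.
Qed.

(** The inverse of an algebraic element is a polynomial in it. *)
Lemma qspan_inv (I : finType) (g : I -> C) x :
  1 \in qspan g -> (forall x y, x \in qspan g -> y \in qspan g -> x * y \in qspan g) ->
  x \in qspan g -> x^-1 \in qspan g.
Proof.
move=> g1 gM xg; have [->|x0] := eqVneq x 0; first by rewrite invr0 qspan0.
have gX n : x ^+ n \in qspan g by elim: n => [|n IH]; rewrite ?expr0 // exprS gM.
have [q [q0 qQ rq]] := @padic_algebraic R p C x.
have {q q0 qQ rq} [q [q0 qQ rq]] : exists q : {poly C}, [/\ (q`_0)%R != 0, forall i, Qp (q`_i)%R & root q x].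
  elim: {q}(size q) {-2}q (leqnn (size q)) q0 qQ rq => [|n IH] q sq q0 qQ rq.
    by move: q0; rewrite -size_poly_eq0; move: sq; rewrite leqn0 => ->.
  have [e|] := eqVneq (q`_0)%R 0; last by exists q.
  have qE : q = drop_poly 1 q * 'X.
    apply/polyP => i; rewrite coefMX coef_drop_poly; case: i => [|i] //=; by rewrite addn1.
  apply: (IH (drop_poly 1 q)).
  - by rewrite size_drop_poly leq_subLR add1n.
  - by apply: contra q0 => /eqP e1; rewrite qE e1 mul0r.
  - by move=> i; rewrite coef_drop_poly.
  have : root (drop_poly 1 q * 'X) x by rewrite -qE.
  by rewrite rootM rootX (negbTE x0) orbF.
have /choice[a ha] : forall i, exists a : QpF, val a = (q`_i)%R by move=> i; apply: QpFP; exact: qQ.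
have sq : (0 < size q)%N by rewrite lt0n; apply: contra q0 => /eqP e; rewrite nth_default ?e.
have := rootP rq; rewrite horner_coef -(prednK sq) big_ord_recl expr0 mulr1 /= -ha => e.
have a0 : val (a 0%N) != 0 by rewrite ha.
have -> : x^-1 = \sum_(i < (size q).-1) val (- (a 0%N)^-1 * a i.+1) * x ^+ i.
  apply: (mulfI x0); rewrite mulfV // mulr_sumr.
  have e1 : \sum_(i < (size q).-1) val (a i.+1) * x ^+ i.+1 = - val (a 0%N).
    by apply/eqP; rewrite -addr_eq0 addrC; apply/eqP; rewrite -{2}e; congr (_ + _); apply: eq_bigr => i _; rewrite ha.
  transitivity (- (val (a 0%N))^-1 * \sum_(i < (size q).-1) val (a i.+1) * x ^+ i.+1).
    by rewrite e1 mulrNN mulVf.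
  rewrite mulr_sumr; apply: eq_bigr => i _; rewrite rmorphM rmorphN fmorphV exprS; ring.
exact: qspan_sum.
Qed.

(** Divide a relation by its largest coefficient. *)
Lemma Qp_relation (I : finType) (g : I -> C) n (x : 'I_n -> C) :
  (#|I| < n)%N -> (forall i, x i \in qspan g) ->
  exists (a : 'I_n -> C) (i0 : 'I_n), [/\ forall i, Qp (a i) /\ pabs (a i) <= 1, a i0 = 1 & \sum_i a i * x i = 0].
Proof.
move=> lt hx; have /choice[A hA] : forall i, exists a : I -> QpF, x i = \sum_j val (a j) * g j.
  by move=> i; exact/qspanP/hx.
pose M : 'M[QpF]_(n, #|I|) := \matrix_(i, j) A i (enum_val j).
have : kermx M != 0.
  rewrite kermx_eq0 /row_free; apply/eqP => e; move: lt; rewrite ltnNge -e => /negP; apply.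
  exact: rank_leq_col.
case/rowV0Pn => v /sub_kermxP vM v0.
have [i0 _ hi0] : exists2 i0, true & forall i, pabs (val (v 0 i)) <= pabs (val (v 0 i0)).
  have /rV0Pn[i1 _] := v0.
  exists [arg max_(i > i1) pabs (val (v 0 i))]%O => // i.
  by case: Order.TotalTheory.arg_maxP => // k _ /(_ i); apply.
have vi0 : val (v 0 i0) != 0.
  have /rV0Pn[i1 hi1] := v0; apply: contra hi1 => /eqP e.
  apply/eqP/val_inj; apply/pabs_eq0/le_anti; rewrite pabs_ge0 andbT; move: (hi0 i1); rewrite e pabs0.
  by [].
have av : 0 < pabs (val (v 0 i0)) by rewrite lt_def pabs_ge0 andbT; apply: contra vi0 => /eqP/pabs_eq0 ->.
exists (fun i => val (v 0 i / v 0 i0)), i0; split.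
- move=> i; split; first by have /asboolP := valP (v 0 i / v 0 i0).
  by rewrite fmorph_div pabsM pabsV ler_pdivrMr // mul1r; exact: hi0.
- by rewrite fmorph_div divff.
have e j : \sum_i val (v 0 i) * val (A i j) = 0.
  have := congr1 (fun B : 'rV_ _ => val (B 0 (enum_rank j))) vM; rewrite !mxE rmorph_sum /=.
  by move=> e; rewrite -[RHS]e; apply: eq_bigr => i _; rewrite mxE enum_rankK.
transitivity ((val (v 0 i0))^-1 * \sum_j (\sum_i val (v 0 i) * val (A i j)) * g j); last first.
  by rewrite big1 ?mulr0 // => j _; rewrite e mul0r.
under [in RHS]eq_bigr => j _ do rewrite mulr_suml.
rewrite exchange_big mulr_sumr; apply: eq_bigr => i _ /=.
rewrite {1}hA !mulr_sumr; apply: eq_bigr => j _.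
by rewrite -!mulrA mulrCA.
Qed.

(** A rational approximation of it has denominator prime to p, which can be inverted modulo p. *)
Lemma Qp_int (a : C) : Qp a -> pabs a <= 1 -> exists b : int, pabs (a - b%:~R) < 1.
Proof.
have [h hh] := ratr_rmorph.
move=> aQ a1; have [q hq] := aQ 1 ltr01.
have q1 : pabs (ratr q : C) <= 1.
  rewrite -(subrK a (ratr q)); apply: le_trans (pabsD _ _) _; rewrite ge_max a1 andbT.
  by rewrite -pabsN opprB ltW.
have nd : ~~ (p%:Z %| denq q)%Z.
  apply/negP => pd; have pn : ~~ (p%:Z %| numq q)%Z.
    have := coprime_num_den q; apply: contraL => pn.
    apply/negP => /eqP e; have : (p %| gcdn `|numq q| `|denq q|)%N by rewrite dvdn_gcd; apply/andP.
    by rewrite e dvdn1 => /eqP e1; move: pp; rewrite e1.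
  move: q1; rewrite /ratr pabsM (pabs_unit pn) mul1r pabsV invf_le1; last first.
    rewrite lt_def pabs_ge0 andbT; apply/eqP => /pabs_eq0/eqP; apply/negP.
    by apply: intr_neq0; exact: denq_neq0.
  by rewrite leNgt => /negP; apply; apply: le_lt_trans (pabs_dvd pd) pinv_lt1.
have : coprimez p (denq q) by rewrite coprimezE /= prime_coprime.
case/coprimezP => [[u v]] /= e; exists (numq q * v).
have ce : (u%:~R * p%:R + v%:~R * (denq q)%:~R : C) = 1.
  by rewrite -[p%:R]/(p%:~R) -!intrM -intrD e.
have dn : ((denq q)%:~R : C) != 0 by rewrite intr_neq0 ?denq_neq0.
have -> : a - (numq q * v)%:~R = (a - ratr q) + ratr q * (u%:~R * p%:R).
  have -> : u%:~R * p%:R = 1 - v%:~R * (denq q)%:~R :> C by rewrite -[X in X - _]ce addrK.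
  rewrite intrM mulrBr mulr1 addrA subrK; congr (_ - _).
  by rewrite /ratr mulrCA mulrC divfK // mulrC.
apply: le_lt_trans (pabsD _ _) _; rewrite gt_max hq /= [pabs (ratr q * _)]pabsM [pabs (_ * p%:R)]pabsM pabs_p.
apply: le_lt_trans pinv_lt1; rewrite mulrA ler_piMl ?invr_ge0 ?ler0n //.
by rewrite mulr_ile1 ?pabs_ge0 ?pabs_int.
Qed.
End PadicField.

Section HeckeInt.
Variables (R : realType) (p : nat) (C : padicClosure R p) (f : nat -> C) (w : hecke_int f).
Hypotheses (pp : prime p) (uw : uniformizer w).
Notation O := (hecke_int f).
Implicit Types x y z : O.

Definition vabs (x : O) : R := pabs (val (val x)).

Lemma vabsM x y : vabs (x * y) = vabs x * vabs y.
Proof. by rewrite /vabs !rmorphM pabsM. Qed.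
Lemma vabsD x y : vabs (x + y) <= Num.max (vabs x) (vabs y).
Proof. by rewrite /vabs !rmorphD pabsD. Qed.
Lemma vabs_ge0 x : 0 <= vabs x. Proof. exact: pabs_ge0. Qed.
Lemma vabs1 : vabs 1 = 1. Proof. by rewrite /vabs !rmorph1 pabs1. Qed.
Lemma vabs0 x : vabs x = 0 <-> x = 0.
Proof.
split=> [/pabs_eq0 h|->]; last by apply/pabs_eq0; rewrite !rmorph0.
by do 2! apply: val_inj; rewrite h !rmorph0.
Qed.
Lemma vabsX x n : vabs (x ^+ n) = vabs x ^+ n.
Proof. by elim: n => [|n IH]; rewrite ?expr0 ?vabs1 // !exprS vabsM IH. Qed.
Lemma vabs_le1 x : vabs x <= 1. Proof. exact: (valP x). Qed.
Lemma mk_hecke_int (x : hecke_field f) : pabs (val x) <= 1 -> exists y : O, val y = x.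
Proof. by move=> h; exists (exist _ x h). Qed.

Lemma vabs_lt1 x : vabs x < 1 <-> exists y, x = y * w.
Proof.
split=> [/(proj2 uw)//|[y ->]]; rewrite vabsM; apply: le_lt_trans (proj1 uw).
by rewrite ler_piMl ?vabs_ge0 ?vabs_le1.
Qed.
Lemma vabs_intr (n : int) : vabs n%:~R = pabs (n%:~R : C).
Proof. by rewrite /vabs !rmorph_int. Qed.
Lemma vabs_int_lt1 (n : int) : vabs n%:~R < 1 <-> (p%:Z %| n)%Z.
Proof.
rewrite vabs_intr; split=> [|h]; first exact: pabs_intP.
by apply: le_lt_trans (pabs_dvd _ h) (pinv_lt1 _ pp).
Qed.
Lemma p_dvd_w : exists y, p%:R = y * w.
Proof. by apply/vabs_lt1; rewrite -[p%:R]/(p%:Z%:~R); apply/vabs_int_lt1; rewrite dvdzz. Qed.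
Lemma w_neq0 : val (val w) != 0.
Proof.
apply/eqP => h; have w0 : w = 0 by apply/vabs0/pabs_eq0.
have [y e] := p_dvd_w; have /negP := natr_neq0 C pp (prime_gt0 pp); apply.
by apply/eqP; have := congr1 (fun t => val (val t)) e; rewrite w0 mulr0 !rmorph_nat !rmorph0.
Qed.
Lemma vabs_w_gt0 : 0 < vabs w.
Proof. by rewrite lt_def pabs_ge0 andbT; apply: contra w_neq0 => /eqP/pabs_eq0 ->. Qed.
Lemma hecke_wreg x : x * w = 0 -> x = 0.
Proof.
move=> e; apply/vabs0/eqP; have /eqP := (vabs0 (x * w)).2 e.
by rewrite vabsM mulf_eq0 (gt_eqF vabs_w_gt0) orbF.
Qed.
Lemma hecke_unit x : vabs x = 1 -> exists y, y * x = 1.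
Proof.
move=> h; have x0 : val x != 0.
  by apply/eqP => e; move/eqP: h; rewrite /vabs e rmorph0 pabs0 eq_sym oner_eq0.
have [|y hy] := @mk_hecke_int (val x)^-1; first by rewrite fmorphV pabsV -/(vabs x) h invr1.
by exists y; apply: val_inj; rewrite -[LHS]/(val y * val x) hy mulVf.
Qed.

Lemma hecke_residue : exists (F : fieldType) (res : {rmorphism O -> F}),
  [/\ forall x, res x = 0 <-> exists y, x = y * w,
      forall x, res x != 0 -> exists y, y * x = 1
    & forall a, exists x, res x = a].
Proof.
pose S : {pred O} := fun x => vabs x < 1.
have SE x : (x \in S) = (vabs x < 1) by [].
have [||F [res [res0 rsurj]]] := @residue_field_of _ S.
- split; rewrite ?SE; first by rewrite (vabs0 0).2 // ltr01.
    by rewrite vabs1 ltxx.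
  move=> a x y; rewrite !SE => hx hy; apply: le_lt_trans (vabsD _ _) _; rewrite gt_max hy andbT.
  by rewrite vabsM; apply: le_lt_trans hx; rewrite ler_piMl ?vabs_ge0 ?vabs_le1.
- move=> x; rewrite SE -leNgt => h; have [|y e] := @hecke_unit x; first by apply/le_anti; rewrite vabs_le1.
  by exists y; rewrite e subrr SE (vabs0 0).2 // ltr01.
exists F, res; split=> // [x|x].
  by rewrite res0 SE; exact: vabs_lt1.
move=> h; apply: hecke_unit; apply/le_anti; rewrite vabs_le1 /= leNgt.
by apply: contra h => h; apply/eqP/res0.
Qed.

(** The powers of |w| tend to 0, so that x is not divisible by all the powers of w. *)
Lemma hecke_ord x : x != 0 -> exists m v, x = v * w ^+ m /\ vabs v = 1.
Proof.
move=> x0; have ax : 0 < vabs x by rewrite lt_def vabs_ge0 andbT; apply: contra x0 => /eqP/vabs0 ->.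
apply: contrapT => nex.
have dv n : exists y, x = y * w ^+ n.
  elim: n => [|n [y ey]]; first by exists x; rewrite mulr1.
  have : vabs y < 1.
    rewrite lt_def vabs_le1 andbT; apply/eqP => y1; apply: nex; by exists n, y.
  by case/vabs_lt1 => z ez; exists z; rewrite ey ez -mulrA -exprS.
pose b := 1 - vabs w; have b0 : 0 < b by rewrite subr_gt0; exact: (proj1 uw).
have bern n : vabs w ^+ n * (1 + n%:R * b) <= 1.
  elim: n => [|n IH]; first by rewrite mul0r addr0 mulr1.
  apply: le_trans IH; rewrite exprSr -mulrA ler_wpM2l ?exprn_ge0 ?vabs_ge0 //.
  rewrite (_ : vabs w = 1 - b); last by rewrite /b; ring.
  rewrite mulrSr -subr_ge0 (_ : _ - _ = (n%:R + 1) * b ^+ 2); last by ring.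
  by apply: mulr_ge0; [rewrite addr_ge0 ?ler0n ?ler01 | exact/exprn_ge0/ltW].
have [n hn] : exists n : nat, (vabs x)^-1 < n%:R * b.
  exists (Num.bound ((vabs x)^-1 / b)); rewrite -ltr_pdivrMr //.
  by apply: archi_boundP; rewrite divr_ge0 ?invr_ge0 ?vabs_ge0 // ltW.
have [y ey] := dv n; have : vabs x <= vabs w ^+ n.
  by rewrite ey vabsM vabsX ler_piMl ?exprn_ge0 ?vabs_ge0 ?vabs_le1.
have := bern n; have : 1 < vabs x * (1 + n%:R * b).
  by rewrite -ltr_pdivrMl // mulr1; apply: lt_le_trans hn _; rewrite lerDr ler01.
have c0 : 0 <= 1 + n%:R * b by rewrite addr_ge0 ?mulr_ge0 ?ler0n ?ler01 // ltW.
by move=> h1 h2 h3; have := lt_le_trans h1 (le_trans (ler_wpM2r c0 h3) h2); rewrite ltxx.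
Qed.

Lemma ord_atE (x : hecke_field f) y m v : val y = x -> y = v * w ^+ m -> vabs v = 1 ->
  ord_at w x = (m%:Z)%:E.
Proof.
move=> <- e hv; rewrite /ord_at.
have hm : pabs (val (val y)) = pabs (val (val w)) ^ (m%:Z).
  by rewrite -/(vabs y) e vabsM hv mul1r vabsX.
have -> : (val y == 0) = false.
  apply/negbTE/eqP => y0; move: hm; rewrite y0 rmorph0 pabs0 => /esym/eqP.
  by rewrite expf_eq0 (gt_eqF vabs_w_gt0) andbF.
congr (_%:E); have := @xgetPex _ 0 [set n : int | pabs (val (val y)) = pabs (val (val w)) ^ n] (ex_intro _ (m : int) hm).
rewrite /= {1}hm; move/ieexprIz => -> //; first exact: vabs_w_gt0.
by rewrite lt_eqF //; exact: (proj1 uw).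
Qed.

(** A relation over Q_p with largest coefficient 1 reduces to a nontrivial relation over F_p. *)
Lemma residue_bound (k : nat) : cusp_space R p k f -> exists D, forall n (x : 'I_n -> O), (D < n)%N ->
  exists b : 'I_n -> int, (exists i, ~~ (p%:Z %| b i)%Z) /\ exists y, \sum_i (b i)%:~R * x i = y * w.
Proof.
case=> r [c [bb [_ fE]]].
have [I [g [g1 gM gc]]] := finite_ring pp [seq c i | i <- enum 'I_r].
have gQ (a : C) : Qp a -> a \in qspan g by exact: (qspan_Qp pp).
have gK (x : hecke_field f) : val x \in qspan g.
  have /asboolP := valP x; apply.
  - split=> [|u v hu hv|u v hu hv]; [exact: g1| |exact: gM _ _ hu (qspan_inv pp g1 gM hv)].
    exact: (qspanB pp).
  - exact: gQ.
  move=> n; rewrite fE; elim/big_ind: _ => [|u v hu hv|i _]; first exact: (qspan0 pp).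
    exact: (qspanD pp).
  apply: gM; first by apply: gc; rewrite map_f ?mem_enum.
  by apply: gQ => e e0; exists (bb i n)%:~R; rewrite ratr_int subrr pabs0.
exists #|I| => n x lt.
have [a [i0 [ha ai0 e]]] := Qp_relation pp lt (fun i => gK (val (x i))).
have /choice[b hb] : forall i, exists b : int, pabs (a i - b%:~R) < 1.
  by move=> i; case: (ha i) => h1 h2; exact: Qp_int.
exists b; split.
  exists i0; apply/negP => /(pabs_dvd C) h; have := hb i0; rewrite ai0 => h1.
  have := ltxx (1 : R); rewrite -{1}(pabs1 C) -(subrK (b i0)%:~R 1) => /negP; apply.
  apply: le_lt_trans (pabsD _ _) _; rewrite gt_max h1 /=.
  exact: le_lt_trans h (pinv_lt1 _ pp).
apply/vabs_lt1; rewrite /vabs.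
have -> : val (val (\sum_i (b i)%:~R * x i)) = \sum_i ((b i)%:~R - a i) * val (val (x i)).
  transitivity (\sum_i (b i)%:~R * val (val (x i))).
    by rewrite !rmorph_sum; apply: eq_bigr => i _; rewrite !rmorphM !rmorph_int.
  under [RHS]eq_bigr => i _ do rewrite mulrBl.
  by rewrite sumrB e subr0.
apply: pabs_sum => // i _; rewrite pabsM -[pabs (_ - _)]pabsN opprB.
apply: le_lt_trans (hb i); rewrite ler_piMr ?pabs_ge0 //; exact: vabs_le1.
Qed.

(** A maximal family independent over F_p. *)
Lemma residue_basis (k : nat) : cusp_space R p k f -> exists d (e : 'I_d -> O),
  (forall b : 'I_d -> int, (exists y, \sum_i (b i)%:~R * e i = y * w) -> forall i, (p%:Z %| b i)%Z) /\
  forall x, exists (b : 'I_d -> int) y, x = \sum_i (b i)%:~R * e i + y * w.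
Proof.
case/residue_bound => D hD.
pose indep d (e : 'I_d -> O) := forall b : 'I_d -> int,
  (exists y, \sum_i (b i)%:~R * e i = y * w) -> forall i, (p%:Z %| b i)%Z.
have [d [[e he] dmax]] : exists d, (exists e, @indep d e) /\ forall d', (exists e, @indep d' e) -> (d' <= d)%N.
  pose Q d := `[< exists e, @indep d e >].
  have Qb d : Q d -> (d <= D)%N.
    move=> /asboolP[e he]; rewrite leqNgt; apply/negP => lt; have [b [[i /negP ni] hb]] := hD d e lt.
    by apply: ni; exact: he.
  have Q0 : exists d, Q d by exists 0%N; apply/asboolP; exists (fun=> 0) => b _ [].
  case: (ex_maxnP Q0 Qb) => d /asboolP hd dm; exists d; split=> // d' h; apply: dm; exact/asboolP.
exists d, e; split=> // x.
apply: contrapT => nx.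
suff : (d.+1 <= d)%N by rewrite ltnn.
apply: dmax; exists (fun i => oapp e x (unlift ord0 i)) => b [y].
rewrite big_ord_recl unlift_none /=; under eq_bigr => i _ do rewrite liftK.
move=> hb; have b0 : (p%:Z %| b ord0)%Z.
  apply: contrapT => /negP nd; apply: nx.
  have : coprimez p (b ord0) by rewrite coprimezE /= prime_coprime.
  case/coprimezP => [[u v]] /= ce; have [z hz] := p_dvd_w.
  exists (fun i => - (v * b (lift ord0 i))), (u%:~R * z * x + v%:~R * y).
  have ex : x = u%:~R * p%:R * x + v%:~R * ((b ord0)%:~R * x).
    by rewrite [X in _ + X]mulrA -mulrDl -[p%:R]/(p%:~R) -!intrM -intrD ce mul1r.
  have hbx : (b ord0)%:~R * x = y * w - \sum_(i < d) (b (lift ord0 i))%:~R * e i by rewrite -hb addrK.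
  rewrite {1}ex hbx hz mulrBr mulr_sumr addrCA addrC; under [in RHS]eq_bigr => i _ do rewrite mulrNz mulNr intrM -mulrA.
  rewrite sumrN; ring.
have [z hz] := p_dvd_w; have /dvdzP[q hq] := b0.
move=> i; case: (unliftP ord0 i) => [i' ->|-> //].
apply: he (fun i => b (lift ord0 i)) _ i'; exists (y - q%:~R * z * x).
rewrite mulrBl -hb hq intrM -[p%:~R]/(p%:R) hz; ring.
Qed.
End HeckeInt.

(** * Characters to Q/Z and residual cocycles *)
Lemma QZ_divisible (q : QZ) (n : nat) : (0 < n)%N -> exists r : QZ, r *+ n = q.
Proof.
move=> n0; exists (\pi_QZ (repr q / n%:R))%qT.
rewrite -(raddfMn (\pi_(Quotient.quot int_rat)%qT)) -[in RHS](reprK q); congr (\pi_(_)%qT _).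
by rewrite -(mulr_natr (repr q / _)) divfK // pnatr_eq0 -lt0n.
Qed.

Lemma mulrz_divz (V : zmodType) (x : V) (m : int) (d : nat) :
  x *~ m = x *+ d *~ (m %/ d)%Z + x *~ (m %% d)%Z.
Proof. by rewrite {1}(divz_eq m d) mulrzDr mulrC mulrzA -pmulrn. Qed.

(** Injectivity of Q/Z, by Zorn's lemma on graphs of partial extensions: to extend to one more element
    x, divide the value prescribed on the least positive multiple of x in the domain. *)
Lemma QZ_extend (A : zmodType) (D : set A) (h : A -> QZ) :
  D 0 -> (forall x y, D x -> D y -> D (x - y)) ->
  (forall x y, D x -> D y -> h (x - y) = h x - h y) ->
  exists chi : {additive A -> QZ}, forall x, D x -> chi x = h x.
Proof.
move=> D0 DB hB.
pose good (X : set (A * QZ)) := [/\ X 0, forall u v, X u -> X v -> X (u - v),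
  forall q, X (0, q) -> q = 0 & forall x, D x -> X (x, h x)].
pose X0 : set (A * QZ) := [set u | D u.1 /\ u.2 = h u.1].
have h0 : h 0 = 0 by rewrite -(subr0 0) hB // subrr.
have gX0 : good X0.
  split=> [|u v [Du eu] [Dv ev]|q [_ /= ->]|x Dx] //.
  by split; [exact: DB | rewrite /= hB // -eu -ev].
have [F FP Ftot|X [Xgood Xmax]] := @Zorn_bigcup (A * QZ)%type (fun X => X = set0 \/ good X).
  have [[Y FY gY]|no] := pselect (exists2 X, F X & good X); last first.
    left; apply/seteqP; split=> // x [X FX Xx].
    by case: (FP X FX) => [e|gX]; [rewrite e in Xx | case: no; exists X].
  right; have gX X x : F X -> X x -> good X.
    by move=> FX Xx; case: (FP X FX) => // e; rewrite e in Xx.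
  case: (gY) => Y0 _ _ Yh; split.
  - by exists Y.
  - move=> u v [U FU Uu] [V FV Vv].
    have [_ UB _ _] := gX U u FU Uu; have [_ VB _ _] := gX V v FV Vv.
    by case: (Ftot U V FU FV) => s; [exists V => //; apply: VB => //; exact: s | exists U => //; apply: UB => //; exact: s].
  - by move=> q [U FU Uq]; have [_ _ Uf _] := gX U _ FU Uq; exact: Uf.
  - by move=> x Dx; exists Y => //; exact: Yh.
have gX : good X.
  case: Xgood => // e; exfalso; apply: (Xmax X0); last by right.
  rewrite e; split=> // h1; have : (set0 : set (A * QZ)) 0 by apply: h1; case: gX0.
  by [].
case: (gX) => X00 XB Xf Xh.
have XN u : X u -> X (- u) by move=> hu; rewrite -sub0r; exact: XB.
have XNp a b : X (a, b) -> X (- a, - b) by move=> hu; exact: XN _ hu.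
have XD u v : X u -> X v -> X (u + v) by move=> hu hv; rewrite -[v]opprK; apply: XB => //; exact: XN.
have XMn x q n : X (x, q) -> X (x *+ n, q *+ n).
  move=> hu; elim: n => [|n IH]; first by rewrite !mulr0n.
  by rewrite !mulrS; exact: (XD _ _ hu IH).
have XMz x q (m : int) : X (x, q) -> X (x *~ m, q *~ m).
  by case: m => n hu; [exact: XMn | rewrite NegzE !mulrNz; exact/XNp/XMn].
have Xuniq x q q' : X (x, q) -> X (x, q') -> q = q'.
  move=> hq hq'; apply/eqP; rewrite -subr_eq0; apply/eqP/Xf.
  by have := XB _ _ hq hq'; rewrite /GRing.add /GRing.opp /= /add_pair /= subrr.
have total x : exists q, X (x, q).
  have [q hq] : exists q, forall (m : int) v, X (x *~ m, v) -> q *~ m = v.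
    have [[n [n0 [v hv]]]|no] := pselect (exists n, (0 < n)%N /\ exists v, X (x *+ n, v)); last first.
      exists 0 => m v hm; rewrite mul0rz; have [e|m0] := eqVneq m 0.
        by apply/esym/Xf; rewrite e mulr0z in hm.
      case: no; exists `|m|%N; rewrite absz_gt0; split=> //.
      case: m hm m0 => n hm _; first by exists v.
      by exists (- v); have := XNp _ _ hm; rewrite NegzE mulrNz opprK.
    have ex : exists n, (0 < n)%N && `[< exists v, X (x *+ n, v) >].
      by exists n; rewrite n0; apply/asboolP; exists v.
    case: (ex_minnP ex) => d /andP[d0 /asboolP[u hu]] dmin {n n0 v hv}.
    have [q qd] := QZ_divisible u d0; exists q => m v hm.
    have e := divz_eq m d; have hr : X (x *~ (m %% d)%Z, v - u *~ (m %/ d)%Z).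
      have := XB _ _ hm (XMz _ _ (m %/ d)%Z hu).
      rewrite (_ : x *~ (m %% d)%Z = x *~ m - x *+ d *~ (m %/ d)%Z) //.
      by rewrite [x *~ m](mulrz_divz _ _ d) addrC addKr.
    have r0 : (m %% d)%Z = 0.
      have := modz_ge0 m (lt0r_neq0 (d0 : 0 < d%:Z)); have := ltz_mod m (lt0r_neq0 (d0 : 0 < d%:Z)).
      case: (m %% d)%Z hr => // -[|r] // hr lt _; have := dmin r.+1.
      have -> : `[< exists v, X (x *+ r.+1, v) >] by apply/asboolP; exists (v - u *~ (m %/ d)%Z).
      by move=> /(_ isT); rewrite leqNgt -ltz_nat lt.
    move: hr; rewrite r0 mulr0z => /Xf/eqP; rewrite subr_eq0 => /eqP ->.
    by rewrite {1}e r0 addr0 mulrC mulrzA -pmulrn qd.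
  exists q; apply: contrapT => nX.
  pose X' : set (A * QZ) := [set u | exists v (m : int), X v /\ u = (v.1 + x *~ m, v.2 + q *~ m)].
  apply: (Xmax X').
    split=> [[a b] hv|h1]; first by exists (a, b), 0; rewrite !mulr0z !addr0.
    by apply: nX; apply: h1; exists 0, 1; rewrite !mulr1z !add0r.
  right; split.
  - by exists 0, 0; rewrite !mulr0z !addr0.
  - move=> _ _ [u [m [hu ->]]] [v [n [hv ->]]]; exists (u - v), (m - n); split; first exact: XB.
    by rewrite !mulrzBr /=; congr pair; rewrite /= opprD addrACA.
  - move=> r [[a b] [m [hv [/= e ->]]]].
    have := hq m (- b); rewrite (_ : x *~ m = - a); last by apply/eqP; rewrite -addr_eq0 addrC -e.
    by move=> ->; rewrite ?subrr //; exact: (XN _ hv).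
  by move=> y Dy; exists (y, h y), 0; rewrite !mulr0z !addr0; split=> //; exact: Xh.
have /choice[g hg] := total.
have [|chi hchi] := @additive_of A QZ g.
  by move=> x y; apply: Xuniq (hg _) _; exact: (XB _ _ (hg x) (hg y)).
by exists chi => x Dx; rewrite hchi; exact: Xuniq (hg x) (Xh x Dx).
Qed.

Lemma QZ_separates (A : zmodType) (x : A) : x != 0 -> exists chi : {additive A -> QZ}, chi x != 0.
Proof.
move=> x0.
(* the order of x, or 2 if it is infinite *)
have [q q0 hq] : exists2 q : QZ, q != 0 & forall m : int, x *~ m = 0 -> q *~ m = 0.
  have half n : (1 < n)%N -> exists2 q : QZ, q != 0 & q *+ n = 0.
    move=> n1; have n0 : (0 < n)%N by exact: ltnW.
    have nq : n%:R != 0 :> rat by rewrite pnatr_eq0 -lt0n.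
    exists (\pi_QZ (n%:R^-1))%qT.
      rewrite quot_eq0; apply/negP => /intrP[z hz].
      have : (z * n == 1)%Z by rewrite -(eqr_int rat) intrM -hz -[n%:~R]/(n%:R) mulVf.
      by move/eqP/(congr1 absz); rewrite abszM => /eqP; rewrite muln_eq1 => /andP[_ e]; move: n1; rewrite (eqP (e : n == 1%N)).
    rewrite -(raddfMn (\pi_(Quotient.quot int_rat)%qT)) -(mulr_natr n%:R^-1) mulVf //; apply/eqP; rewrite quot_eq0.
    exact: rpred1.
  have [[n [n0 hn]]|no] := pselect (exists n, (0 < n)%N /\ x *+ n = 0); last first.
    have [q q0 _] := half 2 isT; exists q => // m; have [->|m0] := eqVneq m 0; first by rewrite mulr0z.
    move=> e; case: no; exists `|m|%N; rewrite absz_gt0; split=> //.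
    by case: m e m0 => n e _ //; apply/eqP; rewrite -oppr_eq0; apply/eqP; move: e; rewrite NegzE mulrNz.
  have ex : exists n, (0 < n)%N && (x *+ n == 0) by exists n; rewrite n0 hn eqxx.
  case: (ex_minnP ex) => d /andP[d0 /eqP xd] dmin {n n0 hn}.
  have [|q q0 qd] := half d.
    by rewrite ltn_neqAle d0 andbT; apply: contra x0 => /eqP e; rewrite -[x]mulr1n e xd.
  exists q => // m e; have dv := divz_eq m d.
  have xr : x *~ (m %% d)%Z = 0.
    by move: e; rewrite {1}dv mulrzDr mulrC mulrzA -pmulrn xd mul0rz add0r.
  have r0 : (m %% d)%Z = 0.
    have := modz_ge0 m (lt0r_neq0 (d0 : 0 < d%:Z)); have := ltz_mod m (lt0r_neq0 (d0 : 0 < d%:Z)).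
    case: (m %% d)%Z xr => // -[|r] // xr lt _; have := dmin r.+1.
    by rewrite -pmulrn in xr; rewrite xr eqxx => /(_ isT); rewrite leqNgt -ltz_nat lt.
  by rewrite dv r0 addr0 mulrC mulrzA -pmulrn qd mul0rz.
pose D : set A := [set y | exists m : int, y = x *~ m].
have /choice[mu hmu] : forall y, exists m : int, D y -> y = x *~ m.
  by move=> y; have [[m hm]|ny] := pselect (D y); [exists m | exists 0].
have DP m : D (x *~ m) by exists m.
have hE m : q *~ mu (x *~ m) = q *~ m.
  apply/eqP; rewrite -subr_eq0 -mulrzBr; apply/eqP/hq; rewrite mulrzBr -hmu ?subrr //.
have [|||chi hchi] := @QZ_extend A D (fun y => q *~ mu y).
- by exists 0; rewrite mulr0z.
- by move=> _ _ [m ->] [n ->]; exists (m - n); rewrite mulrzBr.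
- by move=> _ _ [m ->] [n ->]; rewrite -mulrzBr !hE mulrzBr.
by exists chi; rewrite -[x]mulr1z hchi // hE mulr1z.
Qed.

(** A character to Q/Z takes values in (1/p)Z/Z, which is isomorphic to the group of p-th roots of
    unity. *)
Lemma mu_separates (A : zmodType) (p : nat) (zeta : algC) (x : A) :
  (0 < p)%N -> p.-primitive_root zeta -> (forall y : A, y *+ p = 0) -> x != 0 ->
  exists chi : A -> algC, [/\ forall y z, chi (y + z) = chi y * chi z, forall y, chi y ^+ p = 1,
    forall y n, chi (y *+ n) = chi y ^+ n & chi x != 1].
Proof.
move=> p0 pz Ap x0; have [g gx] := QZ_separates x0.
have pq : p%:R != 0 :> rat by rewrite pnatr_eq0 -lt0n.
have /choice[n hn] : forall y, exists n : nat, g y = (\pi_QZ (n%:R / p%:R))%qT.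
  move=> y; have : (g y *+ p) = 0 by rewrite -raddfMn Ap raddf0.
  rewrite -{1}[g y]reprK -(raddfMn (\pi_(Quotient.quot int_rat)%qT)) => /eqP.
  rewrite quot_eq0 => /intrP[z hz]; exists (absz (z %% p)%Z).
  have p0z : p%:Z != 0 by rewrite eqz_nat -lt0n.
  rewrite -[g y]reprK; apply/eqP; rewrite -subr_eq0 -raddfB quot_eq0.
  have -> : (absz (z %% p)%Z)%:R = (z %% p)%Z%:~R :> rat.
    by rewrite -[in RHS](gez0_abs (modz_ge0 z p0z)).
  have -> : repr (g y) = z%:~R / p%:R by rewrite -hz -(mulr_natr (repr (g y))) mulfK.
  rewrite -mulrBl -intrB {1}(divz_eq z p) addrK intrM -[p%:~R]/(p%:R) mulfK //.
  exact: rpred_int.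
have key a b : (\pi_QZ (a%:R / p%:R))%qT = (\pi_QZ (b%:R / p%:R))%qT -> zeta ^+ a = zeta ^+ b.
  move/eqP; rewrite -subr_eq0 -raddfB quot_eq0 -mulrBl => /intrP[z hz].
  have e : (a%:Z - b%:Z = z * p%:Z)%Z.
    by apply: (@intr_inj rat); rewrite intrB intrM -hz -![_%:~R]/(_%:R) divfK.
  have ea : (a%:Z = b%:Z + z * p%:Z)%Z by rewrite -e addrC subrK.
  apply/eqP; rewrite (eq_prim_root_expr pz); apply/eqP.
  by apply/eqP; rewrite -eqz_nat -!modz_nat ea addrC modzMDl.
have chiD y z : zeta ^+ n (y + z) = zeta ^+ n y * zeta ^+ n z.
  by rewrite -exprD; apply: key; rewrite -hn raddfD /= !hn -raddfD natrD mulrDl.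
exists (fun y => zeta ^+ n y); split=> //.
- by move=> y; rewrite exprAC (prim_expr_order pz) expr1n.
- move=> y; elim=> [|m IH]; last by rewrite mulrS chiD IH exprS.
  rewrite mulr0n expr0; apply: (mulfI (_ : zeta ^+ n 0 != 0)); last by rewrite -chiD addr0 mulr1.
  rewrite expf_neq0 //; apply: contraTneq (oner_neq0 algC) => z0.
  by rewrite -(prim_expr_order pz) z0 expr0n gtn_eqF // eqxx.
rewrite -(expr0 zeta); apply: contra gx => /eqP e; rewrite hn.
move/eqP: e; rewrite (eq_prim_root_expr pz) mod0n => /dvdnP[c ->].
by rewrite quot_eq0 natrM mulfK // rpred_nat.
Qed.

Section ResidualKummer.
Variables (p k j : nat) (F : fieldType) (P0 : set algC).
Hypotheses (pp : prime p) (hP0 : prime_above p P0) (podd : odd p) (charF : p%:R = 0 :> F)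
  (keven : ~~ odd k) (k2 : (2 <= k)%N) (j2 : (2 <= j)%N) (kj : (k = j %[mod p.-1])%N)
  (hcl : class_eigenspace_vanishes p j).

(** Continuous cocycles with values in F(omega^(k-1)), unramified outside p. *)
Record residual_cocycle (b : galQ -> F) : Prop := ResidualCocycle {
  rcM : forall (s t : galQ) a, acts_on_mu s p a -> b (s * t)%g = b s + a%:R ^+ (k - 1) * b t;
  rc_loc : locally_constant setT b;
  rc_unr : forall l Q s, prime l -> l != p -> prime_above l Q -> inertia Q s -> b s = 0 }.

Let G1 : set galQ := [set s | acts_on_mu s p 1].

Lemma rc_conj b s t a : residual_cocycle b -> G1 s -> acts_on_mu t p a ->
  b (t * s * t^-1)%g = a%:R ^+ (k - 1) * b s.
Proof.
move=> hb hs ha.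
have b1 : b 1%g = 0.
  have := rcM hb 1%g (@acts1 p); rewrite mulg1 mulr1n expr1n mul1r => /eqP.
  by rewrite -subr_eq subrr eq_sym => /eqP.
have e := rcM hb t^-1%g ha; rewrite mulgV b1 in e.
have -> : b (t * s * t^-1)%g = b t + a%:R ^+ (k - 1) * (b s + b t^-1%g).
  rewrite -mulgA (rcM hb _ ha) (rcM hb _ hs) expr1n mul1r //.
by rewrite mulrDr addrCA -e addr0.
Qed.

(** A linear functional of the values turns a cocycle into a Kummer character. *)
Lemma rc_kummer (zeta : algC) b (x : F) :
  p.-primitive_root zeta -> residual_cocycle b -> x != 0 ->
  exists chi : F -> algC, [/\ kummer_char p k (fun s => chi (b s)), chi x != 1, chi x ^+ p = 1 & chi 0 = 1].
Proof.
move=> pz hb x0; have Fp (y : F) : y *+ p = 0 by rewrite -mulr_natr charF mulr0.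
have [chi [chiD chip chiX chix]] := mu_separates (prime_gt0 pp) pz Fp x0.
have chi0 : chi 0 = 1 by rewrite -(mulr0n 0) chiX expr0.
exists chi; split=> //; split.
- by move=> s t hs ht; rewrite (rcM hb _ hs) expr1n mul1r chiD.
- by move=> s hs; exact: chip.
- by move=> s hs; have [r hr] := rc_loc hb (I : setT s); exists r => t _ e; rewrite hr.
- by move=> s t a hs ha; rewrite (rc_conj hb hs ha) -natrX mulr_natl chiX.
by move=> l Q s pl lp hQ hs; rewrite (rc_unr hb pl lp hQ hs).
Qed.

(** Complex conjugation acts by -1 and commutes with everything modulo Gal(Qbar/Q(zeta)), so that v is
    determined by its value there. *)
Lemma rc_coboundary v : residual_cocycle v -> (forall s, G1 s -> v s = 0) ->
  exists d : F, forall s a, acts_on_mu s p a -> v s = (a%:R ^+ (k - 1) - 1) * d.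
Proof.
move=> hv vG; have vM (s t : galQ) a : acts_on_mu s p a -> v (s * t)%g = v s + a%:R ^+ (k - 1) * v t.
  by move=> ha; exact: (rcM hv _ ha).
pose cc := conj_gal; have hcc : acts_on_mu cc p p.-1 by exact: conj_acts.
have two : (2%:R : F) != 0.
  apply/eqP => e2; have : p%:R = 1 :> F.
    by rewrite -(odd_double_half p) podd natrD -muln2 natrM e2 mulr0 addr0.
  by rewrite charF => /eqP; rewrite eq_sym oner_eq0.
have pm1 : (p.-1)%:R = -1 :> F.
  by apply/eqP; rewrite -addr_eq0 -[1]/(1%:R) -natrD addn1 prednK ?prime_gt0 // charF.
have ek : (-1 : F) ^+ (k - 1) = -1 by rewrite -signr_odd oddB ?(ltnW k2) // (negbTE keven) expr1.
exists (- v cc / 2%:R) => s a ha.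
have e1 := vM cc s _ hcc; have e2 := vM s cc a ha.
have h1 : G1 ((s * cc)%g * (cc * s)^-1)%g.
  move=> z zp; pose z' := (cc * s)^-1%g z.
  have zp' : z' ^+ p = 1 by rewrite -rmorphXn zp rmorph1.
  rewrite expr1 -[LHS]/((s * cc)%g z') (actsM ha hcc zp') mulnC -(actsM hcc ha zp').
  by rewrite -[LHS]/((cc * s * (cc * s)^-1)%g z) mulgV.
have e3 : v (s * cc)%g = v (cc * s)%g.
  have -> : (s * cc = (s * cc * (cc * s)^-1) * (cc * s))%g by rewrite mulgKV.
  by rewrite (vM _ _ _ h1) vG // expr1n mul1r add0r.
move: e3; rewrite e1 e2 pm1 ek; set A := a%:R ^+ (k-1) => e3.
apply: (mulIf two); rewrite mulrA divfK //.
have -> : v s * 2%:R = (v s + A * v cc) - (v cc + -1 * v s) + (A - 1) * (- v cc) by ring.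
by rewrite e3 subrr add0r.
Qed.

(** Restrict to Gal(Qbar/Q(zeta)). If y were not a multiple of b there, then two functionals would give
    independent Kummer characters; and a class that vanishes there is a coboundary. *)
Lemma residual_unique b y : residual_cocycle b -> residual_cocycle y ->
  (exists2 s, G1 s & b s != 0) ->
  exists c d : F, forall s a, acts_on_mu s p a -> y s = c * b s + (a%:R ^+ (k - 1) - 1) * d.
Proof.
move=> hb hy [s0 hs0 b0].
have [zeta pz] := C_prim_root_exists (prime_gt0 pp).
pose c := y s0 / b s0; pose v s := y s - c * b s.
have vM (s t : galQ) a : acts_on_mu s p a -> v (s * t)%g = v s + a%:R ^+ (k - 1) * v t.
  by move=> ha; rewrite /v (rcM hb _ ha) (rcM hy _ ha); ring.
have hv : residual_cocycle v.
  split=> // [s _|l Q s pl lp hQ hs]; last first.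
    by rewrite /v (rc_unr hb pl lp hQ hs) (rc_unr hy pl lp hQ hs) mulr0 subr0.
  have [r hr] := rc_loc hb (I : setT s); have [r' hr'] := rc_loc hy (I : setT s).
  exists (r ++ r') => t _ e; rewrite /v hr ?hr' // => x hx; apply: e; by rewrite mem_cat hx ?orbT.
have v0 : v s0 = 0 by rewrite /v /c divfK // subrr.
have vG s : G1 s -> v s = 0.
  move=> hs; apply/eqP; apply: contraPT isT => vs; rewrite -/(~ _) => _.
  have [chi [hchi chib chip _]] := rc_kummer pz hb b0.
  have [chi' [hchi' chiv chip' chi'0]] := rc_kummer pz hv vs.
  have [n1 [n2 [nn e]]] := kummer_dependence pp podd pz hP0 keven k2 j2 kj hcl hchi hchi'.
  have dv (z : algC) n : z ^+ p = 1 -> z ^+ n = 1 -> z != 1 -> (p %| n)%N.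
    move=> zp zn z1; have [m mu_z] := prim_order_exists (prime_gt0 pp) zp.
    move=> /(prime_nt_dvdP pp) mp; rewrite -(mp _) ?(prim_order_dvd mu_z) ?zn //.
    by apply: contra z1 => /eqP m1; rewrite m1 in mu_z; have := prim_expr_order mu_z; rewrite expr1 => ->.
  apply: nn; split.
    by have := e s0 hs0; rewrite v0 chi'0 expr1n mulr1 => h; apply: dv chip h chib.
  have p1 : (p %| n1)%N by have := e s0 hs0; rewrite v0 chi'0 expr1n mulr1 => h; apply: dv chip h chib.
  have := e s hs; case/dvdnP: p1 => m ->; rewrite mulnC exprM (kchp hchi hs) expr1n mul1r => h.
  exact: dv chip' h chiv.
have [d hd] := rc_coboundary hv vG.
exists c, d => s a ha; have := hd s a ha; rewrite /v => <-; by rewrite addrC subrK.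
Qed.
End ResidualKummer.

(** * Torsion modules K^n/O^n and the residual representation *)
Section Topology.
Lemma agree_sub (r r' : seq algC) (s t : galQ) :
  {subset r <= r'} -> {in r', forall x, s x = t x} -> {in r, forall x, s x = t x}.
Proof. by move=> h e x /h/e. Qed.

(** The closed sets of points at which c varies within precision n decrease to the empty set. *)
Lemma locally_constant_uniform (S : set galQ) (T : Type) (c : galQ -> T) :
  agree_closed S -> locally_constant S c ->
  exists r : seq algC, forall s t, S s -> S t -> {in r, forall x, s x = t x} -> c s = c t.
Proof.
move=> Scl hc; apply: contrapT => /forallNP no.
pose xs n : seq algC := [seq odflt 0 (unpickle i) | i <- iota 0 n].
have xs_sub m n : (m <= n)%N -> {subset xs m <= xs n}.
  by move=> mn x /mapP[i]; rewrite mem_iota /= => im ->; apply: map_f; rewrite mem_iota /= add0n (leq_trans im).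
have xs_all (r : seq algC) : exists n, {subset r <= xs n}.
  elim: r => [|x r [n hn]]; first by exists 0%N.
  exists (maxn n (pickle x).+1) => y; rewrite inE => /orP[/eqP ->|/hn].
    by apply/mapP; exists (pickle x); rewrite ?pickleK // mem_iota /= add0n leq_maxr.
  by apply: xs_sub; rewrite leq_maxl.
have [| | |s hs] := @galQ_nested (fun n => [set s | S s /\ exists t, [/\ S t, {in xs n, forall x, s x = t x} & c s <> c t]]).
- move=> n s hs; have Ss : S s by apply: Scl => r; have [t [St _] ht] := hs r; exists t.
  have [r hr] := hc s Ss; have [t [St [t' [St' tt' ne]]] ht] := hs (xs n ++ r).
  split=> //; exists t'; split=> //.
    by move=> x hx; rewrite -tt' // ht // mem_cat hx.
  by rewrite -(hr t) // => x hx; apply: ht; rewrite mem_cat hx orbT.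
- by move=> n s [Ss [t [St st ne]]]; split=> //; exists t; split=> //; apply: agree_sub st; exact: xs_sub.
- move=> n; have /existsNP[s /existsNP[t h]] := no (xs n).
  by move/not_implyP: h => [Ss /not_implyP[St /not_implyP[st ne]]]; exists s; split=> //; exists t.
have [Ss _] := hs 0%N; have [r hr] := hc s Ss; have [n hn] := xs_all r.
by have [_ [t [St st]]] := hs n; apply; rewrite (hr t) // => x /hn/st.
Qed.

(** The restrictions of automorphisms to a finite set are finite in number. *)
Lemma locally_constant_finite (S : set galQ) (T : choiceType) (c : galQ -> T) :
  agree_closed S -> locally_constant S c -> exists vs : seq T, forall s, S s -> c s \in vs.
Proof.
move=> Scl hc; have [r hr] := locally_constant_uniform Scl hc.
have [rs hrs] : exists L : seq (seq algC), forall s : galQ, map s r \in L.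
  elim: {hr} r => [|x r [L hL]]; first by exists [:: [::]] => s; rewrite inE.
  have [ys hys] := finite_conj x; exists [seq y :: l | y <- ys, l <- L] => s.
  by apply/allpairsP; exists (s x, map s r); rewrite hys hL.
have [[s0 Ss0]|no] := pselect (exists s, S s); last by exists [::] => s Ss; case: no; exists s.
pose g l := xget (c s0) [set v | exists s, [/\ S s, map s r = l & v = c s]].
exists (map g rs) => s Ss; have -> : c s = g (map s r).
  have ex : exists v, (exists s', [/\ S s', map s' r = map s r & v = c s']) by exists (c s), s.
  have [s' [Ss' e ee]] := xgetPex (c s0) ex; transitivity (c s'); last exact: esym ee.
  apply: hr => // x hx.
  by apply/eq_in_map: x hx.
by apply: map_f.
Qed.

Lemma locally_constant_id (T : choiceType) (vs : seq T) (act : galQ -> T -> T) :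
  (forall v, exists r : seq algC, forall t : galQ, {in r, forall x, t x = x} -> act t v = v) ->
  exists r : seq algC, forall t : galQ, {in r, forall x, t x = x} -> {in vs, forall v, act t v = v}.
Proof.
move=> /choice[r hr]; exists (flatten (map r vs)) => t ht v hv; apply: hr => x hx.
by apply: ht; apply/flattenP; exists (r v) => //; exact: map_f.
Qed.

(** By compactness, the elements of S trivial on all the Q_n are limits of those trivial on Q_n for n large. *)
Lemma near_gal_Qinf (p : nat) (pp : prime p) (S : set galQ) (r : seq algC) : agree_closed S ->
  exists n, forall t, S t -> cyc_res p n t = 1%g ->
    exists h, [/\ S h, gal_Qinf p h & {in r, forall x, h x = t x}].
Proof.
move=> Scl; apply: contrapT => /forallNP no.
have [| | |t ht] := @galQ_nested (fun n => [set t | [/\ S t, cyc_res p n t = 1%g &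
    ~ exists h, [/\ S h, gal_Qinf p h & {in r, forall x, h x = t x}]]]).
- move=> n s hs; split.
  + by apply: Scl => r'; have [t [St _ _] ht] := hs r'; exists t.
  + have [z hz] := cyc_res_loc pp n; have [t [_ t1 _] ht] := hs [:: z].
    by rewrite -t1; apply: hz; rewrite ht // inE.
  move=> [h [Sh hh hr]]; have [t [_ _ nt] ht] := hs r; apply: nt; exists h; split=> // x hx.
  by rewrite hr // ht.
- move=> n s [Ss s1 ns]; split=> //; rewrite -(cyc_res_map pp) s1.
  by have := tower_map1 (cyc_tower p) n.
- move=> n; have /existsNP[t h] := no n.
  by move/not_implyP: h => [St /not_implyP[t1 nt]]; exists t.
have [St _ nt] := ht 0%N; apply: nt; exists t; split=> // n; by case: (ht n).
Qed.

Lemma inertia_closed P : agree_closed (inertia P).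
Proof. by move=> s hs x xA; have [t ht e] := hs [:: x]; rewrite -e ?inE //; exact: ht. Qed.
Lemma setT_closed : agree_closed setT. Proof. by []. Qed.
End Topology.

Section CotorsionModules.
Variables (K : fieldType) (O : comNzRingType) (i : {rmorphism O -> K}).

Lemma pi_eq n (v v' : 'cV[K]_n) :
  (\pi_(cotorsion i n) v = \pi_(cotorsion i n) v')%qT <-> exists t, v - v' = map_mx i t.
Proof.
split=> [/eqP|[t ht]]; last apply/eqP.
  by rewrite -subr_eq0 -(raddfB (\pi_(Quotient.quot _)%qT)) quot_eq0 => /asboolP.
by rewrite -subr_eq0 -(raddfB (\pi_(Quotient.quot _)%qT)) quot_eq0; apply/asboolP; exists t.
Qed.
Lemma piB n (v v' : 'cV[K]_n) : (\pi_(cotorsion i n) (v - v') = \pi_(cotorsion i n) v - \pi_(cotorsion i n) v')%qT.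
Proof. exact: (raddfB (\pi_(Quotient.quot _)%qT)). Qed.
Lemma piD n (v v' : 'cV[K]_n) : (\pi_(cotorsion i n) (v + v') = \pi_(cotorsion i n) v + \pi_(cotorsion i n) v')%qT.
Proof. exact: (raddfD (\pi_(Quotient.quot _)%qT)). Qed.
Lemma pi0 n : (\pi_(cotorsion i n) 0 = 0)%qT. Proof. exact: (raddf0 (\pi_(Quotient.quot _)%qT)). Qed.

Lemma cmx_pi m n (M : 'M[O]_(m, n)) v :
  cotorsion_mx M (\pi_(cotorsion i n) v)%qT = (\pi_(cotorsion i m) (map_mx i M *m v))%qT.
Proof.
rewrite /cotorsion_mx; apply/pi_eq; rewrite -mulmxBr.
have /pi_eq[t ->] : (\pi_(cotorsion i n) (repr (\pi_(cotorsion i n) v)) = \pi_(cotorsion i n) v)%qT by rewrite reprK.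
by exists (M *m t); rewrite map_mxM.
Qed.
Lemma cmxM l m n (M : 'M[O]_(l, m)) (N : 'M[O]_(m, n)) (x : cotorsion i n) :
  cotorsion_mx (M *m N) x = cotorsion_mx M (cotorsion_mx N x).
Proof. by rewrite -[x]reprK [cotorsion_mx N _]cmx_pi !cmx_pi map_mxM mulmxA. Qed.
Lemma cmx1 n (x : cotorsion i n) : cotorsion_mx 1%:M x = x.
Proof. by rewrite -[x]reprK cmx_pi map_mx1 mul1mx. Qed.
Lemma cmxDl m n (M N : 'M[O]_(m, n)) (x : cotorsion i n) :
  cotorsion_mx (M + N) x = cotorsion_mx M x + cotorsion_mx N x.
Proof. by rewrite -[x]reprK !cmx_pi map_mxD mulmxDl piD. Qed.
Lemma cmx0l m n (x : cotorsion i n) : cotorsion_mx (0 : 'M[O]_(m, n)) x = 0.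
Proof. by rewrite -[x]reprK cmx_pi map_mx0 mul0mx pi0. Qed.

Definition sc n (a : O) : cotorsion i n -> cotorsion i n := cotorsion_mx a%:M.
Lemma sc_cmx m n (M : 'M[O]_(m, n)) a x : cotorsion_mx M (sc a x) = sc a (cotorsion_mx M x).
Proof. by rewrite /sc -!cmxM scalar_mxC. Qed.
Lemma scM n a b (x : cotorsion i n) : sc (a * b) x = sc a (sc b x).
Proof. by rewrite /sc -cmxM scalar_mxM. Qed.
Lemma scD n a b (x : cotorsion i n) : sc (a + b) x = sc a x + sc b x.
Proof. by rewrite /sc raddfD cmxDl. Qed.
Lemma sc1 n (x : cotorsion i n) : sc 1 x = x. Proof. exact: cmx1. Qed.
Lemma sc0 n (x : cotorsion i n) : sc 0 x = 0. Proof. by rewrite /sc raddf0 cmx0l. Qed.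
Lemma scN n a (x : cotorsion i n) : sc (- a) x = - sc a x.
Proof. by apply/eqP; rewrite -addr_eq0 -scD addNr sc0. Qed.
Lemma scB n a (x y : cotorsion i n) : sc a (x - y) = sc a x - sc a y.
Proof. exact: raddfB. Qed.
Lemma scDr n a (x y : cotorsion i n) : sc a (x + y) = sc a x + sc a y.
Proof. exact: raddfD. Qed.
Lemma scr0 n a : sc a (0 : cotorsion i n) = 0. Proof. exact: raddf0. Qed.

Variable w : O.
Hypotheses (w0 : i w != 0) (iinj : injective i).

Lemma sc_divisible n (x : cotorsion i n) : exists y, sc w y = x.
Proof.
exists (\pi_(cotorsion i n) ((i w)^-1 *: repr x))%qT; rewrite /sc cmx_pi map_scalar_mx mul_scalar_mx.
by rewrite scalerA mulfV // scale1r reprK.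
Qed.

Variables (F : fieldType) (res : {rmorphism O -> F}).
Hypotheses (res0 : forall x, res x = 0 <-> exists y, x = y * w) (res_surj : forall a, exists x, res x = a).

Definition iota n (t : 'cV[O]_n) : cotorsion i n := (\pi_(cotorsion i n) ((i w)^-1 *: map_mx i t))%qT.
Lemma iota0 n (t : 'cV[O]_n) : iota t = 0 <-> map_mx res t = 0.
Proof.
rewrite /iota -pi0; split=> [/pi_eq[z]|h].
  rewrite subr0 => e; apply/matrixP => a b; rewrite !mxE; apply/res0; exists (z a b).
  apply: iinj; rewrite rmorphM mulrC; have := congr1 (fun B : 'cV_n => i w * B a b) e.
  by rewrite !mxE mulVKf // => ->.
apply/pi_eq; have hz a : exists y, t a 0 = y * w.
  by apply/res0; have := congr1 (fun B : 'cV_n => B a 0) h; rewrite !mxE.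
have /choice[z hz'] := hz; exists (\col_a z a); rewrite subr0; apply/matrixP => a b.
by rewrite !mxE ord1 hz' rmorphM mulrC mulfK.
Qed.
Lemma iotaB n (t t' : 'cV[O]_n) : iota (t - t') = iota t - iota t'.
Proof. by rewrite /iota map_mxB scalerBr piB. Qed.
Lemma iota_cmx m n (M : 'M[O]_(m, n)) t : cotorsion_mx M (iota t) = iota (M *m t).
Proof. by rewrite /iota cmx_pi map_mxM scalemxAr. Qed.
Lemma iotaP n (x : cotorsion i n) : sc w x = 0 -> exists t, x = iota t.
Proof.
rewrite -{1}[x]reprK /sc cmx_pi -pi0 => /pi_eq[t]; rewrite subr0 map_scalar_mx mul_scalar_mx => e.
by exists t; rewrite /iota -e scalerA mulVf // scale1r reprK.
Qed.

Definition sect (a : F) : O := xget 0 [set x | res x = a].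
Lemma sectK a : res (sect a) = a. Proof. exact: (xgetPex 0 (res_surj a)). Qed.
(** The isomorphism from F^n onto the w-torsion of K^n/O^n, through division by w. *)
Definition jm n (v : 'cV[F]_n) : cotorsion i n := iota (map_mx sect v).
Lemma res_sect n m (v : 'M[F]_(n, m)) : map_mx res (map_mx sect v) = v.
Proof. by apply/matrixP => a b; rewrite !mxE sectK. Qed.
Lemma iota_jm n (t : 'cV[O]_n) : iota t = jm (map_mx res t).
Proof. by apply/eqP; rewrite -subr_eq0 -iotaB; apply/eqP/iota0; rewrite map_mxB res_sect subrr. Qed.
Lemma jm0 n (v : 'cV[F]_n) : jm v = 0 <-> v = 0.
Proof. by rewrite /jm iota0 res_sect. Qed.
Lemma jmB n (v v' : 'cV[F]_n) : jm (v - v') = jm v - jm v'.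
Proof. by rewrite -iotaB iota_jm map_mxB !res_sect. Qed.
Lemma jmD n (v v' : 'cV[F]_n) : jm (v + v') = jm v + jm v'.
Proof. by apply/eqP; rewrite -subr_eq -jmB addrK. Qed.
Lemma jm_inj n (v v' : 'cV[F]_n) : jm v = jm v' -> v = v'.
Proof. by move/eqP; rewrite -subr_eq0 -jmB => /eqP/jm0/eqP; rewrite subr_eq0 => /eqP. Qed.
Lemma jmP n (x : cotorsion i n) : sc w x = 0 -> exists v, x = jm v.
Proof. by case/iotaP => t ->; exists (map_mx res t); exact: iota_jm. Qed.
Lemma jm_cmx m n (M : 'M[O]_(m, n)) v : cotorsion_mx M (jm v) = jm (map_mx res M *m v).
Proof. by rewrite /jm iota_cmx iota_jm map_mxM res_sect. Qed.
Lemma jm_sc n a (v : 'cV[F]_n) : sc a (jm v) = jm (res a *: v).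
Proof. by rewrite /sc jm_cmx map_scalar_mx mul_scalar_mx. Qed.
End CotorsionModules.

Section ResidualRepresentation.
Variables (p k j : nat) (F : fieldType) (P0 : set algC) (rb : galQ -> 'M[F]_2) (ub : 'cV[F]_2).
Hypotheses (pp : prime p) (hP0 : prime_above p P0) (podd : odd p) (charF : p%:R = 0 :> F)
  (keven : ~~ odd k) (k2 : (2 <= k)%N) (j2 : (2 <= j)%N) (kj : (k = j %[mod p.-1])%N)
  (hcl : class_eigenspace_vanishes p j).
Hypotheses (rb1 : rb 1%g = 1%:M) (rbM : forall s t, rb (s * t)%g = rb s *m rb t)
  (rb_loc : locally_constant setT rb)
  (rb_unr : forall l Q s, prime l -> l != p -> prime_above l Q -> inertia Q s -> rb s = 1%:M)
  (ub0 : ub != 0) (rb_ub : forall s a, acts_on_mu s p a -> rb s *m ub = a%:R ^+ (k - 1) *: ub)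
  (rb_quo : forall s t, exists b, rb s *m t - t = b *: ub)
  (rb_nonsplit : ~ exists v, (forall b, v <> b *: ub) /\ forall s, rb s *m v = v).

Lemma charF_odd : (2%:R : F) != 0.
Proof.
apply/eqP => e2; have : p%:R = 1 :> F.
  by rewrite -(odd_double_half p) podd natrD -muln2 natrM e2 mulr0 addr0.
by rewrite charF => /eqP; rewrite eq_sym oner_eq0.
Qed.
Lemma signk (s : galQ) : acts_on_mu s p p.-1 -> rb s *m ub = - ub.
Proof.
move=> /rb_ub ->; have pm1 : (p.-1)%:R = -1 :> F.
  by apply/eqP; rewrite -addr_eq0 -[1]/(1%:R) -natrD addn1 prednK ?prime_gt0 // charF.
by rewrite pm1 -signr_odd oddB ?(ltnW k2) // (negbTE keven) expr1 scaleN1r.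
Qed.
Lemma neg_fixed n (v : 'cV[F]_n) : v = - v -> v = 0.
Proof.
move/eqP; rewrite -addr_eq0 -mulr2n -scaler_nat scaler_eq0 (negbTE charF_odd) => /eqP //.
Qed.

(** Complex conjugation fixes Q_oo and acts by -1 on the line of ub; an invariant vector outside the
    line, under the normal subgroup Gal(Qbar/Q_oo), would split the extension. *)
Lemma residual_invariants (v : 'cV[F]_2) : (forall h, gal_Qinf p h -> rb h *m v = v) -> v = 0.
Proof.
move=> hv; have cH : gal_Qinf p conj_gal.
  by apply: (involution_gal_Qinf pp podd); apply: galQ_eqP => x; exact: conjCK.
have cu : rb conj_gal *m ub = - ub by apply: signk; exact: conj_acts.
have line b : (forall h, gal_Qinf p h -> rb h *m (b *: ub) = b *: ub) -> b *: ub = 0.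
  by move=> /(_ _ cH); rewrite -scalemxAr cu scalerN => /esym/neg_fixed.
have [[b e]|nb] := pselect (exists b, v = b *: ub); first by rewrite e; apply: line => h hh; rewrite -e hv.
case: rb_nonsplit; exists v; split; first by move=> b e; apply: nb; exists b.
move=> s; have [b e] := rb_quo s v; apply/eqP; rewrite -subr_eq0 e; apply/eqP/line => h hh.
rewrite -e mulmxBr (hv h hh) mulmxA -rbM.
have -> : (h * s = s * (s^-1 * h * s))%g by rewrite !mulgA mulgV mul1g.
rewrite rbM -mulmxA (hv (s^-1 * h * s)%g) //; exact: (gal_QinfJ pp).
Qed.

(** The determinant gives coordinates in a basis of the plane. *)
Definition wedge (x y : 'cV[F]_2) : F := x 0 0 * y 1 0 - x 1 0 * y 0 0.
Lemma wedge_expand u t v : wedge u t != 0 ->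
  v = (wedge v t / wedge u t) *: u + (wedge u v / wedge u t) *: t.
Proof.
move=> d0; apply/matrixP => a b; rewrite !mxE ord1; apply: (mulIf d0).
transitivity (wedge v t * u a 0 + wedge u v * t a 0); last by field.
have [->|->] : a = 0 \/ a = 1 by case: a => [[|[|//]] ia]; [left|right]; apply/val_inj.
  by rewrite /wedge; ring.
by rewrite /wedge; ring.
Qed.

(** If b vanished over Q(zeta), it would be a coboundary, and the extension would split. *)
Lemma residual_class : exists (t1 : 'cV[F]_2) (b : galQ -> F),
  [/\ wedge ub t1 != 0, forall s, rb s *m t1 = t1 + b s *: ub, residual_cocycle p k b &
      exists2 s, acts_on_mu s p 1 & b s != 0].
Proof.
have [t1 d0] : exists t1, wedge ub t1 != 0.
  have /cV0Pn[a ha] := ub0; case: a ha => [[|[|//]] ia] ha.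
    exists (delta_mx 1 0); rewrite /wedge !mxE /= mulr0 subr0 mulr1.
    by apply: contra ha => /eqP e; rewrite -e; apply/eqP; congr (ub _ _); apply/val_inj.
  exists (delta_mx 0 0); rewrite /wedge !mxE /= mulr0 sub0r mulr1 oppr_eq0.
  by apply: contra ha => /eqP e; rewrite -e; apply/eqP; congr (ub _ _); apply/val_inj.
have /choice[b hb] : forall s, exists b, rb s *m t1 = t1 + b *: ub.
  by move=> s; have [b hb] := rb_quo s t1; exists b; rewrite -hb addrC subrK.
have cancel x y : x *: ub = y *: ub -> x = y.
  by move/eqP; rewrite -subr_eq0 -scalerBl scaler_eq0 (negbTE ub0) orbF subr_eq0 => /eqP.
have hrc : residual_cocycle p k b.
  split.
  - move=> s t a ha; apply: cancel; apply: (addrI t1).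
    rewrite -hb rbM -mulmxA hb mulmxDr hb -scalemxAr (rb_ub ha) scalerA scalerDl addrA.
    by rewrite [b t * _]mulrC.
  - move=> s hs; have [r hr] := rb_loc hs; exists r => t ht e.
    by apply: cancel; apply: (addrI t1); rewrite -!hb hr.
  move=> l Q s pl lp hQ hs; apply: cancel; apply: (addrI t1).
  by rewrite -hb (rb_unr pl lp hQ hs) mul1mx scale0r addr0.
exists t1, b; split=> //; apply: contrapT => no.
have [|d hd] := rc_coboundary pp podd charF keven k2 hrc.
  by move=> s hs; apply/eqP/negPn/negP => bs; apply: no; exists s.
case: rb_nonsplit; exists (t1 - d *: ub); split.
  move=> c e; case/eqP: d0; have -> : t1 = (c + d) *: ub by rewrite scalerDl -e subrK.
  by rewrite /wedge !mxE; ring.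
move=> s; have [a _ [ha _]] := acts_exists (prime_gt0 pp) s.
rewrite mulmxBr hb -scalemxAr (rb_ub ha) scalerA (hd s a ha) -addrA; congr (_ + _).
by rewrite -scalerBl -scaleNr; congr (_ *: _); ring.
Qed.
End ResidualRepresentation.

(** * Pontryagin duality for the Selmer group *)
Lemma sub_sub_swap (V : zmodType) (a b c d : V) : (a - b) - (c - d) = (a - c) - (b - d).
Proof. by rewrite !opprD !opprK addrACA. Qed.

Lemma QZ_ptorsion (p : nat) : (0 < p)%N -> exists tau : QZ,
  [/\ forall q : QZ, q *+ p = 0 -> exists n : nat, q = tau *+ n,
      forall n, tau *+ n = 0 -> (p %| n)%N & forall n, (p %| n)%N -> tau *+ n = 0].
Proof.
move=> p0; have pq : p%:R != 0 :> rat by rewrite pnatr_eq0 -lt0n.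
have tauE n : ((\pi_QZ (p%:R^-1)) *+ n = \pi_QZ (n%:R / p%:R))%qT.
  by rewrite -(raddfMn (\pi_(Quotient.quot int_rat)%qT)) -(mulr_natr p%:R^-1) mulrC.
exists (\pi_QZ (p%:R^-1))%qT; split=> [q|n|n].
- rewrite -{1}[q]reprK -(raddfMn (\pi_(Quotient.quot int_rat)%qT)) => /eqP.
  rewrite quot_eq0 => /intrP[z hz]; exists (absz (z %% p)%Z); rewrite tauE.
  have p0z : p%:Z != 0 by rewrite eqz_nat -lt0n.
  rewrite -[q]reprK; apply/eqP; rewrite -subr_eq0 -raddfB quot_eq0.
  have -> : (absz (z %% p)%Z)%:R = (z %% p)%Z%:~R :> rat.
    by rewrite -[in RHS](gez0_abs (modz_ge0 z p0z)).
  have -> : repr q = z%:~R / p%:R by rewrite -hz -(mulr_natr (repr q)) mulfK.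
  rewrite -mulrBl -intrB {1}(divz_eq z p) addrK intrM -[p%:~R]/(p%:R) mulfK //.
  exact: rpred_int.
- rewrite tauE => /eqP; rewrite quot_eq0 => /intrP[z hz].
  have e : (n%:Z = z * p%:Z)%Z by apply: (@intr_inj rat); rewrite intrM -hz -![_%:~R]/(_%:R) divfK.
  by have : (p%:Z %| n%:Z)%Z by rewrite e dvdz_mull.
case/dvdnP => c ->; rewrite tauE natrM mulfK //.
by apply/eqP; rewrite quot_eq0; exact: rpred_nat.
Qed.

(** A row-free square matrix over F_p is invertible. *)
Lemma Fp_solve (p d : nat) (N : 'I_d -> 'I_d -> nat) (c : 'I_d -> nat) : prime p ->
  (forall b : 'I_d -> nat, (forall j, p %| \sum_i b i * N i j)%N -> forall i, (p %| b i)%N) ->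
  exists a : 'I_d -> nat, forall j, (\sum_i a i * N i j = c j %[mod p])%N.
Proof.
move=> pp inj; have ch := pchar_Fp pp.
pose M : 'M['F_p]_d := \matrix_(i, j) (N i j)%:R.
have valK (x : 'F_p) : (val x)%:R = x by exact: natr_Zp.
have freeM : row_free M.
  rewrite -kermx_eq0; apply/eqP/row_matrixP => r; rewrite row0.
  have kM : row r (kermx M) *m M = 0 by apply/sub_kermxP/row_sub.
  apply/rowP => i; have := inj (fun i => val (row r (kermx M) 0 i)).
  move=> /(_ _ i); rewrite (dvdn_pcharf ch) valK => h; rewrite [RHS]mxE; apply/eqP/h => j.
  rewrite (dvdn_pcharf ch) natr_sum; apply/eqP.
  have e2 := congr1 (fun B : 'rV_d => B 0 j) kM; rewrite mxE [RHS]mxE in e2; rewrite -[RHS]e2; apply: eq_bigr => i' _.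
  by rewrite natrM valK; congr (_ * _); rewrite [RHS]mxE.
have uM : M \in unitmx by rewrite -row_free_unit.
pose cv : 'rV['F_p]_d := \row_j (c j)%:R.
exists (fun i => val ((cv *m invmx M) 0 i)) => j.
have e : \sum_i (cv *m invmx M) 0 i * M i j = (c j)%:R.
  by have := congr1 (fun B : 'rV_d => B 0 j) (mulmxKV uM cv); rewrite mxE [RHS]mxE.
apply/eqP; have h (x y : nat) : (x%:R == y%:R :> 'F_p) = (x == y %[mod p])%N.
  wlog le : x y / (x <= y)%N => [h|].
    by have [/h//|/ltnW/h] := leqP x y; rewrite eq_sym => ->; rewrite eq_sym.
  by rewrite eq_sym -subr_eq0 -natrB // -(dvdn_pcharf ch) eq_sym eqn_mod_dvd.
rewrite -h natr_sum -e; apply/eqP/eq_bigr => i _.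
by rewrite natrM valK; congr (_ * _); rewrite [RHS]mxE.
Qed.

Section Duality.
Variables (p m : nat) (O : comNzRingType) (w : O) (F : fieldType) (res : {rmorphism O -> F})
  (S : zmodType) (X : lmodType (iwasawa_algebra p O)) (e : X -> {additive S -> QZ})
  (scl : O -> S -> S) (cj : galQ -> S -> S) (g0 : galQ) (d : nat) (b_ : 'I_d -> O).
Hypotheses (pp : prime p) (p_w : exists y, p%:R = y * w)
  (res0 : forall x, res x = 0 <-> exists y, x = y * w)
  (res_unit : forall x, res x != 0 -> exists y, y * x = 1)
  (b_free : forall b : 'I_d -> int, (exists y, \sum_i (b i)%:~R * b_ i = y * w) -> forall i, (p%:Z %| b i)%Z)
  (b_gen : forall x, exists (b : 'I_d -> int) y, x = \sum_i (b i)%:~R * b_ i + y * w).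
Hypotheses (sclBl : forall a b x, scl (a - b) x = scl a x - scl b x)
  (sclB : forall a x y, scl a (x - y) = scl a x - scl a y)
  (sclM : forall a b x, scl (a * b) x = scl a (scl b x)) (scl1 : forall x, scl 1 x = x)
  (cjB : forall t x y, cj t (x - y) = cj t x - cj t y)
  (cjM : forall s t x, cj (s * t)%g x = cj s (cj t x)) (cj1 : forall x, cj 1%g x = x)
  (cj_scl : forall t a x, cj t (scl a x) = scl a (cj t x))
  (cj_smooth : forall x, exists n, forall t, cyc_res p n t = 1%g -> cj t x = x)
  (g0gen : forall n, [set: cyc_level p n]%SET = <[cyc_res p n g0]>%g)
  (line : forall x x0, cj g0 x = x -> cj g0 x0 = x0 -> scl w x = 0 -> scl w x0 = 0 -> x0 != 0 ->
     exists a, x = scl a x0)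
  (killS : forall x, cj g0 x = x -> scl (w ^+ m) x = 0).
Hypotheses (eD : forall u v x, e (u + v) x = e u x + e v x)
  (einj : forall u, (forall x, e u x = 0) -> u = 0)
  (esurj : forall chi : {additive S -> QZ}, exists u, forall x, e u x = chi x)
  (eL : forall (a : iwasawa_algebra p O) u x n (lift : cyc_level p n -> galQ),
        (forall g, cyc_res p n (lift g) = g) -> (forall t, cyc_res p n t = 1%g -> cj t x = x) ->
        e (a *: u) x = \sum_g e u (scl (cgr_coef a n g) (cj (lift g)^-1%g x))).

Definition gam0 n : cyc_tower p n := cyc_res p n g0.
Lemma gam0_map n : tower_map (gam0 n.+1) = gam0 n. Proof. exact: cyc_res_map. Qed.
Let Lam := iwasawa_algebra p O.
Let T : Lam := gamma O gam0_map - 1.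
Let cst : O -> Lam := cgr_const (cyc_tower p).

Let eB u v x : e (u - v) x = e u x - e v x.
Proof. by apply/eqP; rewrite eq_sym subr_eq -eD subrK. Qed.
Let e0 x : e 0 x = 0. Proof. by rewrite -(subrr 0) eB subrr. Qed.
Let scl0 x : scl 0 x = 0. Proof. by rewrite -(subrr 1) sclBl subrr. Qed.
Let sclr0 a : scl a 0 = 0. Proof. by have := sclB a 0 0; rewrite !subrr. Qed.
Let cj0 t : cj t 0 = 0. Proof. by have := cjB t 0 0; rewrite !subrr. Qed.
Let scl_comm a b x : scl a (scl b x) = scl b (scl a x). Proof. by rewrite -!sclM mulrC. Qed.

Lemma dual_const a u x : e (cst a *: u) x = e u (scl a x).
Proof.
have [n hn] := cj_smooth x.
have /choice[l hl] : forall g : cyc_level p n, exists t, cyc_res p n t = g by exact: cyc_res_onto.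
pose lift g := if g == 1%g then 1%g else l g.
rewrite (eL (cst a) u (n := n) (lift := lift)) // => [|g]; last first.
  by rewrite /lift; case: eqVneq => // ->; rewrite cyc_res1.
have cE g : cgr_coef (cst a) n g = a *+ (g == 1%g) by exact: coef_const.
rewrite (bigD1 1%g) //= /lift eqxx invg1 cj1 cE eqxx big1 ?addr0 // => g g1.
by rewrite cE (negbTE g1) scl0 raddf0.
Qed.

Lemma dual_gamma u x : e (gamma O gam0_map *: u) x = e u (cj g0^-1%g x).
Proof.
have [n hn] := cj_smooth x.
have /choice[l hl] : forall g : cyc_level p n, exists t, cyc_res p n t = g by exact: cyc_res_onto.
pose lift g := if g == cyc_res p n g0 then g0 else l g.
have cE g : cgr_coef (gamma O gam0_map) n g = (g == cyc_res p n g0)%:R.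
  by rewrite -[gamma _ _]expr1 coef_gammaX expg1.
rewrite (eL _ u (n := n) (lift := lift)) // => [|g]; last by rewrite /lift; case: eqVneq.
rewrite (bigD1 (cyc_res p n g0)) //= /lift eqxx cE eqxx scl1 big1 ?addr0 // => g g1.
by rewrite cE (negbTE g1) scl0 raddf0.
Qed.

Lemma dual_T u x : e (T *: u) x = e u (cj g0^-1%g x - x).
Proof. by rewrite scalerBl scale1r eB dual_gamma raddfB. Qed.

Let fixV x : cj g0^-1%g x = x <-> cj g0 x = x.
Proof.
by split=> h; [rewrite -{1}h -cjM mulgV cj1 | rewrite -{1}h -cjM mulVg cj1].
Qed.

(** Extend a character from (g0 - 1) S to S. *)
Lemma dual_annihilator u : (forall x, cj g0 x = x -> e u x = 0) -> exists v, u = T *: v.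
Proof.
move=> hu; pose D : set S := [set z | exists x, z = cj g0^-1%g x - x].
have /choice[h hh] : forall z, exists q, forall x, z = cj g0^-1%g x - x -> e u x = q.
  move=> z; have [[x hx]|no] := pselect (D z); last by exists 0 => x hx; case: no; exists x.
  exists (e u x) => x' hx'; apply/eqP; rewrite -subr_eq0 -raddfB; apply/eqP/hu/fixV.
  have ee : cj g0^-1%g x' - x' = cj g0^-1%g x - x by rewrite -hx' hx.
  by rewrite cjB (sub_swap ee).
have [|x y [x' ->] [y' ->]|x y [x' ->] [y' ->]|chi hchi] := @QZ_extend S D h.
- by exists 0; rewrite cj0 subr0.
- by exists (x' - y'); rewrite cjB; exact: sub_sub_swap.
- rewrite -(hh _ x' erefl) -(hh _ y' erefl) -raddfB; apply/esym/hh.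
  by rewrite cjB; exact: sub_sub_swap.
have [v hv] := esurj chi; exists v; apply/eqP; rewrite -subr_eq0; apply/eqP/einj => x.
by rewrite eB dual_T hv hchi ?(hh _ x erefl) ?subrr //; exists x.
Qed.

Lemma residual_functional (L : O -> QZ) : (forall a b, L (a - b) = L a - L b) ->
  (forall i, L (b_ i) = 0) -> (forall y, L (y * w) = 0) -> forall b, L b = 0.
Proof.
move=> LB Lb Lw b; have [g hg] := additive_of LB; rewrite -hg.
have [c [y ->]] := b_gen b; rewrite raddfD raddf_sum hg Lw addr0 big1 // => i _.
by rewrite mulrzl raddfMz hg Lb mul0rz.
Qed.

(** The dual of a residual line is a residual line, by counting: its pairing
    matrix in a residual basis is injective over F_p, hence invertible. *)
Lemma dual_line u0 u x0 : scl w x0 = 0 -> e u0 x0 != 0 ->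
  exists a, forall b, e u (scl b x0) = e u0 (scl a (scl b x0)).
Proof.
move=> wx0 u0x0; have [tau [tauP tau0 tauM]] := QZ_ptorsion (prime_gt0 pp).
have wz v c : e v (scl (c * w) x0) = 0 by rewrite sclM wx0 sclr0 raddf0.
have tor v c : e v (scl c x0) *+ p = 0.
  have Lv a b : e v (scl (a - b) x0) = e v (scl a x0) - e v (scl b x0) by rewrite sclBl raddfB.
  have [g hg] := additive_of Lv; rewrite -hg -raddfMn hg -mulr_natl; have [y ->] := p_w.
  by rewrite mulrAC wz.
have /choice[N hN] : forall ij : 'I_d * 'I_d, exists n : nat, e u0 (scl (b_ ij.1 * b_ ij.2) x0) = tau *+ n.
  by move=> ij; apply: tauP; exact: tor.
have /choice[c hc] : forall j, exists n : nat, e u (scl (b_ j) x0) = tau *+ n.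
  by move=> j; apply: tauP; exact: tor.
have comb (a : 'I_d -> nat) j : e u0 (scl ((\sum_i (a i)%:R * b_ i) * b_ j) x0) = tau *+ (\sum_i a i * N (i, j))%N.
  have Lv a1 a2 : e u0 (scl ((a1 - a2) * b_ j) x0) = e u0 (scl (a1 * b_ j) x0) - e u0 (scl (a2 * b_ j) x0).
    by rewrite mulrBl sclBl raddfB.
  have [g hg] := additive_of (f := fun a1 => e u0 (scl (a1 * b_ j) x0)) Lv.
  rewrite -hg raddf_sum -sumrMnr; apply: eq_bigr => i _.
  by rewrite mulr_natl raddfMn hg (hN (i, j)) -mulrnA mulnC.
have modp x y : (x = y %[mod p])%N -> tau *+ x = tau *+ y.
  move=> exy; rewrite (divn_eq x p) (divn_eq y p) !mulrnDr exy.
  by rewrite (tauM (x %/ p * p)%N (dvdn_mull _ (dvdnn p))) (tauM (y %/ p * p)%N (dvdn_mull _ (dvdnn p))).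
have [|a ha] := @Fp_solve p d (fun i j => N (i, j)) c pp.
  move=> b hb i; pose al := \sum_i (b i)%:R * b_ i.
  have Lz : forall y, e u0 (scl (al * y) x0) = 0.
    apply: residual_functional => [a1 a2|j|y].
    - by rewrite mulrBr sclBl raddfB.
    - by rewrite comb tauM.
    by rewrite mulrA wz.
  apply: (@b_free (fun i => (b i)%:Z)).
  have [/res0[y hy]|h] := eqVneq (res al) 0; first by exists y.
  have [y hy] := res_unit h; case/eqP: u0x0.
  by have := Lz y; rewrite mulrC hy scl1.
exists (\sum_i (a i)%:R * b_ i) => b; apply/eqP; rewrite -subr_eq0; apply/eqP; move: b.
apply: residual_functional => [a1 a2|j|y].
- rewrite sclBl sclB (raddfB (e u)) (raddfB (e u0)); exact: sub_sub_swap.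
- by rewrite -sclM comb hc (modp _ _ (ha j)) subrr.
by rewrite wz sclM wx0 !sclr0 raddf0 subrr.
Qed.

(** The bracket of u0 with S is chosen nonzero on the invariants killed by w, which form a line. Any u
    then agrees there with a multiple of u0; the difference, on the invariants, factors through
    multiplication by w. Iterating m times uses up the invariants, which are killed by w^m. *)
Lemma dual_generators : exists u0 : X,
  (forall x : X, exists a y, x = cst a *: u0 + T *: y) /\ exists y : X, cst w ^+ m *: u0 = T *: y.
Proof.
have cstX n : cst w ^+ n = cst (w ^+ n) by rewrite /cst rmorphXn.
have kill (u : X) : exists y, cst (w ^+ m) *: u = T *: y.
  by apply: dual_annihilator => x hx; rewrite dual_const killS // raddf0.
have [u0 hu0] : exists u0, forall u, exists a, forall x, cj g0 x = x -> scl w x = 0 ->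
    e (u - cst a *: u0) x = 0.
  have [[x0 [fx0 wx0 x00]]|no] := pselect (exists x0, [/\ cj g0 x0 = x0, scl w x0 = 0 & x0 != 0]); last first.
    exists 0 => u; exists 0 => x fx wx; have -> : x = 0.
      by apply/eqP/negPn/negP => x0; apply: no; exists x.
    by rewrite raddf0.
  have [chi hchi] := QZ_separates x00; have [u0 hu0] := esurj chi; exists u0 => u.
  have [|a ha] := @dual_line u0 u x0 wx0; first by rewrite hu0.
  exists a => x fx wx; have [b ->] := line fx fx0 wx wx0 x00.
  by rewrite eB dual_const ha subrr.
exists u0; split; last by rewrite cstX; exact: kill.
have step u : exists a u' v, u = cst a *: u0 + cst w *: u' + T *: v.
  have [a ha] := hu0 u; set u1 := u - cst a *: u0 in ha; exists a.
  pose D : set S := [set z | exists x, cj g0 x = x /\ z = scl w x].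
  have /choice[h hh] : forall z, exists q, forall x, cj g0 x = x -> z = scl w x -> e u1 x = q.
    move=> z; have [[x [fx hx]]|no] := pselect (D z); last by exists 0 => x fx hx; case: no; exists x.
    exists (e u1 x) => x' fx' hx'; apply/eqP; rewrite -subr_eq0 -raddfB; apply/eqP/ha.
      by rewrite cjB fx fx'.
    by rewrite sclB -hx -hx' subrr.
  have [|x y [x' [fx ->]] [y' [fy ->]]|x y [x' [fx ->]] [y' [fy ->]]|chi hchi] := @QZ_extend S D h.
  - by exists 0; rewrite sclr0 cj0.
  - by exists (x' - y'); rewrite cjB fx fy sclB.
  - by rewrite -(hh _ x' fx erefl) -(hh _ y' fy erefl) -raddfB; apply/esym/hh; rewrite ?cjB ?fx ?fy ?sclB.
  have [u' hu'] := esurj chi; have [|v hv] := @dual_annihilator (u1 - cst w *: u').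
    move=> x fx; rewrite eB dual_const hu' hchi; last by exists x.
    by rewrite -(hh _ x fx erefl) subrr.
  by exists u', v; rewrite -hv addrC [cst a *: u0 + _]addrC addrA subrK /u1 subrK.
have iter M u : exists a u' v, u = cst a *: u0 + cst (w ^+ M) *: u' + T *: v.
  elim: M u => [|M IH] u; first by exists 0, u, 0; rewrite /cst rmorph0 scale0r add0r expr0 rmorph1 scale1r scaler0 addr0.
  have [a [u' [v ->]]] := IH u; have [a' [u'' [v' ->]]] := step u'.
  exists (a + w ^+ M * a'), u'', (cst (w ^+ M) *: v' + v).
  have cM x y : cst (x * y) = cst x * cst y by rewrite /cst rmorphM.
  have cD x y : cst (x + y) = cst x + cst y by rewrite /cst rmorphD.
  have eT : T *: (cst (w ^+ M) *: v' + v) = cst (w ^+ M) *: (T *: v') + T *: v.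
    by rewrite scalerDr !scalerA mulrC.
  by rewrite eT exprSr cM cD cM [(cst a + _) *: u0]scalerDl !scalerDr -!scalerA !addrA.
move=> x; have [a [u' [v ->]]] := iter m x; have [y hy] := kill u'.
by exists a, (y + v); rewrite hy -addrA -scalerDr.
Qed.
End Duality.

(** * The Selmer group *)
Lemma inertia_decomposition p P s : prime_above p P -> inertia P s -> decomposition P s.
Proof.
move=> hP hs x; have [[Qsub _] QD _ _ _] := hP; split=> hx.
  by rewrite -(subrK x (s x)); apply: QD => //; apply: hs; exact: Qsub.
have xA : x \in Aint by have := Qsub _ hx; rewrite /= Aint_aut.
by rewrite -(subKr (s x) x); apply: (primeB hP) => //; exact: hs.
Qed.

Section AbstractSelmer.
Variables (p k j : nat) (K : fieldType) (O : comNzRingType) (i : {rmorphism O -> K}) (w : O)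
  (rho : galQ -> 'M[O]_2) (P : set algC) (lambda : 'rV[O]_2) (eta : galQ -> O)
  (F : fieldType) (res : {rmorphism O -> F}) (ub : 'cV[F]_2).
Hypotheses (pp : prime p) (podd : odd p) (keven : ~~ odd k) (k2 : (2 <= k)%N) (j2 : (2 <= j)%N)
  (kj : (k = j %[mod p.-1])%N) (hcl : class_eigenspace_vanishes p j) (hP : prime_above p P).
Hypotheses (charF : p%:R = 0 :> F) (iinj : injective i) (wi0 : i w != 0)
  (res0 : forall x, res x = 0 <-> exists y, x = y * w) (res_surj : forall a, exists x, res x = a).
Hypotheses (rho1 : rho 1%g = 1%:M) (rhoM : forall s t, rho (s * t)%g = rho s *m rho t)
  (rho_unr : forall l Q s, prime l -> l != p -> prime_above l Q -> inertia Q s -> rho s = 1%:M)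
  (eta1 : forall s, inertia P s -> eta s = 1)
  (lambda_in : forall s, inertia P s -> lambda *m rho s = lambda)
  (lambda_surj : exists t, lambda *m t = 1%:M).
Notation A := (cotorsion i 2).
Notation H := (gal_Qinf p).
Notation S := (selmer p i rho P lambda eta).
Notation coc := (cocycle (mx_act i rho) (gal_Qinf p)).
Notation cob := (coboundary (mx_act i rho) (gal_Qinf p)).
Notation Z := (Z1 (mx_act i rho) (gal_Qinf p)).

Let act (s : galQ) (x : A) : A := cotorsion_mx (rho s) x.
Let lam (x : A) : cotorsion i 1 := cotorsion_mx lambda x.
Let rb s := map_mx res (rho s).
Hypotheses
  (act_smooth : forall x, exists r : seq algC, forall t : galQ, {in r, forall z, t z = z} -> act t x = x)
  (w_torsion : forall x : A, exists M : nat, sc (w ^+ M) x = 0)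
  (rb_loc : locally_constant setT rb) (ub0 : ub != 0)
  (rb_ub : forall s a, acts_on_mu s p a -> rb s *m ub = a%:R ^+ (k - 1) *: ub)
  (rb_quo : forall s t, exists b, rb s *m t - t = b *: ub)
  (rb_ns : ~ exists v, (forall b, v <> b *: ub) /\ forall s, rb s *m v = v).

Let rb1 : rb 1%g = 1%:M. Proof. by rewrite /rb rho1 map_mx1. Qed.
Let rbM s t : rb (s * t)%g = rb s *m rb t. Proof. by rewrite /rb rhoM map_mxM. Qed.
Let rb_unr l Q s : prime l -> l != p -> prime_above l Q -> inertia Q s -> rb s = 1%:M.
Proof. by move=> pl lp hQ hs; rewrite /rb (rho_unr pl lp hQ hs) map_mx1. Qed.
Let actM s t x : act (s * t)%g x = act s (act t x). Proof. by rewrite /act rhoM cmxM. Qed.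
Let act1 x : act 1%g x = x. Proof. by rewrite /act rho1 cmx1. Qed.
Let actK s x : act s (act s^-1%g x) = x. Proof. by rewrite -actM mulgV act1. Qed.
Let actB s x y : act s (x - y) = act s x - act s y. Proof. exact: raddfB. Qed.
Let actD s x y : act s (x + y) = act s x + act s y. Proof. exact: raddfD. Qed.
Let actN s x : act s (- x) = - act s x. Proof. exact: raddfN. Qed.
Let act0 s : act s 0 = 0. Proof. exact: raddf0. Qed.
Let act_sc s a x : act s (sc a x) = sc a (act s x). Proof. exact: sc_cmx. Qed.
Let act_unr l Q s x : prime l -> l != p -> prime_above l Q -> inertia Q s -> act s x = x.
Proof. by move=> pl lp hQ hs; rewrite /act (rho_unr pl lp hQ hs) cmx1. Qed.
Let inertia_dec s : inertia P s -> decomposition P s.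
Proof. exact: (inertia_decomposition hP). Qed.
Let lamI s x : inertia P s -> lam (act s x) = lam x.
Proof. by move=> hs; rewrite /lam /act -cmxM lambda_in. Qed.
Let lamB x y : lam (x - y) = lam x - lam y. Proof. exact: raddfB. Qed.
Let lamD x y : lam (x + y) = lam x + lam y. Proof. exact: raddfD. Qed.
Let lam_sc a x : lam (sc a x) = sc a (lam x). Proof. exact: sc_cmx. Qed.
Let jmw n := @jm _ O i w F res n.
Let jm_act s v : act s (jmw v) = jmw (rb s *m v). Proof. exact: jm_cmx. Qed.

(** Devissage from the residual case, as every element is killed by a power of w. *)
Lemma no_invariants (x : A) : (forall h, H h -> act h x = x) -> x = 0.
Proof.
have step (z : A) : sc w z = 0 -> (forall h, H h -> act h z = z) -> z = 0.
  move=> /(jmP wi0 iinj res0 res_surj)[v ->] hv; apply/(jm0 wi0 iinj res0 res_surj).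
  apply: (residual_invariants pp podd charF keven k2 rbM rb_ub rb_quo rb_ns) => h hh.
  by apply: (jm_inj wi0 iinj res0 res_surj); rewrite -[LHS]/(jmw _) -jm_act; exact: hv.
have [M hM] := w_torsion x; elim: M x hM => [|M IH] x; first by rewrite expr0 sc1.
move=> hM hx; apply: IH => //; apply: step; first by rewrite -scM -exprS.
by move=> h hh; rewrite act_sc hx.
Qed.

(** Inertia acts trivially on the modules in question, so that coboundaries vanish on it. *)
Definition local_cond (c : galQ -> A) : Prop :=
  (forall l Q s, prime l -> l != p -> prime_above l Q -> inertia Q s -> H s -> c s = 0) /\
  (forall s, inertia P s -> H s -> lam (c s) = 0).

Lemma selmer_cocycleP (c : Z) : selmer_cocycle P lambda eta c <-> local_cond (val c).
Proof.
split=> [[c1 c2]|[c1 c2]]; split.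
- move=> l Q s pl lp hQ hs Hs; have [a ha] := c1 l Q pl lp hQ.
  by rewrite ha // -[mx_act _ _ _ _]/(act s a) (act_unr a pl lp hQ hs) subrr.
- move=> s hs Hs; case: c2 => a /(_ s (conj hs Hs)) e; rewrite /lam e.
  by rewrite -[mx_act _ _ _ _]/(cotorsion_mx (eta s)%:M a) eta1 // cmx1 subrr.
- move=> l Q pl lp hQ; exists 0 => s [hs Hs]; rewrite raddf0 subr0; exact: c1 pl lp hQ hs Hs.
exists 0 => s [hs Hs]; rewrite raddf0 subr0; exact: c2.
Qed.

(** Cocycles representing a Selmer class; only their values on Gal(Qbar/Q_oo), up to coboundaries,
    matter. *)
Definition represents (x : S) (c : galQ -> A) := exists c' : Z, val c' = c /\ H1_class c' = val x.

Lemma cocycleP c : c \in coc <->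
  (forall s t, H s -> H t -> c (s * t)%g = c s + act s (c t)) /\ locally_constant H c.
Proof. by split=> [/asboolP|h]; last exact/asboolP. Qed.
Lemma mkZ1 c : c \in coc -> exists c' : Z, val c' = c.
Proof. by move=> h; exists (exist _ c h). Qed.
Lemma cobB_H (c d : galQ -> A) : (forall s, H s -> c s = d s) -> cob (c - d).
Proof.
by move=> e; exists 0 => s Hs; rewrite raddf0 subr0 -[LHS]/(c s - d s) e // subrr.
Qed.

Lemma H1_class_eq (c d : Z) : H1_class c = H1_class d <-> cob (val c - val d).
Proof.
rewrite -[val c - val d](raddfB val c d); split=> [/eqP|h]; last apply/eqP.
  by rewrite -subr_eq0 -(raddfB (\pi_(Quotient.quot _)%qT)) quot_eq0 => /asboolP.
by rewrite -subr_eq0 -(raddfB (\pi_(Quotient.quot _)%qT)) quot_eq0; apply/asboolP.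
Qed.

Lemma local_cond_cob c d : cob (c - d) -> local_cond c -> local_cond d.
Proof.
move=> [a ha] [c1 c2]; have e s : H s -> d s = c s - (act s a - a).
  by move=> Hs; rewrite -[act s a]/(mx_act i rho s a) -ha // -[(c - d) s]/(c s - d s) opprB addrC subrK.
split=> [l Q s pl lp hQ hs Hs|s hs Hs].
  by rewrite e // (c1 l Q s) // (act_unr a pl lp hQ hs) subrr subr0.
by rewrite e // !lamB c2 // lamI // subrr subr0.
Qed.

Lemma rep_ex x : exists c, represents x c.
Proof. by have /asboolP[c [e _]] := valP x; exists (val c), c. Qed.
Lemma rep_coc x c : represents x c -> c \in coc. Proof. by case=> c' [<- _]; exact: (valP c'). Qed.
Lemma rep_cond x c : represents x c -> local_cond c.
Proof.
case=> c' [<- e]; have /asboolP[d [ed /selmer_cocycleP hd]] := valP x.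
by apply: local_cond_cob hd; apply/H1_class_eq; rewrite ed e.
Qed.
Lemma repB x x' c c' : represents x c -> represents x' c' -> represents (x - x') (c - c').
Proof.
move=> [d [<- e]] [d' [<- e']]; exists (d - d'); split; first exact: raddfB.
by rewrite raddfB /= -e -e' /H1_class (raddfB (\pi_(Quotient.quot _)%qT)).
Qed.
Lemma rep_inj x x' c c' : represents x c -> represents x' c' -> cob (c - c') -> x = x'.
Proof. by move=> [d [<- e]] [d' [<- e']] /H1_class_eq h; apply: val_inj; rewrite -e h e'. Qed.
Lemma rep_eq x c c' : represents x c -> represents x c' -> cob (c - c').
Proof. by move=> [d [<- e]] [d' [<- e']]; apply/H1_class_eq; rewrite e e'. Qed.
Lemma rep0 : represents 0 0.
Proof. by exists 0; split=> //; rewrite raddf0 /H1_class (raddf0 (\pi_(Quotient.quot _)%qT)). Qed.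
Lemma rep_zero x c : represents x c -> cob c -> x = 0.
Proof. by move=> h hc; apply: rep_inj h rep0 _; rewrite subr0. Qed.
Lemma rep_cob x c c' : represents x c -> c' \in coc -> cob (c - c') -> represents x c'.
Proof. by move=> [d [<- e]] /mkZ1[d' <-] /H1_class_eq h; exists d'; rewrite -h. Qed.

Lemma rep_map (Phi : (galQ -> A) -> galQ -> A) x c :
  (forall c, c \in coc -> Phi c \in coc) -> (forall c d, Phi (c - d) = Phi c - Phi d) ->
  (forall c, cob c -> cob (Phi c)) -> (forall c, c \in coc -> local_cond c -> local_cond (Phi c)) ->
  represents x c -> represents (insubd 0 (H1_map Phi (val x))) (Phi c).
Proof.
move=> Pcoc PB Pcob Pcond hc; have [d' hd'] := mkZ1 (Pcoc c (rep_coc hc)).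
have e : H1_map Phi (val x) = H1_class d'.
  rewrite /H1_map; apply/H1_class_eq; rewrite insubdK; last exact: Pcoc (valP _).
  rewrite hd' -PB; apply: Pcob; case: hc => c' [<- ec]; apply/H1_class_eq.
  by rewrite ec /H1_class reprK.
exists d'; split=> //; rewrite e insubdK //; apply/asboolP; exists d'; split=> //.
by apply/selmer_cocycleP; rewrite hd'; apply: Pcond (rep_coc hc) (rep_cond hc).
Qed.

Lemma rep_scale a x c : represents x c -> represents (selmer_scale a x) (fun s => sc a (c s)).
Proof.
apply: (rep_map (Phi := fun c s => cotorsion_mx a%:M (c s))) => [d|d d'|d [z hz]|d _ [d1 d2]].
- move=> /cocycleP[dM dl]; apply/cocycleP; split=> [s t Hs Ht|s Hs].
    by rewrite dM // [LHS]scDr act_sc.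
  by have [r hr] := dl s Hs; exists r => t Ht e; rewrite hr.
- by apply/funext => s; exact: scB.
- exists (sc a z) => s Hs; rewrite hz // [LHS]scB; congr (_ - _); exact: (esym (act_sc s a z)).
split=> [l Q s pl lp hQ hs Hs|s hs Hs]; first by rewrite (d1 l Q s) // raddf0.
by rewrite /lam [LHS]sc_cmx -[cotorsion_mx lambda _]/(lam _) d2 // scr0.
Qed.

Lemma prime_above_pull l Q (t : galQ) : prime_above l Q -> prime_above l [set x | Q (t x)].
Proof.
case=> [[Qs Ql] QD QM Q1 QP]; split.
- split=> [x /= /Qs /=|]; first by rewrite Aint_aut.
  by rewrite /= rmorph_nat.
- by move=> x y /= hx hy; rewrite rmorphD; exact: QD.
- by move=> x y xA /= hy; rewrite rmorphM; apply: QM => //; rewrite Aint_aut.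
- by rewrite /= rmorph1.
by move=> x y xA yA /=; rewrite rmorphM; apply: QP; rewrite Aint_aut.
Qed.
Lemma inertia_pull Q (s t : galQ) : inertia Q s -> inertia [set x | Q (t x)] (t^-1 * s * t)%g.
Proof.
move=> hs x xA /=; rewrite rmorphB.
have -> : t ((t^-1 * s * t)%g x) = s (t x).
  by rewrite -[LHS]/((t * (t^-1 * s * t))%g x) !mulgA mulgV mul1g.
by apply: hs; rewrite Aint_aut.
Qed.
Lemma inertia_conj s d : inertia P s -> inertia P d -> inertia P (d^-1 * s * d)%g.
Proof.
move=> hs hd x xA; have := inertia_pull d hs xA => /=.
by rewrite -(inertia_dec hd).
Qed.
Lemma inertiaM s t : inertia P s -> inertia P t -> inertia P (s * t)%g.
Proof.
move=> hs ht x xA; rewrite (_ : (s * t)%g x - x = (s (t x) - t x) + (t x - x)); last by rewrite addrA subrK.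
by case: hP => _ PD _ _ _; apply: PD; [apply: hs; rewrite Aint_aut | exact: ht].
Qed.
Lemma inertiaV s : inertia P s -> inertia P s^-1%g.
Proof.
move=> hs x xA; apply/(inertia_dec hs); rewrite rmorphB.
have -> : s (s^-1%g x) = x by rewrite -[LHS]/((s * s^-1)%g x) mulgV.
by rewrite -opprB -sub0r; apply: (primeB hP); [exact: (prime0 hP) | exact: hs].
Qed.

Lemma coc_conj_in c h s : c \in coc -> H h -> H s ->
  act h (c (h^-1 * s * h)%g) = c s + (act s (c h) - c h).
Proof.
move=> /cocycleP[cM _] Hh Hs; have Hj := gal_QinfJ pp h Hs.
have := cM h _ Hh Hj; rewrite !mulgA mulgV mul1g cM // => e.
by rewrite addrA e [RHS]addrC addKr.
Qed.

(** At p, write t as an inertial element times one over Q_oo: the former preserves lambda, the latter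
    changes the cocycle by a coboundary. *)
Lemma rep_conj (t : galQ) x c : represents x c -> represents (selmer_conj t x) (fun s => act t (c (t^-1 * s * t)%g)).
Proof.
apply: (rep_map (Phi := fun c s => mx_act i rho t (c (t^-1 * s * t)%g))) => [d|d d'|d [z hz]|d hd [d1 d2]].
- move=> /cocycleP[dM dl]; apply/cocycleP; split=> [s s' Hs Hs'|s Hs].
    have -> : (t^-1 * (s * s') * t = (t^-1 * s * t) * (t^-1 * s' * t))%g.
      by rewrite !mulgA mulgK.
    rewrite (dM _ _ (gal_QinfJ pp t Hs) (gal_QinfJ pp t Hs')).
    rewrite -[LHS]/(act t (d (t^-1 * s * t)%g + act (t^-1 * s * t)%g (d (t^-1 * s' * t)%g))).
    rewrite -[RHS]/(act t (d (t^-1 * s * t)%g) + act s (act t (d (t^-1 * s' * t)%g))).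
    rewrite actD -!actM; congr (_ + act _ _).
    by rewrite !mulgA mulgV mul1g.
  have [r hr] := dl (t^-1 * s * t)%g (gal_QinfJ pp (s:=s) t Hs).
  exists [seq t z | z <- r] => s' Hs' e.
  congr (mx_act i rho t _); apply: hr; first exact: (gal_QinfJ pp t Hs').
  move=> z zr.
  by rewrite -[LHS]/((t^-1)%g (s' (t z))) -[RHS]/((t^-1)%g (s (t z))) e // map_f.
- by apply/funext => s; exact: raddfB.
- exists (act t z) => s Hs; rewrite (hz _ (gal_QinfJ pp t Hs)) raddfB /=; congr (_ - _).
  rewrite -[LHS]/(act t (act (t^-1 * s * t)%g z)) -[RHS]/(act s (act t z)) -!actM.
  by rewrite !mulgA mulgV mul1g.
split=> [l Q s pl lp hQ hs Hs|s hs Hs].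
  rewrite (d1 l _ _ pl lp (prime_above_pull t hQ) (inertia_pull t hs)) ?raddf0 //.
  exact: gal_QinfJ.
have [h Hh hth] := inertia_onto pp t hP; set dd := (t * h)%g in hth.
have et : t = (dd * h^-1)%g by rewrite mulgK.
have Hs' : H (dd^-1 * s * dd)%g by exact: gal_QinfJ.
have -> : (t^-1 * s * t = (h^-1)^-1 * (dd^-1 * s * dd) * h^-1)%g by rewrite et !invMg invgK !mulgA.
rewrite -[mx_act i rho _ _]/(act _ _) et actM (coc_conj_in hd (gal_QinfV pp Hh) Hs') lamI //.
have hs' := inertia_conj hs hth.
by rewrite lamD lamB lamI // d2 // subrr addr0.
Qed.

Lemma selmer_conj_H h (x : S) : H h -> selmer_conj h x = x.
Proof.
move=> Hh; have [c hc] := rep_ex x; have cc := rep_coc hc; apply: rep_inj (rep_conj h hc) hc _.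
by exists (c h) => s Hs; rewrite -[LHS]/(act h _ - c s) (coc_conj_in cc Hh Hs) addrC addKr.
Qed.
Lemma selmer_conjM s t (x : S) : selmer_conj (s * t)%g x = selmer_conj s (selmer_conj t x).
Proof.
have [c hc] := rep_ex x; apply: rep_inj (rep_conj _ hc) (rep_conj _ (rep_conj _ hc)) _.
by apply: cobB_H => g Hg; rewrite actM invMg !mulgA.
Qed.
Lemma selmer_scale1 (x : S) : selmer_scale 1 x = x.
Proof. by have [c hc] := rep_ex x; apply: rep_inj (rep_scale 1 hc) hc _; apply: cobB_H => s Hs; rewrite sc1. Qed.
Lemma selmer_scaleM a b (x : S) : selmer_scale (a * b) x = selmer_scale a (selmer_scale b x).
Proof.
have [c hc] := rep_ex x; apply: rep_inj (rep_scale _ hc) (rep_scale _ (rep_scale _ hc)) _.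
by apply: cobB_H => s Hs; rewrite scM.
Qed.
Lemma selmer_scaleBl a b (x : S) : selmer_scale (a - b) x = selmer_scale a x - selmer_scale b x.
Proof.
have [c hc] := rep_ex x; apply: rep_inj (rep_scale _ hc) (repB (rep_scale _ hc) (rep_scale _ hc)) _.
by apply: cobB_H => s Hs; rewrite scD scN.
Qed.
Lemma selmer_scaleB a (x y : S) : selmer_scale a (x - y) = selmer_scale a x - selmer_scale a y.
Proof.
have [c hc] := rep_ex x; have [d hd] := rep_ex y.
apply: rep_inj (rep_scale _ (repB hc hd)) (repB (rep_scale _ hc) (rep_scale _ hd)) _.
by apply: cobB_H => s Hs; exact: scB.
Qed.
Lemma selmer_conjB t (x y : S) : selmer_conj t (x - y) = selmer_conj t x - selmer_conj t y.
Proof.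
have [c hc] := rep_ex x; have [d hd] := rep_ex y.
apply: rep_inj (rep_conj _ (repB hc hd)) (repB (rep_conj _ hc) (rep_conj _ hd)) _.
by apply: cobB_H => s Hs; exact: actB.
Qed.

Lemma coc_values c : c \in coc -> exists vs : seq A, forall s, H s -> c s \in vs.
Proof. by move=> /cocycleP[_ cl]; exact: (locally_constant_finite (gal_Qinf_closed pp) cl). Qed.

(** A cocycle takes finitely many values and depends on a finite amount of data, all fixed by t when t
    is close to 1. *)
Lemma coc_smooth c : c \in coc -> exists r : seq algC, forall t : galQ, {in r, forall z, t z = z} ->
  forall s, H s -> act t (c (t^-1 * s * t)%g) = c s.
Proof.
move=> hc; have [vs hvs] := coc_values hc; case/cocycleP: hc => _ cl.
have [r hr] := locally_constant_uniform (gal_Qinf_closed pp) cl.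
have [r' hr'] := locally_constant_id vs act_smooth.
have /choice[cj hcj] : forall x, exists rs : seq algC, forall s : galQ, s x \in rs by move=> x; exact: finite_conj.
exists (r ++ r' ++ flatten (map cj r)) => t ht s Hs.
have e : c (t^-1 * s * t)%g = c s.
  apply: hr => //; first exact: gal_QinfJ.
  move=> x xr; rewrite -[LHS]/((t^-1)%g (s (t x))) ht; last by rewrite mem_cat xr.
  have tsx : t (s x) = s x.
    apply: ht; rewrite !mem_cat; apply/orP; right; apply/orP; right.
    by apply/flattenP; exists (cj x); rewrite ?map_f.
  by rewrite -{1}tsx -[LHS]/((t^-1 * t)%g (s x)) mulVg.
rewrite e; apply: hr' (hvs s Hs) => x xr; apply: ht; by rewrite !mem_cat xr orbT.
Qed.

Lemma selmer_smooth (x : S) : exists n, forall t, cyc_res p n t = 1%g -> selmer_conj t x = x.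
Proof.
have [c hc] := rep_ex x; have [r hr] := coc_smooth (rep_coc hc).
have [n hn] := near_gal_Qinf pp r setT_closed; exists n => t ht.
have [h [_ Hh hh]] := hn t I ht; have -> : t = (h * (h^-1 * t))%g by rewrite mulKVg.
rewrite selmer_conjM (selmer_conj_H _ Hh).
apply: rep_inj (rep_conj _ hc) hc _; apply: cobB_H => s Hs; apply: hr => // z zr.
by rewrite -[LHS]/((h^-1)%g (t z)) -hh // -[LHS]/((h^-1 * h)%g z) mulVg.
Qed.

Definition extends (x : S) (y : galQ -> A) : Prop :=
  [/\ forall s t, y (s * t)%g = y s + act s (y t), locally_constant setT y & represents x y].

Lemma inv_uniq (a a' : A) : (forall s, H s -> act s a - a = act s a' - a') -> a = a'.
Proof.
move=> e; apply/eqP; rewrite -subr_eq0; apply/eqP/no_invariants => h Hh.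
by rewrite actB; have := sub_swap (e h Hh).
Qed.

(** For x invariant, t c(t^-1 s t) - c(s) = s a - a for a unique a, since there are no invariants over
    Q_oo; the extension maps t to this a, and the cocycle relation follows from uniqueness. *)
Lemma extends_exists x : (forall t, selmer_conj t x = x) -> exists y, extends x y.
Proof.
move=> hx; have [c hc] := rep_ex x; have cc := rep_coc hc; have [cM cl] := (cocycleP c).1 cc.
have /choice[y hy] : forall t, exists a, forall s, H s -> act t (c (t^-1 * s * t)%g) - c s = act s a - a.
  move=> t; have h1 := rep_conj t hc; rewrite hx in h1; have [a ha] := rep_eq h1 hc.
  by exists a => s Hs; exact: ha.
have yH h : H h -> y h = c h.
  by move=> Hh; apply: inv_uniq => s Hs; rewrite -hy // (coc_conj_in cc Hh Hs) addrC addKr.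
have yM s t : y (s * t)%g = y s + act s (y t).
  apply: inv_uniq => g Hg; rewrite -hy //; have Hg' := gal_QinfJ pp s Hg.
  have e1 : act g (act s (y t)) - act s (y t) = act s (act (s^-1 * g * s)%g (y t) - y t).
    by rewrite actB -!actM !mulgA mulgV mul1g.
  have e0 : act g (y s + act s (y t)) - (y s + act s (y t)) =
      (act g (y s) - y s) + (act g (act s (y t)) - act s (y t)) by rewrite actD opprD addrACA.
  rewrite e0 e1 -(hy t _ Hg') -(hy s g Hg) actB [RHS]addrC addrA subrK -actM.
  by rewrite invMg !mulgA.
exists y; split=> //.
  move=> s _; have [r hr] := coc_smooth cc; exists r => t _ e.
  have y0 : y (s^-1 * t)%g = 0.
    apply: inv_uniq => g Hg; rewrite -hy // hr ?act0 ?subrr // => z zr.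
    by rewrite -[LHS]/((s^-1)%g (t z)) e // -[LHS]/((s^-1 * s)%g z) mulVg.
  by rewrite -(mulKVg s t) yM y0 act0 addr0.
apply: rep_cob hc _ _; last by apply: cobB_H => s Hs; rewrite yH.
apply/cocycleP; split=> [s t _ _|s Hs]; first exact: yM.
by have [r hr] := cl s Hs; exists r => t Ht e; rewrite !yH // hr.
Qed.

Lemma extendsB x x' y y' : extends x y -> extends x' y' -> extends (x - x') (y - y').
Proof.
move=> [yM yl hy] [yM' yl' hy']; split; last exact: repB.
  by move=> s t; rewrite -[LHS]/(y _ - y' _) yM yM' -[(y - y') t]/(y t - y' t) actB opprD addrACA.
move=> s _; have [r hr] := yl s I; have [r' hr'] := yl' s I; exists (r ++ r') => t _ e.
by rewrite -[LHS]/(y t - y' t) hr ?hr' // => z zr; apply: e; rewrite mem_cat zr ?orbT.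
Qed.
Lemma extends_scale a x y : extends x y -> extends (selmer_scale a x) (fun s => sc a (y s)).
Proof.
move=> [yM yl hy]; split; last exact: rep_scale.
  by move=> s t; rewrite yM scDr act_sc.
by move=> s _; have [r hr] := yl s I; exists r => t ht e; rewrite hr.
Qed.

(** The value at t is invariant under Gal(Qbar/Q_oo). *)
Lemma cocycle_zero (y : galQ -> A) : (forall s t, y (s * t)%g = y s + act s (y t)) ->
  (forall h, H h -> y h = 0) -> forall t, y t = 0.
Proof.
move=> yM y0 t; apply: no_invariants => h Hh; have Hj := gal_QinfJ pp t Hh.
have := yM h t; rewrite (y0 h Hh) add0r => <-.
by rewrite -[(h * t)%g](mulKVg t) [(t^-1 * _)%g]mulgA yM (y0 _ Hj) act0 addr0.
Qed.

Lemma cocycle_sub (y : galQ -> A) a : (forall s t, y (s * t)%g = y s + act s (y t)) ->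
  forall s t, y (s * t)%g - (act (s * t)%g a - a) = (y s - (act s a - a)) + act s (y t - (act t a - a)).
Proof.
move=> yM s t; rewrite yM actM !actB addrACA -opprD; congr (_ - _).
by rewrite [RHS]addrC addrA subrK.
Qed.

Lemma cocycle_bound c : c \in coc -> exists M, forall s, H s -> sc (w ^+ M) (c s) = 0.
Proof.
move=> /coc_values[vs hvs].
have [M hM] : exists M, {in vs, forall v, sc (w ^+ M) v = 0}.
  elim: {hvs} vs => [|v vs [M hM]]; first by exists 0%N.
  have [N hN] := w_torsion v; exists (M + N)%N => z; rewrite inE => /orP[/eqP ->|/hM e].
    by rewrite exprD scM hN scr0.
  by rewrite addnC exprD scM e scr0.
by exists M => s /hvs/hM.
Qed.

(** Inertia at p maps onto Gal(Q(zeta)/Q), by total ramification. *)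
Lemma inertia_minus : exists2 s, inertia P s & acts_on_mu s p p.-1.
Proof.
have q0 : (0 < p ^ 1)%N by rewrite expn1 prime_gt0.
have [y py] := C_prim_root_exists q0.
have [||s hs||s hs hin] := @inertia_lift p P hP [set s : galQ | acts_on_mu s (p ^ 1) 1] conj_gal.
- exact: acts1.
- by move=> s t hs ht; have := actsM hs ht; rewrite muln1.
- by move=> z zq; have [r hr rs] := hs [:: z]; rewrite -rs ?inE // hr.
- move=> z zA fz; apply: (cyc_residue_gal pp py) => //; apply: (cyclotomic_fixed py) => s sy.
  by apply: fz; apply: (acts_prim py); rewrite sy expr1.
exists (conj_gal * s)%g => //; rewrite expn1 in hs.
by have := actsM (conj_acts pp) hs; rewrite muln1.
Qed.

(** Inertia at p acts on the line of ub through the nontrivial character omega^(k-1), but trivially on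
    the target of lambda. *)
Lemma lambda_residual : map_mx res lambda *m ub = 0.
Proof.
have [s hs ha] := inertia_minus; apply: (neg_fixed podd charF).
rewrite -mulmxN -(signk pp charF keven k2 rb_ub ha) mulmxA -map_mxM lambda_in //.
Qed.

(** After a coboundary, y takes values in the plane of w-torsion. Its coordinate in the quotient F is a
    character unramified everywhere, at p because lambda is injective on that quotient; hence it
    vanishes by Minkowski's theorem. The remaining coordinate is a class in F(omega^(k-1)), hence a
    multiple of the class b of the lattice itself. Since the extension T/wT defines b, it becomes a
    coboundary in K^2/O^2. *)
Lemma unramified_class_w x y : extends x y -> selmer_scale w x = 0 ->
  (forall s, inertia P s -> lam (y s) = 0) -> x = 0.
Proof.
move=> hxy wx lamy; have [yM yl hy] := hxy.
have [a ha] : cob (fun s => sc w (y s)).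
  have [_ _ h1] := extends_scale w hxy; rewrite wx in h1.
  by have := rep_eq h1 rep0; rewrite subr0.
have [a' ea] := sc_divisible wi0 a.
pose y' s := y s - (act s a' - a').
have y'M s t : y' (s * t)%g = y' s + act s (y' t).
  exact: cocycle_sub.
have wy' s : sc w (y' s) = 0.
  apply: (cocycle_zero (y := fun s => sc w (y' s))) => [s' t|h Hh]; first by rewrite y'M scDr act_sc.
  by rewrite /y' scB ha // -[mx_act _ _ _ _]/(act h a) !scB -act_sc ea subrr.
have /choice[v hv] : forall s, exists v, y' s = jmw v by move=> s; exact: (jmP wi0 iinj res0 res_surj).
have jinj (u u' : 'cV[F]_2) : jmw u = jmw u' -> u = u' by exact: (jm_inj wi0 iinj res0 res_surj).
have vM s t : v (s * t)%g = v s + rb s *m v t.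
  apply: jinj; rewrite -hv y'M !hv jm_act; exact: esym (jmD wi0 iinj res0 res_surj _ _).
have vl : locally_constant setT v.
  move=> s _; have [r hr] := yl s I; have [r' hr'] := act_smooth a'; exists (r ++ r') => t _ e.
  apply: jinj; rewrite -!hv /y' hr //; last by move=> z zr; apply: e; rewrite mem_cat zr.
  have -> : act t a' = act s a' => //.
  rewrite -(mulKVg s t) actM hr' // => z zr.
  by rewrite -[LHS]/((s^-1)%g (t z)) e ?mem_cat ?zr ?orbT // -[LHS]/((s^-1 * s)%g z) mulVg.
have v_unr l Q s : prime l -> l != p -> prime_above l Q -> inertia Q s -> v s = 0.
  move=> pl lp hQ hs; apply: jinj; rewrite -hv /y' (act_unr a' pl lp hQ hs) subrr subr0.
  have [h1 _] := rep_cond hy; rewrite (h1 l Q s) //; last exact: (inertia_gal_Qinf pp pl lp hQ hs).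
  exact: esym ((jm0 wi0 iinj res0 res_surj _).2 erefl).
have [t1 [b [d0 ht1 hb bne]]] := residual_class pp podd charF keven k2 rbM rb_loc rb_unr ub0 rb_ub rb_quo rb_ns.
pose al s := wedge (v s) t1 / wedge ub t1; pose be s := wedge ub (v s) / wedge ub t1.
have vE s : v s = al s *: ub + be s *: t1 by exact: wedge_expand.
have lt1 : map_mx res lambda *m t1 != 0.
  apply/eqP => e; have [t ht] := lambda_surj.
  have : map_mx res lambda *m map_mx res t = 1%:M by rewrite -map_mxM ht map_mx1.
  rewrite (wedge_expand (map_mx res t) d0) mulmxDr -!scalemxAr e lambda_residual !scaler0 addr0.
  by move/matrixP/(_ 0 0)/eqP; rewrite !mxE eqxx eq_sym oner_eq0.
have be_in s : inertia P s -> be s = 0.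
  move=> hs; have : lam (y' s) = 0 by rewrite /y' !lamB lamI // lamy // subrr subr0.
  rewrite hv; have -> : lam (jmw (v s)) = @jm _ O i w F res 1 (map_mx res lambda *m v s).
    exact: (jm_cmx wi0 iinj res0 res_surj).
  move/(jm0 wi0 iinj res0 res_surj); rewrite vE mulmxDr -!scalemxAr lambda_residual scaler0 add0r.
  by move/eqP; rewrite scaler_eq0 (negbTE lt1) orbF => /eqP.
have beM s t : be (s * t)%g = be s + be t.
  rewrite /be vM -mulrDl; congr (_ / _); have [c e] := rb_quo s (v t).
  have -> : rb s *m v t = v t + c *: ub by rewrite -e addrC subrK.
  by rewrite /wedge !mxE; ring.
have be1 : be 1%g = 0 by have := beM 1%g 1%g; rewrite mulg1 => /eqP; rewrite -subr_eq subrr eq_sym => /eqP.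
have beV s : be s^-1%g = - be s by apply/eqP; rewrite -addr_eq0 addrC -beM mulgV be1.
have be0 s : be s = 0.
  apply: (unramified_character_trivial (y := be)) => //.
  - by move=> s' _; have [r hr] := vl s' I; exists r => t ht e; rewrite /be hr.
  - move=> l Q s' pl hQ hs; have [lp|lp] := eqVneq l p; last first.
      by rewrite /be (v_unr l Q s' pl lp hQ hs) /wedge !mxE !mulr0 subrr mul0r.
    rewrite lp in hQ; have [g hg] := prime_conj pp hP hQ.
    have : be (g * s' * g^-1)%g = 0.
      apply: be_in => x0 xA.
      have -> : (g * s' * g^-1)%g x0 - x0 = g (s' ((g^-1)%g x0) - (g^-1)%g x0).
        by rewrite rmorphB -[g ((g^-1)%g x0)]/((g * g^-1)%g x0) mulgV.
      by apply/hg/hs; rewrite Aint_aut.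
    by rewrite !beM beV addrAC subrr add0r.
  move=> c hc; have : be (c * c)%g = 0.
    by have -> : (c * c)%g = 1%g by apply: galQ_eqP => z; rewrite -[LHS]/(c (c z)) !hc conjCK.
  rewrite beM -mulr2n -mulr_natl => /eqP; rewrite mulf_eq0 (negbTE (charF_odd podd charF)) /=.
  by move/eqP.
have vE' s : v s = al s *: ub by rewrite vE be0 scale0r addr0.
have cancel z1 z2 : z1 *: ub = z2 *: ub -> z1 = z2.
  by move/eqP; rewrite -subr_eq0 -scalerBl scaler_eq0 (negbTE ub0) orbF subr_eq0 => /eqP.
have hal : residual_cocycle p k al.
  split.
  - move=> s t n hn; apply: cancel; rewrite -vE' vM !vE' -scalemxAr (rb_ub hn) scalerA scalerDl.
    by rewrite [al t * _]mulrC.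
  - by move=> s hs; have [r hr] := vl s hs; exists r => t ht e; rewrite /al hr.
  by move=> l Q s pl lp hQ hs; apply: cancel; rewrite -vE' (v_unr l Q s pl lp hQ hs) scale0r.
have [c [d hcd]] := residual_unique pp hP podd charF keven k2 j2 kj hcl hb hal bne.
apply: (rep_zero hy); exists (jmw (c *: t1 + d *: ub) + a') => s Hs.
rewrite -[mx_act _ _ _ _]/(act s _) actD opprD addrACA jm_act.
have -> : y s = y' s + (act s a' - a') by rewrite subrK.
congr (_ + _); rewrite hv; apply: etrans (jmB wi0 iinj res0 res_surj _ _); congr (jmw _).
have [n _ [hn _]] := acts_exists (prime_gt0 pp) s.
rewrite vE' (hcd s n hn) mulmxDr -!scalemxAr ht1 (rb_ub hn).
by apply/matrixP => r1 r2; rewrite !mxE; ring.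
Qed.

(** Reduce to a class killed by w, multiplying by powers of w. *)
Lemma unramified_class x y : extends x y -> (forall s, inertia P s -> lam (y s) = 0) -> x = 0.
Proof.
move=> hxy lamy; have [_ _ hy] := hxy; have [M hM] := cocycle_bound (rep_coc hy).
have : selmer_scale (w ^+ M) x = 0.
  apply: rep_zero (rep_scale _ hy) _; exists 0 => s Hs; rewrite hM // raddf0 subr0 //.
elim: M {hM hy} => [|M IH]; first by rewrite expr0 selmer_scale1.
rewrite exprS selmer_scaleM => e; apply: IH; apply: unramified_class_w (extends_scale _ hxy) e _.
by move=> s hs; rewrite lam_sc lamy // scr0.
Qed.

Lemma lam_hom x y s t : extends x y -> inertia P s -> lam (y (s * t)%g) = lam (y s) + lam (y t).
Proof. by move=> [yM _ _] hs; rewrite yM lamD lamI. Qed.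

(** Conjugation by a Frobenius element d multiplies lambda(y) by 1 + phi on inertia, but it acts
    trivially on Gal(Q_oo/Q), through which lambda(y) factors. *)
Lemma frobenius_kills (phi : O) x y : (forall d, frobenius p P d -> lambda *m rho d = (1 + phi) *: lambda) ->
  extends x y -> selmer_scale phi x = 0.
Proof.
move=> hphi hxy; apply: unramified_class (extends_scale phi hxy) _ => s hs; rewrite lam_sc.
have [yM _ hy] := hxy; have [_ c2] := rep_cond hy; have [d hd] := frobenius_exists hP pp.
have dP u : P u -> P (d u).
  move=> Pu; have uA := prime_sub hP Pu; rewrite -(subrK (u ^+ p) (d u)).
  have [_ PD PM _ _] := hP; apply: PD; first exact: hd.
  by rewrite -(prednK (prime_gt0 pp)) exprSr; apply: PM => //; exact: rpredX.
have hds : inertia P (d * s * d^-1)%g.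
  move=> z zA; have -> : (d * s * d^-1)%g z - z = d (s ((d^-1)%g z) - (d^-1)%g z).
    by rewrite rmorphB -[d ((d^-1)%g z)]/((d * d^-1)%g z) mulgV.
  by apply/dP/hs; rewrite Aint_aut.
have y1 : y 1%g = 0 by have := yM 1%g 1%g; rewrite mulg1 act1 => /eqP; rewrite -subr_eq subrr eq_sym => /eqP.
have e1 : lam (y (d * s * d^-1)%g) = lam (y s) + sc phi (lam (y s)).
  have -> : y (d * s * d^-1)%g = act d (y s) + (y d - act (d * s * d^-1)%g (y d)).
    have dV : act d (y d^-1%g) = - y d by apply/eqP; rewrite -addr_eq0 addrC -yM mulgV y1.
    have dsV : act (d * s)%g (y d^-1%g) = - act (d * s * d^-1)%g (y d).
      by rewrite -[y d in RHS]opprK -dV actN opprK -actM mulgKV.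
    by rewrite yM dsV yM addrA [y d + _]addrC.
  rewrite lamD lamB (lamI (y d) hds) subrr addr0 /lam /act -cmxM hphi //.
  by rewrite -mul_scalar_mx cmxM -[cotorsion_mx _ _]/(sc _ _) scD sc1.
have hc : inertia P (d * s * d^-1 * s^-1)%g by apply: inertiaM => //; exact: inertiaV.
have Hc : H (d * s * d^-1 * s^-1)%g.
  move=> n; rewrite !(cyc_resM pp) !(cyc_resV pp) -[(_ * cyc_res p n s)%g]cyc_level_mulC.
  by rewrite mulgK mulgV.
have e2 : lam (y (d * s * d^-1)%g) = lam (y s).
  by rewrite -[(d * s * d^-1)%g](mulgKV s) (lam_hom _ hxy hc) c2 // add0r.
by apply: (addrI (lam (y s))); rewrite -e1 e2 addr0.
Qed.

Section Line.
Variable g0 : galQ.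
Hypothesis g0gen : forall n, [set: cyc_level p n]%SET = <[cyc_res p n g0]>%g.

(** On inertia at p, lambda(y) factors through Gal(Q_oo/Q), which is generated by g0. *)
Lemma local_class_cyclic x y sg : extends x y -> inertia P sg ->
  (forall n, cyc_res p n sg = cyc_res p n g0) -> lam (y sg) = 0 -> x = 0.
Proof.
move=> hxy hsg sgE e0; apply: unramified_class (hxy) _ => s hs.
have [yM yl hy] := hxy; have [_ c2] := rep_cond hy.
have [r hr] := locally_constant_uniform setT_closed yl.
have [n hn] := near_gal_Qinf pp r (@inertia_closed P).
have : cyc_res p n s \in <[cyc_res p n g0]>%g by rewrite -g0gen inE.
case/cycleP => m em.
have y1 : y 1%g = 0 by have := yM 1%g 1%g; rewrite mulg1 act1 => /eqP; rewrite -subr_eq subrr eq_sym => /eqP.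
have [hX X0] : inertia P (sg ^+ m)%g /\ lam (y (sg ^+ m)%g) = 0.
  elim: m {em} => [|m [IH1 IH2]]; last by rewrite expgS (lam_hom _ hxy hsg) e0 IH2 addr0; split=> //; exact: inertiaM.
  rewrite expg0 y1 /lam raddf0; split=> // z zA; rewrite subrr; exact: (prime0 hP).
have cX : cyc_res p n (sg ^+ m)%g = (cyc_res p n g0 ^+ m)%g.
  by elim: (m) => [|l IH]; rewrite ?expg0 ?(cyc_res1 pp) // !expgS (cyc_resM pp) IH sgE.
set t := ((sg ^+ m)^-1 * s)%g.
have ht : inertia P t by apply: inertiaM => //; exact: inertiaV.
have [|h [hh Hh eh]] := hn t ht; first by rewrite (cyc_resM pp) (cyc_resV pp) cX em mulVg.
rewrite -[s](mulKVg (sg ^+ m)%g) -/t (lam_hom _ hxy hX) X0 add0r -(hr h t) //.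
exact: c2.
Qed.

Lemma local_class_w x y s : extends x y -> selmer_scale w x = 0 -> inertia P s -> sc w (lam (y s)) = 0.
Proof.
move=> hxy wx hs; have [yM _ hy] := hxy.
have [_ _ h1] := extends_scale w hxy; rewrite wx in h1.
have [a ha] : cob (fun s => sc w (y s)) by have := rep_eq h1 rep0; rewrite subr0.
have e : sc w (y s) - (act s a - a) = 0.
  apply: (cocycle_zero (y := fun s => sc w (y s) - (act s a - a))) => [|h Hh].
    by apply: cocycle_sub => s' t; rewrite yM scDr act_sc.
  by rewrite ha // subrr.
by rewrite -lam_sc -(subrK (act s a - a) (sc w (y s))) e add0r lamB lamI // subrr.
Qed.

(** Such a class is determined by the value of lambda(y) at one element, in a line over F. *)
Lemma invariant_line x x0 y y0 : extends x y -> extends x0 y0 ->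
  selmer_scale w x = 0 -> selmer_scale w x0 = 0 -> x0 != 0 -> exists a, x = selmer_scale a x0.
Proof.
move=> hxy hxy0 wx wx0 x00; have [h Hh hsg] := inertia_onto pp g0 hP; set sg := (g0 * h)%g in hsg.
have sgE n : cyc_res p n sg = cyc_res p n g0 by rewrite (cyc_resM pp) Hh mulg1.
have [v hv] := jmP wi0 iinj res0 res_surj (local_class_w hxy wx hsg).
have [v0 hv0] := jmP wi0 iinj res0 res_surj (local_class_w hxy0 wx0 hsg).
have v00 : v0 0 0 != 0.
  apply: contra x00 => /eqP e; apply/eqP; apply: local_class_cyclic hxy0 hsg sgE _.
  by rewrite hv0; apply/(jm0 wi0 iinj res0 res_surj)/matrixP => r c; rewrite !ord1 mxE.
have [a ha] := res_surj (v 0 0 / v0 0 0); exists a; apply/eqP; rewrite -subr_eq0; apply/eqP.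
apply: local_class_cyclic (extendsB hxy (extends_scale a hxy0)) hsg sgE _.
rewrite -[(_ - _) sg]/(y sg - sc a (y0 sg)) lamB lam_sc hv hv0 (jm_sc wi0 iinj res0 res_surj).
have -> : res a *: v0 = v by apply/matrixP => r c; rewrite !ord1 mxE ha divfK.
exact: subrr.
Qed.

(** The class is fixed by Gal(Qbar/Q_n) for some n, and g0 generates Gal(Q_n/Q). *)
Lemma fixed_all (x : S) : selmer_conj g0 x = x -> forall t, selmer_conj t x = x.
Proof.
move=> hx t; have [n hn] := selmer_smooth x.
have : cyc_res p n t \in <[cyc_res p n g0]>%g by rewrite -g0gen inE.
case/cycleP => m em; have hX : selmer_conj (g0 ^+ m)%g x = x.
  elim: (m) => [|l IH]; first by rewrite expg0; apply: selmer_conj_H; exact: gal_Qinf1.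
  by rewrite expgS selmer_conjM IH.
rewrite -[t](mulKVg (g0 ^+ m)%g) selmer_conjM hn ?hX //.
rewrite (cyc_resM pp) (cyc_resV pp) em.
have -> : cyc_res p n (g0 ^+ m)%g = (cyc_res p n g0 ^+ m)%g.
  by elim: (m) => [|l IH]; rewrite ?expg0 ?(cyc_res1 pp) // !expgS (cyc_resM pp) IH.
exact: mulVg.
Qed.

Lemma selmer_dual_generators (m d : nat) (phi v : O) (X : lmodType (iwasawa_algebra p O))
    (e : X -> {additive S -> QZ}) (b_ : 'I_d -> O) :
  (forall x, res x != 0 -> exists y, y * x = 1) ->
  (forall b : 'I_d -> int, (exists y, \sum_i (b i)%:~R * b_ i = y * w) -> forall i, (p%:Z %| b i)%Z) ->
  (forall x, exists (b : 'I_d -> int) y, x = \sum_i (b i)%:~R * b_ i + y * w) ->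
  (forall d, frobenius p P d -> lambda *m rho d = (1 + phi) *: lambda) -> w ^+ m = v * phi ->
  selmer_dual e ->
  exists u0 : X,
    (forall x : X, exists a y, x = cgr_const (cyc_tower p) a *: u0 + (gamma O (gam0_map g0 pp) - 1) *: y) /\
    exists y : X, cgr_const (cyc_tower p) w ^+ m *: u0 = (gamma O (gam0_map g0 pp) - 1) *: y.
Proof.
move=> res_unit b_free b_gen hphi hv [eD einj esurj eL].
have fixed_ext (x : S) : selmer_conj g0 x = x -> exists y, extends x y.
  by move=> hx; apply: extends_exists; exact: fixed_all.
apply: (@dual_generators p m O w F res S X e (fun a x => selmer_scale a x) (fun t x => selmer_conj t x) g0 d b_) => //.
- by apply/res0; rewrite rmorph_nat.
- exact: selmer_scaleBl.
- exact: selmer_scaleB.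
- exact: selmer_scaleM.
- exact: selmer_scale1.
- exact: selmer_conjB.
- exact: selmer_conjM.
- by move=> x; apply: selmer_conj_H; exact: gal_Qinf1.
- exact: selmer_smooth.
- move=> x x0 /fixed_ext[y hy] /fixed_ext[y0 hy0] wx wx0 x00; exact: invariant_line hy hy0 wx wx0 x00.
move=> x /fixed_ext[y hy]; rewrite hv selmer_scaleM (frobenius_kills hphi hy).
by have := selmer_scaleB v 0 0; rewrite !subrr.
Qed.
End Line.
End AbstractSelmer.

(** * The Galois representation of an eigenform, and the theorem *)
Section HeckeRepresentation.
Variables (R : realType) (p : nat) (C : padicClosure R p) (k : nat) (f : nat -> C) (w : hecke_int f)
  (rho : galQ -> 'M[hecke_int f]_2).
Hypotheses (uw : uniformizer w) (hrep : attached_rep k rho) (hns : residually_nonsplit k w rho).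
Variables (F : fieldType) (res : {rmorphism hecke_int f -> F}).
Hypotheses (res0 : forall x, res x = 0 <-> exists y, x = y * w)
  (res_surj : forall a, exists x, res x = a).
Notation O := (hecke_int f).
Notation i := (hecke_incl f).
Notation A := (cotorsion (hecke_incl f) 2).
Let rho1 : rho 1%g = 1%:M. Proof. by case: hrep => -[]. Qed.

Lemma act_smooth (x : A) : exists r : seq algC, forall t : galQ, {in r, forall z, t z = z} -> cotorsion_mx (rho t) x = x.
Proof.
pose B : R := 1 + \sum_b pabs (val (repr x b 0)).
have B1 b : pabs (val (repr x b 0)) <= B.
  rewrite /B (bigD1 b) //= addrCA lerDl addr_ge0 ?ler01 //; apply: sumr_ge0 => *; exact: pabs_ge0.
have B0 : 0 < B by apply: lt_le_trans ltr01 _; rewrite lerDl; apply: sumr_ge0 => *; exact: pabs_ge0.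
case: hrep => _ hcont _ _ _; have [|r hr] := hcont B^-1 1%g; first by rewrite invr_gt0.
exists r => t ht; rewrite -[x]reprK cmx_pi; apply/pi_eq.
have hd a b : pabs (val (val (rho t a b - rho 1%g a b))) < B^-1 by apply: hr => z /ht.
have h a : exists y : O, val y = (map_mx i (rho t) *m repr x - repr x) a 0.
  apply: mk_hecke_int; have -> : map_mx i (rho t) *m repr x - repr x = map_mx i (rho t - rho 1%g) *m repr x.
    by rewrite rho1 map_mxB map_mx1 mulmxBl mul1mx.
  rewrite mxE rmorph_sum; apply: pabs_sum_le => // b _; rewrite rmorphM pabsM !mxE.
  apply: le_trans (_ : B^-1 * B <= 1); last by rewrite mulVf // gt_eqF.
  by apply: ler_pM; [exact: pabs_ge0 | exact: pabs_ge0 | exact/ltW/hd | exact: B1].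
have /choice[y hy] := h; exists (\col_a y a); apply/matrixP => a b; rewrite ord1 !mxE.
by have := hy a; rewrite !mxE => <-.
Qed.

Lemma w_bound (y : hecke_field f) : exists M : nat, pabs (val (i (w ^+ M) * y)) <= 1.
Proof.
have [y1|y1] := leP (pabs (val y)) 1; first by exists 0%N; rewrite expr0 rmorph1 mul1r.
have y0 : y != 0 by apply: contraTneq y1 => ->; rewrite rmorph0 pabs0 ltNge ler01.
have [|z hz] := @mk_hecke_int R p C f y^-1.
  by rewrite fmorphV pabsV invf_le1 ?ltW // (lt_trans ltr01).
have [|m [v [e v1]]] := hecke_ord uw (_ : z != 0).
  by apply: contra_neq (invr_neq0 y0) => z0; rewrite -hz z0 rmorph0.
exists m; have : vabs z = vabs (w ^+ m) by rewrite e vabsM v1 mul1r.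
rewrite /vabs hz fmorphV pabsV => e1.
have -> : pabs (val (i (w ^+ m) * y)) = pabs (val (val (w ^+ m))) * pabs (val y) by rewrite rmorphM pabsM.
rewrite -e1.
by rewrite mulVf // gt_eqF // (lt_trans ltr01).
Qed.

Lemma w_torsion (x : A) : exists M : nat, sc (w ^+ M) x = 0.
Proof.
have /choice[M hM] : forall b, exists M : nat, pabs (val (i (w ^+ M) * repr x b 0)) <= 1 by move=> b; exact: w_bound.
exists (\sum_b M b)%N; rewrite -[x]reprK /sc cmx_pi map_scalar_mx mul_scalar_mx -pi0; apply/pi_eq.
have h a : exists y : O, val y = (i (w ^+ (\sum_b M b)) *: repr x - 0) a 0.
  apply: mk_hecke_int; rewrite subr0 mxE.
  have -> : i (w ^+ (\sum_b M b)) = i (w ^+ (\sum_(b | b != a) M b)) * i (w ^+ M a).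
    by rewrite -rmorphM -exprD addnC [in LHS](bigD1 a).
  have vM (a1 a2 : hecke_field f) : pabs (val (a1 * a2)) = pabs (val a1) * pabs (val a2) by rewrite rmorphM pabsM.
  rewrite -mulrA vM; apply: mulr_ile1; [exact: pabs_ge0 | exact: pabs_ge0 | | exact: hM].
  exact: (vabs_le1 (w ^+ _)).
have /choice[y hy] := h; exists (\col_a y a); apply/matrixP => a b; rewrite ord1 !mxE.
by have := hy a; rewrite !mxE => <-.
Qed.

Let rb s := map_mx res (rho s).
Lemma eq_modP (x y : 'cV[O]_2) : eq_mod w x y <-> map_mx res x = map_mx res y.
Proof.
split=> [[z e]|e].
  apply/eqP; rewrite -subr_eq0 -map_mxB e; apply/eqP/matrixP => a b; rewrite !mxE; apply/res0.
  by exists (z a b); rewrite mulrC.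
have h a : exists z, (x - y) a 0 = z * w.
  by apply/res0; have := congr1 (fun B : 'cV_2 => B a 0) e; rewrite !mxE rmorphB => ->; rewrite subrr.
have /choice[z hz] := h; exists (\col_a z a); apply/matrixP => a b.
by rewrite ord1 hz !mxE mulrC.
Qed.

Lemma residual_data : exists ub : 'cV[F]_2,
  [/\ ub != 0, forall s a, acts_on_mu s p a -> rb s *m ub = a%:R ^+ (k - 1) *: ub,
    forall s t, exists b, rb s *m t - t = b *: ub
  & ~ exists v, (forall b, v <> b *: ub) /\ forall s, rb s *m v = v].
Proof.
case: hns => u [u0 uE uq uns]; exists (map_mx res u); split.
- by apply/eqP => e; apply: u0; apply/eq_modP; rewrite e map_mx0.
- move=> s a ha; have /eq_modP := uE s a ha; rewrite map_mxM => ->.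
  by rewrite map_mxZ rmorphXn rmorph_nat.
- move=> s t; have [b /eq_modP e] := uq s (map_mx (sect res) t); exists (res b).
  by move: e; rewrite map_mxB map_mxM map_mxZ res_sect.
case=> v [v1 v2]; apply: uns; exists (map_mx (sect res) v); split.
  by move=> b /eq_modP; rewrite map_mxZ res_sect //; exact: v1.
by move=> s; apply/eq_modP; rewrite map_mxM !(res_sect res_surj); exact: v2.
Qed.
Lemma rb_loc : locally_constant setT rb.
Proof.
move=> s _; case: hrep => _ hcont _ _ _; have [r hr] := hcont 1 s ltr01; exists r => t _ ht.
apply/matrixP => a b; rewrite !mxE; apply/eqP; rewrite -subr_eq0 -rmorphB; apply/eqP/res0.
by apply/(vabs_lt1 uw); exact: hr.
Qed.


End HeckeRepresentation.

Lemma frobenius_decomposition p P s : prime p -> prime_above p P -> frobenius p P s -> decomposition P s.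
Proof.
move=> pp hP hs x; have [[Psub _] PD PM _ PP] := hP.
have PX y n : P y -> P (y ^+ n.+1).
  by move=> hy; rewrite exprSr; apply: (PM) => //; apply: rpredX; exact: Psub hy.
split=> hx.
  rewrite -(subrK (x ^+ p) (s x)); apply: (PD); first by apply: hs; exact: Psub.
  by rewrite -(prednK (prime_gt0 pp)); exact: PX.
have xA : x \in Aint by have := Psub _ hx; rewrite /= Aint_aut.
have : P (x ^+ p) by rewrite -(subKr (s x) (x ^+ p)); apply: (primeB hP) => //; exact: hs.
have rad n : P (x ^+ n.+1) -> P x.
  elim: n => [|n IH]; first by rewrite expr1.
  by rewrite exprS => /(PP _ _ xA (rpredX _ xA))[//|/IH].
by rewrite -(prednK (prime_gt0 pp)); exact: rad.
Qed.

Lemma even_mod_pred p k j : odd p -> ~~ odd j -> (k = j %[mod p.-1])%N -> ~~ odd k.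
Proof.
move=> po je e; have h m : odd (m %% p.-1) = odd m.
  by rewrite [in RHS](divn_eq m p.-1) oddD oddM; case: (p) po => [//|q] /= /negbTE ->; rewrite andbF.
by rewrite -h e h.
Qed.

Theorem theorem1p8 (R : realType) (p j : nat) (C : padicClosure R p)
    (k : nat) (f : nat -> C)
    (w : hecke_int f)
    (rho : galQ -> 'M[hecke_int f]_2)
    (P : set algC) (lambda : 'rV[hecke_int f]_2) (eta : galQ -> hecke_int f)
    (X : lmodType (iwasawa_algebra p (hecke_int f)))
    (e : X -> {additive selmer p (hecke_incl f) rho P lambda eta -> QZ}) :
  irregular_pair p j ->
  class_eigenspace_vanishes p j ->
  hida_eigenform j k f ->
  uniformizer w ->
  attached_rep k rho ->
  residually_nonsplit k w rho ->
  ordinary_quotient rho P lambda eta ->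
  selmer_dual e ->
  ((mu_invariant (cgr_const (cyc_tower p) w) X)%:Z%:E
     <= ord_at w (hecke_eigenvalue f p - 1)%R)%E.
Proof.
move=> irr hcl [[k2 kj] [hcusp _] fp1 _ _] uw hrep hns hord hdual.
have podd := irregular_odd irr; case: (irr) => pp j2 jeven _.
have keven := even_mod_pred podd jeven kj.
have [ap hap] : exists ap : hecke_int f, val ap = hecke_eigenvalue f p.
  by apply: mk_hecke_int; rewrite /= fp1.
have [a1|a1] := eqVneq (ap - 1) 0.
  by rewrite /ord_at -hap -(rmorph1 (hecke_incl f)) -[val ap]/(hecke_incl f ap) -rmorphB a1 rmorph0 eqxx leey.
have [m [v [av v1]]] := hecke_ord uw a1.
have -> : ord_at w (hecke_eigenvalue f p - 1) = (m%:Z)%:E.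
  by apply: (ord_atE pp uw (y := ap - 1)) av v1; rewrite -hap.
rewrite lee_fin lez_nat.
have [F [res [res0 res_unit res_surj]]] := hecke_residue uw.
have [d [b_ [b_free b_gen]]] := residue_basis pp uw hcusp.
have [g0 g0gen] := cyc_generator pp podd.
have charF : p%:R = 0 :> F by have [y ey] := p_dvd_w pp uw; rewrite -(rmorph_nat res); apply/res0; exists y.
have [ub [ub0 rb_ub rb_quo rb_ns]] := residual_data hns res0 res_surj.
case: (hrep) => -[rho1 rhoM] _ rho_unr _ _; case: (hord) => hP lsurj hdec eta1 hfr.
have iinj : injective (hecke_incl f) by exact: val_inj.
have wi0 : hecke_incl f w != 0.
  by apply: contra (w_neq0 pp uw) => /eqP ew; rewrite -[val w]/(hecke_incl f w) ew rmorph0.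
have lin s : inertia P s -> lambda *m rho s = lambda.
  by move=> hs; rewrite hdec ?eta1 ?scale1r //; exact: inertia_decomposition hP hs.
have hphi s : frobenius p P s -> lambda *m rho s = (1 + (ap - 1)) *: lambda.
  move=> hs; rewrite hdec; last exact: (frobenius_decomposition pp hP hs).
  congr (_ *: _); rewrite addrC subrK; do 2! apply: val_inj.
  by rewrite (hfr s hs) hap.
have [v' hv'] := hecke_unit v1.
have hwm : w ^+ m = v' * (ap - 1) by rewrite av mulrA hv' mul1r.
have [u0 [genX killX]] := selmer_dual_generators pp podd keven k2 j2 kj hcl hP charF iinj wi0 res0
  res_surj rho1 rhoM rho_unr eta1 lin lsurj (act_smooth hrep) (w_torsion uw) (rb_loc uw hrep res0) ub0 rb_ub rb_quo rb_ns
  g0gen res_unit b_free b_gen hphi hwm hdual.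
rewrite /mu_invariant; case: xgetP => [n _ [c [hc hdiv _]]|_]; last exact: leq0n.
have resp : res p%:R = 0 by rewrite rmorph_nat.
exact: (mu_bound (gam := gam0 p g0) g0gen res0 res_unit (hecke_wreg pp uw) pp resp (card_cyc_level pp) res_surj genX killX hc hdiv).
Qed.
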